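(* Let $(X_k)_{k\ge 1}$ be i.i.d. real random variables, $S_n := X_1+\dots+X_n$, and let $(a_n)_{n\ge1}$ be a sequence of positive numbers such that $S_n/a_n$ converges weakly to the standard normal law $\varphi(x)\,dx$. Assume that $X_1$ is lattice with span $c>0$, supported in $b+c\mathbb{Z}$ with $b\in\mathbb{R}$. Let $\mathcal{C}_n := (S_1>0,\dots,S_n>0)$. Then, as $n\to\infty$, $$\frac{a_n}{c}\,\mathbf{P}\big(S_n=bn+cx\,\big|\,\mathcal{C}_n\big)=\varphi^+\big((bn+cx)/a_n\big)+o(1)$$ uniformly for $x\in\mathbb{Z}$.
   Context: Notation: $\varphi(x):=\frac{1}{\sqrt{2\pi}}e^{-x^2/2}$; $\varphi^+(x):=x\,e^{-x^2/2}\,\mathbf{1}_{(x\ge0)}$. ''$X_1$ is lattice with span $c$, supported in $b+c\mathbb{Z}$'' means that $\mathbf{P}(X_1\in b+c\mathbb{Z})=1$ and that $c>0$ is maximal with this property, i.e. $X_1$ is not almost surely supported in $b'+c'\mathbb{Z}$ for any $b'\in\mathbb{R}$ and $c'>c$. Finite variance is not assumed. *)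

(* Defs.v *)
(* MathComp-Analysis *)
From HB Require Import structures.
From mathcomp Require Import all_boot all_order all_algebra.
From mathcomp Require Import finmap.
From mathcomp Require Import all_classical all_reals all_analysis.

Set Implicit Arguments.
Unset Strict Implicit.
Unset Printing Implicit Defensive.
Import Order.TTheory GRing.Theory Num.Theory.
Import numFieldNormedType.Exports.

Local Open Scope classical_set_scope.
Local Open Scope ring_scope.

Definition phi_plus {R : realType} (x : R) : R :=
  x * expR (- (x ^+ 2 / 2)) * \1_[set y : R | 0 <= y] x.

(* Weak convergence of the laws of W 0, W 1, ... to mu, tested against bounded
   continuous functions; meaningful when every W n is measurable. *)
Definition cvg_in_law {d : measure_display} {T : measurableType d}
    {R : realType} (P : probability T R) (W : nat -> T -> R)
    (mu : probability (measurableTypeR R) R) : Prop :=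
  forall f : R -> R, continuous f -> bounded_fun f ->
    ('E_P[f \o W n])%E @[n --> \oo] --> (\int[mu]_x (f x)%:E)%E.

Definition mutually_independent {d : measure_display} {T : measurableType d}
    {R : realType} (P : probability T R) (X : nat -> {RV P >-> R}) : Prop :=
  forall (J : {fset nat}) (A : nat -> set R),
    (forall i, i \in J -> measurable (A i)) ->
    P (\bigcap_(i in [set` J]) (X i @^-1` A i)) =
    (\prod_(i <- J) P (X i @^-1` A i))%E.

(* Only Borel sets are tested: a probability is unconstrained, hence may be
   arbitrary, on nonmeasurable sets. *)
Definition identically_distributed {d : measure_display}
    {T : measurableType d} {R : realType} (P : probability T R)
    (X : nat -> {RV P >-> R}) : Prop :=
  forall (i j : nat) (A : set R), measurable A ->
    distribution P (X i) A = distribution P (X j) A.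

(* Families of steps are indexed from 0: X 0, ..., X n.-1 are the first n steps
   X_1, ..., X_n of the walk. *)
Definition partial_sum {d : measure_display} {T : measurableType d}
    {R : realType} (P : probability T R) (X : nat -> {RV P >-> R}) (n : nat)
    (w : T) : R :=
  \sum_(i < n) X i w.

Definition lattice {R : realType} (b c : R) : set R :=
  [set b + c * z%:~R | z in [set: int]].

Definition is_lattice {d : measure_display} {T : measurableType d}
    {R : realType} (P : probability T R) (Y : {RV P >-> R}) (b c : R) : Prop :=
  [/\ 0 < c,
      P (Y @^-1` lattice b c) = 1%E &
      forall b' c' : R, c < c' -> P (Y @^-1` lattice b' c') <> 1%E].

Definition stays_positive {d : measure_display} {T : measurableType d}
    {R : realType} (P : probability T R) (X : nat -> {RV P >-> R}) (n : nat) :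
    set T :=
  [set w | forall k : nat, (0 < k <= n)%N -> 0 < partial_sum X k w].

(* Equals 0 when P B = 0. *)
Definition cond_prob {d : measure_display} {T : measurableType d}
    {R : realType} (P : probability T R) (A B : set T) : R :=
  fine (P (A `&` B)) / fine (P B).

(* Main.v *)
Require Import Defs.
From HB Require Import structures.
From mathcomp Require Import all_boot all_order all_algebra.
From mathcomp Require Import finmap.
From mathcomp Require Import all_classical all_reals all_analysis.
From mathcomp Require Import measurable_realfun.
From mathcomp Require Import ring lra zify.
Set Implicit Arguments.
Unset Strict Implicit.
Unset Printing Implicit Defensive.
Import Order.TTheory GRing.Theory Num.Theory.
Import numFieldNormedType.Exports.
Local Open Scope classical_set_scope.
Local Open Scope ring_scope.
From mathcomp Require Import complex.
Import Normc.

(** Conditioned to stay positive, a walk whose steps carry no jump of order a_n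
    is at time n distributed on the scale a_n like a Brownian meander at time 1,
    whose density is phi_plus. The lattice refinement comes from smoothing the
    last m = t n steps, with t small, and from the sine transform of the past.

    For an arbitrary event of the past, Fourier inversion over the last m steps
    gives a local limit theorem with an error proportional to the probability of
    that event (local_limit). Hence P(C_(n-m), S_n = x), multiplied by a_n / c, is
    close to the expectation on C_(n-m) of the centred Gaussian density of
    variance t, taken at (x - S_(n-m)) / a_n. When x is of order a_n the reflected
    kernel, taken at (x + S_(n-m)) / a_n, is negligible. After subtracting it only
    the sine transform of S_(n-m) on C_(n-m) matters (heat_reflection).

    That transform obeys an almost closed recursion. A step multiplies it by the
    characteristic function of the step, up to the contribution of the walks that
    leave the half-line; these are then close to 0, where the sine vanishes,
    because no step is of order a_n (pr_big_step, sine_propagation). Started at a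
    small fraction of n, where the sine is still linear, the recursion gives
    K l exp(- l^2 (1 - t) / 2) at frequency l / a_n (sine_relation). The Gaussian
    kernel contributes the missing factor exp(- l^2 t / 2), and the inverse sine
    transform of l exp(- l^2 / 2) is a multiple of phi_plus for every t
    (sine_inversion).

    The argument needs two facts about q_n = P(C_n): for m <= n the ratio
    q_n / q_m is at least about 2 m / (n + m) (pr_positive_ratio), and given C_n
    the position is of order a_n (Ex_positive_trunc_sq). Both follow from Spitzer's identity
    n E[h(S_n); C_n] = sum_k E[h(S_n); S_k > 0, S_n maximal after time k]
    (spitzer_sum). It rests on the exchangeability of the steps, and for h = 1 it
    reads n q_n = sum_k P(S_k > 0) q_(n-k), where P(S_k > 0) tends to 1/2.

    The smoothing is then removed. Away from 0, surviving the last block costs a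
    fraction of order t, by Ottaviani's inequality (block_loss). Near 0 the
    probability is small, because a walk at a low height soon dies, whereas q
    varies slowly (pr_positive_low, hit_near_zero). Finally K is identified by
    summing over the lattice: the total mass must be q_n (limit_const_lim).

    Everything is carried out for the law of the whole trajectory on the space of
    sequences, where shifts and permutations of the steps act. *)

(** * Trajectories and their law *)

Section path_space.
Context {R : realType}.

Definition cylinder : set (set (nat -> R)) :=
  [set C | exists n (A : nat -> set R), (forall i, measurable (A i)) /\
     C = [set x | forall i, (i < n)%N -> A i (x i)]].

(** A separate name keeps this sigma-algebra apart from other measurable
    structures on functions. *)
Definition path := g_sigma_algebraType cylinder.

HB.instance Definition _ := Measurable.on path.

Definition walk (n : nat) (x : path) : R := \sum_(i < n) x i.

Definition shift (j : nat) (x : path) : path := fun i => x (j + i)%N.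

Definition past (j : nat) (E : set path) :=
  forall x y : path, (forall i, (i < j)%N -> x i = y i) -> E x -> E y.

Lemma measurable_cylinder C : cylinder C -> measurable (C : set path).
Proof. exact: sub_sigma_algebra. Qed.

Lemma measurable_coord i : measurable_fun [set: path] (fun x : path => x i : R).
Proof.
move=> _ A mA; rewrite setTI; apply: measurable_cylinder.
exists i.+1, (fun j => if j == i then A else setT); split.
  by move=> j; case: ifP.
apply/seteqP; split => x /=.
  by move=> Ax j _; case: eqP => [->|].
by move=> /(_ i (ltnSn _)); rewrite eqxx.
Qed.

Lemma measurable_walk n : measurable_fun [set: path] (walk n).
Proof.
apply: (@measurable_sum _ _ _ _ 'I_n) => i; exact: measurable_coord.
Qed.

Lemma measurable_to_path d (T : measurableType d) (f : T -> path) :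
  (forall i, measurable_fun [set: T] (fun w => f w i : R)) ->
  measurable_fun [set: T] f.
Proof.
move=> mf; apply: (@measurability _ _ T path _ _ cylinder) => //.
move=> _ [_ [n [A [mA ->]] <-]]; rewrite setTI.
rewrite (_ : _ @^-1` _ = \bigcap_i (if (i < n)%N then (fun w => f w i : R) @^-1` A i else setT)).
  apply: bigcapT_measurable => i; case: ifP => // _.
  by rewrite -[X in measurable X]setTI; exact: mf.
apply/seteqP; split => x /=.
  by move=> h i _; case: ifP => // ni; exact: h.
by move=> h i ni; have := h i Logic.I; rewrite ni.
Qed.

Lemma measurable_shift j : measurable_fun [set: path] (shift j).
Proof. by apply: measurable_to_path => i; exact: measurable_coord. Qed.

Lemma setI_closed_cylinder : setI_closed cylinder.
Proof.
move=> _ _ [n [A [mA ->]]] [m [B [mB ->]]].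
exists (maxn n m), (fun i => (if (i < n)%N then A i else setT) `&`
   (if (i < m)%N then B i else setT)); split.
  by move=> i; apply: measurableI; case: ifP.
apply/seteqP; split => x /=.
  by move=> [hA hB] i _; split; case: ifP => // h; [exact: hA|exact: hB].
move=> h; split => i hi.
  by have := h i; rewrite hi leq_max hi => /(_ isT)[].
by have := h i; rewrite hi leq_max hi orbT => /(_ isT)[].
Qed.

Lemma walk_shift j n (x : path) : walk (j + n) x = walk j x + walk n (shift j x).
Proof. by rewrite /walk big_split_ord. Qed.

Lemma walk_eq n (x y : path) : (forall i, (i < n)%N -> x i = y i) ->
  walk n x = walk n y.
Proof. by move=> xy; apply: eq_bigr => i _; exact: xy. Qed.

(** Stationarity (take E full) together with independence of past and future: the
    only form in which the steps being i.i.d. is used. *)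
Definition markov_property (Q : set path -> \bar R) :=
  forall j (E F : set path), measurable E -> measurable F -> past j E ->
  Q (E `&` shift j @^-1` F) = (Q E * Q F)%E.

End path_space.
Arguments path : clear implicits.

Section product_formula.
Context {d : measure_display} {T : measurableType d} {R : realType}.
Variables (P : probability T R) (f g : T -> path R) (A : set T).
Hypotheses (mf : measurable_fun [set: T] f) (mg : measurable_fun [set: T] g).
Hypothesis mA : measurable A.

(** Both sides are sigma-additive in F and the cylinders are stable under
    intersection, so Dynkin's lemma applies. *)
Lemma product_formula_cylinders :
  (forall F, cylinder F -> P (A `&` f @^-1` F) = (P A * P (g @^-1` F))%E) ->
  forall F, measurable F -> P (A `&` f @^-1` F) = (P A * P (g @^-1` F))%E.
Proof.
move=> PF F mF.
have mpf C : measurable C -> measurable (f @^-1` C).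
  by move=> mC; rewrite -[X in measurable X]setTI; exact: mf.
have mpg C : measurable C -> measurable (g @^-1` C).
  by move=> mC; rewrite -[X in measurable X]setTI; exact: mg.
have Pfin B : measurable B -> P B \is a fin_num.
  by move=> mB; exact: fin_num_measure.
apply: (@dynkin_induction _ (path R) cylinder
  [set F | P (A `&` f @^-1` F) = (P A * P (g @^-1` F))%E]) => //=.
- exact: setI_closed_cylinder.
- by rewrite !preimage_setT setIT probability_setT mule1.
- move=> S mS PS; rewrite -(preimage_setC f) -(preimage_setC g) -setDE.
  have mfS := mpf _ mS; have mgS := mpg _ mS.
  have PAoo : (P A < +oo)%E by rewrite ltey_eq Pfin.
  rewrite (measureD mA mfS PAoo) (probability_setC _ mgS).
  transitivity (P A - P A * P (g @^-1` S))%E; first by congr (_ - _)%E; exact: PS.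
  by rewrite muleBr ?mule1// ?fin_num_adde_defr// Pfin.
- move=> G mG tG PG.
  have tpre (h : T -> path R) : trivIset setT (fun n => h @^-1` G n).
    apply/trivIsetP => /= i j _ _ ij; rewrite -preimage_setI.
    by move/trivIsetP : tG => /(_ _ _ _ _ ij) ->//; rewrite preimage_set0.
  have sum_bigcup (F' : (set T)^nat) : (forall n, measurable (F' n)) ->
      trivIset setT F' -> P (\bigcup_n F' n) = (\sum_(0 <= n <oo) P (F' n))%E.
    by move=> mF' tF'; apply: measure_semi_bigcup => //; exact: bigcupT_measurable.
  rewrite !preimage_bigcup setI_bigcupr sum_bigcup; last 2 first.
  + by move=> i; apply: measurableI => //; exact: mpf.
  + by apply: trivIset_setIl; exact: tpre.
  rewrite sum_bigcup; last 2 first.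
  + by move=> i; exact: mpg.
  + exact: tpre.
  rewrite -[P A]fineK ?Pfin// -nneseriesZl; last by move=> ? _; exact: measure_ge0.
  by apply: eq_eseriesr => i _; rewrite fineK ?Pfin//; exact: PG.
Qed.
End product_formula.

Section law.
Context {d : measure_display} {T : measurableType d} {R : realType}.
Variables (P : probability T R) (X : nat -> {RV P >-> R}).
Hypothesis X_indep : mutually_independent X.
Hypothesis X_ident : identically_distributed X.

Definition trajectory (w : T) : path R := fun i => X i w.

Lemma measurable_trajectory : measurable_fun [set: T] trajectory.
Proof. by apply: measurable_to_path => i; exact: measurable_funPT. Qed.

Lemma independent_block j n (A : nat -> set R) : (forall i, measurable (A i)) ->
  P [set w | forall i, (i < n)%N -> A i (X (j + i)%N w)] =
  (\prod_(i < n) P (X 0 @^-1` A i))%E.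
Proof.
move=> mA.
have [J memJ pJ] : exists2 J : {fset nat}, (forall i, (i \in J) = (j <= i < j + n)%N) &
    perm_eq J (iota j n).
  exists (seq_fset tt (iota j n)); first by move=> i; rewrite seq_fsetE mem_iota.
  by rewrite -[X in perm_eq _ X]undup_id ?iota_uniq//; exact: seq_fset_perm.
have := X_indep (J := J) (A := fun i => A (i - j)%N).
move=> /(_ (fun i _ => mA _)).
have -> : \bigcap_(i in [set` J]) X i @^-1` A (i - j)%N =
   [set w | forall i, (i < n)%N -> A i (X (j + i)%N w)].
  apply/seteqP; split => w /= h i.
    move=> ni; have /= := h (j + i)%N; rewrite addKn; apply.
    by rewrite /= memJ leq_addr ltn_add2l.
  rewrite /= memJ => /andP[ji ijn].
  by have := h (i - j)%N; rewrite subnKC//; apply; rewrite ltn_subLR.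
move=> ->; rewrite (perm_big _ pJ)/=.
rewrite -[X in iota X _]addn0 iotaDl big_map -{1}(subn0 n) -/(index_iota 0 n) big_mkord.
apply: eq_bigr => i _; rewrite addKn.
exact: (X_ident _ 0 (mA i)).
Qed.

Lemma independent_blocks j n (A B : nat -> set R) :
  (forall i, measurable (A i)) -> (forall i, measurable (B i)) ->
  P ([set w | forall i, (i < j)%N -> A i (X i w)] `&`
     [set w | forall i, (i < n)%N -> B i (X (j + i)%N w)]) =
  (P [set w | forall i, (i < j)%N -> A i (X i w)] *
   P [set w | forall i, (i < n)%N -> B i (X i w)])%E.
Proof.
move=> mA mB.
have block0 m (C : nat -> set R) : (forall i, measurable (C i)) ->
    P [set w | forall i, (i < m)%N -> C i (X i w)] = (\prod_(i < m) P (X 0 @^-1` C i))%E.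
  by move=> mC; rewrite -(independent_block 0 m mC); congr (P _); apply/seteqP; split => w /=.
pose C i := if (i < j)%N then A i else B (i - j)%N.
have mC i : measurable (C i) by rewrite /C; case: ifP.
have := independent_block 0 (j + n) mC; rewrite big_split_ord/=.
have -> : [set w | forall i, (i < j + n)%N -> C i (X (0 + i)%N w)] =
  [set w | forall i, (i < j)%N -> A i (X i w)] `&`
     [set w | forall i, (i < n)%N -> B i (X (j + i)%N w)].
  apply/seteqP; split => w /=.
    move=> h; split => i hi.
      by have := h i (ltn_addr _ hi); rewrite /C hi.
    by have := h (j + i)%N; rewrite ltn_add2l => /(_ hi); rewrite /C ltnNge leq_addr/= addKn.
  move=> [hA hB] i ijn; rewrite add0n /C; case: ltnP => ij; first exact: hA.
  by have := hB (i - j)%N; rewrite subnKC//; apply; rewrite ltn_subLR.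
move=> ->.
have -> : (\prod_(i < j) P (X 0 @^-1` C (lshift n i)) =
   P [set w | forall i, (i < j)%N -> A i (X i w)])%E.
  rewrite block0//; apply: eq_bigr => i _.
  by rewrite /C /= ltn_ord.
rewrite (block0 n)//; congr (_ * _)%E; apply: eq_bigr => i _.
by rewrite /C /= ltnNge leq_addr/= addKn.
Qed.

(** Mutual independence gives the formula for cylinders; the future and then the
    past are extended to all measurable sets. *)
Lemma trajectory_markov j (E F : set (path R)) : measurable E -> measurable F ->
  past j E ->
  P (trajectory @^-1` (E `&` shift j @^-1` F)) =
  (P (trajectory @^-1` E) * P (trajectory @^-1` F))%E.
Proof.
move=> mE mF pE; have mtr := measurable_trajectory.
have mpre C : measurable C -> measurable (trajectory @^-1` C).
  by move=> mC; rewrite -[X in measurable X]setTI; exact: mtr.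
have msh C : measurable C -> measurable (shift j @^-1` C : set (path R)).
  by move=> mC; rewrite -[X in measurable X]setTI; exact: measurable_shift.
pose tr (x : path R) : path R := fun i => if (i < j)%N then x i else 0.
have mtr' : measurable_fun [set: path R] tr.
  apply: measurable_to_path => i; rewrite /tr; case: (i < j)%N => //.
  exact: measurable_coord.
have mtrp C : measurable C -> measurable (tr @^-1` C).
  by move=> mC; rewrite -[X in measurable X]setTI; exact: mtr'.
have mrect n (A : nat -> set R) : (forall i, measurable (A i)) ->
    measurable ([set x | forall i, (i < n)%N -> A i (x i)] : set (path R)).
  by move=> mA; apply: measurable_cylinder; exists n, A.
(* one side at a time is extended from cylinders to measurable sets *)
have cyl_fut (A : nat -> set R) : (forall i, measurable (A i)) ->
    P (trajectory @^-1` [set x | forall i, (i < j)%N -> A i (x i)] `&`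
       (shift j \o trajectory) @^-1` F) =
    (P (trajectory @^-1` [set x | forall i, (i < j)%N -> A i (x i)]) *
     P (trajectory @^-1` F))%E.
  move=> mA.
  apply: product_formula_cylinders => //.
  - by apply: measurableT_comp => //; exact: measurable_shift.
  - by apply: mpre; exact: mrect.
  by move=> _ [n [B [mB ->]]]; exact: independent_blocks.
have Etr : trajectory @^-1` E = (tr \o trajectory) @^-1` E.
  by apply/seteqP; split => w /=; apply: pE => i ij; rewrite /tr ij.
have mtt : measurable_fun [set: T] (tr \o trajectory).
  apply: measurable_to_path => i; rewrite /tr /=; case: (i < j)%N => //.
have stat : P (trajectory @^-1` F) = P (trajectory @^-1` (shift j @^-1` F)).
  have := cyl_fut (fun=> setT) (fun=> measurableT).
  rewrite (_ : [set x | _] = setT) ?preimage_setT ?setTI ?probability_setT ?mul1e//.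
  by apply/seteqP; split.
rewrite preimage_setI [in LHS]setIC Etr muleC stat.
apply: (@product_formula_cylinders _ _ _ P (tr \o trajectory) (tr \o trajectory)
  (trajectory @^-1` (shift j @^-1` F)) _ _ _ _ E) => //.
- by apply: mpre; exact: msh.
move=> _ [n [A [mA ->]]]; rewrite setIC muleC -stat.
have [[i [ji ni nAi]]|nA] := pselect (exists i, [/\ (j <= i)%N, (i < n)%N & ~ A i 0]).
  rewrite (_ : _ @^-1` _ = set0) ?set0I ?measure0 ?mul0e//.
  by apply/seteqP; split => w //= /(_ i ni); rewrite /tr ltnNge ji.
pose B i := if (i < n)%N then A i else setT.
rewrite (_ : _ @^-1` _ = trajectory @^-1` [set x | forall i, (i < j)%N -> B i (x i)]).
  apply: cyl_fut => //; by move=> i; rewrite /B; case: ifP.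
apply/seteqP; split => w /= h i.
  by move=> ij; rewrite /B; case: ifP => // ni; have := h i ni; rewrite /tr ij.
move=> ni; rewrite /tr; case: ltnP => ij.
  by have := h i ij; rewrite /B ni.
by apply: contrapT => nAi; apply: nA; exists i.
Qed.
End law.

(** * Expectations of bounded variables *)

Section expectation.
Context {d : measure_display} {T : measurableType d} {R : realType}.
Variable P : probability T R.

Definition pr (A : set T) : R := fine (P A).

Definition Ex (f : T -> R) : R := \int[P]_w f w.

(** Bounded measurable functions: the class is stable under every operation below,
    which disposes of all integrability conditions. *)
Definition bmf (f : T -> R) :=
  measurable_fun [set: T] f /\ exists M : R, forall w, `|f w| <= M.

Lemma prE A : measurable A -> (pr A)%:E = P A.
Proof. by move=> mA; rewrite fineK// fin_num_measure. Qed.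

Lemma pr_ge0 A : 0 <= pr A.
Proof. exact: fine_ge0. Qed.

Lemma prT : pr setT = 1.
Proof. by rewrite /pr probability_setT. Qed.

Lemma pr0 : pr set0 = 0.
Proof. by rewrite /pr measure0. Qed.

Lemma le_pr A B : measurable A -> measurable B -> A `<=` B -> pr A <= pr B.
Proof.
by move=> mA mB AB; rewrite -lee_fin !prE//; apply: le_measure; rewrite ?inE.
Qed.

Lemma pr_le1 A : measurable A -> pr A <= 1.
Proof. by move=> mA; rewrite -prT; exact: le_pr. Qed.

Lemma prU A B : measurable A -> measurable B -> [disjoint A & B] ->
  pr (A `|` B) = pr A + pr B.
Proof.
move=> mA mB /eqP AB; apply: EFin_inj; rewrite EFinD !prE//; last exact: measurableU.
by apply: measureU => //; move: AB; rewrite disj_set2E => /eqP.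
Qed.

Lemma prD A B : measurable A -> measurable B -> pr (A `\` B) = pr A - pr (A `&` B).
Proof.
move=> mA mB; apply/eqP; rewrite eq_sym subr_eq -prU; last first.
- by rewrite disj_set2E; apply/eqP/seteqP; split=> x // [[_ ?] [_ ?]].
- exact: measurableI.
- exact: measurableD.
by rewrite setUC setUIDK.
Qed.

Lemma prC A : measurable A -> pr (~` A) = 1 - pr A.
Proof. by move=> mA; rewrite -setTD prD// setTI prT. Qed.

Lemma prU_le A B : measurable A -> measurable B -> pr (A `|` B) <= pr A + pr B.
Proof.
move=> mA mB; rewrite -lee_fin EFinD !prE//; last exact: measurableU.
exact: measureU2.
Qed.

Lemma bmf_integrable f : bmf f -> P.-integrable [set: T] (EFin \o f).
Proof.
move=> [mf [M fM]]; apply: measurable_bounded_integrable => //.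
  by rewrite ltey_eq fin_num_measure.
by exists M; split; [exact: num_real|move=> x Mx w _; exact: le_trans (fM w) (ltW Mx)].
Qed.

Lemma bmf_cst r : bmf (fun=> r).
Proof. by split => //; exists `|r|. Qed.

Lemma bmfD f g : bmf f -> bmf g -> bmf (fun w => f w + g w).
Proof.
move=> [mf [M fM]] [mg [N gN]]; split; first exact: measurable_funD.
by exists (M + N) => w; rewrite (le_trans (ler_normD _ _))// lerD.
Qed.

Lemma bmfN f : bmf f -> bmf (fun w => - f w).
Proof.
move=> [mf [M fM]]; split; first exact: measurableT_comp.
by exists M => w; rewrite normrN.
Qed.

Lemma bmfB f g : bmf f -> bmf g -> bmf (fun w => f w - g w).
Proof. by move=> bf bg; apply: bmfD => //; exact: bmfN. Qed.

Lemma bmfM f g : bmf f -> bmf g -> bmf (fun w => f w * g w).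
Proof.
move=> [mf [M fM]] [mg [N gN]]; split; first exact: measurable_funM.
by exists (M * N) => w; rewrite normrM ler_pM.
Qed.

Lemma bmf_norm f : bmf f -> bmf (fun w => `|f w|).
Proof.
move=> [mf [M fM]]; split; first exact: measurableT_comp.
by exists M => w; rewrite normr_id.
Qed.

Lemma bmf_ind A : measurable A -> bmf \1_A.
Proof.
move=> mA; split; first exact: measurable_indic.
by exists 1 => w; rewrite indicE; case: (_ \in _); rewrite ?normr1 ?normr0.
Qed.

Lemma bmf_comp (h : R -> R) f : continuous h -> (exists M : R, forall x, `|h x| <= M) ->
  measurable_fun [set: T] f -> bmf (fun w => h (f w)).
Proof.
move=> ch [M hM] mf; split; last by exists M.
by apply: measurableT_comp => //; exact: continuous_measurable_fun.
Qed.

Lemma bmf_cos f : measurable_fun [set: T] f -> bmf (fun w => cos (f w)).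
Proof.
apply: bmf_comp; first exact: continuous_cos.
by exists 1 => x; rewrite ler_norml cos_geN1 cos_le1.
Qed.

Lemma bmf_sin f : measurable_fun [set: T] f -> bmf (fun w => sin (f w)).
Proof.
apply: bmf_comp; first exact: continuous_sin.
by exists 1 => x; rewrite ler_norml sin_geN1 sin_le1.
Qed.

Lemma bmf_sum (I : Type) (r : seq I) (p : pred I) (f : I -> T -> R) :
  (forall i, bmf (f i)) -> bmf (fun w => \sum_(i <- r | p i) f i w).
Proof.
move=> bf; elim: r => [|i r IH].
  by under eq_fun do rewrite big_nil; exact: bmf_cst.
under eq_fun do rewrite big_cons; case: (p i) => //; exact: bmfD.
Qed.

Lemma eq_Ex f g : (forall w, f w = g w) -> Ex f = Ex g.
Proof. by move=> fg; congr Ex; apply/funext. Qed.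

Lemma ExD f g : bmf f -> bmf g -> Ex (fun w => f w + g w) = Ex f + Ex g.
Proof. by move=> bf bg; rewrite /Ex RintegralD//; exact: bmf_integrable. Qed.

Lemma ExB f g : bmf f -> bmf g -> Ex (fun w => f w - g w) = Ex f - Ex g.
Proof. by move=> bf bg; rewrite /Ex RintegralB//; exact: bmf_integrable. Qed.

Lemma ExZ r f : bmf f -> Ex (fun w => r * f w) = r * Ex f.
Proof. by move=> bf; rewrite /Ex RintegralZl//; exact: bmf_integrable. Qed.

Lemma Ex_cst r : Ex (fun=> r) = r.
Proof. by rewrite /Ex Rintegral_cst// -[X in _ * X]/(pr setT) prT mulr1. Qed.

Lemma ExN f : bmf f -> Ex (fun w => - f w) = - Ex f.
Proof.
move=> bf; rewrite -mulN1r -ExZ//; congr Ex; apply/funext => w.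
by rewrite mulN1r.
Qed.

Lemma le_Ex f g : bmf f -> bmf g -> (forall w, f w <= g w) -> Ex f <= Ex g.
Proof.
by move=> bf bg fg; rewrite /Ex le_Rintegral//; exact: bmf_integrable.
Qed.

Lemma Ex_ge0 f : (forall w, 0 <= f w) -> 0 <= Ex f.
Proof. by move=> f0; exact: Rintegral_ge0. Qed.

Lemma norm_Ex f : bmf f -> `|Ex f| <= Ex (fun w => `|f w|).
Proof. by move=> bf; rewrite /Ex le_normr_Rintegral//; exact: bmf_integrable. Qed.

Lemma norm_Ex_le f g : bmf f -> bmf g -> (forall w, `|f w| <= g w) -> `|Ex f| <= Ex g.
Proof.
move=> bf bg fg; apply: le_trans (norm_Ex bf) _.
by apply: le_Ex => //; exact: bmf_norm.
Qed.

Lemma Ex_ind A : measurable A -> Ex \1_A = pr A.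
Proof. by move=> mA; rewrite /Ex /Rintegral integral_indic// setIT. Qed.

Lemma Ex_sum (I : Type) (r : seq I) (p : pred I) (f : I -> T -> R) :
  (forall i, bmf (f i)) ->
  Ex (fun w => \sum_(i <- r | p i) f i w) = \sum_(i <- r | p i) Ex (f i).
Proof.
move=> bf; elim: r => [|i r IH].
  by under eq_fun do rewrite big_nil; rewrite big_nil Ex_cst.
rewrite big_cons; under eq_fun do rewrite big_cons; case: (p i) => //.
by rewrite ExD ?IH//; exact: bmf_sum.
Qed.

Lemma pr_cvg_bigcup (F : (set T)^nat) : (forall n, measurable (F n)) ->
  nondecreasing_seq F -> pr (F n) @[n --> \oo] --> pr (\bigcup_n F n).
Proof.
move=> mF ndF; apply: fine_cvg; rewrite prE; last exact: bigcupT_measurable.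
by apply: nondecreasing_cvg_mu => //; exact: bigcupT_measurable.
Qed.

Lemma pr_cvg_bigcap (F : (set T)^nat) : (forall n, measurable (F n)) ->
  nonincreasing_seq F -> pr (F n) @[n --> \oo] --> pr (\bigcap_n F n).
Proof.
move=> mF niF; apply: fine_cvg; rewrite prE; last exact: bigcapT_measurable.
apply: nonincreasing_cvg_mu => //; last exact: bigcapT_measurable.
by rewrite ltey_eq fin_num_measure.
Qed.

(** Independent bounded variables: the expectation of a product factorizes, by
    Fubini for the product of the two laws. *)
Lemma Ex_prod f g : bmf f -> bmf g ->
  (forall A B, measurable A -> measurable B ->
     P (f @^-1` A `&` g @^-1` B) = (P (f @^-1` A) * P (g @^-1` B))%E) ->
  Ex (fun w => f w * g w) = Ex f * Ex g.
Proof.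
move=> bf bg fg; have [mf [M fM]] := bf; have [mg [N gN]] := bg.
pose F : {mfun T >-> R} := HB.pack f (isMeasurableFun.Build _ _ _ _ _ mf).
pose G : {mfun T >-> R} := HB.pack g (isMeasurableFun.Build _ _ _ _ _ mg).
have mfg : measurable_fun [set: T] (fun w => (f w, g w)).
  exact: measurable_fun_pair.
pose H : {mfun T >-> (R * R)%type} := HB.pack (fun w => (f w, g w))
   (isMeasurableFun.Build _ _ _ _ _ mfg).
pose m1 := distribution P F; pose m2 := distribution P G.
pose m := distribution P H.
have mE X : measurable X -> (m1 \x m2)%E X = m X.
  by apply: product_measure_unique => A B mA mB; rewrite -fg.
have mxy : measurable_fun [set: (R * R)%type] (fun z : R * R => (z.1 * z.2)%:E).
  by apply/measurable_EFinP; apply: measurable_funM.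
have ifg := bmf_integrable (bmfM bf bg).
have im : m.-integrable setT (fun z : R * R => (z.1 * z.2)%:E).
  by apply: integrable_pushforward.
have e1 : (\int[P]_w (f w * g w)%:E = \int[m]_z (z.1 * z.2)%:E)%E.
  by rewrite integral_distribution.
rewrite {1}/Ex /Rintegral e1.
have im12 : (m1 \x m2)%E.-integrable setT (fun z : R * R => (z.1 * z.2)%:E).
  apply/integrableP; split => //.
  rewrite (eq_measure_integral m); first by case/integrableP: im.
  by move=> A mA _; exact: mE.
rewrite (eq_measure_integral (m1 \x m2)%E); last by move=> A mA _; apply/esym; exact: mE.
rewrite -integral12_prod_meas1//.
have if1 : m1.-integrable setT (EFin \o id).
  by apply: integrable_pushforward => //; [exact/measurable_EFinP|exact: bmf_integrable].
have ig1 : m2.-integrable setT (EFin \o id).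
  by apply: integrable_pushforward => //; [exact/measurable_EFinP|exact: bmf_integrable].
have Eg : (\int[m2]_y y%:E = (Ex g)%:E)%E.
  rewrite (@integral_distribution _ _ _ _ _ _ G EFin)//; last exact: bmf_integrable.
  by rewrite /Ex /Rintegral fineK//; apply: integrable_fin_num => //; exact: bmf_integrable.
have Ef : (\int[m1]_y y%:E = (Ex f)%:E)%E.
  rewrite (@integral_distribution _ _ _ _ _ _ F EFin)//; last exact: bmf_integrable.
  by rewrite /Ex /Rintegral fineK//; apply: integrable_fin_num => //; exact: bmf_integrable.
transitivity (fine (\int[m1]_(x in setT) ((Ex g)%:E * (x : R)%:E)))%E.
  congr fine; apply: eq_integral => x _; rewrite /fubini_F/=.
  rewrite [RHS]muleC -Eg -integralZl//.
by rewrite integralZl// Ef mulrC.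
Qed.

End expectation.

(** * Characteristic functions of walks *)

Section complex_modulus.
Context {R : realType}.
Implicit Types z w : R[i].

Lemma normc_ge0 z : 0 <= normc z.
Proof. by case: z => a b; exact: sqrtr_ge0. Qed.

Lemma normcX z n : normc (z ^+ n) = normc z ^+ n.
Proof.
elim: n => [|n IH]; first by rewrite !expr0 normc1.
by rewrite !exprS normcM IH.
Qed.

Lemma normcB z w : normc (z - w) = normc (w - z).
Proof. by rewrite -normcN opprB. Qed.

Lemma le_normcB z w : normc (z - w) <= normc z + normc w.
Proof. by rewrite (le_trans (le_normcD _ _))// normcN. Qed.

Lemma ler_dist_normc z w : `|normc z - normc w| <= normc (z - w).
Proof.
rewrite ler_norml; apply/andP; split.
  rewrite lerNl opprB lerBlDr -[X in normc X <= _](subrK z) normcB.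
  by apply: le_trans (le_normcD _ _) _; rewrite normcB.
by rewrite lerBlDr -{1}(subrK w z); exact: le_normcD.
Qed.

Lemma sqr_normc z : normc z ^+ 2 = Re z ^+ 2 + Im z ^+ 2.
Proof. by case: z => a b /=; rewrite sqr_sqrtr// addr_ge0 ?sqr_ge0. Qed.

Lemma normc_Re z : `|Re z| <= normc z.
Proof.
rewrite -(ler_pXn2r (n := 2)) ?nnegrE ?normr_ge0 ?normc_ge0//.
by rewrite sqr_normc real_normK ?num_real// lerDl sqr_ge0.
Qed.

Lemma normc_Im z : `|Im z| <= normc z.
Proof.
rewrite -(ler_pXn2r (n := 2)) ?nnegrE ?normr_ge0 ?normc_ge0//.
by rewrite sqr_normc real_normK ?num_real// lerDr sqr_ge0.
Qed.

Lemma normc_le_ReIm z : normc z <= `|Re z| + `|Im z|.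
Proof.
rewrite -(ler_pXn2r (n := 2)) ?nnegrE ?addr_ge0 ?normr_ge0 ?normc_ge0//.
rewrite sqr_normc sqrrD !real_normK ?num_real//.
by rewrite lerD2r lerDl mulrn_wge0// mulr_ge0.
Qed.

Lemma normcR (r : R) : normc (r%:C)%C = `|r|.
Proof. by rewrite /normc /= expr0n/= addr0 sqrtr_sqr. Qed.

Lemma ReB z w : Re (z - w) = Re z - Re w. Proof. by case: z w => ? ? []. Qed.
Lemma ImB z w : Im (z - w) = Im z - Im w. Proof. by case: z w => ? ? []. Qed.

Lemma normc_prod_sub1 z n (e : R) : normc z <= 1 -> normc (z - 1) <= e ->
  normc (z ^+ n - 1) <= n%:R * e.
Proof.
move=> z1 ze; elim: n => [|n IH]; first by rewrite expr0 subrr normc0 mul0r.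
rewrite exprS (_ : z * z ^+ n - 1 = z * (z ^+ n - 1) + (z - 1)); last by ring.
apply: le_trans (le_normcD _ _) _; rewrite normcM -natr1 mulrDl mul1r lerD//.
apply: le_trans IH; rewrite -[leRHS]mul1r ler_wpM2r//.
exact: normc_ge0.
Qed.
End complex_modulus.

Section markov.
Context {R : realType}.
Variable Q : probability (path R) R.
Hypothesis MP : markov_property Q.

Definition depends (U : Type) (j : nat) (f : path R -> U) :=
  forall x y : path R, (forall i, (i < j)%N -> x i = y i) -> f x = f y.

Lemma depends_past (U : Type) j (f : path R -> U) (A : set U) :
  depends j f -> past j (f @^-1` A).
Proof. by move=> df x y xy /=; rewrite (df x y xy). Qed.

Lemma depends_walk j n : (n <= j)%N -> depends j (walk n : path R -> R).
Proof. by move=> nj x y xy; apply: walk_eq => i ni; apply: xy; exact: leq_trans nj. Qed.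

Lemma past_depends_ind j (A : set (path R)) : past j A -> depends j (\1_A : path R -> R).
Proof.
move=> pA x y xy; rewrite !indicE; congr ((_ : bool)%:R).
apply/idP/idP => /set_mem Ax; apply/mem_set; first exact: pA Ax.
by apply: pA Ax => i ij; rewrite xy.
Qed.

Lemma measurable_shiftP j (F : set (path R)) : measurable F -> measurable (shift j @^-1` F).
Proof. by move=> mF; rewrite -[X in measurable X]setTI; exact: measurable_shift. Qed.

Lemma past_setT j : past j [set: path R].
Proof. by []. Qed.

Lemma pr_shift j F : measurable F -> pr Q (shift j @^-1` F) = pr Q F.
Proof.
move=> mF; have := MP (j := j) measurableT mF (@past_setT j).
by rewrite /pr setTI probability_setT mul1e => ->.
Qed.

Lemma pr_markov j E F : measurable E -> measurable F -> past j E ->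
  pr Q (E `&` shift j @^-1` F) = pr Q E * pr Q F.
Proof.
by move=> mE mF pE; rewrite /pr MP// fineM// fin_num_measure.
Qed.

Lemma bmf_shift j (g : path R -> R) : bmf g -> bmf (g \o shift j).
Proof.
move=> [mg [M gM]]; split; last by exists M => x; exact: gM.
by apply: measurableT_comp => //; exact: measurable_shift.
Qed.

Lemma Ex_markov_gen j f g : bmf f -> bmf g -> depends j f ->
  Ex Q (fun x => f x * g (shift j x)) = Ex Q f * Ex Q (g \o shift j).
Proof.
move=> bf bg df.
apply: (@Ex_prod _ _ _ Q f (g \o shift j)) => //; first exact: bmf_shift.
move=> A B mA mB; rewrite (comp_preimage _ (shift j) g).
have mE : measurable (f @^-1` A) by rewrite -[X in measurable X]setTI; case: bf => + _; apply.
have mF : measurable (g @^-1` B) by rewrite -[X in measurable X]setTI; case: bg => + _; apply.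
rewrite MP//; last exact: depends_past.
by congr (_ * _)%E; rewrite -[LHS]prE// -(pr_shift j)// prE//; exact: measurable_shiftP.
Qed.

(** Both expectations are integrals of the identity against the same image law. *)
Lemma Ex_preserved (t : path R -> path R) g : measurable_fun [set: path R] t ->
  (forall F, measurable F -> pr Q (t @^-1` F) = pr Q F) -> bmf g -> Ex Q (g \o t) = Ex Q g.
Proof.
move=> mt Qt bg; have [mg [M gM]] := bg.
have bgt : bmf (g \o t).
  by split; [exact: measurableT_comp|exists M => x; exact: gM].
have mh := bgt.1.
pose G : {mfun path R >-> R} := HB.pack g (isMeasurableFun.Build _ _ _ _ _ mg).
pose H : {mfun path R >-> R} := HB.pack (g \o t) (isMeasurableFun.Build _ _ _ _ _ mh).
have e (K : {mfun path R >-> R}) : bmf (K : path R -> R) ->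
    Ex Q K = fine (\int[distribution Q K]_y y%:E)%E.
  move=> bK; rewrite (@integral_distribution _ _ _ _ _ _ K EFin)//.
  exact: bmf_integrable.
rewrite -[LHS]/(Ex Q H) -[RHS]/(Ex Q G) !e//.
congr fine; apply: eq_measure_integral => A mA _.
have mF : measurable (g @^-1` A) by have := mg measurableT A mA; rewrite setTI.
transitivity (Q (t @^-1` (g @^-1` A))); first by rewrite -comp_preimage.
rewrite -[LHS]prE ?Qt ?prE//.
by have := mt measurableT _ mF; rewrite setTI.
Qed.

Lemma Ex_shift j g : bmf g -> Ex Q (g \o shift j) = Ex Q g.
Proof.
by move=> bg; apply: Ex_preserved => // [|F mF]; [exact: measurable_shift|exact: pr_shift].
Qed.

Lemma Ex_markov j f g : bmf f -> bmf g -> depends j f ->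
  Ex Q (fun x => f x * g (shift j x)) = Ex Q f * Ex Q g.
Proof. by move=> bf bg df; rewrite Ex_markov_gen// Ex_shift. Qed.

(** Transform of the n-th position weighted by [f]; for [f = 1] this is the
    characteristic function. *)
Definition wcf (f : path R -> R) n (s : R) : R[i] :=
  (Ex Q (fun x => f x * cos (s * walk n x)) +i*
   Ex Q (fun x => f x * sin (s * walk n x)))%C.

Definition cf (s : R) : R[i] := wcf (fun=> 1) 1 s.

Lemma measurable_scaled_walk n s : measurable_fun [set: path R] (fun x => s * walk n x).
Proof. by apply: measurable_funM => //; exact: measurable_walk. Qed.

Lemma bmf_cos_walk n s : bmf (fun x : path R => cos (s * walk n x)).
Proof. by apply: bmf_cos; exact: measurable_scaled_walk. Qed.

Lemma bmf_sin_walk n s : bmf (fun x : path R => sin (s * walk n x)).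
Proof. by apply: bmf_sin; exact: measurable_scaled_walk. Qed.

(** The exponential of a sum of independent blocks factorizes. *)
Lemma wcf_concat f g n m s : bmf f -> bmf g -> depends n f ->
  wcf (fun w => f w * g (shift n w)) (n + m) s = wcf f n s * wcf g m s.
Proof.
move=> bf bg df; have bc := bmf_cos_walk; have bs := bmf_sin_walk.
have dfc : depends n (fun x : path R => f x * cos (s * walk n x)).
  by move=> x y xy; rewrite (df x y xy) (depends_walk (leqnn n) xy).
have dfs : depends n (fun x : path R => f x * sin (s * walk n x)).
  by move=> x y xy; rewrite (df x y xy) (depends_walk (leqnn n) xy).
have fc := bmfM bf (bc n s); have fs := bmfM bf (bs n s).
have gc := bmfM bg (bc m s); have gs := bmfM bg (bs m s).
have gC := bmf_shift n gc; have gS := bmf_shift n gs.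
rewrite /wcf; congr Complex => /=.
  rewrite -(Ex_markov fc gc dfc) -(Ex_markov fs gs dfs) -ExB; [|exact: bmfM|exact: bmfM].
  by apply: eq_Ex => x /=; rewrite walk_shift mulrDr cosD; ring.
rewrite -(Ex_markov fc gs dfc) -(Ex_markov fs gc dfs) -ExD; [|exact: bmfM|exact: bmfM].
by apply: eq_Ex => x /=; rewrite walk_shift mulrDr sinD; ring.
Qed.

Lemma wcf_markov f j n s : bmf f -> depends j f ->
  wcf f (j + n) s = wcf f j s * wcf (fun=> 1) n s.
Proof.
move=> bf df; rewrite -wcf_concat//; last exact: bmf_cst.
by congr wcf; apply/funext => w; rewrite mulr1.
Qed.

Lemma walk0 (x : path R) : walk 0 x = 0.
Proof. by rewrite /walk big_ord0. Qed.

Lemma walk1 (x : path R) : walk 1 x = x 0%N.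
Proof. by rewrite /walk big_ord1. Qed.

Lemma wcf1 n s : wcf (fun=> 1) n s = cf s ^+ n.
Proof.
elim: n => [|n IH].
  rewrite expr0 /wcf; congr Complex.
    by under eq_Ex => x do rewrite walk0 mulr0 cos0 mulr1; rewrite Ex_cst.
  by under eq_Ex => x do rewrite walk0 mulr0 sin0 mulr0; rewrite Ex_cst.
rewrite -addn1 wcf_markov//; last exact: bmf_cst.
by rewrite IH exprD expr1.
Qed.

Lemma wcfM f j n s : bmf f -> depends j f -> wcf f (j + n) s = wcf f j s * cf s ^+ n.
Proof. by move=> bf df; rewrite wcf_markov// wcf1. Qed.

(** Project on the direction of the complex number itself: the modulus is the
    expectation of f times a cosine. *)
Lemma normc_wcf_ge0 f n s : bmf f -> (forall w, 0 <= f w) -> normc (wcf f n s) <= Ex Q f.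
Proof.
move=> bf f0; set z := wcf f n s; have z0 := normc_ge0 z.
have F0 : 0 <= Ex Q f by apply: Ex_ge0.
have [->//|zn0] := eqVneq (normc z) 0; have zp : 0 < normc z by rewrite lt_neqAle eq_sym zn0.
have bc := bmfM bf (bmf_cos_walk n s); have bs := bmfM bf (bmf_sin_walk n s).
pose u := Re z; pose v := Im z; rewrite -(ler_pM2l zp) -expr2 sqr_normc -/u -/v.
have -> : u ^+ 2 + v ^+ 2 = Ex Q (fun w => u * (f w * cos (s * walk n w)) + v * (f w * sin (s * walk n w))).
  by rewrite ExD ?ExZ//; apply: bmfM => //; exact: bmf_cst.
rewrite -ExZ//; apply: le_Ex.
- by apply: bmfD; apply: bmfM => //; exact: bmf_cst.
- by apply: bmfM => //; exact: bmf_cst.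
move=> w; set C := cos _; set S := sin _.
have -> : u * (f w * C) + v * (f w * S) = (u * C + v * S) * f w by ring.
rewrite ler_wpM2r//.
have zE : normc z ^+ 2 = u ^+ 2 + v ^+ 2 by rewrite sqr_normc.
have CS : C ^+ 2 + S ^+ 2 = 1 by exact: cos2Dsin2.
rewrite leNgt; apply/negP => h.
have : normc z ^+ 2 < (u * C + v * S) ^+ 2 by rewrite ltr_sqr// nnegrE ltW// (le_lt_trans z0 h).
rewrite zE => h2; have := sqr_ge0 (u * S - v * C).
have -> : (u * S - v * C) ^+ 2 = (u ^+ 2 + v ^+ 2) * (C ^+ 2 + S ^+ 2) - (u * C + v * S) ^+ 2 by ring.
by rewrite CS mulr1; lra.
Qed.

Lemma normc_cf_le1 s : normc (cf s) <= 1.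
Proof. by rewrite -(Ex_cst Q 1); apply: normc_wcf_ge0 => //; exact: bmf_cst. Qed.

End markov.

(** * Gaussian integrals *)

Section gaussian.
Context {R : realType}.
Notation mu := (@lebesgue_measure R).
Implicit Types (A l u s : R).

Definition gaussian A l : R := expR (- (A * l ^+ 2 / 2)).

Lemma gaussian_ge0 A l : 0 <= gaussian A l. Proof. exact: expR_ge0. Qed.

Lemma gaussian_le1 A l : 0 <= A -> gaussian A l <= 1.
Proof.
move=> A0; rewrite -expR0 ler_expR oppr_le0.
by rewrite divr_ge0// mulr_ge0// sqr_ge0.
Qed.

Lemma gaussianN A l : gaussian A (- l) = gaussian A l.
Proof. by rewrite /gaussian sqrrN. Qed.

Lemma is_derive_gaussian A l : is_derive l 1 (gaussian A) (- (A * l) * gaussian A l).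
Proof.
rewrite /gaussian; apply: is_derive_eq.
by rewrite /GRing.scale /=; field.
Qed.

Lemma continuous_gaussian A : continuous (gaussian A).
Proof.
move=> l; apply: differentiable_continuous; apply/derivable1_diffP.
by have := is_derive_gaussian A l; case.
Qed.

Lemma measurable_gaussian A : measurable_fun [set: R] (gaussian A).
Proof. by apply: continuous_measurable_fun; exact: continuous_gaussian. Qed.

Lemma gaussian_normal_pdf A l : 0 < A ->
  gaussian A l = Num.sqrt (2 * pi / A) * normal_pdf 0 (Num.sqrt A)^-1 l.
Proof.
move=> A0; have sA : (Num.sqrt A)^-1 != 0 by rewrite invr_eq0 sqrtr_eq0 -ltNge.
rewrite /normal_pdf (negbTE sA) /normal_peak /normal_fun subr0 mulrA.
have -> : (Num.sqrt A)^-1 ^+ 2 = A^-1 by rewrite exprVn sqr_sqrtr ?ltW.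
have -> : A^-1 * pi *+ 2 = 2 * pi / A :> R by rewrite -mulr_natl; ring.
rewrite divff ?mul1r; last first.
  by rewrite sqrtr_eq0 -ltNge divr_gt0// mulr_gt0// pi_gt0.
rewrite /gaussian; congr expR; rewrite -mulr_natl; field; exact: lt0r_neq0.
Qed.

Lemma integrable_gaussian A : 0 < A -> mu.-integrable [set: R] (EFin \o gaussian A).
Proof.
move=> A0; rewrite (_ : EFin \o _ = fun l => (Num.sqrt (2 * pi / A))%:E *
  (normal_pdf 0 (Num.sqrt A)^-1 l)%:E)%E; last first.
  by apply/funext => l; rewrite /= gaussian_normal_pdf// EFinM.
by apply: integrableZl => //; exact: integrable_normal_pdf.
Qed.

Lemma Rintegral_gaussian A : 0 < A -> \int[mu]_l gaussian A l = Num.sqrt (2 * pi / A).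
Proof.
move=> A0; under eq_Rintegral => l _ do rewrite gaussian_normal_pdf//.
rewrite RintegralZl//; last exact: integrable_normal_pdf.
by rewrite /Rintegral integral_normal_pdf mulr1.
Qed.

Lemma integrable_le (f g : R -> R) : measurable_fun [set: R] f ->
  mu.-integrable [set: R] (EFin \o g) -> (forall x, `|f x| <= g x) ->
  mu.-integrable [set: R] (EFin \o f).
Proof.
move=> mf ig fg; apply: (le_integrable measurableT _ _ ig); first exact/measurable_EFinP.
by move=> x _; rewrite /= lee_fin (le_trans (fg x))// ler_norm.
Qed.

Lemma sqr_gaussian_le A l : 0 < A -> l ^+ 2 * gaussian A l <= 4 / A * gaussian (A / 2) l.
Proof.
move=> A0; have -> : gaussian A l = gaussian (A / 2) l * gaussian (A / 2) l.
  by rewrite /gaussian -expRD; congr expR; field.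
rewrite mulrA ler_wpM2r ?gaussian_ge0// /gaussian expRN ler_pdivrMr ?expR_gt0//.
have h : A * l ^+ 2 / 4 <= expR (A / 2 * l ^+ 2 / 2).
  apply: le_trans (expR_ge1Dx _); rewrite (_ : A / 2 * l ^+ 2 / 2 = A * l ^+ 2 / 4); last by field.
  by rewrite lerDr.
apply: (@le_trans _ _ (4 / A * (A * l ^+ 2 / 4))).
  by rewrite le_eqVlt; apply/orP; left; apply/eqP; field; exact: lt0r_neq0.
by rewrite ler_wpM2l// divr_ge0// ltW.
Qed.

Lemma integrable_sqr_gaussian A : 0 < A ->
  mu.-integrable [set: R] (EFin \o (fun l => l ^+ 2 * gaussian A l)).
Proof.
move=> A0; apply: (@integrable_le _ (fun l => 4 / A * gaussian (A / 2) l)).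
- by apply: measurable_funM; [exact: measurable_funX|exact: measurable_gaussian].
- rewrite (_ : EFin \o _ = fun l => (4 / A)%:E * (gaussian (A / 2) l)%:E)%E//.
  by apply: integrableZl => //; apply: integrable_gaussian; rewrite divr_gt0.
by move=> l; rewrite ger0_norm ?sqr_gaussian_le// mulr_ge0 ?sqr_ge0 ?gaussian_ge0.
Qed.

Lemma integrable_norm_gaussian A : 0 < A ->
  mu.-integrable [set: R] (EFin \o (fun l => `|l| * gaussian A l)).
Proof.
move=> A0; apply: (@integrable_le _ (fun l => gaussian A l + l ^+ 2 * gaussian A l)).
- by apply: measurable_funM; [exact: normr_measurable|exact: measurable_gaussian].
- rewrite (_ : EFin \o _ = (EFin \o gaussian A) \+ (EFin \o (fun l => (l ^+ 2 * gaussian A l)%R)))%E//.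
  apply: integrableD => //; first exact: integrable_gaussian.
  exact: integrable_sqr_gaussian.
move=> l; rewrite ger0_norm ?mulr_ge0 ?gaussian_ge0//.
rewrite -[X in X + _]mul1r -mulrDl ler_wpM2r ?gaussian_ge0//.
have := sqr_ge0 (`|l| - 1); rewrite sqrrB1 real_normK ?num_real//; have := normr_ge0 l.
move: (l ^+ 2) `|l| => a b; nra.
Qed.

(** The integral of a derivative vanishes when the primitive vanishes at both
    infinities. *)
Lemma Rintegral_derivative0 (F f : R -> R) : (forall x : R, is_derive x 1 F (f x)) ->
  continuous f -> mu.-integrable [set: R] (EFin \o f) ->
  F n%:R @[n --> \oo] --> 0 -> F (- n%:R) @[n --> \oo] --> 0 ->
  \int[mu]_x f x = 0.
Proof.
move=> dF cf intf Fp Fn.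
have cF : continuous F.
  move=> x; apply: differentiable_continuous; apply/derivable1_diffP.
  by have := dF x; case.
pose fn (n : nat) x := (f x * \1_(`[- n.+1%:R, n.+1%:R]%classic : set R) x)%:E.
have FTC n : (\int[mu]_x fn n x = (F n.+1%:R - F (- n.+1%:R))%:E)%E.
  rewrite EFinB -(@continuous_FTC2 _ f)//.
  - rewrite [RHS]integral_mkcond; apply: eq_integral => x _.
    by rewrite /fn patchE indicE; case: ifP => _; rewrite ?mulr1 ?mulr0.
  - by rewrite (@lt_le_trans _ _ 0)// ltrNl oppr0.
  - exact: continuous_subspaceT.
  - split; first by move=> x _; have := dF x; case.
    + by apply: cvg_at_right_filter; exact: cF.
    + by apply: cvg_at_left_filter; exact: cF.
  - by move=> x _; rewrite derive1E; exact: (@derive_val _ _ _ _ _ _ _ (dF x)).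
have mf : measurable_fun [set: R] f by exact: continuous_measurable_fun.
have : ((\int[mu]_x fn n x) @[n --> \oo] --> \int[mu]_x (f x)%:E)%E.
  apply: (@dominated_cvg _ _ _ mu setT measurableT fn (EFin \o f) (fun x => `|f x|%:E)) => //.
  - by move=> n; apply/measurable_EFinP; apply: measurable_funM => //; exact: measurable_indic.
  - move=> x _; apply: cvg_EFin; first by near=> n.
    apply: cvg_near_cst; near=> n; rewrite /fn /= indicE mem_set ?mulr1//=.
    rewrite in_itv /= -ler_norml (@le_trans _ _ n%:R) ?ler_nat//.
    by near: n; exact: nbhs_infty_ger.
  - have := integrable_abse intf; congr (integrable _ _ _).
  - move=> n x _; rewrite /fn /= lee_fin normrM ler_piMr// indicE.
    by case: (_ \in _); rewrite ?normr1 ?normr0.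
move=> c1; have c2 : ((\int[mu]_x fn n x) @[n --> \oo] --> 0%:E)%E.
  under eq_fun do rewrite FTC; apply: cvg_EFin; first by near=> n.
  rewrite -[X in _ --> X]subr0; apply: cvgB.
    by have := Fp; rewrite -cvg_shiftS.
  by have := Fn; rewrite -cvg_shiftS.
by rewrite /Rintegral (cvg_unique _ c1 c2).
Unshelve. all: by end_near.
Qed.

Lemma cvg_gaussian A : 0 < A -> gaussian A n%:R @[n --> \oo] --> 0.
Proof.
move=> A0; apply: (@squeeze_cvgr _ _ _ _ (fun=> 0) (fun n => 4 / A / n%:R)).
- near=> n; rewrite gaussian_ge0/= ler_pdivlMr; last by rewrite ltr0n; near: n; exists 1%N.
  apply: (@le_trans _ _ (n%:R ^+ 2 * gaussian A n%:R)).
    rewrite mulrC ler_wpM2r ?gaussian_ge0// expr2 ler_peMl// ler1n; near: n; by exists 1%N.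
  apply: le_trans (sqr_gaussian_le _ A0) _.
  by apply: ler_piMr; [rewrite divr_ge0// ltW|apply: gaussian_le1; rewrite divr_ge0// ltW].
- exact: cvg_cst.
- have h : 4 / A * harmonic n @[n --> \oo] --> 4 / A * 0.
    by apply: cvgMl_tmp; exact: cvg_harmonic.
  by rewrite -cvg_shiftS; rewrite mulr0 in h; exact: h.
Unshelve. all: by end_near.
Qed.

Definition gaussian_cos A u : R := \int[mu]_l (gaussian A l * cos (l * u)).
Definition gaussian_sin A u : R := \int[mu]_l (gaussian A l * (l * sin (l * u))).

Lemma measurable_cosM u : measurable_fun [set: R] (fun l => cos (l * u)).
Proof.
apply: measurableT_comp; first by apply: continuous_measurable_fun; exact: continuous_cos.
exact: measurable_funM.
Qed.

Lemma measurable_sinM u : measurable_fun [set: R] (fun l => sin (l * u)).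
Proof.
apply: measurableT_comp; first by apply: continuous_measurable_fun; exact: continuous_sin.
exact: measurable_funM.
Qed.

Lemma norm_cos_le1 (x : R) : `|cos x| <= 1.
Proof. by rewrite ler_norml cos_geN1 cos_le1. Qed.

Lemma norm_sin_le1 (x : R) : `|sin x| <= 1.
Proof. by rewrite ler_norml sin_geN1 sin_le1. Qed.

Lemma integrable_gaussian_cos A u : 0 < A ->
  mu.-integrable [set: R] (EFin \o (fun l => gaussian A l * cos (l * u))).
Proof.
move=> A0; apply: integrable_le (integrable_gaussian A0) _.
  by apply: measurable_funM; [exact: measurable_gaussian|exact: measurable_cosM].
move=> l; rewrite normrM ger0_norm ?gaussian_ge0// ler_piMr ?gaussian_ge0//.
exact: norm_cos_le1.
Qed.

Lemma integrable_gaussian_sin A u : 0 < A ->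
  mu.-integrable [set: R] (EFin \o (fun l => gaussian A l * (l * sin (l * u)))).
Proof.
move=> A0; apply: integrable_le (integrable_norm_gaussian A0) _.
  apply: measurable_funM; first exact: measurable_gaussian.
  by apply: measurable_funM => //; exact: measurable_sinM.
move=> l; rewrite !normrM (ger0_norm (gaussian_ge0 A l)) mulrA [_ * `|l|]mulrC.
by rewrite ler_piMr ?mulr_ge0 ?gaussian_ge0// norm_sin_le1.
Qed.

Lemma is_derive_gaussian_cos A u : 0 < A ->
  is_derive u 1 (gaussian_cos A) (- gaussian_sin A u).
Proof.
move=> A0.
pose f (x y : R) := gaussian A y * cos (y * x).
have df (x y : R) : is_derive x 1 (f ^~ y) (- (gaussian A y * (y * sin (y * x)))).
  by rewrite /f; apply: is_derive_eq; rewrite /GRing.scale /=; ring.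
have d1E x y : partial1of2 f x y = - (gaussian A y * (y * sin (y * x))).
  by rewrite partial1of2E; exact: (@derive_val _ _ _ _ _ _ _ (df x y)).
have uI : (`]u - 1, u + 1[%classic : set R) u.
  by rewrite /= in_itv /= ltrBlDr ltrDl ltr01.
have intf x : mu.-integrable [set: R] (EFin \o f x) by exact: integrable_gaussian_cos.
have der x y : derivable (f ^~ y) x 1 by have := df x y; case.
have ub x y : `|partial1of2 f x y| <= `|y| * gaussian A y.
  rewrite d1E normrN !normrM (ger0_norm (gaussian_ge0 A y)) mulrA [_ * `|y|]mulrC.
  by rewrite ler_piMr ?mulr_ge0 ?gaussian_ge0// norm_sin_le1.
have G0 y : 0 <= `|y| * gaussian A y by rewrite mulr_ge0 ?gaussian_ge0.
have D := @derivable_under_integral R _ _ mu f setT measurableT u (u - 1) (u + 1) uI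
  (fun x _ => intf x) (fun x y _ _ => der x y) _ G0 (integrable_norm_gaussian A0)
  (fun x y _ _ => ub x y).
have E := @differentiation_under_integral R _ _ mu f setT measurableT u (u - 1) (u + 1) uI
  (fun x _ => intf x) (fun x y _ _ => der x y) _ G0 (integrable_norm_gaussian A0)
  (fun x y _ _ => ub x y).
apply: DeriveDef => //; rewrite -derive1E E.
rewrite /gaussian_sin -mulN1r -RintegralZl//; last exact: integrable_gaussian_sin.
by apply: eq_Rintegral => l _; rewrite d1E mulN1r.
Qed.

(** Integration by parts. *)
Lemma gaussian_sinE A u : 0 < A -> gaussian_sin A u = u / A * gaussian_cos A u.
Proof.
move=> A0.
pose F l := gaussian A l * sin (l * u).
pose f l := u * (gaussian A l * cos (l * u)) - A * (gaussian A l * (l * sin (l * u))).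
have dF l : is_derive l 1 F (f l).
  have dg := is_derive_gaussian A l.
  by rewrite /F; apply: is_derive_eq; rewrite /f /GRing.scale /=; ring.
have ic := integrable_gaussian_cos u A0; have is_ := integrable_gaussian_sin u A0.
have intf : mu.-integrable [set: R] (EFin \o f).
  rewrite (_ : EFin \o f = (fun l => u%:E * (gaussian A l * cos (l * u))%:E -
     A%:E * (gaussian A l * (l * sin (l * u)))%:E))%E; last by apply/funext.
  by apply: integrableB => //; apply: integrableZl.
have cf : continuous f.
  have cg := @continuous_gaussian A.
  have ccos : continuous (fun l => cos (l * u)).
    by move=> l; apply: continuous_comp; [exact: mulrr_continuous|exact: continuous_cos].
  have csin : continuous (fun l => sin (l * u)).
    by move=> l; apply: continuous_comp; [exact: mulrr_continuous|exact: continuous_sin].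
  move=> l; apply: cvgB; apply: cvgMl_tmp; apply: cvgM; [exact: cg|exact: ccos|exact: cg|].
  by apply: cvgM; [exact: cvg_id|exact: csin].
have bnd (e : nat -> R) : (forall n, gaussian A (e n) = gaussian A n%:R) ->
    F (e n) @[n --> \oo] --> 0.
  move=> eg; apply: (@squeeze_cvgr _ _ _ _ (fun n => - gaussian A n%:R) (fun n => gaussian A n%:R)).
  - apply: nearW => n; rewrite -ler_norml /F normrM eg ger0_norm ?gaussian_ge0//.
    by rewrite ler_piMr ?gaussian_ge0// norm_sin_le1.
  - by rewrite -oppr0; apply: cvgN; exact: cvg_gaussian.
  - exact: cvg_gaussian.
have := Rintegral_derivative0 dF cf intf (bnd (fun n => n%:R) (fun=> erefl))
  (bnd (fun n => - n%:R) (fun n => gaussianN A n%:R)).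
rewrite /f RintegralB//; last 2 first.
- by rewrite (_ : EFin \o _ = (fun l => u%:E * (gaussian A l * cos (l * u))%:E))%E//; exact: integrableZl.
- by rewrite (_ : EFin \o _ = (fun l => A%:E * (gaussian A l * (l * sin (l * u)))%:E))%E//; exact: integrableZl.
rewrite !RintegralZl// -/(gaussian_cos A u) -/(gaussian_sin A u) => /eqP.
rewrite subr_eq0 => /eqP E; apply: (mulfI (lt0r_neq0 A0)); rewrite -E.
by field; exact: lt0r_neq0.
Qed.

(** By the formula for the derivative and the integration by parts above, the
    product of the transform with the inverse Gaussian is constant. *)
Lemma gaussian_cosE A u : 0 < A ->
  gaussian_cos A u = Num.sqrt (2 * pi / A) * expR (- (u ^+ 2 / (2 * A))).
Proof.
move=> A0; have An := lt0r_neq0 A0.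
pose H v := gaussian_cos A v * expR (v ^+ 2 / (2 * A)).
have dH (v : R) : is_derive v 1 H 0.
  have dg := is_derive_gaussian_cos v A0.
  rewrite /H; apply: is_derive_eq; rewrite gaussian_sinE// /GRing.scale /=.
  by field.
have := is_derive_0_is_cst u 0 dH; rewrite /H expr0n /= mul0r expR0 mulr1.
rewrite (_ : gaussian_cos A 0 = Num.sqrt (2 * pi / A)); last first.
  rewrite -Rintegral_gaussian//; apply: eq_Rintegral => l _.
  by rewrite mulr0 cos0 mulr1.
by move=> <-; rewrite -mulrA -expRD subrr expR0 mulr1.
Qed.

End gaussian.

Section normal_law.
Context {R : realType}.
Notation mu := (@lebesgue_measure R).

Definition std_normal : probability (measurableTypeR R) R := normal_prob (0 : R) (1 : R).

Let pdf : R -> R := normal_pdf 0 1.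

Lemma normal_pdf_gaussian (x : R) : pdf x = (Num.sqrt (2 * pi))^-1 * gaussian 1 x.
Proof.
rewrite gaussian_normal_pdf// divr1 sqrtr1 invr1 mulrA mulVf ?mul1r//.
by rewrite sqrtr_eq0 -ltNge mulr_gt0// pi_gt0.
Qed.

Lemma integral_std_normal f : measurable_fun [set: R] f ->
  (\int[std_normal]_x `|f x| < +oo)%E ->
  (\int[std_normal]_x f x = \int[mu]_x (f x * (pdf x)%:E))%E.
Proof.
move=> mf finf.
rewrite -(Radon_Nikodym_change_of_variables (normal_prob_dominates 0 1))//=; last first.
  by apply/integrableP; split.
have mpdf : measurable_fun [set: R] (EFin \o pdf).
  by apply/measurable_EFinP; exact: measurable_normal_pdf.
apply: ae_eq_integral => //.
- apply: emeasurable_funM => //; apply: (measurable_int mu).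
  by apply: Radon_Nikodym_integrable; exact: normal_prob_dominates.
- exact: emeasurable_funM.
- apply: ae_eqe_mul2l => /=.
  rewrite Radon_NikodymE//=; first exact: normal_prob_dominates.
  move=> abmu; case: cid => /= h [h1 h2 h3].
  apply: integral_ae_eq => //=.
  by move=> E _ mE; rewrite -h3.
Qed.

Lemma Ex_std_normal (f : R -> R) : bmf f ->
  Ex std_normal f = (Num.sqrt (2 * pi))^-1 * \int[mu]_x (gaussian 1 x * f x).
Proof.
move=> bf; have [mf [M fM]] := bf; rewrite /Ex /Rintegral integral_std_normal; last 2 first.
- exact/measurable_EFinP.
- by have /integrableP[] := bmf_integrable std_normal bf.
have ig : mu.-integrable [set: R] (EFin \o (fun x => gaussian 1 x * f x)).
  apply: (@integrable_le _ _ (fun x => M * gaussian 1 x)).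
  - by apply: measurable_funM => //; exact: measurable_gaussian.
  - rewrite (_ : EFin \o _ = (fun x => M%:E * (gaussian 1 x)%:E))%E//.
    by apply: integrableZl => //; exact: integrable_gaussian.
  - move=> x; rewrite normrM ger0_norm ?gaussian_ge0// mulrC.
    by rewrite ler_wpM2r ?gaussian_ge0.
rewrite -[RHS]RintegralZl//; congr fine; apply: eq_integral => x _.
by rewrite normal_pdf_gaussian -EFinM; congr EFin; ring.
Qed.

Lemma sqrt2pi_gt0 : 0 < Num.sqrt (2 * pi) :> R.
Proof. by rewrite sqrtr_gt0 mulr_gt0// pi_gt0. Qed.

Lemma cos_std_normal s : Ex std_normal (fun x => cos (s * x)) = expR (- (s ^+ 2 / 2)).
Proof.
rewrite Ex_std_normal; last first.
  by apply: bmf_cos; exact: measurable_funM.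
under eq_Rintegral => x _ do rewrite [s * x]mulrC.
rewrite -/(gaussian_cos 1 s) gaussian_cosE// divr1 mulr1 mulrA mulVf ?mul1r//.
by rewrite gt_eqF// sqrt2pi_gt0.
Qed.

Lemma std_normalN (A : set R) : measurable A ->
  pr std_normal (-%R @^-1` A) = pr std_normal A.
Proof.
move=> mA; rewrite /pr; congr fine.
have mpdf : measurable_fun [set: R] (EFin \o pdf).
  by apply/measurable_EFinP; exact: measurable_normal_pdf.
have pdfN x : pdf (- x) = pdf x by rewrite !normal_pdf_gaussian gaussianN.
have mN : measurable_fun [set: R] (-%R : R -> measurableTypeR R) by [].
have mNA : measurable (-%R @^-1` A).
  by rewrite -[X in measurable X]setTI; exact: mN.
rewrite /std_normal /= /normal_prob.
rewrite [RHS](_ : _ = \int[pushforward mu (-%R : R -> measurableTypeR R)]_(x in A) (pdf x)%:E)%E.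
  transitivity (\int[mu]_(x in -%R @^-1` A) ((EFin \o pdf) \o -%R) x)%E.
    by apply: eq_integral => x _; rewrite /= pdfN.
  apply/esym; apply: ge0_integral_pushforward => //.
  - exact: measurable_funS mpdf.
  - by move=> x _; rewrite lee_fin normal_pdf_ge0.
by apply: eq_measure_integral => B mB _; apply/esym; exact: lebesgue_measureN.
Qed.

Lemma sin_std_normal s : Ex std_normal (fun x => sin (s * x)) = 0.
Proof.
have bs : @bmf _ (measurableTypeR R) R (fun x => sin (s * x)).
  by apply: bmf_sin; exact: measurable_funM.
suff : Ex std_normal (fun x => sin (s * x)) = - Ex std_normal (fun x => sin (s * x)).
  by move/eqP; rewrite -subr_eq0 opprK -mulr2n mulrn_eq0 => /eqP.
rewrite -ExN//; under [RHS]eq_Ex => x do rewrite -sinN -mulrN.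
rewrite /Ex /Rintegral; congr fine.
have mN : measurable_fun [set: R] (-%R : R -> measurableTypeR R) by [].
have mf : measurable_fun [set: R] (EFin \o (fun x => sin (s * x))).
  by apply/measurable_EFinP; case: bs.
transitivity (\int[pushforward std_normal (-%R : R -> measurableTypeR R)]_x (sin (s * x))%:E)%E.
  apply: eq_measure_integral => A mA _; rewrite /pushforward.
  have mNA : measurable (-%R @^-1` A) by rewrite -[X in measurable X]setTI; exact: mN.
  have := congr1 EFin (std_normalN mA).
  by rewrite /pr !fineK ?fin_num_measure.
rewrite integral_pushforward//; apply: (bmf_integrable std_normal).
by apply: bmf_sin; apply: measurable_funM.
Qed.

Lemma normal_pdf_le1 x : pdf x <= 1.
Proof.
rewrite normal_pdf_gaussian mulrC.
apply: mulr_ile1; [exact: gaussian_ge0| |exact: gaussian_le1|].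
  by rewrite invr_ge0 ltW// sqrt2pi_gt0.
rewrite invf_le1 ?sqrt2pi_gt0// -[leLHS]sqrtr1 ler_sqrt ?mulr_ge0 ?pi_ge0//.
have := pi_ge2 R; lra.
Qed.

Lemma std_normal_itv (e : R) : 0 <= e -> pr std_normal `]- e, e[ <= 2 * e.
Proof.
move=> e0; rewrite /pr -lee_fin fineK; last by rewrite fin_num_measure.
rewrite /std_normal /= /normal_prob.
apply: (@le_trans _ _ (\int[mu]_(x in `](- e)%R, e[) 1)%E).
  apply: ge0_le_integral => //=.
  - by move=> x _; rewrite lee_fin normal_pdf_ge0.
  - by apply/measurable_EFinP; apply: measurable_funTS; exact: measurable_normal_pdf.
  - by move=> x _; rewrite lee_fin normal_pdf_le1.
rewrite integral_cst//= mul1e lebesgue_measure_itv/= lte_fin.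
case: ifPn => _; last by rewrite lee_fin mulr_ge0.
by rewrite -EFinD lee_fin; lra.
Qed.

Lemma std_normal_ge e : 0 <= e -> 2^-1 - e <= pr std_normal [set x | e <= x].
Proof.
move=> e0.
have mge : measurable [set x : R | e <= x].
  by rewrite [X in measurable X](_ : _ = `[e, +oo[%classic)//; apply/seteqP; split => x /=; rewrite in_itv/= andbT.
have mle : measurable [set x : R | x <= - e].
  by rewrite [X in measurable X](_ : _ = `]-oo, - e]%classic)//; apply/seteqP; split => x /=; rewrite in_itv.
have : 1 <= pr std_normal ([set x | e <= x] `|` [set x | x <= - e] `|` `]- e, e[).
  rewrite (_ : _ `|` _ = setT) ?prT//; apply/seteqP; split => // x _ /=.
  rewrite in_itv /=; have [|] := leP e x; first by left; left.
  by have [|] := leP x (- e); [left; right|right; apply/andP].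
have := @prU_le _ (measurableTypeR R) R std_normal _ _ (measurableU _ _ mge mle) (measurable_itv `]- e, e[).
move=> h2 h1; have := le_trans h1 h2.
have := prU_le std_normal mge mle.
have -> : pr std_normal [set x | x <= - e] = pr std_normal [set x | e <= x].
  rewrite -(std_normalN mge); congr pr; apply/seteqP; split => x /=; lra.
have := std_normal_itv e0; lra.
Qed.

Lemma std_normal_gt e : 0 <= e -> pr std_normal [set x | - e < x] <= 2^-1 + e.
Proof.
move=> e0.
have mge : measurable [set x : R | e <= x].
  by rewrite [X in measurable X](_ : _ = `[e, +oo[%classic)//; apply/seteqP; split => x /=; rewrite in_itv/= andbT.
have -> : [set x | - e < x] = ~` (-%R @^-1` [set x : R | e <= x]).
  by apply/seteqP; split => x /=; [move=> h1 h2; lra|move=> /negP; lra].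
rewrite prC; last first.
  have mN : measurable_fun [set: R] (-%R : R -> measurableTypeR R) by [].
  by rewrite -[X in measurable X]setTI; exact: mN.
rewrite std_normalN//; have := std_normal_ge e0; lra.
Qed.

Definition clamp (u v x : R) : R := Num.min 1 (Num.max 0 ((x - u) / (v - u))).

Lemma continuous_clamp u v : continuous (clamp u v).
Proof.
pose f (x : R) := (x - u) / (v - u).
have cf : continuous f.
  by move=> x; apply: cvgMr_tmp; apply: cvgB; [exact: cvg_id|exact: cvg_cst].
have cc (r : R) : continuous ((fun=> r) : R -> R) by move=> x; exact: cvg_cst.
have cmax : continuous ((fun=> 0) \max f) by exact: max_fun_continuous.
have cmin : continuous ((fun=> 1) \min ((fun=> 0) \max f)) by exact: min_fun_continuous.
exact: cmin.
Qed.

Lemma clamp_ge0 u v x : 0 <= clamp u v x.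
Proof. by rewrite /clamp le_min ler01/= le_max lexx. Qed.

Lemma clamp_le1 u v x : clamp u v x <= 1.
Proof. by rewrite /clamp ge_min lexx. Qed.

Lemma clamp1 u v x : u < v -> v <= x -> clamp u v x = 1.
Proof.
move=> uv vx; rewrite /clamp; apply/min_idPl; rewrite le_max; apply/orP; right.
by rewrite ler_pdivlMr ?subr_gt0// mul1r lerB.
Qed.

Lemma clamp0 u v x : u < v -> x <= u -> clamp u v x = 0.
Proof.
move=> uv xu; rewrite /clamp (_ : Num.max _ _ = 0); first exact/min_idPr.
by apply/max_idPl; rewrite pmulr_lle0 ?invr_gt0 ?subr_gt0// subr_le0.
Qed.

Lemma bounded_clamp u v x : `|clamp u v x| <= 1.
Proof. by rewrite ger0_norm ?clamp_ge0// clamp_le1. Qed.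

Definition norm1_std_normal : R := (Num.sqrt (2 * pi))^-1 * \int[mu]_x (`|x| * gaussian 1 x).

Lemma clamp_norm_std_normal (h : R) : 0 < h ->
  Ex std_normal (fun x => clamp 0 1 (h * `|x|)) <= h * norm1_std_normal.
Proof.
move=> h0; have cc : continuous (fun x : R => clamp 0 1 (h * `|x|)).
  move=> x; apply: (@continuous_comp _ _ _ (fun x : R => h * `|x|)); last exact: continuous_clamp.
  by apply: cvgMl_tmp; exact: norm_continuous.
have bc : bmf (fun x : R => clamp 0 1 (h * `|x|)).
  split; first exact: continuous_measurable_fun.
  by exists 1 => x; exact: bounded_clamp.
have i1 := integrable_norm_gaussian (@ltr01 R).
rewrite Ex_std_normal// /norm1_std_normal mulrCA ler_wpM2l//.
rewrite -RintegralZl//; apply: le_Rintegral => //.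
- apply: (integrable_le _ (integrable_gaussian (@ltr01 R))).
    by apply: measurable_funM; [exact: measurable_gaussian|case: bc].
  move=> x; rewrite normrM ger0_norm ?gaussian_ge0// ler_piMr ?gaussian_ge0//.
  exact: bounded_clamp.
- rewrite (_ : EFin \o _ = (fun x => h%:E * (`|x| * gaussian 1 x)%:E))%E//.
  exact: integrableZl.
move=> x _; rewrite mulrA mulrC ler_wpM2r ?gaussian_ge0//.
rewrite /clamp !subr0 divr1 ge_min; apply/orP; right.
by rewrite (max_idPr _)// mulr_ge0// ltW.
Qed.

Lemma norm1_std_normal_ge0 : 0 <= norm1_std_normal.
Proof.
rewrite mulr_ge0//.
apply: Rintegral_ge0 => x _.
by rewrite mulr_ge0 ?gaussian_ge0.
Qed.

End normal_law.

(** * The continuity theorem *)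

Section elementary.
Context {R : realType}.
Implicit Types (x y u v s t : R).

Lemma lipschitz_derive (f df : R -> R) (M : R) : (forall x : R, is_derive x 1 f (df x)) ->
  (forall x, `|df x| <= M) -> forall x y, `|f x - f y| <= M * `|x - y|.
Proof.
move=> dfE dfM.
have cf x : {for x, continuous f}.
  apply: differentiable_continuous; apply/derivable1_diffP.
  by have := dfE x; case.
have main x y : x < y -> `|f x - f y| <= M * `|x - y|.
  move=> xy; have [z _ E] := MVT xy (fun z _ => dfE z) (continuous_subspaceT cf).
  by rewrite distrC E normrM [in leRHS]distrC ler_wpM2r.
move=> x y; have [xy|yx|->] := ltgtP x y; first exact: main.
  by rewrite distrC [in leRHS]distrC; exact: main.
by rewrite !subrr !normr0 mulr0.
Qed.

Lemma lipschitz_cos x y : `|cos x - cos y| <= `|x - y|.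
Proof.
rewrite -[leRHS]mul1r; apply: (@lipschitz_derive cos (fun x => - sin x)).
by move=> z; rewrite normrN norm_sin_le1.
Qed.

Lemma lipschitz_sin x y : `|sin x - sin y| <= `|x - y|.
Proof.
rewrite -[leRHS]mul1r; apply: (@lipschitz_derive sin cos).
by move=> z; exact: norm_cos_le1.
Qed.

Lemma norm_sin_le x : `|sin x| <= `|x|.
Proof. by have := lipschitz_sin x 0; rewrite sin0 !subr0. Qed.

Lemma lipschitz_expRN x y : 0 <= x -> 0 <= y -> `|expR (- x) - expR (- y)| <= `|x - y|.
Proof.
wlog xy : x y / x <= y => [h|] x0 y0.
  have [xy|yx] := leP x y; first exact: h.
  by rewrite distrC [in leRHS]distrC; apply: h => //; exact: ltW.
rewrite ger0_norm; last by rewrite subr_ge0 ler_expR lerN2.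
rewrite distrC ger0_norm ?subr_ge0//.
have -> : expR (- y) = expR (- x) * expR (- (y - x)) by rewrite -expRD; congr expR; ring.
have e1 : expR (- x) <= 1 by rewrite -expR0 ler_expR oppr_le0.
have e2 := expR_ge1Dx (- (y - x)).
have e0 := expR_ge0 (- x).
have : 0 <= 1 - expR (- (y - x)) by rewrite subr_ge0 -expR0 ler_expR oppr_le0 subr_ge0.
by move: e1 e2 e0; move: (expR (- x)) (expR (- (y - x))) => p q; nra.
Qed.

Lemma clamp01 (x : R) : 0 <= x -> clamp 0 1 x = Num.min 1 x.
Proof. by move=> x0; rewrite /clamp !subr0 divr1 (max_idPr _). Qed.

Lemma le_clamp01 u v : 0 <= u -> u <= v -> clamp 0 1 u <= clamp 0 1 v.
Proof.
move=> u0 uv; rewrite !clamp01//; last exact: le_trans uv.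
by rewrite le_min ge_min lexx/= ge_min uv orbT.
Qed.

Lemma cos_clamp x y : `|cos x - cos y| <= 2 * clamp 0 1 (`|x - y| / 2).
Proof.
have h1 := lipschitz_cos x y; have h2 := ler_normB (cos x) (cos y).
have h3 := norm_cos_le1 x; have h4 := norm_cos_le1 y.
rewrite clamp01 ?divr_ge0//; have [] := leP 1 (`|x - y| / 2); lra.
Qed.

Lemma sin_clamp x y : `|sin x - sin y| <= 2 * clamp 0 1 (`|x - y| / 2).
Proof.
have h1 := lipschitz_sin x y; have h2 := ler_normB (sin x) (sin y).
have h3 := norm_sin_le1 x; have h4 := norm_sin_le1 y.
rewrite clamp01 ?divr_ge0//; have [] := leP 1 (`|x - y| / 2); lra.
Qed.

End elementary.

Section transforms.
Context {R : realType}.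
Variable Q : probability (path R) R.

Lemma bmf_clamp_walk n (h : R) : bmf (fun x : path R => clamp 0 1 (h * `|walk n x|)).
Proof.
split; last by exists 1 => x; exact: bounded_clamp.
apply: measurableT_comp; first by apply: continuous_measurable_fun; exact: continuous_clamp.
by apply: measurable_funM => //; apply: measurableT_comp => //; exact: measurable_walk.
Qed.

(** The distance of two characteristic functions is controlled by a continuous
    bounded function of the walk, to which the convergence in law applies. *)
Lemma dist_wcf n (s t h : R) : `|s - t| <= 2 * h ->
  normc (wcf Q (fun=> 1) n s - wcf Q (fun=> 1) n t) <=
  4 * Ex Q (fun x => clamp 0 1 (h * `|walk n x|)).
Proof.
move=> sth; have h0 : 0 <= h.
  by rewrite -(pmulr_rge0 _ (@ltr0n R 2)) (le_trans _ sth).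
have bh := bmf_clamp_walk n h; have b2 := bmfM (bmf_cst 2) bh.
have st x : `|s * walk n x - t * walk n x| / 2 <= h * `|walk n x|.
  rewrite -mulrBl normrM ler_pdivrMr// [leRHS]mulrAC; apply: ler_wpM2r => //.
  by rewrite mulrC.
apply: le_trans (normc_le_ReIm _) _; rewrite ReB ImB /=.
have -> : (4 : R) = 2 + 2 by rewrite -natrD.
rewrite mulrDl; under [X in `|X - _| + _]eq_Ex => x do rewrite mul1r.
under [X in `|_ - X| + _]eq_Ex => x do rewrite mul1r.
under [X in _ + `|X - _|]eq_Ex => x do rewrite mul1r.
under [X in _ + `|_ - X|]eq_Ex => x do rewrite mul1r.
have bc u := @bmf_cos_walk R n u; have bs u := @bmf_sin_walk R n u.
rewrite -(ExB Q (bc s) (bc t)) -(ExB Q (bs s) (bs t)) -(ExZ Q 2 bh).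
apply: lerD; apply: norm_Ex_le => //.
- exact: bmfB.
- move=> x; apply: le_trans (cos_clamp _ _) _; rewrite ler_wpM2l//.
  by apply: le_clamp01; rewrite ?divr_ge0.
- exact: bmfB.
- move=> x; apply: le_trans (sin_clamp _ _) _; rewrite ler_wpM2l//.
  by apply: le_clamp01; rewrite ?divr_ge0.
Qed.

Lemma clamp_walk_small n (e : R) : 0 < e -> exists2 h0 : R, 0 < h0 &
  forall h, 0 <= h <= h0 -> Ex Q (fun x => clamp 0 1 (h * `|walk n x|)) <= e.
Proof.
move=> e0; have e20 : 0 < e / 2 by rewrite divr_gt0.
pose F m := [set x : path R | m%:R < `|walk n x|].
have mF m : measurable (F m).
  have mw : measurable_fun [set: path R] (fun x => `|walk n x|).
    by apply: measurableT_comp => //; exact: measurable_walk.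
  rewrite -[F m]setTI (_ : F m = (fun x => `|walk n x|) @^-1` `]m%:R, +oo[%classic).
    by apply: mw.
  by apply/seteqP; split => x /=; rewrite in_itv/= andbT.
have F0 : \bigcap_m F m = set0.
  apply/seteqP; split => // x /= h.
  have := h (Num.truncn `|walk n x|).+1 Logic.I; rewrite /F /= ltNge.
  by rewrite ltW// truncnS_gt.
have cF : pr Q (F m) @[m --> \oo] --> 0.
  rewrite -(pr0 Q) -F0; apply: pr_cvg_bigcap => // i j ij; apply/subsetPset => x /=.
  by apply: le_lt_trans; rewrite ler_nat.
have [m _ Fm] : \forall m \near \oo, pr Q (F m) <= e / 2.
  move/cvgrPdist_le : cF => /(_ _ e20); apply: filterS => m.
  by rewrite sub0r normrN ger0_norm// pr_ge0.
have {}Fm : pr Q (F m) <= e / 2 := Fm m (leqnn m).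
exists (e / 2 / m.+1%:R); first by rewrite divr_gt0.
move=> h /andP[h0 hh]; have bh := bmf_clamp_walk n h.
apply: (@le_trans _ _ (Ex Q (fun x => e / 2 + \1_(F m) x))).
  apply: le_Ex => //; first by apply: bmfD; [exact: bmf_cst|exact: bmf_ind].
  move=> x; rewrite indicE; have [xF|xF] := boolP (x \in F m).
    by apply: le_trans (clamp_le1 _ _ _) _; rewrite lerDr ltW.
  rewrite addr0 clamp01 ?mulr_ge0// ge_min; apply/orP; right.
  have xm : `|walk n x| <= m.+1%:R.
    move: xF; rewrite notin_setE /F /= => /negP; rewrite -leNgt => /le_trans; apply.
    by rewrite ler_nat.
  by apply: le_trans (ler_pM h0 (normr_ge0 _) hh xm) _; rewrite divfK.
rewrite ExD ?Ex_cst ?Ex_ind//; [|exact: bmf_cst|exact: bmf_ind].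
by rewrite [leRHS](splitr e) lerD2l.
Qed.

Lemma cf_uniformly_continuous (e : R) : 0 < e -> exists2 h : R, 0 < h &
  forall s t, `|s - t| <= h -> normc (cf Q s - cf Q t) <= e.
Proof.
move=> e0; have [|h h0 H] := @clamp_walk_small 1 (e / 4); first by rewrite divr_gt0.
exists (2 * h); first by rewrite mulr_gt0.
move=> s t st; apply: le_trans (dist_wcf 1 st) _.
by rewrite mulrC -ler_pdivlMr//; apply: H; rewrite lexx ltW.
Qed.

Lemma cf0 : cf Q 0 = 1.
Proof.
rewrite /cf /wcf; congr Complex.
  by under eq_Ex => x do rewrite mul0r cos0 mulr1; rewrite Ex_cst.
by under eq_Ex => x do rewrite mul0r sin0 mulr0; rewrite Ex_cst.
Qed.

Hypothesis MP : markov_property Q.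
Variable a : nat -> R.
Hypothesis a_gt0 : forall n, (0 < n)%N -> 0 < a n.
Hypothesis CLT : forall (f : R -> R) (M : R), continuous f -> (forall x, `|f x| <= M) ->
  Ex Q (fun x => f (walk n x / a n)) @[n --> \oo] --> Ex std_normal f.

Lemma clt_dist (f : R -> R) (M e : R) : continuous f -> (forall x, `|f x| <= M) -> 0 < e ->
  \forall n \near \oo, `|Ex Q (fun x => f (walk n x / a n)) - Ex std_normal f| <= e.
Proof.
move=> cf' bf e0; have /cvgrPdist_le /(_ _ e0) := CLT cf' bf.
by apply: filterS => n; rewrite distrC.
Qed.

Lemma cf_expn n s : cf Q (s / a n) ^+ n = wcf Q (fun=> 1) n (s / a n).
Proof. by rewrite wcf1. Qed.

Lemma cf_pointwise (s e : R) : 0 < e ->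
  \forall n \near \oo, normc (cf Q (s / a n) ^+ n - (expR (- (s ^+ 2 / 2)))%:C%C) <= e.
Proof.
move=> e0; have e20 : 0 < e / 2 by rewrite divr_gt0.
have cM : continuous (fun x : R => s * x) by move=> x; apply: cvgMl_tmp; exact: cvg_id.
have hc := @clt_dist (fun x => cos (s * x)) 1 (e / 2) _ _ e20.
have hs := @clt_dist (fun x => sin (s * x)) 1 (e / 2) _ _ e20.
have {}hc := hc (fun x => continuous_comp (cM x) (@continuous_cos R _))
  (fun x => norm_cos_le1 _).
have {}hs := hs (fun x => continuous_comp (cM x) (@continuous_sin R _))
  (fun x => norm_sin_le1 _).
near=> n; rewrite cf_expn; apply: le_trans (normc_le_ReIm _) _; rewrite ReB ImB /=.
rewrite (splitr e); apply: lerD.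
  under [X in `|X - _|]eq_Ex => x do rewrite mul1r mulrAC -mulrA.
  by rewrite -cos_std_normal; near: n.
under [X in `|X - _|]eq_Ex => x do rewrite mul1r mulrAC -mulrA.
by rewrite -[X in _ - X](sin_std_normal s); near: n.
Unshelve. all: by end_near. Qed.

(** Convergence in law gives tightness without moments: the truncated first moment
    of S_n / a_n is eventually close to the Gaussian one. *)
Lemma cf_equicontinuous (e : R) : 0 < e -> exists2 h : R, 0 < h &
  \forall n \near \oo, forall s t, `|s - t| <= h ->
    normc (cf Q (s / a n) ^+ n - cf Q (t / a n) ^+ n) <= e.
Proof.
move=> e0; set K := @norm1_std_normal R; have K0 : 0 <= K := norm1_std_normal_ge0.
pose h := e / (8 * (K + 1)).
have K1 : 0 < 8 * (K + 1) by rewrite mulr_gt0// ltr_wpDl.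
have h0 : 0 < h by rewrite divr_gt0.
exists (2 * h); first by rewrite mulr_gt0.
have cc : continuous (fun x : R => clamp 0 1 (h * `|x|)).
  move=> x; apply: (@continuous_comp _ _ _ (fun x : R => h * `|x|)); last exact: continuous_clamp.
  by apply: cvgMl_tmp; exact: norm_continuous.
have e8 : 0 < e / 8 by rewrite divr_gt0.
have H := clt_dist cc (fun x => bounded_clamp _ _ _) e8.
near=> n; move=> s t st; have an0 : 0 < a n by apply: a_gt0; near: n; exists 1%N.
rewrite !cf_expn; apply: le_trans (@dist_wcf n _ _ (h / a n) _) _.
  rewrite -mulrBl normrM normfV (gtr0_norm an0) mulrA ler_wpM2r// invr_ge0 ltW//.
have : `|Ex Q (fun x => clamp 0 1 (h * `|walk n x / a n|)) -
   Ex std_normal (fun x : R => clamp 0 1 (h * `|x|))| <= e / 8 by near: n.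
have E x : h * `|walk n x / a n| = h / a n * `|walk n x|.
  by rewrite normrM normfV (gtr0_norm an0); ring.
under eq_Ex => x do rewrite E.
move=> H1; have H2 := clamp_norm_std_normal h0; rewrite -/K in H2.
have H3 : h * K <= e / 8.
  have hK : h * (8 * (K + 1)) = e by rewrite /h divfK// gt_eqF.
  by move: hK h0; lra.
move: H1; rewrite ler_distl => /andP[_ H1].
by move: H1 H2 H3; move: (Ex _ _) (Ex _ _) (h * K) => p q r; lra.
Unshelve. all: by end_near. Qed.

Lemma lipschitz_gauss (s t L : R) : 0 <= s <= L -> 0 <= t <= L ->
  `|expR (- (s ^+ 2 / 2)) - expR (- (t ^+ 2 / 2))| <= L * `|s - t|.
Proof.
move=> /andP[s0 sL] /andP[t0 tL].
apply: le_trans (lipschitz_expRN _ _) _; rewrite ?divr_ge0 ?sqr_ge0//.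
rewrite (_ : s ^+ 2 / 2 - t ^+ 2 / 2 = (s + t) / 2 * (s - t)); last by field.
rewrite normrM ler_wpM2r// ger0_norm; last by rewrite divr_ge0// addr_ge0.
by lra.
Qed.

Lemma near_finite (N : nat) (A : nat -> nat -> Prop) :
  (forall i, \forall n \near \oo, A i n) -> \forall n \near \oo, forall i, (i < N)%N -> A i n.
Proof.
move=> H; elim: N => [|N IH]; first by near=> n.
near=> n; move=> i; rewrite ltnS leq_eqVlt => /predU1P[->|iN].
  by near: n.
by move: i iN; near: n.
Unshelve. all: by end_near. Qed.

(** Levy's continuity theorem: equicontinuity makes the pointwise convergence
    uniform on compact sets. *)
Lemma cf_uniform (L e : R) : 0 < e -> \forall n \near \oo, forall s, 0 <= s <= L ->
  normc (cf Q (s / a n) ^+ n - (expR (- (s ^+ 2 / 2)))%:C%C) <= e.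
Proof.
move=> e0; have e30 : 0 < e / 3 by rewrite divr_gt0.
have [h1 h10 H1] := cf_equicontinuous e30.
pose L1 := `|L| + 1; have L10 : 0 < L1 by rewrite ltr_wpDl.
pose h := Num.min h1 (e / 3 / L1).
have h0 : 0 < h by rewrite lt_min h10 divr_gt0.
pose N := (Num.truncn (L1 / h)).+1.
have H2 := @near_finite N.+1 (fun i n =>
  normc (cf Q (i%:R * h / a n) ^+ n - (expR (- ((i%:R * h) ^+ 2 / 2)))%:C%C) <= e / 3)
  (fun i => cf_pointwise _ e30).
apply: filterS2 H1 H2 => n H1n H2n s /andP[s0 sL].
have sL1 : s <= L1 by rewrite (le_trans sL)// (le_trans (ler_norm _))// lerDl.
pose i := Num.truncn (s / h); pose t := i%:R * h.
have /andP[ti1 ti2] : t <= s < t + h.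
  have := truncn_itv (divr_ge0 s0 (ltW h0)); rewrite -/i => /andP[i1 i2].
  apply/andP; split; first by rewrite /t -ler_pdivlMr.
  by rewrite /t -[X in _ + X]mul1r -mulrDl -ltr_pdivrMr// natr1.
have t0 : 0 <= t by rewrite mulr_ge0// ltW.
have iN : (i < N.+1)%N.
  rewrite ltnS /N ltnW// ltnS; apply: le_truncn.
  by rewrite ler_pM2r ?invr_gt0.
have st : `|s - t| <= h by rewrite ger0_norm ?subr_ge0//; lra.
have A1 : normc (cf Q (s / a n) ^+ n - cf Q (t / a n) ^+ n) <= e / 3.
  by apply: H1n; rewrite (le_trans st)// ge_min lexx.
have A2 : normc (cf Q (t / a n) ^+ n - (expR (- (t ^+ 2 / 2)))%:C%C) <= e / 3.
  exact: H2n.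
have A3 : `|expR (- (t ^+ 2 / 2)) - expR (- (s ^+ 2 / 2))| <= e / 3.
  apply: le_trans (@lipschitz_gauss _ _ L1 _ _) _; rewrite ?t0 ?s0//=; first lra.
  rewrite distrC -ler_pdivlMl// (le_trans st)// ge_min; apply/orP; right.
  by rewrite mulrC.
have -> : cf Q (s / a n) ^+ n - (expR (- (s ^+ 2 / 2)))%:C%C =
  (cf Q (s / a n) ^+ n - cf Q (t / a n) ^+ n) +
  ((cf Q (t / a n) ^+ n - (expR (- (t ^+ 2 / 2)))%:C%C) +
  (expR (- (t ^+ 2 / 2)) - expR (- (s ^+ 2 / 2)))%:C%C).
  by rewrite rmorphB; ring.
rewrite (_ : e = e / 3 + (e / 3 + e / 3)); last by field.
apply: le_trans (le_normcD _ _) _; apply: lerD => //.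
by apply: le_trans (le_normcD _ _) _; apply: lerD => //; rewrite normcR.
Qed.

End transforms.

(** * The norming sequence *)

Section norming_sequence.
Context {R : realType}.
Implicit Types (s t e L : R) (k n : nat).

Lemma near_ex (A : nat -> Prop) : (\forall n \near \oo, A n) ->
  exists N, forall n, (N <= n)%N -> A n.
Proof. by move=> [N _ H]; exists N => n Nn; exact: H. Qed.

Lemma ln_le_sub1 (u : R) : 0 < u -> ln u <= u - 1.
Proof.
move=> u0; rewrite lerBrDl -[leRHS](@lnK R) ?posrE//.
exact: expR_ge1Dx.
Qed.

Lemma ln_dist (u v r : R) : 0 < r -> r <= u -> r <= v -> `|ln u - ln v| <= `|u - v| / r.
Proof.
move=> r0; wlog uv : u v / v <= u => [h|] ru rv.
  have [vu|uv] := leP v u; first exact: h.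
  by rewrite distrC [in leRHS]distrC; apply: h => //; exact: ltW.
have v0 := lt_le_trans r0 rv; have u0 := lt_le_trans r0 ru.
have lnvu : ln v <= ln u by rewrite ler_ln ?posrE.
rewrite !ger0_norm ?subr_ge0//.
rewrite -ln_div ?posrE//; apply: le_trans (ln_le_sub1 _) _; first by rewrite divr_gt0.
have -> : u / v - 1 = (u - v) / v by rewrite mulrBl divff// gt_eqF.
by rewrite ler_wpM2l ?subr_ge0// lef_pV2 ?posrE.
Qed.

Lemma expRN_half_ge : 2^-1 <= expR (- 2^-1) :> R.
Proof. by apply: le_trans (expR_ge1Dx _); lra. Qed.

Variables (phi : R -> R[i]) (a : nat -> R).
Hypothesis a_gt0 : forall n, (0 < n)%N -> 0 < a n.
Hypothesis phi0 : phi 0 = 1.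
Hypothesis phi_le1 : forall s, normc (phi s) <= 1.
Hypothesis phi_uc : forall e, 0 < e -> exists2 h : R, 0 < h &
  forall s t, `|s - t| <= h -> normc (phi s - phi t) <= e.
Hypothesis phi_lim : forall L e, 0 < e -> \forall n \near \oo, forall s, 0 <= s <= L ->
  normc (phi (s / a n) ^+ n - (expR (- (s ^+ 2 / 2)))%:C%C) <= e.

(** Logarithm of the convergence of characteristic functions; near frequency 0 the
    limit stays away from 0, so the logarithm is Lipschitz. *)
Lemma log_modulus e : 0 < e -> exists N, forall n, (N <= n)%N -> forall s, 0 <= s <= 1 ->
  `|n%:R * ln (normc (phi (s / a n))) + s ^+ 2 / 2| <= e.
Proof.
move=> e0; pose e1 := Num.min (4^-1) (e / 4).
have e10 : 0 < e1 by rewrite lt_min invr_gt0 ltr0n /= divr_gt0.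
have e1a : e1 <= 4^-1 by rewrite ge_min lexx.
have e1b : e1 <= e / 4 by rewrite ge_min lexx orbT.
have [N H] := near_ex (phi_lim 1 e10); exists N.+1 => n Nn s s01.
have n0 : (0 < n)%N by apply: leq_ltn_trans Nn.
have := H n (ltnW Nn) s s01; have /andP[s0 s1] := s01.
move=> /(le_trans (ler_dist_normc _ _)); rewrite normcX normcR (ger0_norm (expR_ge0 _)).
set y := normc _; set E := expR _ => yE.
have E2 : 2^-1 <= E.
  apply: le_trans expRN_half_ge _; rewrite ler_expR lerN2 ler_pdivrMr// mulVf//.
  by rewrite expr_le1.
have yn4 : 4^-1 <= y ^+ n.
  by move: yE; rewrite ler_distl => /andP[h _]; lra.
have y0 : 0 < y.
  rewrite lt0r normc_ge0 andbT; apply/eqP => yz; move: yn4.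
  by rewrite yz expr0n gtn_eqF//= leNgt invr_gt0 ltr0n.
have E4 : 4^-1 <= E by lra.
have := @ln_dist (y ^+ n) E (4^-1); rewrite invr_gt0 ltr0n => /(_ isT yn4 E4).
rewrite invrK /E expRK opprK lnXn// -[ln y *+ n]mulr_natl => /le_trans; apply.
by rewrite -ler_pdivlMr//; apply: le_trans e1b.
Qed.

(** When a_k <= a_n, the modulus of phi at the frequency 1 / a_n is known from
    time n and, as 1 / a_n = (a_k / a_n) / a_k, from time k; the other case is
    symmetric. *)
Lemma norming_ratio e : 0 < e -> exists K, forall k n, (K <= k)%N -> (k <= n)%N ->
  `|(a k / a n) ^+ 2 - k%:R / n%:R| <= e.
Proof.
move=> e0; pose e1 := Num.min (8^-1) (e / 12).
have e10 : 0 < e1 by rewrite lt_min invr_gt0 ltr0n /= divr_gt0.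
have e1a : e1 <= 8^-1 by rewrite ge_min lexx.
have e1b : e1 <= e / 12 by rewrite ge_min lexx orbT.
have [N H] := log_modulus e10; exists N.+1 => k n Nk kn.
have k0 : (0 < k)%N by apply: leq_ltn_trans Nk.
have n0 : (0 < n)%N := leq_trans k0 kn.
have ak0 := a_gt0 k0; have an0 := a_gt0 n0.
have kR : (0 : R) < k%:R by rewrite ltr0n.
have nR : (0 : R) < n%:R by rewrite ltr0n.
have knR : (k%:R : R) <= n%:R by rewrite ler_nat.
have h01 : 0 <= (1 : R) <= 1 by rewrite ler01 lexx.
have [akn|akn] := leP (a k) (a n).
  pose l := a k / a n; have l01 : 0 <= l <= 1.
    by rewrite divr_ge0 ?(ltW ak0) ?(ltW an0)//= ler_pdivrMr// mul1r.
  have := H k (ltnW Nk) l l01; rewrite {1}/l mulrAC divff ?gt_eqF// -/l.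
  have := H n (leq_trans (ltnW Nk) kn) 1 h01; rewrite expr1n.
  set y := ln _; rewrite -/l !ler_norml => /andP[h1 h2] /andP[h3 h4].
  pose r : R := k%:R / n%:R; have r01 : 0 <= r <= 1.
    by rewrite divr_ge0 ?(ltW kR) ?(ltW nR)//= ler_pdivrMr// mul1r.
  have ky : k%:R * y = r * (n%:R * y) by rewrite mulrA /r divfK// gt_eqF.
  rewrite ky in h3 h4; rewrite -/r; move: (n%:R * y) h1 h2 h3 h4 => z h1 h2 h3 h4.
  have /andP[r0 r1] := r01; move: (l ^+ 2) h3 h4 => l2 h3 h4.
  by apply/andP; split; nra.
pose l := a n / a k; have l01 : 0 <= l <= 1.
  by rewrite divr_ge0 ?(ltW ak0) ?(ltW an0)//= ler_pdivrMr// mul1r ltW.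
have := H n (leq_trans (ltnW Nk) kn) l l01; rewrite {1}/l mulrAC divff ?gt_eqF// -/l.
have := H k (ltnW Nk) 1 h01; rewrite expr1n.
set y := ln _; rewrite !ler_norml => /andP[h1 h2] /andP[h3 h4].
have -> : a k / a n = l^-1 by rewrite invf_div.
have l0 : 0 < l by rewrite divr_gt0.
pose r : R := k%:R / n%:R; have r0 : 0 < r by rewrite divr_gt0.
have r1 : r <= 1 by rewrite ler_pdivrMr// mul1r.
have ky : k%:R * y = r * (n%:R * y) by rewrite mulrA /r divfK// gt_eqF.
rewrite ky in h1 h2; rewrite -/r; move: (n%:R * y) h1 h2 h3 h4 => z h1 h2 h3 h4.
have l21 : l ^+ 2 <= 1 by rewrite expr_le1 ?(ltW l0)//; case/andP: l01.
have l20 : 0 < l ^+ 2 by rewrite exprn_gt0.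
rewrite exprVn; move: (l ^+ 2) l20 l21 h3 h4 => l2 l20 l21 h3 h4.
have zb : - (2^-1 + e1) <= z by nra.
have rb : 1 - 4 * e1 <= r by nra.
have zb2 : z <= - (2^-1 - e1) by nra.
have lb : 1 - 4 * e1 <= l2 by nra.
have lV : l2^-1 <= 1 + 8 * e1.
  by rewrite -[leLHS]mul1r ler_pdivrMr//; nra.
have lV1 : 1 <= l2^-1 by rewrite invf_ge1.
by apply/andP; split; lra.
Qed.

Lemma norming_double : exists K, forall k n, (K <= k)%N -> (8 * k <= n)%N -> 2 * a k <= a n.
Proof.
have e8 : (0 : R) < 8^-1 by rewrite invr_gt0.
have [K H] := norming_ratio e8; exists K.+1 => k n Kk kn.
have k0 : (0 < k)%N by apply: leq_ltn_trans Kk.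
have kn' : (k <= n)%N by apply: leq_trans kn; rewrite leq_pmull.
have n0 : (0 < n)%N := leq_trans k0 kn'.
have := H k n (ltnW Kk) kn'; rewrite ler_distl => /andP[_ h].
have ak0 := a_gt0 k0; have an0 := a_gt0 n0.
have kn8 : (k%:R / n%:R : R) <= 8^-1.
  by rewrite ler_pdivrMr ?ltr0n// mulrC ler_pdivlMr// -natrM ler_nat mulnC.
have : (a k / a n) ^+ 2 <= (2^-1) ^+ 2 by rewrite expr2; lra.
rewrite ler_pXn2r ?nnegrE ?invr_ge0 ?divr_ge0 ?(ltW ak0) ?(ltW an0)//.
by rewrite ler_pdivrMr// => ?; lra.
Qed.

Lemma norming_pinfty (M : R) : exists N, forall n, (N <= n)%N -> M <= a n.
Proof.
have [K H] := norming_double.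
have pw i : exists N, forall n, (N <= n)%N -> 2 ^+ i * a K.+1 <= a n.
  elim: i => [|i [N IH]].
    have [K' H'] : exists N, forall n, (N <= n)%N -> 2 * a K.+1 <= a n.
      by exists (8 * K.+1)%N => n; exact: H.
    by exists K' => n /H'; rewrite expr0 mul1r; have := @a_gt0 K.+1 isT; lra.
  exists (8 * (maxn K N))%N => n hn.
  have h1 := IH (maxn K N) (leq_maxr _ _); have h2 := H (maxn K N) n (leq_maxl _ _) hn.
  by rewrite exprS -mulrA (le_trans _ h2)// ler_wpM2l.
have aK0 := @a_gt0 K.+1 isT.
have [i Hi] : exists i, M / a K.+1 <= 2 ^+ i.
  exists (Num.truncn (M / a K.+1)).+1; apply: (le_trans (ltW (truncnS_gt _))).
  by rewrite -natrX ler_nat ltnW// ltn_expl.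
have [N HN] := pw i; exists N => n Nn; apply: le_trans (HN n Nn).
by rewrite -ler_pdivrMr.
Qed.

Lemma norming_step : exists K, forall n, (K <= n)%N -> a n.+1 <= 2 * a n.
Proof.
have e8 : (0 : R) < 4^-1 by rewrite invr_gt0.
have [K H] := norming_ratio e8; exists K.+1 => k Kk.
have k0 : (0 < k)%N by apply: leq_ltn_trans Kk.
have := H k k.+1 (ltnW Kk) (leqnSn k); rewrite ler_distl => /andP[h _].
have ak0 := a_gt0 k0; have an0 := a_gt0 (ltn0Sn k).
have kn8 : 2^-1 <= (k%:R / k.+1%:R : R).
  rewrite ler_pdivlMr ?ltr0n// mulrC ler_pdivrMr// -natrM ler_nat muln2 -addnn.
  by rewrite -addn1 leq_add2l.
have : (2^-1) ^+ 2 <= (a k / a k.+1) ^+ 2.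
  apply: le_trans h; rewrite lerBrDr; apply: le_trans kn8; lra.
rewrite ler_pXn2r ?nnegrE ?invr_ge0 ?divr_ge0 ?(ltW ak0) ?(ltW an0)//.
by rewrite ler_pdivlMr// => ?; lra.
Qed.

(** Halving the index divides the norming sequence by about the square root
    of 2, hence by less than 2: it grows more slowly than the identity. *)
Lemma norming_growth : exists K, forall k n, (K <= k)%N -> (k <= n)%N ->
  k%:R * a n <= 2 * n%:R * a k.
Proof.
have e12 : (0 : R) < 12^-1 by rewrite invr_gt0.
have [K H] := norming_ratio e12; exists K.+2 => k n Kk.
have [m] := ubnP n; elim: m n => // m IH n; rewrite ltnS => nm kn.
have k0 : (1 < k)%N by apply: leq_ltn_trans Kk.
have n0 : (0 < n)%N := leq_trans (ltnW k0) kn.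
have ak0 := a_gt0 (ltnW k0); have an0 := a_gt0 n0.
have kR : (0 : R) < k%:R by rewrite ltr0n ltnW.
have nR : (0 : R) < n%:R by rewrite ltr0n.
have [nk|kn2] := ltnP n (2 * k).
  have := H k n (ltnW (ltnW Kk)) kn; rewrite ler_distl => /andP[h _].
  have kn2 : 2^-1 <= (k%:R / n%:R : R).
    by rewrite ler_pdivlMr// mulrC ler_pdivrMr// -natrM ler_nat mulnC ltnW.
  have : (2^-1) ^+ 2 <= (a k / a n) ^+ 2.
    by apply: le_trans h; rewrite exprVn expr2; lra.
  rewrite ler_pXn2r ?nnegrE ?divr_ge0 ?(ltW ak0) ?(ltW an0)//.
  rewrite ler_pdivlMr// => h5; have knR : (k%:R : R) <= n%:R by rewrite ler_nat.
  by nra.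
pose j := n./2.
have j2 : (2 * j <= n)%N by rewrite mul2n /j -[leqRHS]odd_double_half leq_addl.
have nj : (n <= (2 * j).+1)%N.
  by rewrite mul2n /j -[leqLHS]odd_double_half -addn1 addnC leq_add2l; case: (odd n).
have kj : (k <= j)%N by rewrite -ltnS -(ltn_pmul2l (isT : 0 < 2)%N) (leq_ltn_trans kn2)// mulnS !ltnS.
have jn : (j < n)%N.
  by apply: leq_trans j2; rewrite mul2n -addnn -[ltnLHS]addn0 ltn_add2l (leq_trans _ kj)// ltnW.
have Kj : (K <= j)%N by apply: leq_trans kj; apply: ltnW; apply: ltnW.
have := H j n Kj (ltnW jn); rewrite ler_distl => /andP[h _].
have jR : (1 : R) < j%:R by rewrite ltr1n (leq_trans k0).
have aj0 : 0 < a j by apply: a_gt0; rewrite (leq_trans (ltnW k0)).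
have j3 : 3^-1 <= (j%:R / n%:R : R).
  rewrite ler_pdivlMr// mulrC ler_pdivrMr// -natrM ler_nat (leq_trans nj)//.
  by rewrite [leqRHS]mulnC (mulnDl 2 1 j) mul1n -addn1 leq_add2l (leq_trans (ltnW k0)).
have j2' : (j%:R / n%:R : R) <= 2^-1.
  by rewrite ler_pdivrMr// mulrC ler_pdivlMr// -natrM ler_nat mulnC.
have : (j%:R / n%:R : R) ^+ 2 <= (a j / a n) ^+ 2 by apply: le_trans h; nra.
rewrite ler_pXn2r ?nnegrE ?divr_ge0 ?(ltW aj0) ?(ltW an0)//.
rewrite ler_pdivlMr// mulrAC ler_pdivrMr// => h5.
have := IH j (leq_trans jn nm) kj => h6.
rewrite -(ler_pM2l (lt_trans ltr01 jR)); nra.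
Qed.

(** For k large, a k-th power at frequency s / a_n is a k-th power at frequency
    s (a_k / a_n) / a_k, close to the Gaussian limit since a_k / a_n is close to
    the square root of k / n. For bounded k both sides are close to 1. *)
Lemma cf_power (L e : R) : 0 <= L -> 0 < e -> exists N, forall n, (N <= n)%N ->
  forall k s, (k <= n)%N -> 0 <= s <= L ->
  normc (phi (s / a n) ^+ k - (expR (- (s ^+ 2 * (k%:R / n%:R) / 2)))%:C%C) <= e.
Proof.
move=> L0 e0; have e2 : 0 < e / 2 by rewrite divr_gt0.
have eL : 0 < e / (L ^+ 2 + 1) by rewrite divr_gt0// ltr_wpDl ?sqr_ge0.
have [K1 H1] := near_ex (phi_lim (2 * L) e2).
have [K2 H2] := norming_ratio eL.
have [K3 H3] := norming_ratio ltr01.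
pose K := (maxn K1 (maxn K2 K3)).+1.
have eK : 0 < e / 2 / K%:R by rewrite divr_gt0.
have [h h0 Hh] := phi_uc eK.
have [K4 H4] := norming_pinfty (L / h).
pose K5 := (Num.truncn (L ^+ 2 * K%:R / e)).+1.
exists (maxn K4 K5) => n; rewrite geq_max => /andP[n4 n5] k s kn sL.
have /andP[s0 s1] := sL.
have n0 : (0 < n)%N by apply: leq_trans n5.
have nR : (0 : R) < n%:R by rewrite ltr0n.
have an0 := a_gt0 n0.
have s2 : s ^+ 2 <= L ^+ 2 by rewrite ler_sqr ?nnegrE.
set A := expR _.
have [kK|Kk] := ltnP k K.
  have p1 : normc (phi (s / a n) - 1) <= e / 2 / K%:R.
    rewrite -phi0; apply: Hh; rewrite subr0 ger0_norm ?divr_ge0 ?(ltW an0)//.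
    rewrite ler_pdivrMr// (le_trans s1)// mulrC -ler_pdivrMr//.
    exact: H4.
  have pk : normc (phi (s / a n) ^+ k - 1) <= e / 2.
    apply: le_trans (normc_prod_sub1 k (phi_le1 _) p1) _.
    rewrite mulrA ler_pdivrMr// mulrC ler_wpM2l ?(ltW e2)// ler_nat.
    exact: ltnW.
  have A1 : A <= 1 by rewrite -expR0 ler_expR oppr_le0 !mulr_ge0 ?sqr_ge0 ?invr_ge0.
  have A2 : 1 - e / 2 <= A.
    apply: le_trans (expR_ge1Dx _); rewrite lerD2l lerN2 ler_wpM2r// mulrA ler_pdivrMr//.
    have : L ^+ 2 * K%:R / e <= n%:R.
      by apply: (le_trans (ltW (truncnS_gt _))); rewrite ler_nat.
    rewrite ler_pdivrMr// [e * _]mulrC; apply: le_trans; apply: ler_pM => //.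
      exact: sqr_ge0.
    by rewrite ler_nat ltnW.
  have -> : phi (s / a n) ^+ k - A%:C%C = (phi (s / a n) ^+ k - 1) - (A - 1)%:C%C.
    by rewrite rmorphB/= opprB addrA subrK.
  apply: le_trans (le_normcB _ _) _; rewrite normcR.
  have : `|A - 1| <= e / 2 by rewrite ler_distl; apply/andP; split; lra.
  by lra.
have k0 : (0 < k)%N by apply: leq_trans Kk.
have ak0 := a_gt0 k0.
have Kk' : (maxn K1 (maxn K2 K3) <= k)%N by apply: ltnW.
have k1 : (K1 <= k)%N by apply: leq_trans Kk'; rewrite leq_maxl.
have k2 : (K2 <= k)%N by apply: leq_trans Kk'; rewrite !leq_max leqnn orbT.
have k3 : (K3 <= k)%N by apply: leq_trans Kk'; rewrite !leq_max leqnn !orbT.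
pose r := a k / a n.
have kn1 : (k%:R / n%:R : R) <= 1 by rewrite ler_pdivrMr// mul1r ler_nat.
have r0 : 0 <= r by rewrite divr_ge0 ?ltW.
have r2 : r <= 2.
  rewrite -(ler_pXn2r (n := 2)) ?nnegrE//.
  by have := H3 k n k3 kn; rewrite -/r ler_distl => /andP[_]; rewrite (expr2 2); lra.
have sr : 0 <= s * r <= 2 * L by rewrite mulr_ge0//= mulrC ler_pM.
have := H1 k k1 (s * r) sr.
have -> : s * r / a k = s / a n by rewrite /r mulrA mulrAC mulfK ?gt_eqF.
set B := expR _ => h1.
have -> : phi (s / a n) ^+ k - A%:C%C = (phi (s / a n) ^+ k - B%:C%C) - (A - B)%:C%C.
  by rewrite rmorphB/= opprB addrA subrK.
apply: le_trans (le_normcB _ _) _; rewrite normcR.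
have : `|A - B| <= e / 2.
  apply: le_trans (lipschitz_expRN _ _) _.
  - by rewrite !mulr_ge0 ?sqr_ge0 ?invr_ge0.
  - by rewrite divr_ge0 ?sqr_ge0.
  have -> : s ^+ 2 * (k%:R / n%:R) / 2 - (s * r) ^+ 2 / 2 = - (s ^+ 2 / 2 * (r ^+ 2 - k%:R / n%:R)).
    by rewrite exprMn; field; rewrite pnatr_eq0 gtn_eqF.
  rewrite normrN normrM ger0_norm ?divr_ge0 ?sqr_ge0//.
  have := H2 k n k2 kn; rewrite -/r => hh.
  apply: (@le_trans _ _ (L ^+ 2 / 2 * (e / (L ^+ 2 + 1)))).
    by apply: ler_pM => //; [rewrite divr_ge0 ?sqr_ge0|rewrite ler_wpM2r].
  have L21 : 0 < L ^+ 2 + 1 by rewrite ltr_wpDl ?sqr_ge0.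
  rewrite mulrA ler_pdivrMr//; have := sqr_ge0 L; nra.
by lra.
Qed.

Lemma normc_geometric (w : R[i]) m (d : R) :
  (forall j, (j < m)%N -> normc (w ^+ j - 1) <= d) ->
  normc (m%:R - \sum_(j < m) w ^+ j) <= m%:R * d.
Proof.
elim: m => [|m IH] H; first by rewrite big_ord0 subr0 normc0 mul0r.
rewrite big_ord_recr/=.
have -> : m.+1%:R - (\sum_(i < m) w ^+ i + w ^+ m) =
    (m%:R - \sum_(i < m) w ^+ i) - (w ^+ m - 1) by rewrite -natr1; ring.
apply: le_trans (le_normcB _ _) _; rewrite -natr1 mulrDl mul1r lerD//; last exact: H.
by apply: IH => j jm; apply: H; rewrite ltnW.
Qed.

(** For 1 - phi^m = (1 - phi)(1 + phi + ... + phi^(m-1)) with m a small fraction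
    of n, every power on the right is close to 1 while the left side is bounded. *)
Lemma cf_dist1 (L : R) : 0 <= L -> exists C N, 0 <= C /\ forall n, (N <= n)%N ->
  forall s, 0 <= s <= L -> n%:R * normc (1 - phi (s / a n)) <= C.
Proof.
move=> L0; pose J := (Num.truncn (2 * L ^+ 2)).+1.
have JL : 2 * L ^+ 2 <= J%:R by apply/ltW/truncnS_gt.
have J0 : (0 : R) < J%:R by rewrite ltr0n.
have e4 : (0 : R) < 4^-1 by rewrite invr_gt0.
have [N H] := cf_power L0 e4.
exists (8 * J%:R), (maxn N J); split; first by rewrite mulr_ge0.
move=> n; rewrite geq_max => /andP[Nn Jn] s sL.
have n0 : (0 < n)%N by apply: leq_trans Jn.
have nR : (0 : R) < n%:R by rewrite ltr0n.
pose m := (n %/ J)%N.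
have m0 : (0 < m)%N by rewrite divn_gt0.
have mR : (1 : R) <= m%:R by rewrite ler1n.
have mJ : (m%:R * J%:R : R) <= n%:R by rewrite -natrM ler_nat leq_divM.
have nJm : (n%:R : R) <= 2 * J%:R * m%:R.
  have : (n%:R : R) <= m%:R * J%:R + J%:R.
    by rewrite -natrM -natrD ler_nat {1}(divn_eq n J) leq_add2l ltnW// ltn_mod.
  by nra.
set w := phi _.
have wj j : (j < m)%N -> normc (w ^+ j - 1) <= 2^-1.
  move=> jm; have jn : (j <= n)%N by rewrite (leq_trans (ltnW jm))// leq_div.
  have := H n Nn j s jn sL; set A := expR _ => hA; have /andP[s0 s1] := sL.
  have A1 : A <= 1 by rewrite -expR0 ler_expR oppr_le0 !mulr_ge0 ?sqr_ge0 ?invr_ge0.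
  have A2 : 1 - 4^-1 <= A.
    apply: le_trans (expR_ge1Dx _); rewrite lerD2l lerN2 mulrA -mulrA -invfM.
    rewrite ler_pdivrMr ?mulr_gt0//.
    have jR : (j%:R : R) <= m%:R by rewrite ler_nat ltnW.
    have s2 : s ^+ 2 <= L ^+ 2 by case/andP: sL => ? ?; rewrite ler_sqr ?nnegrE.
    have := sqr_ge0 s; have j0 : (0 : R) <= j%:R by []. nra.
  have -> : w ^+ j - 1 = (w ^+ j - A%:C%C) - (1 - A)%:C%C.
    by rewrite rmorphB/= opprB addrA subrK.
  apply: le_trans (le_normcB _ _) _; rewrite normcR ger0_norm; lra.
have hT := normc_geometric wj.
set T := \sum_(j < m) w ^+ j in hT.
have T2 : m%:R * 2^-1 <= normc T.
  have := le_trans (ler_dist_normc _ _) hT.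
  have -> : normc (m%:R : R[i]) = m%:R.
    by rewrite -(rmorph_nat (real_complex R)) normcR ger0_norm.
  by rewrite ler_distl => /andP[_]; lra.
have hw : normc ((1 - w) * T) <= 2.
  have -> : (1 - w) * T = 1 - w ^+ m by rewrite -opprB mulNr -subrX1 opprB.
  apply: le_trans (le_normcB _ _) _; rewrite normc1 normcX.
  have : normc w ^+ m <= 1 by rewrite exprn_ile1 ?normc_ge0 ?phi_le1.
  by lra.
rewrite normcM in hw; have := normc_ge0 (1 - w).
move: (normc (1 - w)) hw => D hw D0.
have Dm : D * m%:R <= 4.
  have : D * (m%:R * 2^-1) <= 2 by apply: le_trans hw; rewrite ler_wpM2l.
  by lra.
by nra.
Qed.

Lemma expRN_le (v : R) : 0 <= v -> expR (- v) <= 1 - v + v ^+ 2.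
Proof.
move=> v0; rewrite expRN -[leLHS]mul1r ler_pdivrMr ?expR_gt0//.
apply: (@le_trans _ _ ((1 - v + v ^+ 2) * (1 + v))).
  have := exprn_ge0 3 v0; rewrite !exprS expr0; nra.
by rewrite ler_wpM2l ?expR_ge1Dx// expr2; nra.
Qed.

(** The arithmetic of a first-order expansion: here x and y stand for the real
    parts of phi and phi^m, m = q n with q of order 1 / J, and A = exp(- u q). The
    error of the geometric sum is n D = O(1) times e1 + u q, and the error of
    1 - A = u q is of second order in q; both are below e once divided by q. *)
Lemma first_order_term (x y A u e e1 q C J m n D L : R) :
  0 <= D -> n * D <= C ->
  1 - y - D * (m * (e1 + u * q)) <= m * (1 - x) <= 1 - y + D * (m * (e1 + u * q)) ->
  A - e1 <= y <= A + e1 -> 1 - u * q <= A <= 1 - u * q + (u * q) ^+ 2 ->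
  0 < e1 -> 0 <= q -> 0 <= u -> 0 < J -> (2 * C + 4 * J) * e1 = e ->
  2 * C * L ^+ 2 + L ^+ 4 <= J * e -> q * J <= 1 -> u <= L ^+ 2 / 2 ->
  n <= 2 * J * m -> 0 < m -> 0 < n -> q * n = m -> 0 <= C ->
  u - e <= n * (1 - x) <= u + e.
Proof.
move=> D0 hC /andP[g1 g2] /andP[g3 g4] /andP[A1 A2] e10 q0 u0 J0 e1E JL qJ uL nJm m0 n0 qn C0.
have uq0 : 0 <= u * q by rewrite mulr_ge0.
have hD : n * (D * (m * (e1 + u * q))) <= m * (C * (e1 + u * q)).
  have h : 0 <= m * (e1 + u * q) by rewrite mulr_ge0 ?(ltW m0)// addr_ge0 ?(ltW e10).
  by have := ler_wpM2r h hC; lra.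
have E1 : n * e1 <= m * (2 * J * e1) by have := ler_wpM2r (ltW e10) nJm; lra.
have L40 : 0 <= L ^+ 4 by rewrite (_ : L ^+ 4 = (L ^+ 2) ^+ 2) ?sqr_ge0// -exprM.
have CL0 : 0 <= C * L ^+ 2 by rewrite mulr_ge0// sqr_ge0.
have C1 : C * (u * q) * 4 <= e.
  have Cu := ler_wpM2l C0 uL; have Cu0 : 0 <= C * u by rewrite mulr_ge0.
  have h := ler_wpM2l Cu0 qJ; rewrite -(ler_pM2l J0).
  have -> : J * (C * (u * q) * 4) = 4 * (C * u * (q * J)) by ring.
  by lra.
have u2 : u ^+ 2 * 4 <= L ^+ 4.
  have -> : L ^+ 4 = (L ^+ 2) ^+ 2 by rewrite -exprM.
  have : u ^+ 2 <= (L ^+ 2 / 2) ^+ 2 by rewrite ler_sqr ?nnegrE ?divr_ge0 ?sqr_ge0.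
  by rewrite expr_div_n; lra.
have C2 : u ^+ 2 * q * 4 <= e.
  have h := ler_wpM2l (sqr_ge0 u) qJ; rewrite -(ler_pM2l J0).
  have -> : J * (u ^+ 2 * q * 4) = 4 * (u ^+ 2 * (q * J)) by ring.
  by lra.
have S : C * (e1 + u * q) + 2 * J * e1 + u ^+ 2 * q <= e by lra.
have S' : C * (e1 + u * q) + 2 * J * e1 <= e.
  have : 0 <= u ^+ 2 * q by rewrite mulr_ge0 ?sqr_ge0.
  by lra.
have nq : n * (u * q) = m * u by rewrite -qn; ring.
have nq2 : n * (u * q) ^+ 2 = m * (u ^+ 2 * q) by rewrite -qn; ring.
have mS := ler_wpM2l (ltW m0) S; have mS' := ler_wpM2l (ltW m0) S'.
have n0' := ltW n0.
have k1 : m * (n * (1 - x)) <= m * (u + e).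
  have h1 := ler_wpM2l n0' g2.
  have h2 : n * (1 - y) <= n * (u * q + e1) by rewrite ler_wpM2l//; lra.
  by move: h2; rewrite [n * (u * q + e1)]mulrDr nq; lra.
have k2 : m * (u - e) <= m * (n * (1 - x)).
  have h1 := ler_wpM2l n0' g1.
  have h2 : n * (u * q - (u * q) ^+ 2 - e1) <= n * (1 - y) by rewrite ler_wpM2l//; lra.
  by move: h2; rewrite [n * (u * q - _ - e1)]mulrBr [n * (u * q - _)]mulrBr nq nq2; lra.
by move: k1 k2; rewrite !ler_pM2l// => k1 k2; rewrite k1 k2.
Qed.

(** Expand 1 - phi^m by the geometric sum with m = n / J: to first order it is
    m (1 - phi), while its limit is 1 - exp(- s^2 / 2J), that is s^2 / 2J to first
    order. *)
Lemma Re_cf_lim (L e : R) : 0 <= L -> 0 < e -> exists N, forall n, (N <= n)%N ->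
  forall s, 0 <= s <= L -> `|n%:R * (1 - Re (phi (s / a n))) - s ^+ 2 / 2| <= e.
Proof.
move=> L0 e0; have [C [N1 [C0 H1]]] := cf_dist1 L0.
pose J := (Num.truncn ((2 * C * L ^+ 2 + L ^+ 4) / e)).+1.
have JL : 2 * C * L ^+ 2 + L ^+ 4 <= J%:R * e.
  by rewrite -ler_pdivrMr//; apply/ltW/truncnS_gt.
have J0 : (0 : R) < J%:R by rewrite ltr0n.
pose e1 := e / (2 * C + 4 * J%:R).
have d0 : 0 < 2 * C + 4 * J%:R by rewrite ltr_wpDl ?mulr_ge0// mulr_gt0.
have e10 : 0 < e1 by rewrite divr_gt0.
have e1E : (2 * C + 4 * J%:R) * e1 = e by rewrite mulrC divfK// gt_eqF.
have [N2 H2] := cf_power L0 e10.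
exists (maxn (maxn N1 N2) J) => n; rewrite !geq_max => /andP[/andP[n1 n2] Jn] s sL.
have n0 : (0 < n)%N by apply: leq_trans Jn.
have nR : (0 : R) < n%:R by rewrite ltr0n.
pose m := (n %/ J)%N.
have m0 : (0 < m)%N by rewrite divn_gt0.
have mR : (1 : R) <= m%:R by rewrite ler1n.
have mJ : (m%:R * J%:R : R) <= n%:R by rewrite -natrM ler_nat leq_divM.
have nJm : (n%:R : R) <= 2 * J%:R * m%:R.
  have : (n%:R : R) <= m%:R * J%:R + J%:R.
    by rewrite -natrM -natrD ler_nat {1}(divn_eq n J) leq_add2l ltnW// ltn_mod.
  by nra.
have := H1 n n1 s sL; set w := phi _ => hC.
pose u := s ^+ 2 / 2; have /andP[s0 s1] := sL.
have s2 : s ^+ 2 <= L ^+ 2 by rewrite ler_sqr ?nnegrE.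
have u0 : 0 <= u by rewrite divr_ge0 ?sqr_ge0.
have uL : u <= L ^+ 2 / 2 by rewrite ler_wpM2r.
pose q : R := m%:R / n%:R.
have q0 : 0 <= q by rewrite divr_ge0.
have qn : q * n%:R = m%:R by rewrite divfK// gt_eqF.
have qJ : q * J%:R <= 1 by rewrite mulrAC ler_pdivrMr// mul1r.
have vE j : s ^+ 2 * (j%:R / n%:R) / 2 = u * (j%:R / n%:R) by rewrite /u; ring.
have wj j : (j < m)%N -> normc (w ^+ j - 1) <= e1 + u * q.
  move=> jm; have jn : (j <= n)%N by rewrite (leq_trans (ltnW jm))// leq_div.
  have := H2 n n2 j s jn sL; rewrite -/w vE; set A := expR _ => hA.
  have v0 : 0 <= u * (j%:R / n%:R) by rewrite mulr_ge0// divr_ge0.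
  have A1 : A <= 1 by rewrite -expR0 ler_expR oppr_le0.
  have A2 : 1 - u * q <= A.
    apply: le_trans (expR_ge1Dx _); rewrite lerD2l lerN2 ler_wpM2l// ler_wpM2r ?invr_ge0//.
    by rewrite ler_nat ltnW.
  have -> : w ^+ j - 1 = (w ^+ j - A%:C%C) - (1 - A)%:C%C.
    by rewrite rmorphB/= opprB addrA subrK.
  apply: le_trans (le_normcB _ _) _; rewrite normcR ger0_norm; lra.
have hT := normc_geometric wj; set T := \sum_(j < m) w ^+ j in hT.
have mn : (m <= n)%N by rewrite leq_div.
have := H2 n n2 m s mn sL; rewrite -/w vE -/q; set A := expR _ => hA.
have A1 : 1 - u * q <= A by apply: expR_ge1Dx.
have A2 : A <= 1 - u * q + (u * q) ^+ 2 by apply: expRN_le; rewrite mulr_ge0.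
have hR : `|Re ((1 - w) * (m%:R - T))| <= normc (1 - w) * (m%:R * (e1 + u * q)).
  by apply: le_trans (normc_Re _) _; rewrite normcM ler_wpM2l ?normc_ge0.
have hI : (1 - w) * (m%:R - T) = m%:R * (1 - w) - (1 - w ^+ m).
  have -> : 1 - w ^+ m = (1 - w) * T by rewrite -opprB subrX1 -mulNr opprB.
  by rewrite mulrBr mulrC.
have Rem z : Re ((m%:R : R[i]) * z) = m%:R * Re z.
  by rewrite -(rmorph_nat (real_complex R)); case: z => x y /=; rewrite mul0r subr0.
rewrite hI !ReB Rem ReB/= in hR.
have := le_trans (normc_Re _) hA; rewrite ReB/= => hB.
rewrite -/u.
move: hR hB; rewrite !ler_distl -!/(Re _); move: (Re w) (Re (w ^+ m)) => x y.
have D0 := normc_ge0 (1 - w); move: (normc (1 - w)) hC D0 => D hC D0.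
have m1 : 0 < (m%:R : R) by lra.
move=> h1 h2; apply: (first_order_term D0 hC h1 h2 _ e10 q0 u0 J0 e1E JL qJ uL nJm m1 nR qn C0).
by rewrite A1 A2.
Qed.

(** For every small s some index k of the scale on which s is of order 1 is
    available: there phi(s)^k is bounded away from 1, and n is a large multiple of k. *)
Lemma cf_small_domination : exists (s0 c : R) N, [/\ 0 < s0, 0 < c &
  forall n, (N <= n)%N -> forall s, 0 < s <= s0 -> 1 <= s * a n ->
  normc (phi s) ^+ n <= expR (- (c * (s * a n)))].
Proof.
pose e : R := expR (- 16^-1) - expR (- 8^-1).
have e0 : 0 < e by rewrite subr_gt0 ltr_expR ltrN2; lra.
have [K1 H1] := near_ex (phi_lim 1 e0).
have [K2 H2] := norming_step.
have [K3 H3] := norming_growth.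
pose K := (maxn K1 (maxn K2 K3)).+1.
have aK0 : 0 < a K by apply: a_gt0.
exists (2 * a K)^-1, 64^-1, K; split; [by rewrite invr_gt0 mulr_gt0|by rewrite invr_gt0|].
move=> n Kn s /andP[s0 ss] san.
pose p := fun k => (K <= k)%N && (2^-1 <= s * a k).
have pn : p n by rewrite /p Kn/=; lra.
have := @find_ex_minn p (ex_intro _ n pn).
case=> k /andP[Kk ak] kmin; have kn := kmin n pn.
have k0 : (0 < k)%N by apply: leq_trans Kk.
have ak1 : s * a k <= 1.
  have [kK|Kk'] := eqVneq k K.
    rewrite kK; have : s * (2 * a K) <= 1 by rewrite -ler_pdivlMr ?mulr_gt0// mul1r.
    by lra.
  have Kk1 : (K < k)%N by rewrite ltn_neqAle eq_sym Kk'.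
  case: k Kk ak kmin kn k0 Kk' Kk1 => // k _ _ kmin _ _ _; rewrite ltnS => Kk.
  have k2 : (K2 <= k)%N by apply: leq_trans (ltnW Kk); rewrite !leq_max leqnn orbT.
  have := H2 k k2 => a2.
  have : s * a k < 2^-1.
    rewrite ltNge; apply/negP => h; have := kmin k; rewrite /p Kk h ltnn.
    by move=> /(_ isT).
  by nra.
have Kk' : (maxn K1 (maxn K2 K3) <= k)%N by apply: ltnW.
have k1 : (K1 <= k)%N by apply: leq_trans Kk'; rewrite leq_maxl.
have k3 : (K3 <= k)%N by apply: leq_trans Kk'; rewrite !leq_max leqnn !orbT.
have ak0 := a_gt0 k0; have n0 : (0 < n)%N := leq_trans k0 kn.
have h01 : 0 <= s * a k <= 1 by rewrite ak1 andbT; lra.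
have := H1 k k1 _ h01; rewrite mulfK ?gt_eqF// => /(le_trans (ler_dist_normc _ _)).
rewrite normcX normcR (ger0_norm (expR_ge0 _)) ler_distl => /andP[_].
have : expR (- ((s * a k) ^+ 2 / 2)) <= expR (- 8^-1).
  rewrite ler_expR lerN2; have : 2^-1 ^+ 2 <= (s * a k) ^+ 2 by rewrite ler_sqr ?nnegrE; lra.
  by rewrite exprVn expr2; lra.
move=> h2 h1; have hk : normc (phi s) ^+ k <= expR (- 16^-1) by rewrite /e in h1; lra.
pose j := (n %/ k)%N.
have hj : normc (phi s) ^+ n <= expR (- 16^-1) ^+ j.
  apply: (@le_trans _ _ (normc (phi s) ^+ (k * j))).
    by apply: ler_wiXn2l; rewrite ?normc_ge0 ?phi_le1// mulnC leq_divM.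
  by rewrite exprM; apply: lerXn2r; rewrite ?nnegrE ?exprn_ge0 ?normc_ge0 ?expR_ge0.
apply: (le_trans hj); rewrite -expRM_natl ler_expR.
have := H3 k n k3 kn.
have j1 : (1 : R) <= j%:R by rewrite ler1n divn_gt0.
have nj : (n%:R : R) <= 2 * k%:R * j%:R.
  have : (n%:R : R) <= j%:R * k%:R + k%:R.
    by rewrite -natrM -natrD ler_nat {1}(divn_eq n k) leq_add2l ltnW// ltn_mod.
  have : (0 : R) <= k%:R by []. nra.
have kR : (0 : R) < k%:R by rewrite ltr0n.
move=> h3; have : k%:R * (s * a n) <= k%:R * (4 * j%:R).
  have : s * (k%:R * a n) <= s * (2 * n%:R * a k) by rewrite ler_pM2l.
  have : n%:R * (s * a k) <= n%:R by rewrite ler_piMr.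
  by nra.
by rewrite ler_pM2l//; nra.
Qed.

End norming_sequence.

(** * Averages over frequencies *)

Section fubini_expectation.
Context d (T : measurableType d) {R : realType} (P : probability T R).
Notation mu := (@lebesgue_measure R).
Implicit Types (k h : R -> R) (f y : T -> R).

Lemma EFin_Ex f : bmf f -> (Ex P f)%:E = (\int[P]_w (f w)%:E)%E.
Proof.
move=> bf; rewrite /Ex /Rintegral fineK//.
by apply: integrable_fin_num => //; exact: bmf_integrable.
Qed.

Lemma measurable_scaled y l : measurable_fun [set: T] y ->
  measurable_fun [set: T] (fun w => l * y w).
Proof. by move=> my; apply: measurable_funM. Qed.

Lemma bmf_scaled h y l : measurable_fun [set: T] y -> continuous h ->
  (forall x, `|h x| <= 1) -> bmf (fun w => h (l * y w)).
Proof.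
move=> my ch h1; split; last by exists 1.
apply: measurableT_comp; first exact: continuous_measurable_fun.
exact: measurable_funM.
Qed.

Section fixed.
Variables (k h : R -> R) (f y : T -> R).
Hypotheses (ik : mu.-integrable [set: R] (EFin \o k)) (bf : bmf f).
Hypotheses (my : measurable_fun [set: T] y) (ch : continuous h).
Hypothesis h1 : forall x, `|h x| <= 1.

Let mk : measurable_fun [set: R] k.
Proof. by apply/measurable_EFinP; case/integrableP: ik. Qed.

Let F (z : measurableTypeR R * T) : \bar R :=
  (k z.1 * (f z.2 * h (z.1 * y z.2)))%:E.

Let mF : measurable_fun setT F.
Proof.
apply/measurable_EFinP; apply: measurable_funM.
  by apply: measurableT_comp.
apply: measurable_funM.
  by apply: measurableT_comp => //; case: bf.
apply: measurableT_comp; first exact: continuous_measurable_fun.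
apply: measurable_funM; first exact: measurable_fst.
exact: measurableT_comp.
Qed.

Let bfh l : bmf (fun w => f w * h (l * y w)).
Proof. by apply: bmfM => //; exact: bmf_scaled. Qed.

Let iF : (lebesgue_measure \x P)%E.-integrable setT F.
Proof.
apply/integrable12ltyP => //; have [M fM] := bf.2.
have M0 : 0 <= M by apply: le_trans (fM point).
apply: (@le_lt_trans _ _ (\int[mu]_l (M%:E * `|k l|%:E)))%E; last first.
  have := integrable_abse ik; move=> /(integrableZl measurableT M).
  case/integrableP => _; apply: le_lt_trans; apply: ge0_le_integral => //.
  - by move=> l _; rewrite mule_ge0// lee_fin.
  - by apply: emeasurable_funM => //; apply/measurable_EFinP; exact: measurableT_comp.
  - apply: measurableT_comp => //; apply: emeasurable_funM => //.
    by apply/measurable_EFinP; exact: measurableT_comp.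
  - by move=> l _; rewrite lee_abs.
apply: ge0_le_integral => //.
- by move=> l _; apply: integral_ge0.
- apply: (measurable_fun_fubini_tonelli_F (abse \o F)); last by move=> x; exact: abse_ge0.
  exact: measurableT_comp.
- by apply: emeasurable_funM => //; apply/measurable_EFinP; exact: measurableT_comp.
move=> l _; apply: (@le_trans _ _ (\int[P]_w (M * `|k l|)%:E))%E.
  apply: ge0_le_integral => //.
  - apply: measurableT_comp => //; apply/measurable_EFinP.
    by have [] := bmfM (bmf_cst (k l)) (bfh l).
  - move=> w _; rewrite /F/= lee_fin normrM mulrC ler_wpM2r// normrM.
    by rewrite -[leRHS]mulr1 ler_pM.
rewrite (_ : \int[P]__ _ = (M * `|k l|)%:E)%E ?EFinM//.
by rewrite -EFin_Ex ?Ex_cst//; exact: bmf_cst.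
Qed.

Let innerP l : (\int[P]_w F (l, w) = (k l * Ex P (fun w => f w * h (l * y w)))%:E)%E.
Proof.
by rewrite -ExZ// EFin_Ex//; apply: bmfM => //; exact: bmf_cst.
Qed.

Let ikh w : mu.-integrable [set: R] (EFin \o (fun l => k l * h (l * y w))).
Proof.
apply: integrable_le (integrable_abse ik) _.
  apply: measurable_funM => //; apply: measurableT_comp; first exact: continuous_measurable_fun.
  exact: measurable_funM.
by move=> l; rewrite normrM ler_piMr.
Qed.

Let innerL w : (\int[mu]_l F (l, w) = (f w * \int[mu]_l (k l * h (l * y w)))%:E)%E.
Proof.
rewrite -RintegralZl// /Rintegral fineK; last first.
  apply: integrable_fin_num => //.
  have := integrableZl measurableT (f w) (ikh w).
  by apply: eq_integrable => // l _.
by apply: eq_integral => l _; rewrite /F/=; congr EFin; rewrite mulrCA.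
Qed.

Lemma integrable_Ex :
  mu.-integrable [set: R] (EFin \o (fun l => k l * Ex P (fun w => f w * h (l * y w)))).
Proof.
have := integrable_fubini_F iF; apply: eq_integrable => // l _.
by rewrite /fubini_F innerP.
Qed.

Lemma bmf_integral : bmf (fun w => f w * \int[mu]_l (k l * h (l * y w))).
Proof.
split.
  apply/measurable_EFinP; have := measurable_fubini_G iF; apply: eq_measurable_fun => // w _.
  by rewrite /fubini_G innerL.
have [M fM] := bf.2; exists (M * \int[mu]_l `|k l|) => w; rewrite normrM ler_pM//.
apply: le_trans (le_normr_Rintegral _ _) _ => //.
apply: le_Rintegral => //.
- have := integrable_abse (ikh w); by apply: eq_integrable => // l _.
- have := integrable_abse ik; by apply: eq_integrable => // l _.
by move=> l _; rewrite normrM ler_piMr.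
Qed.

(** Fubini's theorem. *)
Lemma Ex_integral : Ex P (fun w => f w * \int[mu]_l (k l * h (l * y w))) =
  \int[mu]_l (k l * Ex P (fun w => f w * h (l * y w))).
Proof.
apply: EFin_inj; rewrite EFin_Ex; last exact: bmf_integral.
rewrite [in RHS]/Rintegral fineK; last first.
  by apply: integrable_fin_num => //; exact: integrable_Ex.
transitivity (\int[P]_w \int[mu]_l F (l, w))%E.
  by apply: eq_integral => w _; rewrite innerL.
by rewrite -(Fubini iF); apply: eq_integral => l _; exact: innerP.
Qed.

End fixed.

End fubini_expectation.

Section sinc.
Context {R : realType}.
Notation mu := (@lebesgue_measure R).
Implicit Types (L l u : R).

Definition window L : R -> R := \1_(`[- L, L]%classic : set R).

Lemma windowE L l : window L l = (`|l| <= L)%R%:R.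
Proof. by rewrite /window indicE mem_setE in_itv/= ler_norml. Qed.

Lemma window01 L l : 0 <= window L l <= 1.
Proof. by rewrite windowE; case: (`|l| <= L)%R; rewrite /= ?lexx ?ler01. Qed.

Lemma integrable_window L : mu.-integrable [set: R] (EFin \o window L).
Proof.
apply: integrable_indic_itv.
Qed.

Lemma Rintegral_window L : 0 <= L -> \int[mu]_l window L l = 2 * L.
Proof.
move=> L0; rewrite /Rintegral /window integral_indic// setIT.
transitivity (fine (lebesgue_measure [set` `[- L, L]])) => //.
rewrite lebesgue_measure_itv/= lte_fin.
case: ltP => h /=; first by rewrite opprK mulr2n mulrDl !mul1r.
by rewrite (_ : L = 0) ?mulr0//; lra.
Qed.

Lemma integrable_windowM L (g : R -> R) : continuous g -> (forall x, `|g x| <= 1) ->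
  mu.-integrable [set: R] (EFin \o (fun l => window L l * g l)).
Proof.
move=> cg g1; apply: integrable_le (integrable_window L) _.
  apply: measurable_funM; first exact: measurable_indic.
  exact: continuous_measurable_fun.
by move=> l; have /andP[w0 _] := window01 L l; rewrite normrM (ger0_norm w0) ler_piMr.
Qed.

Lemma window_cos L u : 0 < L -> u != 0 ->
  \int[mu]_l (window L l * cos (l * u)) = 2 * sin (L * u) / u.
Proof.
move=> L0 u0; pose F l := sin (l * u) / u.
have dF (l : R) : is_derive l 1 F (cos (l * u)).
  by rewrite /F; apply: is_derive_eq; rewrite /GRing.scale/=; field.
have cF : continuous F.
  move=> x; apply: differentiable_continuous; apply/derivable1_diffP.
  by have := dF x; case.
have cc : continuous (fun l => cos (l * u)).
  by move=> x; apply: continuous_comp; [exact: mulrr_continuous|exact: continuous_cos].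
have -> : 2 * sin (L * u) / u = F L - F (- L).
  by rewrite /F mulNr sinN; field.
rewrite /Rintegral; apply: EFin_inj; rewrite fineK; last first.
  apply: integrable_fin_num => //; apply: integrable_windowM => // x.
  exact: norm_cos_le1.
rewrite EFinB -(@continuous_FTC2 _ (fun l => cos (l * u)))//.
- rewrite [RHS]integral_mkcond; apply: eq_integral => x _.
  by rewrite /window patchE indicE; case: ifP => _; rewrite ?mul1r ?mul0r.
- by rewrite (@lt_trans _ _ 0)// oppr_lt0.
- exact: continuous_subspaceT.
- split; first by move=> x _; have := dF x; case.
  + by apply: cvg_at_right_filter; exact: cF.
  + by apply: cvg_at_left_filter; exact: cF.
- by move=> x _; rewrite derive1E; exact: (@derive_val _ _ _ _ _ _ _ (dF x)).
Qed.

(** The average of the cosine over an interval, that is sin u / u, extended by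
    continuity at 0. *)
Definition sinc u : R := 2^-1 * \int[mu]_l (window 1 l * cos (l * u)).

Lemma norm_sinc u : `|u| * `|sinc u| <= 1.
Proof.
have [->|u0] := eqVneq u 0; first by rewrite normr0 mul0r.
rewrite /sinc window_cos// mul1r -normrM.
by have -> : u * (2^-1 * (2 * sin u / u)) = sin u; [field|exact: norm_sin_le1].
Qed.

Lemma sin_half_le u : `|u| <= 1 -> `|u| / 2 <= `|sin u|.
Proof.
wlog u0 : u / 0 <= u.
  move=> h; have [/h//|u0] := leP 0 u; rewrite -normrN -[Num.norm (sin u)]normrN -sinN.
  by apply: h; rewrite oppr_ge0 ltW.
rewrite ger0_norm// => u1; have [->|un0] := eqVneq u 0; first by rewrite mul0r.
have up : 0 < u by rewrite lt_neqAle eq_sym un0.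
have [x xu ] := MVT up (fun z _ => is_derive_sin z) (continuous_subspaceT (@continuous_sin R)).
rewrite sin0 !subr0 => ->; rewrite normrM (ger0_norm u0) mulrC ler_wpM2r//.
move: xu; rewrite in_itv/= => /andP[x0 x1].
apply: le_trans (ler_norm _).
have := norm_sin_le (x / 2); rewrite (ger0_norm (ltW (divr_gt0 x0 _)))//.
have -> : cos x = 1 - 2 * sin (x / 2) ^+ 2.
  rewrite {1}(_ : x = (x / 2) *+ 2) ?cos_mulr2n ?cos2sin2; last by rewrite -mulr_natr divfK.
  ring.
move=> h; have : `|sin (x / 2)| ^+ 2 <= (x / 2) ^+ 2 by rewrite ler_sqr ?nnegrE ?divr_ge0 ?(ltW x0).
by rewrite real_normK ?num_real// exprMn exprVn; nra.
Qed.

Lemma cos_sqr_le u : `|u| <= 2 -> u ^+ 2 / 8 <= 1 - cos u.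
Proof.
move=> u2.
have -> : cos u = 1 - 2 * sin (u / 2) ^+ 2.
  rewrite {1}(_ : u = (u / 2) *+ 2) ?cos_mulr2n ?cos2sin2; last by rewrite -mulr_natr divfK.
  ring.
have h : `|u / 2| / 2 <= `|sin (u / 2)|.
  by apply: sin_half_le; rewrite normrM [Num.norm 2^-1]ger0_norm// ler_pdivrMr// mul1r.
have : (`|u / 2| / 2) ^+ 2 <= `|sin (u / 2)| ^+ 2.
  by rewrite ler_sqr ?nnegrE// divr_ge0.
rewrite exprMn !real_normK ?num_real// !exprMn !exprVn; lra.
Qed.

Definition trunc_sq u : R := Num.min 1 (u ^+ 2).

Lemma trunc_sq_ge0 u : 0 <= trunc_sq u.
Proof. by rewrite le_min ler01 sqr_ge0. Qed.

Lemma trunc_sq_le1 u : trunc_sq u <= 1.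
Proof. by rewrite ge_min lexx. Qed.

Lemma trunc_sq_ge1 u : 1 <= `|u| -> trunc_sq u = 1.
Proof.
move=> u1; rewrite /trunc_sq min_l// -[u ^+ 2]real_normK ?num_real//.
by rewrite exprn_ege1.
Qed.

(** Averaging 1 - cos over the frequencies in [0, 1] removes its periodic zeros. *)
Lemma trunc_sq_sinc u : trunc_sq u <= 64 * (1 - sinc u).
Proof.
have [u2|u2] := leP `|u| 2.
  apply: (@le_trans _ _ (u ^+ 2)); first by rewrite ge_min lexx orbT.
  have iw : mu.-integrable [set: R] (EFin \o (fun l => window 1 l * cos (l * u))).
    apply: integrable_windowM => [x|x]; last exact: norm_cos_le1.
    by apply: continuous_comp; [exact: mulrr_continuous|exact: continuous_cos].
  have i1 := integrable_window 1; have i2 := integrable_window (2^-1).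
  have i3 : mu.-integrable [set: R] (EFin \o (fun l => (window 1 l - window 2^-1 l))).
    by have := integrableB measurableT i1 i2; apply: eq_integrable.
  have i4 : mu.-integrable [set: R] (EFin \o (fun l => window 1 l - window 1 l * cos (l * u))).
    by have := integrableB measurableT i1 iw; apply: eq_integrable.
  have : \int[mu]_l (u ^+ 2 / 32 * (window 1 l - window 2^-1 l)) <=
         \int[mu]_l (window 1 l - window 1 l * cos (l * u)).
    apply: le_Rintegral => //.
      by have := integrableZl measurableT (u ^+ 2 / 32) i3; apply: eq_integrable.
    move=> l _; rewrite -{2}[window 1 l]mulr1 -mulrBr !windowE.
    have [l1|l1] := leP `|l| 1; last first.
      have -> : (`|l| <= 2^-1) = false by apply/negbTE; rewrite -ltNge; lra.
      by rewrite subr0 mulr0 mul0r.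
    have lu2 : `|l * u| <= 2 by rewrite normrM; have := normr_ge0 l; have := normr_ge0 u; nra.
    have := cos_sqr_le lu2; rewrite exprMn => h.
    have [l2|l2] := leP `|l| 2^-1; first by rewrite subrr mulr0 mul1r; have := cos_le1 (l * u); lra.
    rewrite subr0 mulr1 mul1r; apply: le_trans h.
    have : 2^-1 ^+ 2 <= l ^+ 2.
      by rewrite -[l ^+ 2]real_normK ?num_real// ler_sqr ?nnegrE// ltW.
    by rewrite exprVn; have := sqr_ge0 u; nra.
  rewrite RintegralZl// !RintegralB// !Rintegral_window// /sinc.
  by move: (\int[mu]_l _) => I; lra.
rewrite trunc_sq_ge1; last by lra.
have := norm_sinc u; have := ler_norm (sinc u); have := normr_ge0 (sinc u).
by move: `|u| `|sinc u| (sinc u) u2 => a b c; nra.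
Qed.

Lemma sinc_jump u : 5 <= `|u| -> 1 <= 3 / 2 - 2 * sinc u + 2^-1 * sinc (2 * u).
Proof.
move=> u5; have h1 := norm_sinc u; have h2 := norm_sinc (2 * u).
rewrite normrM (ger0_norm (_ : 0 <= 2)) // in h2.
have := ler_norm (sinc u); have := normr_ge0 (sinc u).
have := ler_norm (- sinc (2 * u)); have := normr_ge0 (sinc (2 * u)); rewrite normrN.
move: `|u| `|sinc u| (sinc u) `|sinc (2 * u)| (sinc (2 * u)) u5 h1 h2 => a b c b' c' *.
nra.
Qed.

Context d (T : measurableType d) (P : probability T R).
Variables (f y : T -> R).
Hypotheses (bf : bmf f) (my : measurable_fun [set: T] y).

Let bmf_fsinc (z : T -> R) : measurable_fun [set: T] z -> bmf (fun w => f w * sinc (z w)).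
Proof.
move=> mz; have := @bmf_integral _ _ _ P _ cos _ _ (integrable_window 1) bf mz.
move=> /(_ (@continuous_cos R) norm_cos_le1) /(bmfM (bmf_cst 2^-1)) [m1 m2].
split.
  by move: m1; apply: eq_measurable_fun => w _; rewrite /sinc; ring.
by case: m2 => M HM; exists M => w; rewrite (le_trans _ (HM w))// /sinc mulrCA.
Qed.

Lemma Ex_sinc_le (p q r e : R) :
  (forall l, 0 <= l <= 1 ->
    Ex P (fun w => f w * (p + q * cos (l * y w) + r * cos (l * (2 * y w)))) <= e) ->
  Ex P (fun w => f w * (p + q * sinc (y w) + r * sinc (2 * y w))) <= e.
Proof.
move=> H; have my2 : measurable_fun [set: T] (fun w => 2 * y w) by exact: measurable_scaled.
have bc l (z : T -> R) : measurable_fun [set: T] z -> bmf (fun w => f w * cos (l * z w)).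
  by move=> mz; apply: bmfM => //; apply: bmf_scaled => //; [exact: continuous_cos|exact: norm_cos_le1].
have E1 (g h : T -> R) : bmf (fun w => f w * g w) -> bmf (fun w => f w * h w) ->
    Ex P (fun w => f w * (p + q * g w + r * h w)) =
    p * Ex P f + q * Ex P (fun w => f w * g w) + r * Ex P (fun w => f w * h w).
  move=> bg bh; have b1 := bmfM (bmf_cst p) bf; have b2 := bmfM (bmf_cst q) bg.
  have b3 := bmfM (bmf_cst r) bh.
  rewrite -!ExZ// -!ExD//; first by apply: eq_Ex => w; ring.
  exact: bmfD.
rewrite E1; [|exact: bmf_fsinc|exact: bmf_fsinc].
have key (z : T -> R) : measurable_fun [set: T] z ->
    Ex P (fun w => f w * sinc (z w)) =
    2^-1 * \int[mu]_l (window 1 l * Ex P (fun w => f w * cos (l * z w))) /\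
    mu.-integrable [set: R] (EFin \o (fun l => window 1 l * Ex P (fun w => f w * cos (l * z w)))).
  move=> mz; split; last first.
    apply: integrable_Ex => //; [exact: integrable_window|exact: continuous_cos|exact: norm_cos_le1].
  rewrite -Ex_integral//; [|exact: integrable_window|exact: continuous_cos|exact: norm_cos_le1].
  rewrite -ExZ; first by apply: eq_Ex => w; rewrite /sinc mulrCA.
  apply: bmf_integral => //; [exact: integrable_window|exact: continuous_cos|exact: norm_cos_le1].
have [-> i1] := key _ my; have [-> i2] := key _ my2.
have i0 := integrable_window 1.
pose g l := window 1 l * (p * Ex P f) + q * (window 1 l * Ex P (fun w => f w * cos (l * y w)))
  + r * (window 1 l * Ex P (fun w => f w * cos (l * (2 * y w)))).
have j0 : mu.-integrable [set: R] (EFin \o (fun l => window 1 l * (p * Ex P f))).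
  by have := integrableZl measurableT (p * Ex P f) i0; apply: eq_integrable => // l _ /=; rewrite -EFinM mulrC.
have j1 : mu.-integrable [set: R] (EFin \o (fun l => q * (window 1 l * Ex P (fun w => f w * cos (l * y w))))).
  by have := integrableZl measurableT q i1; apply: eq_integrable.
have j2 : mu.-integrable [set: R] (EFin \o (fun l => r * (window 1 l * Ex P (fun w => f w * cos (l * (2 * y w)))))).
  by have := integrableZl measurableT r i2; apply: eq_integrable.
have j01 : mu.-integrable [set: R] (EFin \o (fun l => window 1 l * (p * Ex P f) + q * (window 1 l * Ex P (fun w => f w * cos (l * y w))))).
  by have := integrableD measurableT j0 j1; apply: eq_integrable.
have : \int[mu]_l g l <= \int[mu]_l (e * window 1 l).
  apply: le_Rintegral => //.
  - by have := integrableD measurableT j01 j2; apply: eq_integrable.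
  - by have := integrableZl measurableT e i0; apply: eq_integrable.
  move=> l _; rewrite /g windowE; have [l1|l1] := leP `|l| 1; last by rewrite !mul0r !mulr0 !addr0.
  rewrite !mul1r mulr1 -E1; [|exact: bc|exact: bc].
  rewrite (eq_Ex _ (_ : forall w, _ = f w * (p + q * cos (`|l| * y w) + r * cos (`|l| * (2 * y w))))).
    by apply: H; rewrite normr_ge0.
  by move=> w; case: (ger0P l) => // _; rewrite !mulNr !cosN.
rewrite RintegralD// RintegralD// !RintegralZl// Rintegral_window//.
under eq_Rintegral do rewrite mulrC.
rewrite RintegralZl// Rintegral_window//.
move: (\int[mu]_l _) (\int[mu]_l _) (Ex P f) => A B C; lra.
Qed.

Lemma bmf_trunc_sq : bmf (fun w => trunc_sq (y w)).
Proof.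
split; last by exists 1 => w; rewrite ger0_norm ?trunc_sq_ge0 ?trunc_sq_le1.
by rewrite /trunc_sq; apply: measurable_minr => //; exact: measurable_funX.
Qed.

Lemma Ex_trunc_sq (e : R) : (forall w, 0 <= f w) ->
  (forall l, 0 <= l <= 1 -> Ex P (fun w => f w * (1 - cos (l * y w))) <= e) ->
  Ex P (fun w => f w * trunc_sq (y w)) <= 64 * e.
Proof.
move=> f0 H; have := @Ex_sinc_le 1 (-1) 0 e.
have E (g h : T -> R) w : f w * (1 + -1 * g w + 0 * h w) = f w * (1 - g w) by ring.
rewrite (eq_Ex _ (E _ _)) => h.
have : Ex P (fun w => f w * (1 - sinc (y w))) <= e.
  by apply: h => l l1; rewrite (eq_Ex _ (E _ _)); exact: H.
have bs : bmf (fun w => f w * (1 - sinc (y w))).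
  have [m1 m2] := bmfB bf (bmf_fsinc my).
  split; first by move: m1; apply: eq_measurable_fun => w _; ring.
  by case: m2 => M HM; exists M => w; rewrite (le_trans _ (HM w))// mulrBr mulr1.
move=> h1; apply: (@le_trans _ _ (64 * Ex P (fun w => f w * (1 - sinc (y w))))); last by lra.
rewrite -ExZ//; apply: le_Ex.
- by apply: bmfM => //; exact: bmf_trunc_sq.
- by apply: bmfM => //; exact: bmf_cst.
by move=> w; rewrite mulrCA ler_wpM2l// trunc_sq_sinc.
Qed.

End sinc.

Section comparison.
Context d (T : measurableType d) {R : realType} (P : probability T R).
Implicit Types (A : set T) (g : T -> R).

Lemma pr_le_Ex A g : measurable A -> bmf g -> (forall w, 0 <= g w) ->
  (forall w, A w -> 1 <= g w) -> pr P A <= Ex P g.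
Proof.
move=> mA bg g0 g1; rewrite -Ex_ind//; apply: le_Ex => //; first exact: bmf_ind.
move=> w; rewrite indicE; case: (boolP (w \in A)) => [/set_mem/g1//|_]; exact: g0.
Qed.

Lemma Ex_le_pr A g : measurable A -> bmf g -> (forall w, g w <= 1) ->
  (forall w, ~ A w -> g w <= 0) -> Ex P g <= pr P A.
Proof.
move=> mA bg g1 g0; rewrite -Ex_ind//; apply: le_Ex => //; first exact: bmf_ind.
move=> w; rewrite indicE; case: (boolP (w \in A)) => [_|/negP]; first exact: g1.
by move=> h; apply: g0 => Aw; apply: h; exact: mem_set.
Qed.

End comparison.

(** * Size of the walk and of its steps *)

Section walk_estimates.
Context {R : realType}.
Variable Q : probability (path R) R.
Hypothesis MP : markov_property Q.
Variable a : nat -> R.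
Hypothesis a_gt0 : forall n, (0 < n)%N -> 0 < a n.
Hypothesis CLT : forall (f : R -> R) (M : R), continuous f -> (forall x, `|f x| <= M) ->
  Ex Q (fun x => f (walk n x / a n)) @[n --> \oo] --> Ex std_normal f.
Implicit Types (e L s : R) (n k N : nat).

Let plim L e (e0 : 0 < e) := cf_uniform MP a_gt0 CLT L e0.

Lemma measurable_walk_set n (B : set R) : measurable B ->
  measurable [set x : path R | B (walk n x)].
Proof. by move=> mB; rewrite -[X in measurable X]setTI; exact: measurable_walk. Qed.

Lemma measurable_gt (u : R) : measurable [set t : R | u < t].
Proof.
rewrite [X in measurable X](_ : _ = `]u, +oo[%classic)//.
by apply/seteqP; split => x /=; rewrite in_itv/= andbT.
Qed.

Lemma measurable_le (u : R) : measurable [set t : R | t <= u].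
Proof.
by rewrite [X in measurable X](_ : _ = `]-oo, u]%classic)//; apply/seteqP; split => x /=; rewrite in_itv.
Qed.

Lemma measurable_ge (u : R) : measurable [set t : R | u <= t].
Proof.
rewrite [X in measurable X](_ : _ = `[u, +oo[%classic)//.
by apply/seteqP; split => x /=; rewrite in_itv/= andbT.
Qed.

Lemma measurable_lt (y : R) : measurable [set t : R | t < y].
Proof.
have := measurableC (measurable_ge y); congr measurable.
by apply/seteqP; split => t /=; [move/negP; rewrite -ltNge|move=> h; apply/negP; rewrite -ltNge].
Qed.

Lemma measurable_norm_ge (u : R) : measurable [set t : R | u <= `|t|].
Proof.
rewrite -[X in measurable X]setTI.
exact: (@normr_measurable R setT measurableT _ (measurable_ge u)).
Qed.

Lemma Re_cfX n s : Re (cf Q s ^+ n) = Ex Q (fun x => cos (s * walk n x)).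
Proof. by rewrite -wcf1//=; apply: eq_Ex => x; rewrite mul1r. Qed.

(** In the unit disc |1 - z^n| is at most n |1 - z|. *)
Lemma cos_walk_dist n s : Ex Q (fun x => 1 - cos (s * walk n x)) <= n%:R * normc (1 - cf Q s).
Proof.
rewrite ExB ?Ex_cst//; [|exact: bmf_cst|exact: bmf_cos_walk].
rewrite -Re_cfX; have := @normc_prod_sub1 _ (cf Q s) n _ (normc_cf_le1 _ s) (lexx _).
have -> : 1 - Re (cf Q s ^+ n) = Re (1 - cf Q s ^+ n) by rewrite ReB.
rewrite normcB [normc (_ - 1)]normcB; apply: le_trans.
exact: le_trans (ler_norm _) (normc_Re _).
Qed.

(** Uniformly in k, the k-th position is of order a_n (k/n)^(1/2): this holds
    without a second moment because 1 - cf^k is at most k times 1 - cf. *)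
Lemma cos_walk_le L : 0 <= L -> exists C N, 0 <= C /\ forall n, (N <= n)%N -> forall k s,
  0 <= s <= L -> Ex Q (fun x => 1 - cos (s / a n * walk k x)) <= C * (k%:R / n%:R).
Proof.
move=> L0; have [C [N [C0 H]]] := cf_dist1 a_gt0 (cf0 Q) (normc_cf_le1 Q)
  (@cf_uniformly_continuous _ Q) plim L0.
exists C, N.+1; split => // n Nn k s sL; apply: le_trans (cos_walk_dist _ _) _.
have n0 : (0 : R) < n%:R by rewrite ltr0n (leq_ltn_trans _ Nn).
have := H n (ltnW Nn) s sL.
by move=> h; rewrite mulrCA ler_wpM2l// ler_pdivlMr// mulrC.
Qed.

(** The truncated second moment of S_k / a_n is of order k / n, by averaging the
    cosine estimate over frequencies. *)
Lemma pr_walk_tail eta : 0 < eta -> exists C N, 0 <= C /\ forall n, (N <= n)%N -> forall k,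
  pr Q [set x | eta * a n <= `|walk k x|] <= C * (k%:R / n%:R).
Proof.
move=> eta0; have L0 : 0 <= eta^-1 by rewrite invr_ge0 ltW.
have [C [N [C0 H]]] := cos_walk_le L0; exists (64 * C), N.+1.
split; first by rewrite mulr_ge0.
move=> n Nn k; have an0 : 0 < a n by apply: a_gt0; apply: leq_ltn_trans Nn.
pose y (x : path R) := (eta * a n)^-1 * walk k x.
have my : measurable_fun [set: path R] y by apply: measurable_scaled; exact: measurable_walk.
apply: (@le_trans _ _ (Ex Q (fun x => 1 * trunc_sq (y x)))).
  apply: pr_le_Ex.
  - exact: (measurable_walk_set k (measurable_norm_ge _)).
  - by apply: bmfM; [exact: bmf_cst|exact: bmf_trunc_sq].
  - by move=> x; rewrite mul1r trunc_sq_ge0.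
  move=> x /= h; rewrite mul1r trunc_sq_ge1// /y normrM ger0_norm ?invr_ge0 ?mulr_ge0 ?(ltW eta0) ?(ltW an0)//.
  by rewrite mulrC ler_pdivlMr ?mulr_gt0// mul1r.
rewrite -mulrA; apply: Ex_trunc_sq => //; first exact: bmf_cst.
move=> l /andP[l0 l1]; apply: le_trans (H n (ltnW Nn) k (l / eta) _).
  rewrite le_eqVlt; apply/orP; left; apply/eqP; apply: eq_Ex => x.
  by rewrite mul1r /y invfM !mulrA.
by rewrite divr_ge0 ?(ltW eta0)//= ler_piMl.
Qed.

Lemma sinc_sqr_ge0 (u : R) : 0 <= 3 / 2 - 2 * sinc u + 2^-1 * sinc (2 * u).
Proof.
pose v := - (3 / 2) + 2 * sinc u + - 2^-1 * sinc (2 * u).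
have : Ex Q (fun=> 1 * v) <= 0; last by rewrite Ex_cst /v; lra.
apply: (@Ex_sinc_le _ _ _ _ _ (fun=> u) (bmf_cst 1)) => // l _.
rewrite Ex_cst mul1r mulrCA [X in _ + _ * cos X](_ : _ = (l * u) *+ 2); last by rewrite mulr_natl.
rewrite cos_mulr2n; have := sqr_ge0 (1 - cos (l * u)).
by move: (cos _) => x; rewrite -[x ^+ 2 *+ 2]mulr_natr !expr2; nra.
Qed.

(** Normality of the limit excludes a step of order a_n among the first n: the
    combination 4(1 - cos t) - (1 - cos 2t) = 2(1 - cos t)^2 is blind to the
    Gaussian part. *)
Lemma pr_big_step eta e : 0 < eta -> 0 < e -> exists N, forall n, (N <= n)%N ->
  n%:R * pr Q [set x | eta * a n <= `|x 0%N|] <= e.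
Proof.
move=> eta0 e0; have L0 : 0 <= 10 / eta by rewrite divr_ge0 ?(ltW eta0).
have e4 : 0 < e / 4 by rewrite divr_gt0.
have [N H] := Re_cf_lim a_gt0 (cf0 Q) (normc_cf_le1 Q) (@cf_uniformly_continuous _ Q) plim L0 e4.
exists N.+1 => n Nn; have an0 : 0 < a n by apply: a_gt0; apply: leq_ltn_trans Nn.
have n0 : (0 : R) < n%:R by rewrite ltr0n (leq_ltn_trans _ Nn).
pose y (x : path R) := (5 / (eta * a n)) * walk 1 x.
have my : measurable_fun [set: path R] y by apply: measurable_scaled; exact: measurable_walk.
have Hcos s : 0 <= s <= 10 / eta -> `|n%:R * (1 - Ex Q (fun x => cos (s / a n * walk 1 x))) - s ^+ 2 / 2| <= e / 4.
  by move=> sL; rewrite -Re_cfX expr1; apply: H => //; exact: ltnW.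
suff : pr Q [set x | eta * a n <= `|x 0%N|] <= e / n%:R by rewrite ler_pdivlMr// mulrC.
have by1 l : bmf (fun x => cos (l * y x)).
  by apply: bmf_cos; exact: measurable_scaled.
have bs2 : bmf (fun x => 1 * (3 / 2 + -2 * sinc (y x) + 2^-1 * sinc (2 * y x))).
  have bsi (z : path R -> R) : measurable_fun [set: path R] z -> bmf (fun x => sinc (z x)).
    move=> mz; have := @bmf_integral _ _ _ Q _ cos _ _ (integrable_window 1) (bmf_cst (2^-1 : R)) mz.
    by move=> /(_ (@continuous_cos R) norm_cos_le1).
  apply: bmfM; first exact: bmf_cst.
  apply: bmfD; last by apply: bmfM; [exact: bmf_cst|apply: bsi; exact: measurable_scaled].
  by apply: bmfD; [exact: bmf_cst|apply: bmfM; [exact: bmf_cst|exact: bsi]].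
have mE : measurable [set x : path R | eta * a n <= `|x 0%N|].
  rewrite [X in measurable X](_ : _ = [set x : path R | eta * a n <= `|walk 1 x|]).
    exact: (measurable_walk_set 1 (measurable_norm_ge _)).
  by apply/seteqP; split => x /=; rewrite walk1.
have key l : 0 <= l <= 1 -> Ex Q (fun x => 1 * (3 / 2 + -2 * cos (l * y x) + 2^-1 * cos (l * (2 * y x)))) <= e / n%:R.
  move=> /andP[l0 l1]; pose s := 5 * l / eta.
  have sE x : l * y x = s / a n * walk 1 x by rewrite /y /s; field; rewrite !gt_eqF.
  have s2E x : l * (2 * y x) = (2 * s) / a n * walk 1 x by rewrite /y /s; field; rewrite !gt_eqF.
  have b1 : bmf (fun x : path R => -2 * cos (s / a n * walk 1 x)) by apply: bmfM; [exact: bmf_cst|exact: bmf_cos_walk].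
  have b2 : bmf (fun x : path R => 2^-1 * cos (2 * s / a n * walk 1 x)) by apply: bmfM; [exact: bmf_cst|exact: bmf_cos_walk].
  under eq_Ex => x do rewrite mul1r sE s2E.
  rewrite ExD//; last by apply: bmfD => //; exact: bmf_cst.
  rewrite ExD//; last exact: bmf_cst.
  rewrite Ex_cst !ExZ; [|exact: bmf_cos_walk|exact: bmf_cos_walk].
  have s0 : 0 <= s by rewrite divr_ge0 ?mulr_ge0 ?(ltW eta0).
  have s2 : 2 * s <= 10 / eta.
    by rewrite /s !mulrA ler_wpM2r ?invr_ge0 ?(ltW eta0)//; lra.
  have h1 := Hcos s; have h2 := Hcos (2 * s).
  have := h1 (_ : is_true (0 <= s <= 10 / eta)); rewrite s0/= => /(_ ltac:(lra)).
  have := h2 (_ : is_true (0 <= 2 * s <= 10 / eta)); rewrite mulr_ge0//= => /(_ s2).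
  rewrite exprMn !ler_distl => /andP[g1 g2] /andP[g3 g4]; rewrite ler_pdivlMr//.
  move: (Ex _ _) (Ex _ _) g1 g2 g3 g4 => A B g1 g2 g3 g4.
  by move: (s ^+ 2) g1 g2 g3 g4 => S g1 g2 g3 g4; lra.
apply: le_trans _ (Ex_sinc_le (bmf_cst 1) my key).
apply: pr_le_Ex => //.
- by move=> x; rewrite mul1r; have := sinc_sqr_ge0 (y x); rewrite mulNr.
move=> x /= h; rewrite mul1r.
have := @sinc_jump R (y x); rewrite mulNr; apply.
rewrite /y walk1 normrM ger0_norm; last by rewrite divr_ge0 ?mulr_ge0 ?(ltW eta0) ?(ltW an0).
rewrite mulrAC ler_pdivlMr ?mulr_gt0//; lra.
Qed.

Lemma pr_walk_gt0 e : 0 < e -> exists N, forall n, (N <= n)%N ->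
  `|pr Q [set x | 0 < walk n x] - 2^-1| <= e.
Proof.
move=> e0; pose h := e / 2; have h0 : 0 < h by rewrite divr_gt0.
have [N1 H1] := near_ex (clt_dist CLT (@continuous_clamp R (- h) 0) (bounded_clamp _ _) h0).
have [N2 H2] := near_ex (clt_dist CLT (@continuous_clamp R 0 h) (bounded_clamp _ _) h0).
have bc (u v : R) n : bmf (fun x : path R => clamp u v (walk n x / a n)).
  split; last by exists 1 => x; exact: bounded_clamp.
  apply: measurableT_comp; first by apply: continuous_measurable_fun; exact: continuous_clamp.
  by apply: measurable_funM => //; exact: measurable_walk.
have bn (u v : R) : @bmf _ (measurableTypeR R) R (clamp u v).
  by split; [apply: continuous_measurable_fun; exact: continuous_clamp|exists 1 => x; exact: bounded_clamp].
exists (maxn N1 N2).+1 => n Nn; have an0 : 0 < a n by apply: a_gt0; apply: leq_ltn_trans Nn.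
have n1 : (N1 <= n)%N by rewrite (leq_trans _ (ltnW Nn))// leq_maxl.
have n2 : (N2 <= n)%N by rewrite (leq_trans _ (ltnW Nn))// leq_maxr.
have mE : measurable [set x : path R | 0 < walk n x] := measurable_walk_set n (measurable_gt 0).
have u1 : pr Q [set x | 0 < walk n x] <= Ex Q (fun x => clamp (- h) 0 (walk n x / a n)).
  apply: pr_le_Ex => // [x|x /= x0]; first exact: clamp_ge0.
  by rewrite clamp1 ?oppr_lt0// divr_ge0 ?ltW.
have u2 : Ex std_normal (clamp (- h) 0) <= pr std_normal [set x | - h < x].
  apply: Ex_le_pr => // [|x|x /= /negP]; first exact: measurable_gt.
    exact: clamp_le1.
  by rewrite -leNgt => xh; rewrite clamp0 ?oppr_lt0.
have l1 : Ex Q (fun x => clamp 0 h (walk n x / a n)) <= pr Q [set x | 0 < walk n x].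
  apply: Ex_le_pr => // [x|x /= /negP]; first exact: clamp_le1.
  by rewrite -leNgt => xh; rewrite clamp0// ler_pdivrMr// mul0r.
have l2 : pr std_normal [set x | h <= x] <= Ex std_normal (clamp 0 h).
  apply: pr_le_Ex => // [|x|x /= xh]; first exact: measurable_ge.
    exact: clamp_ge0.
  by rewrite clamp1.
have := std_normal_gt (ltW h0); have := std_normal_ge (ltW h0).
have := H1 n n1; have := H2 n n2; rewrite !ler_distl => /andP[a1 a2] /andP[a3 a4] b1 b2.
have hE : h * 2 = e by rewrite divfK.
by apply/andP; split; lra.
Qed.

Lemma pr_walk_very_negative : exists N, forall n, (N <= n)%N ->
  4^-1 <= pr Q [set x | walk n x <= - (a n / 16)].
Proof.
have h0 : (0 : R) < 8^-1 by rewrite invr_gt0.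
pose f (x : R) := clamp 16^-1 8^-1 (- x).
have cf' : continuous f.
  move=> x; apply: (@continuous_comp _ _ _ (fun x : R => - x)); last exact: continuous_clamp.
  by apply: cvgN; exact: cvg_id.
have [N1 H1] := near_ex (clt_dist CLT cf' (fun x => bounded_clamp _ _ _) h0).
exists N1.+1 => n Nn; have an0 : 0 < a n by apply: a_gt0; apply: leq_ltn_trans Nn.
have lt168 : (16^-1 : R) < 8^-1 by lra.
have l1 : Ex Q (fun x => f (walk n x / a n)) <= pr Q [set x | walk n x <= - (a n / 16)].
  apply: Ex_le_pr.
  - exact: (measurable_walk_set n (measurable_le _)).
  - split; last by exists 1 => x; exact: bounded_clamp.
    apply: measurableT_comp; first exact: continuous_measurable_fun.
    by apply: measurable_funM => //; exact: measurable_walk.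
  - by move=> x; exact: clamp_le1.
  move=> x /= /negP; rewrite -ltNge => xh; rewrite /f clamp0//.
  by rewrite lerNl -[- 16^-1]mul1r mulrN -mulNr ler_pdivlMr//; lra.
have mge : measurable [set x : R | 8^-1 <= x] := measurable_ge _.
have l2 : pr std_normal [set x | 8^-1 <= x] <= Ex std_normal f.
  rewrite -(std_normalN mge); apply: pr_le_Ex.
  - by rewrite -[X in measurable X]setTI; exact: (oppr_measurable measurableT).
  - by split; [exact: continuous_measurable_fun|exists 1 => x; exact: bounded_clamp].
  - by move=> x; exact: clamp_ge0.
  by move=> x /= xh; rewrite /f clamp1.
have := std_normal_ge (ltW h0); have := H1 n (ltnW Nn); rewrite ler_distl => /andP[a1 _] b1.
by lra.
Qed.

End walk_estimates.

(** * Lattice walks and Fourier inversion *)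

Section trigonometry.
Context {R : realType}.

Lemma sin_piz (z : int) : sin (pi * z%:~R) = 0 :> R.
Proof.
have nat_case n : sin (pi * n%:R) = 0 :> R.
  by rewrite mulr_natr -[pi *+ n]add0r (alternatingn (@sinDpi R)) sin0 mulr0.
case: z => n; first exact: nat_case.
by rewrite NegzE rmorphN mulrN sinN nat_case oppr0.
Qed.

Lemma cosD2piz (t : R) (z : int) : cos (t + 2 * pi * z%:~R) = cos t.
Proof.
have nat_case u n : cos (u + 2 * pi * n%:R) = cos u :> R.
  by rewrite mulr_natr mulr_natl (periodicn (@cosD2pi R)).
case: z => n; first exact: nat_case.
by rewrite NegzE rmorphN mulrN -[in RHS](subrK (2 * pi * n.+1%:R) t) nat_case.
Qed.

Lemma cos_eq1 (t : R) : cos t = 1 -> exists z : int, t = 2 * pi * z%:~R.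
Proof.
move=> ct; have p2 : (0 : R) < 2 * pi by rewrite mulr_gt0 ?pi_gt0.
pose z := Num.floor ((t + pi) / (2 * pi)); exists z.
pose u := t + 2 * pi * (- z)%:~R.
have cu : cos u = 1 by rewrite cosD2piz.
have := floor_itv ((t + pi) / (2 * pi)); rewrite -/z ler_pdivlMr// ltr_pdivrMr// intrD mulrDl mul1r.
move=> /andP[h1 h2].
have u1 : `|u| <= pi by rewrite ler_norml /u rmorphN mulrN; apply/andP; split; lra.
have : cos `|u| = cos 0.
  by rewrite cos0 -cu; case: (ger0P u) => // _; rewrite cosN.
move/(@cos_inj R); rewrite !in_itv/= normr_ge0 u1 lexx pi_ge0 => /(_ isT isT)/eqP.
rewrite normr_eq0 /u rmorphN mulrN => /eqP; lra.
Qed.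

End trigonometry.

Section lattice_walk.
Context {R : realType}.
Variable Q : probability (path R) R.
Hypothesis MP : markov_property Q.
Variable a : nat -> R.
Hypothesis a_gt0 : forall n, (0 < n)%N -> 0 < a n.
Hypothesis CLT : forall (f : R -> R) (M : R), continuous f -> (forall x, `|f x| <= M) ->
  Ex Q (fun x => f (walk n x / a n)) @[n --> \oo] --> Ex std_normal f.
Variables b c : R.
Hypothesis c_gt0 : 0 < c.
Hypothesis step_lattice : pr Q [set x | lattice b c (x 0%N)] = 1.
Hypothesis step_span : forall b' c', c < c' -> pr Q [set x | lattice b' c' (x 0%N)] <> 1.
Notation mu := (@lebesgue_measure R).
Implicit Types (e l s x : R) (n k m N j : nat) (f g : path R -> R).

Let plim L e (e0 : 0 < e) := cf_uniform MP a_gt0 CLT L e0.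

Lemma measurable_lattice (b' c' : R) : measurable (lattice b' c').
Proof.
rewrite /lattice [X in measurable X](_ : _ = \bigcup_(z : int) [set b' + c' * z%:~R]).
  by apply: countable_bigcupT_measurable.
by apply/seteqP; split => t /= [z _ E]; exists z.
Qed.

Lemma measurable_step (B : set R) : measurable B -> measurable [set x : path R | B (x 0%N)].
Proof.
move=> mB; have := measurable_walk_set 1 mB.
by congr measurable; apply/seteqP; split => x /=; rewrite walk1.
Qed.

Lemma walk_lattice n : pr Q [set x | lattice (b * n%:R) c (walk n x)] = 1.
Proof.
elim: n => [|n IH].
  rewrite (_ : [set x | _] = setT) ?prT//; apply/seteqP; split => // x _ /=.
  by rewrite walk0 mulr0; exists 0 => //; rewrite mulr0 addr0.
have mA : measurable [set x : path R | lattice b c (x 0%N)] := measurable_step (measurable_lattice b c).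
have mB : measurable [set x : path R | lattice (b * n%:R) c (walk n x)] := measurable_walk_set n (measurable_lattice _ _).
have mC : measurable [set x : path R | lattice (b * n.+1%:R) c (walk n.+1 x)] := measurable_walk_set n.+1 (measurable_lattice _ _).
apply/eqP; rewrite eq_le pr_le1//=.
have pA : past 1 [set x : path R | lattice b c (x 0%N)] by move=> x y xy /=; rewrite (xy 0%N).
have := pr_markov MP mA mB pA; rewrite step_lattice IH mul1r => E; rewrite -[X in X <= _]E.
apply: le_pr => //; first by apply: measurableI => //; exact: measurable_shiftP.
move=> x /= [[z _ xz] [y _ xy]]; exists (z + y) => //.
by rewrite -[n.+1]add1n walk_shift walk1 -xz -xy natrD rmorphD/=; ring.
Qed.

(** Modulus 1 at s would put the steps on a lattice of span 2 pi / s. *)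
Lemma cf_lt1 s : 0 < s -> s < 2 * pi / c -> normc (cf Q s) < 1.
Proof.
move=> s0 sc; rewrite lt_neqAle normc_cf_le1 andbT; apply/eqP => h1.
have [w wc ws] : exists2 w : R, cos w = Re (cf Q s) & sin w = Im (cf Q s).
  have := sqr_normc (cf Q s); rewrite h1 expr1n => E.
  have r1 : -1 <= Re (cf Q s) <= 1.
    by rewrite -ler_norml -(expr_le1 (n := 2))// real_normK ?num_real//; have := sqr_ge0 (Im (cf Q s)); lra.
  have cE : cos (acos (Re (cf Q s))) = Re (cf Q s) by rewrite acosK// in_itv.
  have sE : sin (acos (Re (cf Q s))) = `|Im (cf Q s)|.
    by rewrite sin_acos// -[in RHS]sqrtr_sqr; congr Num.sqrt; lra.
  have [i0|i0] := leP 0 (Im (cf Q s)).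
    by exists (acos (Re (cf Q s))) => //; rewrite sE ger0_norm.
  by exists (- acos (Re (cf Q s))); rewrite ?cosN// sinN sE ltr0_norm// opprK.
have by1 : bmf (fun x : path R => cos (s * walk 1 x - w)).
  by apply: bmf_cos; apply: measurable_funB => //; exact: measurable_scaled_walk.
have E1 : Ex Q (fun x : path R => 1 - cos (s * walk 1 x - w)) = 0.
  rewrite ExB//; last exact: bmf_cst.
  rewrite Ex_cst; apply/eqP; rewrite subr_eq0; apply/eqP.
  under eq_Ex => x do rewrite cosB.
  rewrite ExD; [|by apply: bmfM; [exact: bmf_cos_walk|exact: bmf_cst]|by apply: bmfM; [exact: bmf_sin_walk|exact: bmf_cst]].
  under eq_Ex => x do rewrite mulrC.
  under [X in _ = _ + X]eq_Ex => x do rewrite mulrC.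
  rewrite !ExZ; [|exact: bmf_sin_walk|exact: bmf_cos_walk].
  have -> : Ex Q (fun x : path R => cos (s * walk 1 x)) = cos w.
    by rewrite wc /cf /wcf/=; apply: eq_Ex => x; rewrite mul1r.
  have -> : Ex Q (fun x : path R => sin (s * walk 1 x)) = sin w.
    by rewrite ws /cf /wcf/=; apply: eq_Ex => x; rewrite mul1r.
  by rewrite -!expr2 cos2Dsin2.
pose F k := [set x : path R | k.+1%:R^-1 <= 1 - cos (s * walk 1 x - w)].
have mF k : measurable (F k).
  have [m1 _] := bmfB (bmf_cst 1) by1.
  by rewrite -[X in measurable X]setTI; exact: (m1 measurableT _ (measurable_ge _)).
have F0 k : pr Q (F k) = 0.
  apply/eqP; rewrite eq_le pr_ge0 andbT.
  apply: (@le_trans _ _ (Ex Q (fun x : path R => k.+1%:R * (1 - cos (s * walk 1 x - w))))).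
    apply: pr_le_Ex => //.
    - by apply: bmfM; [exact: bmf_cst|apply: bmfB => //; exact: bmf_cst].
    by move=> x /=; rewrite -ler_pdivrMl// mulr1.
  by rewrite ExZ ?E1 ?mulr0//; apply: bmfB => //; exact: bmf_cst.
have ndF : nondecreasing_seq F.
  move=> k m km; apply/subsetPset => x /=; apply: le_trans.
  by rewrite lef_pV2 ?posrE// ler_nat.
have U0 : pr Q (\bigcup_k F k) = 0.
  have := pr_cvg_bigcup (P := Q) mF ndF; under eq_fun do rewrite F0.
  by move=> /cvg_lim <- //; rewrite lim_cst.
have mU : measurable (\bigcup_k F k) by exact: bigcupT_measurable.
apply: (@step_span (w / s) (2 * pi / s)).
  by rewrite ltr_pdivlMr// mulrC -ltr_pdivlMr.
have mL := measurable_step (measurable_lattice (w / s) (2 * pi / s)).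
apply/eqP; rewrite eq_le pr_le1//=.
have := prC Q mU; rewrite U0 subr0 => E; rewrite -[X in X <= _]E; apply: le_pr => //; first exact: measurableC.
move=> x /= nU; have : cos (s * walk 1 x - w) = 1.
  apply/eqP; rewrite eq_le cos_le1/=; rewrite leNgt; apply/negP => c1; apply: nU.
  have d0 : 0 < 1 - cos (s * walk 1 x - w) by rewrite subr_gt0.
  exists (Num.truncn (1 - cos (s * walk 1 x - w))^-1) => //=.
  rewrite /F/= -[leRHS]invrK lef_pV2 ?posrE ?invr_gt0//.
  exact/ltW/truncnS_gt.
move/cos_eq1 => [z zE]; exists z => //.
rewrite -(walk1 x) (_ : walk 1 x = (w + 2 * pi * z%:~R) / s).
  by rewrite [RHS]mulrDl; congr (_ + _); rewrite mulrAC.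
by rewrite -zE addrC subrK mulrC mulKf// gt_eqF.
Qed.

Lemma cfN_normc s : normc (cf Q (- s)) = normc (cf Q s).
Proof.
apply/eqP; rewrite -(@eqrXn2 _ 2)// ?normc_ge0//; apply/eqP.
rewrite !sqr_normc /cf /wcf/=; congr (_ + _).
  by congr (_ ^+ 2); apply: eq_Ex => x; rewrite mulNr cosN.
have -> : Ex Q (fun x : path R => 1 * sin (- s * walk 1 x)) = - Ex Q (fun x : path R => 1 * sin (s * walk 1 x)).
  rewrite -ExN; last by apply: bmfM; [exact: bmf_cst|exact: bmf_sin_walk].
  by apply: eq_Ex => x; rewrite mulNr sinN mulrN.
by rewrite sqrrN.
Qed.

(** In each step cf loses a factor exp(-r |l| / n) at frequency l / a_n, on the
    whole dual cell of the lattice. *)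
Lemma cf_domination : exists (r : R) N, 0 < r /\ forall n, (N <= n)%N -> forall l,
  1 <= `|l| -> `|l| <= pi * a n / c -> normc (cf Q (l / a n)) <= expR (- (r * `|l| / n%:R)).
Proof.
have [s0 [r1 [N1 [s00 r10 H1]]]] := cf_small_domination a_gt0 (normc_cf_le1 Q) plim.
have [K HK] := norming_growth a_gt0 plim.
have pc0 : 0 < pi / c by rewrite divr_gt0 ?pi_gt0.
pose s1 := Num.min s0 (pi / c).
have s1c : s1 <= pi / c by rewrite ge_min lexx orbT.
have s10 : 0 < s1 by rewrite lt_min s00.
have cn : {within `[s1, pi / c], continuous (fun s => normc (cf Q s))}.
  apply: continuous_subspaceT => s; apply/cvgrPdist_le => e e0.
  have [h h0 Hh] := cf_uniformly_continuous Q e0.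
  rewrite near_simpl; apply/nbhs_ballP; exists h => // z sz.
  by apply: le_trans (ler_dist_normc (cf Q s) (cf Q z)) _; apply: Hh; exact: ltW.
have [t tI tM] := EVT_max s1c cn.
pose rho := Num.max 2^-1 (normc (cf Q t)).
have rho0 : 0 < rho by rewrite lt_max invr_gt0 ltr0n.
have rho1 : rho < 1.
  rewrite gt_max; apply/andP; split; first lra.
  move: tI; rewrite in_itv/= => /andP[t1 t2]; apply: cf_lt1; first exact: lt_le_trans t1.
  by apply: le_lt_trans t2 _; rewrite -mulrA ltr_pMl// ltr1n.
have lr0 : 0 < - ln rho by rewrite oppr_gt0 ln_lt0// rho0.
pose K1 := K.+1; have aK0 : 0 < a K1 by apply: a_gt0.
pose M := 2 * a K1 * pi / c.
have M0 : 0 < M by rewrite divr_gt0// !mulr_gt0// pi_gt0.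
pose r := Num.min r1 (- ln rho / M).
have r0 : 0 < r by rewrite lt_min r10 divr_gt0.
exists r, (maxn N1 K1); split => // n; rewrite geq_max => /andP[n1 nK] l l1 lp.
have n0 : (0 < n)%N by apply: leq_trans nK.
have an0 := a_gt0 n0; have nR : (0 : R) < n%:R by rewrite ltr0n.
have -> : normc (cf Q (l / a n)) = normc (cf Q (`|l| / a n)).
  by case: (ger0P l) => // _; rewrite mulNr cfN_normc.
move: (`|l|) l1 lp => {}l l1 lp; have l0 : 0 < l by lra.
set s := l / a n.
have s0' : 0 < s by rewrite divr_gt0.
have sa : s * a n = l by rewrite divfK// gt_eqF.
have sp : s <= pi / c by rewrite ler_pdivrMr// mulrAC.
rewrite -(ler_pXn2r n0) ?nnegrE ?expR_ge0 ?normc_ge0//.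
rewrite -expRM_natl (_ : n%:R * - (r * l / n%:R) = - (r * l)); last by field; rewrite gt_eqF.
have [ss|ss] := leP s s1.
  apply: le_trans (H1 n n1 s _ _) _; rewrite ?s0' ?sa//=.
    by rewrite (le_trans ss)// ge_min lexx.
  by rewrite ler_expR lerN2 ler_wpM2r ?(ltW l0)// ge_min lexx.
have : normc (cf Q s) <= rho.
  by rewrite le_max; apply/orP; right; apply: tM; rewrite in_itv/= (ltW ss).
move=> h; apply: (@le_trans _ _ (rho ^+ n)).
  by apply: lerXn2r; rewrite ?nnegrE ?normc_ge0// ltW.
rewrite -{1}(lnK (_ : rho \is Num.pos)) ?posrE// -expRM_natl ler_expR.
rewrite -[X in X <= _]opprK -mulrN lerN2.
apply: (@le_trans _ _ (- ln rho / M * l)); first by rewrite ler_wpM2r ?(ltW l0)// ge_min lexx orbT.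
rewrite -mulrA [n%:R * _]mulrC ler_pM2l// mulrC ler_pdivrMr//.
have aK : a n <= 2 * n%:R * a K1.
  have := HK K1 n (leqnSn K) nK; apply: le_trans; rewrite ler_peMl ?(ltW an0)// ler1n//.
apply: (le_trans lp); rewrite /M.
rewrite ler_pdivrMr// (_ : _ * c = pi * (2 * n%:R * a K1)); last by field; rewrite gt_eqF.
by rewrite ler_pM2l ?pi_gt0.
Qed.

Definition at_point n x : path R -> R := \1_[set w | walk n w = x].

Lemma measurable_at_point n x : measurable [set w : path R | walk n w = x].
Proof. exact: (measurable_walk_set n (measurable_set1 x)). Qed.

Lemma bmf_at_point n x : bmf (at_point n x).
Proof. by apply: bmf_ind; exact: measurable_at_point. Qed.

(** Fourier inversion: off the point x the cosine integrates to 0 over a period. *)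
Lemma at_pointE n x w (A : R) : 0 < A -> lattice (b * n%:R) c x ->
  lattice (b * n%:R) c (walk n w) ->
  at_point n x w = c / (2 * pi * A) *
    \int[mu]_l (window (pi * A / c) l * cos (l * ((walk n w - x) / A))).
Proof.
move=> A0 [z _ <-] [y _ Ew]; rewrite /at_point indicE.
have p0 := @pi_gt0 R; have L0 : 0 < pi * A / c by rewrite divr_gt0// mulr_gt0.
have wx : walk n w - (b * n%:R + c * z%:~R) = c * (y - z)%:~R.
  by rewrite -Ew rmorphB/=; ring.
have [yz|yz] := eqVneq y z.
  rewrite mem_set/=; last by rewrite -Ew yz.
  rewrite wx yz subrr mulr0 mul0r.
  under eq_Rintegral do rewrite mulr0 cos0 mulr1.
  rewrite Rintegral_window ?(ltW L0)//; move: (@pi R) p0 => p p0; field.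
  by rewrite (gt_eqF p0) (gt_eqF A0) (gt_eqF c_gt0).
rewrite memNset/=; last first.
  move=> h; move: wx; rewrite h subrr => /esym/eqP; rewrite mulf_eq0 (gt_eqF c_gt0)/= intr_eq0.
  by rewrite subr_eq0 (negbTE yz).
have u0 : (walk n w - (b * n%:R + c * z%:~R)) / A != 0.
  rewrite wx; apply: mulf_neq0; first apply: mulf_neq0.
  - by rewrite (gt_eqF c_gt0).
  - by rewrite intr_eq0 subr_eq0.
  by rewrite invr_eq0 (gt_eqF A0).
rewrite window_cos// wx [pi * A / c * _](_ : _ = pi * (y - z)%:~R); last first.
  by move: (@pi R) => p; field; rewrite (gt_eqF A0) (gt_eqF c_gt0).
by rewrite sin_piz mulr0 mul0r mulr0.
Qed.

Lemma Ex_lattice n f g : bmf f -> bmf g ->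
  (forall w, lattice (b * n%:R) c (walk n w) -> f w = g w) -> Ex Q f = Ex Q g.
Proof.
move=> bf bg fg; have mL := measurable_walk_set n (measurable_lattice (b * n%:R) c).
apply/eqP; rewrite -subr_eq0 -ExB// -normr_le0.
have bd := bmfB bf bg; have [_ [M HM]] := bd.
apply: (@le_trans _ _ (Ex Q (fun w => M * \1_(~` [set w | lattice (b * n%:R) c (walk n w)]) w))).
  apply: norm_Ex_le => //; first by apply: bmfM; [exact: bmf_cst|apply: bmf_ind; exact: measurableC].
  move=> w; rewrite indicE; case: (boolP (w \in _)) => [_|]; first by rewrite mulr1.
  rewrite notin_setE/= => /contrapT/fg ->; rewrite subrr normr0 mulr0 lexx//.
rewrite ExZ; last by apply: bmf_ind; exact: measurableC.
by rewrite Ex_ind ?prC ?walk_lattice ?subrr ?mulr0//; exact: measurableC.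
Qed.

Lemma measurable_walk_centred n x (A : R) : measurable_fun [set: path R] (fun w => (walk n w - x) / A).
Proof.
apply: measurable_funM => //; apply: measurable_funB => //; exact: measurable_walk.
Qed.

Lemma point_inversion n x f (A : R) : 0 < A -> lattice (b * n%:R) c x -> bmf f ->
  A / c * Ex Q (fun w => f w * at_point n x w) =
  (2 * pi)^-1 * \int[mu]_l (window (pi * A / c) l * Ex Q (fun w => f w * cos (l * ((walk n w - x) / A)))).
Proof.
move=> A0 xL bf; have iw := integrable_window (pi * A / c).
have my := measurable_walk_centred n x A.
have bI := bmf_integral Q iw bf my (@continuous_cos R) norm_cos_le1.
rewrite -(Ex_integral Q iw bf my (@continuous_cos R) norm_cos_le1).
rewrite (@Ex_lattice n _ (fun w => c / (2 * pi * A) * (f w * \int[mu]_l (window (pi * A / c) l * cos (l * ((walk n w - x) / A)))))).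
- rewrite ExZ// !mulrA; congr (_ * _).
  by have := pi_gt0 R; move: (@pi R) => p p0; field; rewrite (gt_eqF p0) (gt_eqF A0) (gt_eqF c_gt0).
- by apply: bmfM => //; exact: bmf_at_point.
- by apply: bmfM => //; exact: bmf_cst.
by move=> w wL; rewrite (at_pointE A0 xL wL) mulrCA.
Qed.

Lemma Ex_cos_centred n x f (A l : R) : bmf f ->
  Ex Q (fun w => f w * cos (l * ((walk n w - x) / A))) =
  Re (wcf Q f n (l / A) * (cos (l * x / A) -i* sin (l * x / A))%C).
Proof.
move=> bf; rewrite /wcf/=.
rewrite mulrN opprK.
rewrite ![Ex _ _ * _]mulrC -!ExZ; [|by apply: bmfM => //; exact: bmf_sin_walk|by apply: bmfM => //; exact: bmf_cos_walk].
rewrite -ExD; [|by apply: bmfM; [exact: bmf_cst|apply: bmfM => //; exact: bmf_cos_walk]|by apply: bmfM; [exact: bmf_cst|apply: bmfM => //; exact: bmf_sin_walk]].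
apply: eq_Ex => w.
have -> : l * ((walk n w - x) / A) = l / A * walk n w - l * x / A by ring.
by rewrite cosB; ring.
Qed.

Lemma normc_cis (t : R) : normc (cos t -i* sin t)%C = 1.
Proof. by apply/eqP; rewrite -(@eqrXn2 _ 2)// ?normc_ge0// sqr_normc/= sqrrN cos2Dsin2 expr1n. Qed.

Lemma norm_Ex_cos_le n x f (A l : R) : bmf f ->
  `|Ex Q (fun w => f w * cos (l * ((walk n w - x) / A)))| <= normc (wcf Q f n (l / A)).
Proof.
move=> bf; rewrite Ex_cos_centred//; apply: le_trans (normc_Re _) _.
by rewrite normcM normc_cis mulr1.
Qed.

End lattice_walk.

(** * Local limit theorem *)

Section integrable_tails.
Context {R : realType}.
Notation mu := (@lebesgue_measure R).

Lemma integrable_expN_norm (r : R) : 0 < r ->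
  mu.-integrable [set: R] (EFin \o (fun l : R => expR (- (r * `|l|)))).
Proof.
move=> r0.
have ce : continuous (fun l : R => expR (- (r * `|l|))).
  move=> l; apply: (@continuous_comp _ _ _ (fun l : R => - (r * `|l|))); last exact: continuous_expR.
  by apply: cvgN; apply: cvgMl_tmp; exact: norm_continuous.
have me : measurable_fun [set: R] (EFin \o (fun l : R => expR (- (r * `|l|)))).
  by apply/measurable_EFinP; exact: continuous_measurable_fun.
apply/integrableP; split => //.
under eq_integral => l _ do rewrite /= ger0_norm ?expR_ge0//.
rewrite ge0_symfun_integralT//; last by move=> l /=; rewrite normrN.
have mD : measurable [set x : R | (0 <= x)%R] := measurable_ge 0.
rewrite lte_mul_pinfty//.
apply: (@le_lt_trans _ _ (\int[mu]_(x in [set x | (0 <= x)%R]) ((r^-1)%:E * (exponential_pdf r x)%:E))%E).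
  apply: ge0_le_integral => //.
  - exact: measurable_funS me.
  - apply/measurable_EFinP; apply: measurable_funM => //.
    by apply: measurable_funS (measurable_exponential_pdf _) => //; exact: ltW.
  move=> x /= x0; rewrite -EFinM lee_fin exponential_pdfE// ger0_norm//.
  by rewrite mulrA mulVf ?gt_eqF// mul1r mulNr.
have ip := integrable_exponential_pdf r0.
have : mu.-integrable [set x : R | (0 <= x)%R] (EFin \o exponential_pdf r).
  by apply: (integrableS _ _ _ ip) => //; exact: mD.
have mD' : measurable ([set x | (0 <= x)%R] : set (measurableTypeR R)) := mD.
move=> /(integrableZl mD' r^-1)/integrableP[_].
apply: le_lt_trans; apply: ge0_le_integral => //.
- by move=> x _; rewrite -EFinM lee_fin mulr_ge0 ?invr_ge0 ?(ltW r0)// exponential_pdf_ge0// ltW.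
- apply/measurable_EFinP; apply: measurable_funM => //.
  by apply: measurable_funS (measurable_exponential_pdf _) => //; exact: ltW.
- apply: measurableT_comp => //; apply/measurable_EFinP; apply: measurable_funM => //.
  by apply: measurable_funS (measurable_exponential_pdf _) => //; exact: ltW.
by move=> x _; rewrite -EFinM lee_fin ler_norm.
Qed.

Lemma integrable_tail (G : R -> R) (e : R) : mu.-integrable [set: R] (EFin \o G) ->
  (forall l, 0 <= G l) -> 0 < e ->
  exists n : nat, \int[mu]_l ((1 - window n%:R l) * G l) <= e.
Proof.
move=> iG G0 e0; have mG : measurable_fun [set: R] G by apply/measurable_EFinP; case/integrableP: iG.
pose fn (n : nat) l := ((1 - window n%:R l) * G l)%:E.
have c1 : ((\int[mu]_l fn n l) @[n --> \oo] --> \int[mu]_l (cst 0%E l))%E.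
  apply: (@dominated_cvg _ _ _ mu setT measurableT fn (cst 0%E) (EFin \o G)) => //.
  - move=> n; apply/measurable_EFinP; apply: measurable_funM => //.
    by apply: measurable_funB => //; exact: measurable_indic.
  - move=> l _; apply: cvg_EFin; first by near=> n.
    apply: cvg_near_cst; near=> n; rewrite /fn /= windowE.
    have -> : (`|l| <= n%:R)%R by near: n; exact: nbhs_infty_ger.
    by rewrite subrr mul0r.
  - move=> n l _; rewrite /fn/= lee_fin normrM (ger0_norm (G0 l)) ler_piMl//.
    by have /andP[w0 w1] := window01 n%:R l; rewrite ger0_norm; lra.
move: c1; rewrite integral0 => /fine_cvg c1.
have /cvgrPdist_le /(_ _ e0) [n _ /(_ n (leqnn n))] := c1.
by rewrite sub0r normrN => h; exists n; apply: le_trans (ler_norm _) h.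
Unshelve. all: by end_near. Qed.

End integrable_tails.

Section local_limit.
Context {R : realType}.
Variable Q : probability (path R) R.
Hypothesis MP : markov_property Q.
Variable a : nat -> R.
Hypothesis a_gt0 : forall n, (0 < n)%N -> 0 < a n.
Hypothesis CLT : forall (f : R -> R) (M : R), continuous f -> (forall x, `|f x| <= M) ->
  Ex Q (fun x => f (walk n x / a n)) @[n --> \oo] --> Ex std_normal f.
Variables b c : R.
Hypothesis c_gt0 : 0 < c.
Hypothesis step_lattice : pr Q [set x | lattice b c (x 0%N)] = 1.
Hypothesis step_span : forall b' c', c < c' -> pr Q [set x | lattice b' c' (x 0%N)] <> 1.
Notation mu := (@lebesgue_measure R).
Implicit Types (e l s x : R) (n k m N j : nat) (f g : path R -> R).

Let plim L e (e0 : 0 < e) := cf_uniform MP a_gt0 CLT L e0.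

(** A block of m steps with m comparable to N gives an exponential decay in the
    frequency, integrable uniformly in N. *)
Lemma cf_power_domination : exists (r : R) N0, 0 < r /\ forall i N m, (N0 <= N)%N ->
  (N <= 2 ^ i * m)%N -> forall l, 1 <= `|l| -> `|l| <= pi * a N / c ->
  normc (cf Q (l / a N)) ^+ m <= expR (- (r / 2 ^+ i * `|l|)).
Proof.
have [r [N0 [r0 H]]] := cf_domination MP a_gt0 CLT c_gt0 step_span.
exists r, N0.+1; split => // i N m NN Nm l l1 lp.
have N0' : (0 < N)%N by apply: leq_ltn_trans NN.
have NR : (0 : R) < N%:R by rewrite ltr0n.
apply: (@le_trans _ _ (expR (- (r * `|l| / N%:R)) ^+ m)).
  by apply: lerXn2r; rewrite ?nnegrE ?expR_ge0 ?normc_ge0// H// ltnW.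
rewrite -expRM_natl ler_expR mulrN lerN2.
have mN : (2 ^+ i)^-1 <= m%:R / N%:R :> R.
  rewrite ler_pdivlMr// mulrC ler_pdivrMr ?exprn_gt0//.
  by rewrite -natrX -natrM ler_nat mulnC.
have -> : m%:R * (r * `|l| / N%:R) = m%:R / N%:R * (r * `|l|) by ring.
have -> : r / 2 ^+ i * `|l| = (2 ^+ i)^-1 * (r * `|l|) by ring.
by rewrite ler_wpM2r// mulr_ge0 ?ltW//; lra.
Qed.

(** The local limit theorem after an arbitrary event of the past: only the last
    m steps are smoothed, and the error is proportional to the weight of the past. *)
Lemma local_limit i e : 0 < e -> exists N0, forall N m, (N0 <= N)%N -> (m <= N)%N ->
  (N <= 2 ^ i * m)%N -> forall j f x, bmf f -> (forall w, 0 <= f w) -> depends j f ->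
  lattice (b * (j + m)%:R) c x ->
  `|a N / c * Ex Q (fun w => f w * at_point (j + m) x w) -
    (2 * pi)^-1 * \int[mu]_l (gaussian (m%:R / N%:R) l *
       Ex Q (fun w => f w * cos (l * ((walk j w - x) / a N))))| <= e * Ex Q f.
Proof.
move=> e0; have [r [N1 [r0 H1]]] := cf_power_domination.
pose r' := r / 2 ^+ i; have r'0 : 0 < r' by rewrite divr_gt0// exprn_gt0.
have t0 : (0 : R) < (2 ^+ i)^-1 by rewrite invr_gt0 exprn_gt0.
pose G (l : R) := expR (- (r' * `|l|)) + gaussian (2 ^+ i)^-1 l.
have iG : mu.-integrable [set: R] (EFin \o G).
  have := integrableD measurableT (integrable_expN_norm r'0) (integrable_gaussian t0).
  by apply: eq_integrable.
have G0 l : 0 <= G l by rewrite addr_ge0 ?expR_ge0// gaussian_ge0.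
have e2 : 0 < e / 2 by rewrite divr_gt0.
have [n0 Hn] := integrable_tail iG G0 e2.
pose L : R := n0.+1%:R; have L0 : 0 <= L by rewrite /L.
have HL : \int[mu]_l ((1 - window L l) * G l) <= e / 2.
  apply: le_trans Hn; apply: le_Rintegral => //.
  - apply: (integrable_le _ iG).
      apply: measurable_funM; first by apply: measurable_funB => //; exact: measurable_indic.
      by apply/measurable_EFinP; case/integrableP: iG.
    by move=> l; rewrite normrM (ger0_norm (G0 l)) ler_piMl//; have /andP[w0 w1] := window01 L l; rewrite ger0_norm; lra.
  - apply: (integrable_le _ iG).
      apply: measurable_funM; first by apply: measurable_funB => //; exact: measurable_indic.
      by apply/measurable_EFinP; case/integrableP: iG.
    by move=> l; rewrite normrM (ger0_norm (G0 l)) ler_piMl//; have /andP[w0 w1] := window01 n0%:R l; rewrite ger0_norm; lra.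
  move=> l _; rewrite ler_wpM2r// lerD2l lerN2 !windowE ler_nat.
  case: (boolP (`|l| <= n0%:R)%R) => // h.
  by rewrite (le_trans h)// /L ler_nat.
pose e1 := e / (4 * L).
have Lp : 0 < L by rewrite ltr0n.
have e10 : 0 < e1 by rewrite divr_gt0// mulr_gt0.
have [N2 H2] := cf_power a_gt0 (cf0 Q) (normc_cf_le1 Q) (@cf_uniformly_continuous _ Q) plim L0 e10.
have [N3 H3] := norming_pinfty a_gt0 plim (L * c / pi).
exists (maxn N1 (maxn N2 N3)).+1 => N m NN mN Nm j f x bf f0 df xL.
have N0' : (0 < N)%N by apply: leq_ltn_trans NN.
have n1 : (N1 <= N)%N by apply: leq_trans (ltnW NN); rewrite leq_maxl.
have n2 : (N2 <= N)%N by apply: leq_trans (ltnW NN); rewrite !leq_max leqnn orbT.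
have n3 : (N3 <= N)%N by apply: leq_trans (ltnW NN); rewrite !leq_max leqnn !orbT.
have aN0 := a_gt0 N0'; have NR : (0 : R) < N%:R by rewrite ltr0n.
have aL : L <= pi * a N / c.
  rewrite ler_pdivlMr// [pi * _]mulrC.
  by have := H3 N n3; rewrite ler_pdivrMr ?pi_gt0.
pose W := pi * a N / c.
rewrite (point_inversion MP c_gt0 step_lattice aN0 xL bf) -mulrBr normrM.
have m0 : (0 < m)%N by case: m Nm {mN xL} => //; rewrite muln0 leqn0 => /eqP N00; rewrite N00 in N0'.
have mR : (0 : R) < m%:R / N%:R by rewrite divr_gt0// ltr0n.
have iW := integrable_window W; have ig := integrable_gaussian mR.
have i1 := integrable_Ex Q iW bf (measurable_walk_centred (j + m) x (a N)) (@continuous_cos R) norm_cos_le1.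
have i2 := integrable_Ex Q ig bf (measurable_walk_centred j x (a N)) (@continuous_cos R) norm_cos_le1.
have i3 : mu.-integrable [set: R] (EFin \o (fun l => window W l * Ex Q (fun w => f w * cos (l * ((walk (j + m) w - x) / a N))) - gaussian (m%:R / N%:R) l *
       Ex Q (fun w => f w * cos (l * ((walk j w - x) / a N))))).
  by have := integrableB measurableT i1 i2; apply: eq_integrable.
rewrite -RintegralB//.
have F0 : 0 <= Ex Q f by apply: Ex_ge0.
have mt : measurable_fun [set: R] (fun l => (1 - window L l) * G l).
  apply: measurable_funM; first by apply: measurable_funB => //; exact: measurable_indic.
  by apply/measurable_EFinP; case/integrableP: iG.
have it : mu.-integrable [set: R] (EFin \o (fun l => (1 - window L l) * G l)).
  apply: (integrable_le mt iG) => l.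
  by rewrite normrM (ger0_norm (G0 l)) ler_piMl//; have /andP[w0 w1] := window01 L l; rewrite ger0_norm; clear -w0 w1 MP a_gt0 CLT c_gt0 step_lattice step_span plim; lra.
have ie : mu.-integrable [set: R] (EFin \o (fun l => e1 * window L l)).
  by have := integrableZl measurableT e1 (integrable_window L); apply: eq_integrable.
have ib : mu.-integrable [set: R] (EFin \o (fun l => e1 * window L l + (1 - window L l) * G l)).
  by have := integrableD measurableT ie it; apply: eq_integrable.
have iB : mu.-integrable [set: R] (EFin \o (fun l => Ex Q f * (e1 * window L l + (1 - window L l) * G l))).
  by have := integrableZl measurableT (Ex Q f) ib; apply: eq_integrable.
have key : \int[mu]_l (Ex Q f * (e1 * window L l + (1 - window L l) * G l)) <= Ex Q f * e.
  rewrite RintegralZl// ler_wpM2l// RintegralD// RintegralZl//; last exact: integrable_window.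
  rewrite Rintegral_window//.
  have -> : e1 * (2 * L) = e / 2 by rewrite /e1; field; rewrite gt_eqF.
  by clear -HL MP a_gt0 CLT c_gt0 step_lattice step_span plim; lra.
have p1 : `|(2 * pi)^-1| <= 1 :> R.
  rewrite ger0_norm ?invr_ge0 ?mulr_ge0 ?pi_ge0// invf_le1 ?mulr_gt0 ?pi_gt0//.
  by have := pi_ge2 R; clear -MP a_gt0 CLT c_gt0 step_lattice step_span plim; lra.
apply: le_trans (ler_piMl (normr_ge0 _) p1) _.
apply: (le_trans (le_normr_Rintegral measurableT i3)).
rewrite [leRHS]mulrC; apply: le_trans key; apply: le_Rintegral => //.
  by have := integrable_abse i3; apply: eq_integrable.
move=> l _.
have even_cos k : Ex Q (fun w => f w * cos (l * ((walk k w - x) / a N))) =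
    Ex Q (fun w => f w * cos (`|l| * ((walk k w - x) / a N))).
  by apply: eq_Ex => w; case: (ger0P l) => // _; rewrite mulNr cosN.
have -> : gaussian (m%:R / N%:R) l = gaussian (m%:R / N%:R) `|l|.
  by case: (ger0P l) => // _; rewrite gaussianN.
rewrite !even_cos !windowE /G.
have -> : gaussian (2 ^+ i)^-1 l = gaussian (2 ^+ i)^-1 `|l|.
  by case: (ger0P l) => // _; rewrite gaussianN.
have l0 := normr_ge0 l; move: `|l| l0 => {}l l0 {even_cos}.
have [lL|lL] := leP l L.
  rewrite (le_trans lL aL) mul1r subrr mul0r addr0 mulr1.
  rewrite !Ex_cos_centred// wcfM//.
  set z := wcf Q f j _; set u := (_ -i* _)%C; set h := cf Q _ ^+ m.
  have -> : Re (z * h * u) - gaussian (m%:R / N%:R) l * Re (z * u) = Re (z * (h - (gaussian (m%:R / N%:R) l)%:C%C) * u).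
    by case: z => z1 z2; case: h => h1 h2; rewrite /u/=; ring.
  apply: le_trans (normc_Re _) _; rewrite !normcM normc_cis mulr1.
  apply: ler_pM; rewrite ?normc_ge0//; first exact: normc_wcf_ge0.
  have := H2 N n2 m l mN; rewrite l0 lL => /(_ isT); rewrite /gaussian.
  by rewrite [l ^+ 2 * _]mulrC.
rewrite mulr0 add0r subr0 mul1r.
apply: le_trans (ler_normB _ _) _; rewrite mulrDr lerD//.
  have [lW|lW] := leP l W; last by rewrite mul0r normr0 mulr_ge0// expR_ge0.
  rewrite mul1r; apply: le_trans (norm_Ex_cos_le _ _ _ _ _ bf) _.
  rewrite wcfM// normcM normcX; apply: ler_pM; rewrite ?exprn_ge0 ?normc_ge0//.
    exact: normc_wcf_ge0.
  have l1 : 1 <= l by apply: le_trans (ltW lL); rewrite ler1n.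
  have := H1 i N m n1 Nm l; rewrite ger0_norm//; apply => //.
rewrite normrM (ger0_norm (gaussian_ge0 _ _)) mulrC; apply: ler_pM; rewrite ?gaussian_ge0//.
  by apply: le_trans (norm_Ex_cos_le _ _ _ _ _ bf) _; exact: normc_wcf_ge0.
rewrite ler_expR lerN2 ler_wpM2r// ler_wpM2r ?sqr_ge0//.
rewrite ler_pdivlMr// mulrC ler_pdivrMr ?exprn_gt0//.
by rewrite -natrX -natrM ler_nat mulnC.
Qed.

(** A block of independent steps smooths the position, whatever happens before
    and after it. *)
Lemma local_bound i : exists (C : R) N0, 0 <= C /\ forall N k, (N0 <= N)%N ->
  (N <= 2 ^ i * k)%N -> forall n m f g x, bmf f -> bmf g ->
  (forall w, 0 <= f w) -> (forall w, 0 <= g w) -> depends n f ->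
  lattice (b * (n + k + m)%:R) c x ->
  a N / c * Ex Q (fun w => f w * g (shift (n + k) w) * at_point (n + k + m) x w) <=
  C * (Ex Q f * Ex Q g).
Proof.
have [r [N1 [r0 H1]]] := cf_power_domination.
pose r' := r / 2 ^+ i; have r'0 : 0 < r' by rewrite divr_gt0// exprn_gt0.
have iw1 := @integrable_window R 1; have ie := integrable_expN_norm r'0.
have iD : mu.-integrable [set: R] (EFin \o (fun l : R => window 1 l + expR (- (r' * `|l|)))).
  by have := integrableD measurableT iw1 ie; apply: eq_integrable.
pose C := \int[mu]_l (window 1 l + expR (- (r' * `|l|))).
have C0 : 0 <= C.
  by apply: Rintegral_ge0 => l _; have /andP[w0 _] := window01 1 l; rewrite addr_ge0 ?expR_ge0.
exists C, N1.+1; split => // N k NN Nk n m f g x bf bg f0 g0 df xL.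
have N0' : (0 < N)%N by apply: leq_ltn_trans NN.
have aN0 := a_gt0 N0'; pose W := pi * a N / c.
have bh : bmf (fun w => f w * g (shift (n + k) w)) by apply: bmfM => //; exact: (bmf_shift (n + k) bg).
rewrite (point_inversion MP c_gt0 step_lattice aN0 xL bh).
have i1 := integrable_Ex Q (integrable_window W) bh (measurable_walk_centred (n + k + m) x (a N)) (@continuous_cos R) norm_cos_le1.
have F0 : 0 <= Ex Q f * Ex Q g by rewrite mulr_ge0// Ex_ge0.
have i2 : mu.-integrable [set: R] (EFin \o (fun l => (Ex Q f * Ex Q g) * (window 1 l + expR (- (r' * `|l|))))).
  by have := integrableZl measurableT (Ex Q f * Ex Q g) iD; apply: eq_integrable.
have p1 : (2 * pi)^-1 <= 1 :> R.
  by rewrite invf_le1 ?mulr_gt0 ?pi_gt0//; have := pi_ge2 R; lra.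
have p0 : 0 <= (2 * pi)^-1 :> R by rewrite invr_ge0 mulr_ge0 ?pi_ge0.
apply: (@le_trans _ _ ((2 * pi)^-1 * ((Ex Q f * Ex Q g) * C))); last first.
  by rewrite [C * _]mulrC ler_piMl// mulr_ge0.
rewrite ler_wpM2l// /C -RintegralZl//; apply: le_Rintegral => // l _.
rewrite !windowE; have [lW|lW] := leP `|l| W; last first.
  by rewrite mul0r mulr_ge0// addr_ge0// expR_ge0.
rewrite mul1r; apply: le_trans (ler_norm _) _; apply: le_trans (norm_Ex_cos_le _ _ _ _ _ bh) _.
have df' : depends (n + k) f by move=> u v uv; apply: df => j jn; apply: uv; rewrite (leq_trans jn)// leq_addr.
rewrite wcf_concat// wcfM// !normcM normcX mulrAC.
apply: ler_pM; rewrite ?mulr_ge0 ?exprn_ge0 ?normc_ge0//.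
  by apply: ler_pM; rewrite ?normc_ge0//; exact: normc_wcf_ge0.
have [l1|l1] := leP `|l| 1.
  rewrite -[leLHS]addr0 lerD ?expR_ge0// exprn_ile1 ?normc_ge0// normc_cf_le1//.
by rewrite add0r; apply: H1 => //; [exact: ltnW|exact: ltW].
Qed.

End local_limit.

(** * Exchangeability and Spitzer's identity *)

Section exchangeability.
Context {R : realType}.
Variable Q : probability (path R) R.
Hypothesis MP : markov_property Q.
Implicit Types (n k m j : nat) (f g : path R -> R).

Definition rearrange (s : nat -> nat) (x : path R) : path R := fun i => x (s i).

Lemma measurable_rearrange s : measurable_fun [set: path R] (rearrange s).
Proof. by apply: measurable_to_path => i; exact: measurable_coord. Qed.

Lemma pr_cylinder n (A : nat -> set R) : (forall i, measurable (A i)) ->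
  pr Q [set x | forall i, (i < n)%N -> A i (x i)] =
  \prod_(i < n) pr Q [set x | A i (x 0%N)].
Proof.
elim: n A => [|n IH] A mA.
  by rewrite big_ord0 (_ : [set x | _] = setT) ?prT//; apply/seteqP; split.
rewrite big_ord_recl/= -(IH (fun i => A i.+1))//.
rewrite -(@pr_markov _ _ MP 1 [set x | A 0%N (x 0%N)] [set x | forall i, (i < n)%N -> A i.+1 (x i)]).
- congr pr; apply/seteqP; split => x /=.
    by move=> h; split; [exact: h|move=> i ni; exact: h].
  by move=> [h0 h] [|i] ni //; have := h i ni.
- exact: measurable_step.
- by apply: measurable_cylinder; exists n, (fun i => A i.+1).
by move=> x y xy /=; rewrite (xy 0%N).
Qed.

(** Exchangeability: a permutation of finitely many steps preserves the product
    probability of cylinders, hence the law. *)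
Lemma pr_rearrange s t m (F : set (path R)) : cancel s t -> cancel t s ->
  (forall n i, (m <= n)%N -> (i < n)%N -> (s i < n)%N) ->
  (forall n i, (m <= n)%N -> (i < n)%N -> (t i < n)%N) ->
  measurable F -> pr Q (rearrange s @^-1` F) = pr Q F.
Proof.
move=> st ts sm tm mF; rewrite /pr; congr fine.
have := @product_formula_cylinders _ _ _ Q (rearrange s) id setT (@measurable_rearrange s).
move=> /(_ (@measurable_id _ _ _) measurableT) H.
have := H _ F mF; rewrite setTI preimage_id.
move=> ->; first by rewrite probability_setT mul1e.
move=> _ [n [A [mA ->]]]; rewrite setTI preimage_id probability_setT mul1e.
pose N := maxn n m; pose B i := if (i < n)%N then A i else setT.
have mB i : measurable (B i) by rewrite /B; case: ifP.
have nN : (n <= N)%N by rewrite leq_maxl.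
have mN : (m <= N)%N by rewrite leq_maxr.
have E x : (forall i, (i < n)%N -> A i (x i)) <-> (forall i, (i < N)%N -> B i (x i)).
  split => h i iN; first by rewrite /B; case: ifP => // /h.
  by have := h i (leq_trans iN nN); rewrite /B iN.
have mC (B' : nat -> set R) : (forall i, measurable (B' i)) ->
    measurable ([set x | forall i, (i < N)%N -> B' i (x i)] : set (path R)).
  by move=> mB'; apply: measurable_cylinder; exists N, B'.
have -> : rearrange s @^-1` [set x | forall i, (i < n)%N -> A i (x i)] =
    [set x | forall i, (i < N)%N -> B (t i) (x i)].
  apply/seteqP; split => x /=; rewrite /rearrange.
    move=> /E h i iN; have := h (t i) (tm _ _ mN iN); by rewrite ts.
  by move=> h; apply/E => i iN; have := h (s i) (sm _ _ mN iN); rewrite st.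
have -> : [set x : path R | forall i, (i < n)%N -> A i (x i)] =
    [set x | forall i, (i < N)%N -> B i (x i)].
  by apply/seteqP; split => x /= /E.
rewrite -!prE; [|exact: mC|exact: (mC (fun i => B (t i)))].
congr EFin; rewrite (@pr_cylinder N (fun i => B (t i)))// (@pr_cylinder N B)//.
pose h (i : 'I_N) : 'I_N := Ordinal (sm _ _ mN (ltn_ord i)).
have hI : injective h by move=> i j [/(can_inj st) ij]; apply: val_inj.
by rewrite (reindex_inj hI)/=; apply: eq_bigr => i _; rewrite st.
Qed.

Lemma Ex_rearrange s t m g : cancel s t -> cancel t s ->
  (forall n i, (m <= n)%N -> (i < n)%N -> (s i < n)%N) ->
  (forall n i, (m <= n)%N -> (i < n)%N -> (t i < n)%N) ->
  bmf g -> Ex Q (g \o rearrange s) = Ex Q g.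
Proof.
move=> st ts sm tm; apply: Ex_preserved; first exact: measurable_rearrange.
by move=> F mF; exact: (pr_rearrange st ts sm tm).
Qed.

Definition reversal n i : nat := if (i < n)%N then (n - i.+1)%N else i.

Lemma reversalK n : involutive (reversal n).
Proof.
move=> i; rewrite /reversal; have [ni|ni] := ltnP i n; last by rewrite ltnNge ni.
rewrite ltn_subrL/= (leq_trans _ ni)//= subnSK// subKn// ltnW//.
Qed.

Lemma reversal_lt n m i : (n <= m)%N -> (i < m)%N -> (reversal n i < m)%N.
Proof.
rewrite /reversal => nm im; case: (ltnP i n) => // ni.
by rewrite (leq_trans _ nm)// ltn_subrL (leq_trans _ ni).
Qed.

Definition rotation k i : nat := if (i < k)%N then i.+1 else if i == k then 0%N else i.

Definition rotation_inv k i : nat := if i is i'.+1 then if (i' < k)%N then i' else i else k.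

Lemma rotationK k : cancel (rotation k) (rotation_inv k).
Proof.
move=> i; rewrite /rotation; have [ik|ki|->] := ltngtP i k => /=; first by rewrite ik.
  by case: i ki => // i; rewrite ltnS /= => ki; rewrite ltnNge ki.
by [].
Qed.

Lemma rotation_invK k : cancel (rotation_inv k) (rotation k).
Proof.
case=> [|i] /=; first by rewrite /rotation ltnn eqxx.
case: ltnP => ik; rewrite /rotation; first by rewrite ik.
by rewrite ltnNge (leq_trans ik)//= gtn_eqF.
Qed.

Lemma rotation_lt k m i : (k.+1 <= m)%N -> (i < m)%N -> (rotation k i < m)%N.
Proof.
rewrite /rotation => km im; case: (ltnP i k) => ik; first exact: leq_ltn_trans km.
by case: eqP => // _; exact: leq_ltn_trans km.
Qed.

Lemma rotation_inv_lt k m i : (k.+1 <= m)%N -> (i < m)%N -> (rotation_inv k i < m)%N.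
Proof.
by case: i => [|i] //= km im; case: (ltnP i k) => // _; exact: ltnW.
Qed.

Lemma walk_reversal n j x : (j <= n)%N ->
  walk j (rearrange (reversal n) x) = walk n x - walk (n - j) x.
Proof.
move=> jn; apply/eqP; rewrite eq_sym subr_eq; apply/eqP.
elim: j jn => [|j IH] jn; first by rewrite walk0 add0r subn0.
have Ej : rearrange (reversal n) x j = x (n - j.+1)%N by rewrite /rearrange /reversal jn.
by rewrite IH ?(ltnW jn)// -(subnSK jn) /walk !big_ord_recr/= Ej addrA addrAC.
Qed.

Lemma walk_rotation k x : walk k (rearrange (rotation k) x) = walk k (shift 1 x).
Proof.
by apply: eq_bigr => i _; rewrite /rearrange /rotation /shift ltn_ord add1n.
Qed.

Lemma walk_rotation_all k n x : (k < n)%N -> walk n (rearrange (rotation k) x) = walk n x.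
Proof.
move=> kn; rewrite -(subnKC kn) walk_shift [RHS]walk_shift; congr (_ + _).
  rewrite -[in LHS]addn1 -[in RHS]add1n [in LHS]walk_shift [RHS]walk_shift walk_rotation !walk1 addrC; congr (_ + _).
  by rewrite /shift /rearrange /rotation addn0 ltnn eqxx.
apply: walk_eq => i _; rewrite /shift /rearrange /rotation.
by rewrite addSn ltnNge (leq_trans (leq_addr i k))//= gtn_eqF// ltnS leq_addr.
Qed.

Lemma shift_rotation k n x : (k < n)%N -> shift n (rearrange (rotation k) x) = shift n x.
Proof.
move=> kn; apply/funext => i; rewrite /shift /rearrange /rotation.
have ki : (k < n + i)%N by rewrite (leq_trans kn)// leq_addr.
by rewrite ltnNge (ltnW ki)/= gtn_eqF.
Qed.

End exchangeability.

Section positivity.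
Context {R : realType}.
Implicit Types (n k m j : nat) (x : path R).

Definition positive n : set (path R) :=
  [set x | forall k, (0 < k <= n)%N -> 0 < walk k x].

(** The time reversal of [positive n]. *)
Definition ladder n : set (path R) := [set x | forall j, (j < n)%N -> walk j x < walk n x].

Lemma measurable_finite_cap n (F : nat -> set (path R)) (p : nat -> bool) :
  (forall i, measurable (F i)) ->
  measurable [set x | forall i, (i < n)%N -> p i -> F i x].
Proof.
move=> mF; rewrite (_ : [set x | _] = \bigcap_i (if (i < n)%N && p i then F i else setT)).
  by apply: bigcapT_measurable => i; case: ifP.
apply/seteqP; split => x /= h i; last by move=> ni pi; have := h i Logic.I; rewrite ni pi.
by move=> _; case: ifP => // /andP[ni pi]; exact: h.
Qed.

Lemma measurable_positive n : measurable (positive n).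
Proof.
have := @measurable_finite_cap n.+1 (fun k => [set x | 0 < walk k x]) (fun k => 0 < k)%N.
move=> /(_ (fun k => measurable_walk_set k (measurable_gt 0))).
congr measurable; apply/seteqP; split => x /= h k.
  by case/andP => k0 kn; exact: h.
by rewrite ltnS => kn k0; apply: h; rewrite k0.
Qed.

Lemma measurable_ladder n : measurable (ladder n).
Proof.
have := @measurable_finite_cap n (fun k => [set x | walk k x < walk n x]) xpredT.
have mlt k : measurable [set x : path R | walk k x < walk n x].
  have mB : measurable_fun [set: path R] (fun x => walk n x - walk k x).
    by apply: measurable_funB; exact: measurable_walk.
  have := mB measurableT _ (measurable_gt 0); rewrite setTI.
  by congr measurable; apply/seteqP; split => x /=; rewrite subr_gt0.
move=> /(_ mlt); congr measurable.
by apply/seteqP; split => [x h k kn|x h k kn _]; [exact: (h k kn isT)|exact: h].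
Qed.

Lemma positive0 : positive 0 = setT.
Proof. by apply/seteqP; split => // x _ k; case: k. Qed.

Lemma ladder0 : ladder 0 = setT.
Proof. by apply/seteqP; split => // x _ k. Qed.

Lemma past_positive n : past n (positive n).
Proof.
move=> x y xy xp k /andP[k0 kn]; rewrite -(@depends_walk R n k kn x y xy).
by apply: xp; rewrite k0.
Qed.

Lemma positiveS n x : positive n.+1 x <-> positive n x /\ 0 < walk n.+1 x.
Proof.
split=> [h|[h1 h2] k /andP[k0]]; first split.
- by move=> k /andP[k0 kn]; apply: h; rewrite k0 leqW.
- by apply: h; rewrite leqnn.
by rewrite leq_eqVlt => /predU1P[->//|]; rewrite ltnS => kn; apply: h1; rewrite k0.
Qed.

Lemma ladder_shift1 n x : ladder n.+1 x <-> ladder n (shift 1 x) /\ 0 < walk n.+1 x.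
Proof.
split=> [h|[h1 h2] j]; first split.
- move=> j jn; rewrite -(ltrD2l (walk 1 x)) -!walk_shift !add1n; exact: h.
- by have := h 0%N isT; rewrite walk0.
case: j => [|j] jn; first by rewrite walk0.
by rewrite -[j.+1]add1n -[n.+1]add1n !walk_shift ltrD2l; exact: h1.
Qed.

Lemma ladder_gt0 n x : (0 < n)%N -> ladder n x -> 0 < walk n x.
Proof. by move=> n0 /(_ 0%N n0); rewrite walk0. Qed.

Lemma ladder_reversal n x : ladder n (rearrange (reversal n) x) <-> positive n x.
Proof.
split=> [h k /andP[k0 kn]|h j jn].
  have nk : (n - k < n)%N by rewrite ltn_subrL k0 (leq_trans k0).
  have := h _ nk; rewrite !walk_reversal//; last exact: leq_subr.
  by rewrite subKn// subnn walk0 subr0 ltrBlDr ltrDl.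
rewrite !walk_reversal//; last exact: ltnW.
rewrite subnn walk0 subr0 ltrBlDr ltrDl; apply: h.
by rewrite subn_gt0 jn leq_subr.
Qed.

End positivity.
Arguments positive {R} n.
Arguments ladder {R} n.

Section spitzer.
Context {R : realType}.
Variable Q : probability (path R) R.
Hypothesis MP : markov_property Q.
Variables b c : R.
Hypothesis step_lattice : pr Q [set x | lattice b c (x 0%N)] = 1.
Implicit Types (n k m j : nat) (f g : path R -> R) (h : R -> R).

(** Reversing the first n steps exchanges the two events and preserves S_n. *)
Lemma Ex_ladder n h : @bmf _ (measurableTypeR R) R h ->
  Ex Q (fun x => \1_(ladder n) x * h (walk n x)) = Ex Q (fun x => \1_(positive n) x * h (walk n x)).
Proof.
move=> [mh [M hM]].
have bl : bmf (fun x : path R => \1_(ladder n) x * h (walk n x)).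
  apply: bmfM; first by apply: bmf_ind; exact: measurable_ladder.
  split; last by exists M => x; exact: hM.
  by apply: measurableT_comp; [exact: mh|exact: measurable_walk].
rewrite -(Ex_rearrange MP (reversalK n) (reversalK n) (fun k i => @reversal_lt n k i) (fun k i => @reversal_lt n k i) bl).
apply: eq_Ex => x /=; rewrite walk_reversal// subnn walk0 subr0; congr (_ * _).
rewrite !indicE; congr ((_ : bool)%:R); apply/idP/idP => /set_mem.
  by move=> /ladder_reversal px; apply/mem_set.
by move=> px; apply/mem_set/ladder_reversal.
Qed.

Let u (i : nat) : R := oapp (fun z : int => b + c * z%:~R) b (@choice.unpickle int i).

(** Conditioning on the first step is elementary, because the steps take countably
    many values. *)
Lemma Ex_condition_step f : bmf f ->
  (forall z, Ex Q (fun x => \1_[set x : path R | x 0%N = z] x * f x) = 0) -> Ex Q f = 0.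
Proof.
move=> bf f0; pose F n := [set x : path R | exists2 i, (i < n)%N & x 0%N = u i].
have mz z : measurable [set x : path R | x 0%N = z] := measurable_step (measurable_set1 z).
have FS n : F n.+1 = F n `|` [set x : path R | x 0%N = u n].
  apply/seteqP; split => x /=.
    by move=> [i iS E]; move: iS; rewrite ltnS leq_eqVlt => /predU1P[<-|ni]; [right|left; exists i].
  by move=> [[i ni E]|E]; [exists i => //; exact: ltnW|exists n].
have mF n : measurable (F n).
  elim: n => [|n IH]; last by rewrite FS; exact: measurableU.
  by rewrite (_ : F 0%N = set0)//; apply/seteqP; split => x //= [].
have bF n : bmf (\1_(F n) : path R -> R) by exact: bmf_ind.
have E0 n : Ex Q (fun x => \1_(F n) x * f x) = 0.
  elim: n => [|n IH].
    rewrite (eq_Ex _ (_ : forall x, _ = 0)) ?Ex_cst// => x.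
    by rewrite indicE memNset ?mul0r// => -[].
  have [un|un] := pselect (exists2 i, (i < n)%N & u n = u i).
    rewrite FS (_ : _ `|` _ = F n)//; apply/seteqP; split => x /=; last by left.
    by move=> [//|xn]; case: un => i ni E; exists i => //; rewrite xn.
  rewrite (eq_Ex _ (_ : forall x, _ = \1_(F n) x * f x + \1_[set x : path R | x 0%N = u n] x * f x)).
    rewrite ExD ?IH ?f0 ?addr0//; apply: bmfM => //; exact: bmf_ind.
  move=> x; rewrite -mulrDl; congr (_ * _); rewrite FS !indicE in_setU.
  have [xF|xF] := boolP (x \in F n); last by rewrite add0r.
  rewrite memNset ?addr0// => /= xn; apply: un.
  by move: xF => /set_mem[i ni E]; exists i => //; rewrite -xn.
have [_ [M fM]] := bf.
have bd n : `|Ex Q f| <= M * (1 - pr Q (F n)).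
  have mC := measurableC (mF n).
  rewrite -prC// -Ex_ind// -ExZ; last exact: bmf_ind.
  have -> : Ex Q f = Ex Q (fun x => \1_(~` F n) x * f x).
    rewrite -[RHS]add0r -(E0 n) -ExD; [|exact: bmfM|by apply: bmfM => //; exact: bmf_ind].
    apply: eq_Ex => x; rewrite -mulrDl !indicE in_setC; case: (x \in F n);
    by rewrite ?addr0 ?add0r mul1r.
  apply: norm_Ex_le => //.
  - by apply: bmfM => //; exact: bmf_ind.
  - by apply: bmfM; [exact: bmf_cst|exact: bmf_ind].
  move=> x; rewrite indicE; case: (x \in _); last by rewrite mul0r mulr0 normr0.
  by rewrite mul1r mulr1.
have ndF : nondecreasing_seq F.
  by move=> n m nm; apply/subsetPset => x /= [i ni E]; exists i => //; exact: leq_trans nm.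
have U1 : pr Q (\bigcup_n F n) = 1.
  apply/eqP; rewrite eq_le pr_le1 ?[X in 1%R <= X]//=; last exact: bigcupT_measurable.
  rewrite -[leLHS]step_lattice; apply: le_pr.
  - exact: (measurable_step (measurable_lattice b c)).
  - exact: bigcupT_measurable.
  move=> x /= [z _ E]; exists (choice.pickle z).+1 => //=; exists (choice.pickle z) => //.
  by rewrite /u choice.pickleK.
have := pr_cvg_bigcup (P := Q) mF ndF; rewrite U1 => c1.
have [//|fn0] := eqVneq (Ex Q f) 0.
have f_gt0 : 0 < `|Ex Q f| by rewrite normr_gt0.
have M0 : 0 <= M by apply: le_trans (fM (fun=> 0)).
have e0 : 0 < `|Ex Q f| / (2 * (M + 1)) by rewrite divr_gt0// mulr_gt0// ltr_wpDl.
have /cvgrPdist_le /(_ _ e0) [n _ /(_ n (leqnn n))] := c1.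
have p1 := pr_le1 Q (mF n).
rewrite ger0_norm ?subr_ge0// ler_pdivlMr ?mulr_gt0// ?ltr_wpDl// => h.
have := bd n; have : 0 <= 1 - pr Q (F n) by rewrite subr_ge0.
by move: (1 - pr Q (F n)) h => t h; nra.
Qed.

Definition last_ladder n k : path R -> R := fun x => \1_(ladder (n - k)) (shift k x).

(** The weights of Spitzer's identity: their pairing with any function of the
    n-th position vanishes. *)
Definition spitzer_weight n : path R -> R := fun x =>
  n%:R * \1_(ladder n) x -
  \sum_(k < n) \1_[set y | 0 < walk k.+1 y] x * last_ladder n k.+1 x.

Lemma bmf_last_ladder n k : bmf (last_ladder n k).
Proof. exact: (bmf_shift k (bmf_ind (measurable_ladder (n - k)))). Qed.

Lemma measurable_walk_gt0 k : measurable [set y : path R | 0 < walk k y].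
Proof. exact: (measurable_walk_set k (measurable_gt 0)). Qed.

Lemma bmf_walk n h : @bmf _ (measurableTypeR R) R h -> bmf (fun x : path R => h (walk n x)).
Proof.
move=> [mh [M hM]]; split; last by exists M => x; exact: hM.
by apply: measurableT_comp; [exact: mh|exact: measurable_walk].
Qed.

Lemma bmf_spitzer_weight n : bmf (spitzer_weight n).
Proof.
apply: bmfB; first by apply: bmfM; [exact: bmf_cst|apply: bmf_ind; exact: measurable_ladder].
apply: bmf_sum => k; apply: bmfM; last exact: bmf_last_ladder.
by apply: bmf_ind; exact: measurable_walk_gt0.
Qed.

Lemma last_ladder_gt0 n k x : (k < n)%N -> last_ladder n k x != 0 -> walk k x < walk n x.
Proof.
move=> kn; rewrite /last_ladder indicE; case: (boolP (_ \in _)) => [/set_mem h _|]; last by rewrite eqxx.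
have := h 0%N; rewrite subn_gt0 kn => /(_ isT).
by rewrite walk0 -(ltrD2l (walk k x)) addr0 -walk_shift subnKC// ltnW.
Qed.

Lemma last_ladderS n k x : (k < n)%N ->
  last_ladder n k x = \1_[set y | walk k y < walk n y] x * last_ladder n k.+1 x.
Proof.
move=> kn; rewrite /last_ladder !indicE -natrM mulnb; congr ((_ : bool)%:R).
have Ek : walk n x = walk k x + walk (n - k) (shift k x) by rewrite -walk_shift subnKC// ltnW.
have shS : shift k.+1 x = shift 1 (shift k x) by apply/funext => i; rewrite /shift addnA addn1.
apply/idP/andP => [/set_mem h|[/set_mem/= h1 /set_mem h2]].
  move: h; rewrite -(subnSK kn) => /ladder_shift1 [h1 h2]; split; apply/mem_set; last by rewrite shS.
  by rewrite /= Ek -(subnSK kn) ltrDl.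
apply/mem_set; rewrite -(subnSK kn); apply/ladder_shift1; split; first by rewrite -shS.
by move: h1; rewrite Ek -(subnSK kn) ltrDl.
Qed.

Lemma last_ladder_n n x : last_ladder n n x = 1.
Proof. by rewrite /last_ladder subnn ladder0 indicE mem_set. Qed.

(** Consecutive terms differ only if S_(k+1) >= S_(n+1), and then S_(k+1) > 0: the
    positivity constraint is automatic and the sum telescopes. *)
Lemma last_ladder_telescope n x : 0 < walk n.+1 x ->
  last_ladder n.+1 1 x =
  \sum_(k < n.+1) \1_[set y | 0 < walk k.+1 y] x * last_ladder n.+1 k.+1 x -
  \sum_(k < n) \1_[set y | 0 < walk k.+1 y] x * last_ladder n.+1 k.+2 x.
Proof.
move=> x0; rewrite big_ord_recr/= addrAC -sumrB last_ladder_n indicE mem_set// mulr1.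
rewrite (eq_bigr (fun k : 'I_n => last_ladder n.+1 k.+1 x - last_ladder n.+1 k.+2 x)).
  have := @telescope_sumr _ 0 n (fun k => last_ladder n.+1 k.+1 x) (leq0n n).
  rewrite big_mkord last_ladder_n => E.
  have -> : \sum_(k < n) (last_ladder n.+1 k.+1 x - last_ladder n.+1 k.+2 x) =
      - (\sum_(k < n) (last_ladder n.+1 k.+2 x - last_ladder n.+1 k.+1 x)).
    by rewrite -sumrN; apply: eq_bigr => k _; rewrite opprB.
  by rewrite E /=; ring.
move=> k _; rewrite -mulrBr indicE; case: (boolP (x \in _)) => [_|]; first by rewrite mul1r.
rewrite notin_setE/= => /negP; rewrite -leNgt => kx.
rewrite (@last_ladderS n.+1 k.+1 x) ?ltnS// indicE mem_set ?mul1r ?subrr ?mulr0//=.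
exact: le_lt_trans x0.
Qed.

(** On S_(n+1) > 0 the weight telescopes into a combination of weights of the
    shifted walk, after a rotation of the steps; conditionally on the first step
    the expectation then vanishes by induction. *)
Lemma spitzer_null n h : @bmf _ (measurableTypeR R) R h ->
  Ex Q (fun x => spitzer_weight n x * h (walk n x)) = 0.
Proof.
elim: n h => [|n IH] h bh.
  rewrite (eq_Ex _ (_ : forall x, _ = 0)) ?Ex_cst// => x.
  by rewrite /spitzer_weight mul0r big_ord0 subr0 mul0r.
pose h' (t : R) := \1_[set t : R | 0 < t] t * h t.
have bh' : @bmf _ (measurableTypeR R) R h'.
  by apply: bmfM => //; apply: bmf_ind; exact: measurable_gt.
have bhw m := bmf_walk m bh'.
have w_h' x : spitzer_weight n.+1 x * h (walk n.+1 x) = spitzer_weight n.+1 x * h' (walk n.+1 x).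
  rewrite /h' indicE; case: (boolP (_ \in _)) => [_|]; first by rewrite mul1r.
  rewrite notin_setE/= => /negP x0; rewrite mul0r mulr0.
  suff -> : spitzer_weight n.+1 x = 0 by rewrite mul0r.
  rewrite /spitzer_weight indicE memNset; last by move=> /(ladder_gt0 (ltn0Sn n)) h0; rewrite h0 in x0.
  rewrite mulr0 big1 ?subr0// => k _; rewrite indicE.
  case: (boolP (x \in _)) => [/set_mem/= xk|_]; last by rewrite mul0r.
  rewrite mul1r; apply/eqP; apply: contraNT x0 => lk.
  have : (k.+1 <= n.+1)%N by []. rewrite leq_eqVlt => /predU1P[E|kn]; first by rewrite -E.
  exact: lt_trans xk (last_ladder_gt0 kn lk).
rewrite (eq_Ex _ w_h').
pose v x := n%:R * last_ladder n.+1 1 x -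
  \sum_(k < n) \1_[set y : path R | 0 < walk k.+1 y] x * last_ladder n.+1 k.+2 x.
have v_h' x : spitzer_weight n.+1 x * h' (walk n.+1 x) = v x * h' (walk n.+1 x).
  have [x0|x0] := ltP 0 (walk n.+1 x); last first.
    by rewrite /h' indicE memNset ?mul0r ?mulr0//= => ?; move: x0; rewrite leNgt => /negP.
  congr (_ * _); rewrite /spitzer_weight /v.
  have -> : \1_(ladder n.+1) x = last_ladder n.+1 1 x.
    rewrite /last_ladder subn1/= !indicE; congr ((_ : bool)%:R); apply/idP/idP => /set_mem.
      by move=> /ladder_shift1[? _]; apply/mem_set.
    by move=> ?; apply/mem_set/ladder_shift1.
  have := last_ladder_telescope x0; rewrite -natr1; set A := \sum_(k < n.+1) _; set B := \sum_(k < n) _.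
  by move=> ->; ring.
rewrite (eq_Ex _ v_h').
have bl k : bmf (last_ladder n.+1 k) := bmf_last_ladder n.+1 k.
have bt k : bmf (fun x : path R => \1_[set y : path R | 0 < walk k.+1 y] x * last_ladder n.+1 k.+2 x * h' (walk n.+1 x)).
  by apply: bmfM => //; apply: bmfM => //; apply: bmf_ind; exact: measurable_walk_gt0.
(* exchanging the first step with the next k+1 *)
have rot k : (k < n)%N -> Ex Q (fun x => \1_[set y : path R | 0 < walk k.+1 y] x * last_ladder n.+1 k.+2 x * h' (walk n.+1 x)) =
    Ex Q (fun x => \1_[set y : path R | 0 < walk k.+1 y] (shift 1 x) * last_ladder n k.+1 (shift 1 x) * h' (walk n.+1 x)).
  move=> kn; rewrite -(Ex_rearrange MP (rotationK k.+1) (rotation_invK k.+1) (fun m i => @rotation_lt k.+1 m i) (fun m i => @rotation_inv_lt k.+1 m i) (bt k)).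
  apply: eq_Ex => x /=; rewrite walk_rotation_all ?ltnS//; congr (_ * _ * _).
    rewrite !indicE; congr ((_ : bool)%:R); apply/idP/idP => /set_mem/= E; apply/mem_set => /=.
      by rewrite -walk_rotation.
    by rewrite walk_rotation.
  rewrite /last_ladder shift_rotation// subSS.
have bsh := bmf_shift 1 (bmf_spitzer_weight n).
transitivity (Ex Q (fun x => spitzer_weight n (shift 1 x) * h' (walk n.+1 x))).
  have E1 x : v x * h' (walk n.+1 x) = n%:R * (last_ladder n.+1 1 x * h' (walk n.+1 x)) -
      \sum_(k < n) (\1_[set y : path R | 0 < walk k.+1 y] x * last_ladder n.+1 k.+2 x * h' (walk n.+1 x)).
    by rewrite /v mulrBl mulrA; congr (_ - _); rewrite mulr_suml.
  have E2 x : spitzer_weight n (shift 1 x) * h' (walk n.+1 x) = n%:R * (last_ladder n.+1 1 x * h' (walk n.+1 x)) -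
      \sum_(k < n) (\1_[set y : path R | 0 < walk k.+1 y] (shift 1 x) * last_ladder n k.+1 (shift 1 x) * h' (walk n.+1 x)).
    rewrite /spitzer_weight mulrBl mulr_suml -(mulrA n%:R).
    by rewrite /last_ladder subn1.
  rewrite (eq_Ex _ E1) (eq_Ex _ E2).
  have bs k : bmf (fun x : path R => \1_[set y : path R | 0 < walk k.+1 y] (shift 1 x) * last_ladder n k.+1 (shift 1 x) * h' (walk n.+1 x)).
    apply: bmfM => //; apply: bmfM.
      exact: (bmf_shift 1 (bmf_ind (measurable_walk_gt0 k.+1))).
    exact: (bmf_shift 1 (bmf_last_ladder n k.+1)).
  rewrite !ExB; [|by apply: bmfM; [exact: bmf_cst|exact: bmfM]|by apply: bmf_sum => k|by apply: bmfM; [exact: bmf_cst|exact: bmfM]|by apply: bmf_sum => k].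
  by congr (_ - _); rewrite !Ex_sum//; apply: eq_bigr => k _; exact: rot.
apply: Ex_condition_step; first exact: bmfM.
move=> z; pose hz (t : R) := h' (z + t).
have bhz : @bmf _ (measurableTypeR R) R hz.
  have [m1 [M hM]] := bh'; split; last by exists M => x; exact: hM.
  by apply: measurableT_comp; [exact: m1|apply: measurable_funD].
have bg : bmf (fun x : path R => spitzer_weight n x * hz (walk n x)).
  by apply: bmfM; [exact: bmf_spitzer_weight|exact: bmf_walk].
have mz : measurable [set x : path R | x 0%N = z] := measurable_step (measurable_set1 z).
have pz : past 1 [set x : path R | x 0%N = z] by move=> x y xy /= <-; rewrite (xy 0%N).
rewrite (eq_Ex _ (_ : forall x, _ = \1_[set x : path R | x 0%N = z] x * (spitzer_weight n (shift 1 x) * hz (walk n (shift 1 x))))).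
  by rewrite (Ex_markov MP (bmf_ind mz) bg (past_depends_ind pz)) IH// mulr0.
move=> x; rewrite indicE; case: (boolP (x \in _)) => [/set_mem/= xz|_]; last by rewrite !mul0r.
by rewrite !mul1r /hz -xz -[n.+1]add1n walk_shift walk1.
Qed.

Lemma spitzer_sum n h : @bmf _ (measurableTypeR R) R h ->
  n%:R * Ex Q (fun x => \1_(positive n) x * h (walk n x)) =
  \sum_(k < n) Ex Q (fun x => \1_[set y : path R | 0 < walk k.+1 y] x * last_ladder n k.+1 x * h (walk n x)).
Proof.
move=> bh; have bhw := bmf_walk n bh; have := spitzer_null n bh.
have bl : bmf (fun x : path R => \1_(ladder n) x * h (walk n x)).
  by apply: bmfM => //; apply: bmf_ind; exact: measurable_ladder.
have bt k : bmf (fun x : path R => \1_[set y : path R | 0 < walk k.+1 y] x * last_ladder n k.+1 x * h (walk n x)).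
  apply: bmfM => //; apply: bmfM; last exact: bmf_last_ladder.
  by apply: bmf_ind; exact: measurable_walk_gt0.
rewrite (eq_Ex _ (_ : forall x, _ = n%:R * (\1_(ladder n) x * h (walk n x)) -
   \sum_(k < n) (\1_[set y : path R | 0 < walk k.+1 y] x * last_ladder n k.+1 x * h (walk n x)))).
  rewrite ExB; [|by apply: bmfM => //; exact: bmf_cst|exact: bmf_sum].
  by rewrite ExZ// Ex_ladder// Ex_sum// => /eqP; rewrite subr_eq0 => /eqP.
by move=> x; rewrite /spitzer_weight mulrBl mulrA; congr (_ - _); rewrite mulr_suml.
Qed.

Lemma pr_ladder n : pr Q (ladder n) = pr Q (positive n).
Proof.
have := Ex_ladder n (bmf_cst 1).
under eq_Ex => x do rewrite mulr1; under [RHS]eq_Ex => x do rewrite mulr1.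
by rewrite !Ex_ind//; [exact: measurable_positive|exact: measurable_ladder].
Qed.

Lemma Ex_gt0_ladder n k g : (k < n)%N -> bmf g ->
  Ex Q (fun x => \1_[set y : path R | 0 < walk k.+1 y] x * (\1_(ladder (n - k.+1)) (shift k.+1 x) * g (shift k.+1 x))) =
  pr Q [set y | 0 < walk k.+1 y] * Ex Q (fun x => \1_(ladder (n - k.+1)) x * g x).
Proof.
move=> kn bg; have mp := measurable_walk_gt0 k.+1.
have bl : bmf (fun x : path R => \1_(ladder (n - k.+1)) x * g x).
  by apply: bmfM => //; apply: bmf_ind; exact: measurable_ladder.
rewrite (Ex_markov MP (bmf_ind mp) bl) ?Ex_ind//.
by apply: past_depends_ind => x y xy /=; rewrite (depends_walk (leqnn k.+1) xy).
Qed.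

Lemma spitzer_pr n : n%:R * pr Q (positive n) =
  \sum_(k < n) pr Q [set y | 0 < walk k.+1 y] * pr Q (positive (n - k.+1)).
Proof.
have := spitzer_sum n (bmf_cst 1).
under eq_Ex => x do rewrite mulr1.
rewrite Ex_ind => [->|]; last exact: measurable_positive.
apply: eq_bigr => k _; have := Ex_gt0_ladder (ltn_ord k) (bmf_cst 1).
under [in RHS]eq_Ex => x do rewrite mulr1.
rewrite (Ex_ind Q (measurable_ladder (n - k.+1))) pr_ladder => <-.
by apply: eq_Ex => x; rewrite !mulr1.
Qed.

Lemma cosD_le (t1 t2 : R) : 1 - cos (t1 + t2) <= 5 / 4 * (1 - cos t2) + 5 * (1 - cos t1).
Proof.
have E (t : R) : 1 - cos t = 2 * sin (t / 2) ^+ 2.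
  rewrite {1}(_ : t = (t / 2) *+ 2) ?cos_mulr2n ?cos2sin2; last by rewrite -mulr_natr divfK.
  ring.
rewrite !E (mulrDl t1 t2) sinD; move: (t1 / 2) (t2 / 2) => p q.
have := norm_cos_le1 p; have := norm_cos_le1 q; rewrite !ler_norml => /andP[q1 q2] /andP[p1 p2].
have h : (sin p * cos q + cos p * sin q) ^+ 2 <=
    5 / 4 * (cos p * sin q) ^+ 2 + 5 * (sin p * cos q) ^+ 2.
  by have := sqr_ge0 (cos p * sin q - 4 * (sin p * cos q)); rewrite !expr2; nra.
have hp : (cos p * sin q) ^+ 2 <= sin q ^+ 2.
  by rewrite exprMn ler_piMl ?sqr_ge0//; rewrite expr2; nra.
have hq : (sin p * cos q) ^+ 2 <= sin p ^+ 2.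
  by rewrite exprMn ler_piMr ?sqr_ge0//; rewrite expr2; nra.
by lra.
Qed.

(** Split S_n = S_k + (S_n - S_k) in the cosine. The factor 5/4 of the second part
    is affordable, since it meets P(S_k > 0), close to 1/2. *)
Lemma spitzer_cos n (s : R) :
  n%:R * Ex Q (fun x => \1_(positive n) x * (1 - cos (s * walk n x))) <=
  \sum_(k < n) (5 / 4 * (pr Q [set y | 0 < walk k.+1 y] *
      Ex Q (fun x => \1_(positive (n - k.+1)) x * (1 - cos (s * walk (n - k.+1) x)))) +
    5 * (Ex Q (fun x => 1 - cos (s * walk k.+1 x)) * pr Q (positive (n - k.+1)))).
Proof.
have bh : @bmf _ (measurableTypeR R) R (fun t => 1 - cos (s * t)).
  by apply: bmfB; [exact: bmf_cst|apply: bmf_cos; exact: measurable_funM].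
rewrite (spitzer_sum n bh); apply: ler_sum => k _.
have kn := ltn_ord k; pose m := (n - k.+1)%N; rewrite -/m.
have bl : bmf (\1_(ladder m) : path R -> R) := bmf_ind (measurable_ladder m).
have bp : bmf (\1_[set y : path R | 0 < walk k.+1 y] : path R -> R) := bmf_ind (measurable_walk_gt0 k.+1).
have mp := measurable_walk_gt0 k.+1.
have bcm := bmf_walk m bh; have bck := bmf_walk k.+1 bh.
have E1 : pr Q [set y | 0 < walk k.+1 y] * Ex Q (fun x => \1_(positive m) x * (1 - cos (s * walk m x))) =
   Ex Q (fun x => \1_[set y : path R | 0 < walk k.+1 y] x * (\1_(ladder m) (shift k.+1 x) * (1 - cos (s * walk m (shift k.+1 x))))).
  by rewrite (Ex_gt0_ladder kn bcm) (Ex_ladder m bh).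
have E2 : Ex Q (fun x => 1 - cos (s * walk k.+1 x)) * pr Q (positive m) =
   Ex Q (fun x => (1 - cos (s * walk k.+1 x)) * \1_(ladder m) (shift k.+1 x)).
  rewrite (Ex_markov MP bck bl) ?Ex_ind ?pr_ladder//; first exact: measurable_ladder.
  by move=> x y xy; rewrite (depends_walk (leqnn k.+1) xy).
rewrite E1 E2.
have b1 : bmf (fun x => \1_[set y : path R | 0 < walk k.+1 y] x * (\1_(ladder m) (shift k.+1 x) * (1 - cos (s * walk m (shift k.+1 x))))).
  by apply: bmfM => //; exact: (bmf_shift k.+1 (bmfM bl bcm)).
have b2 : bmf (fun x => (1 - cos (s * walk k.+1 x)) * \1_(ladder m) (shift k.+1 x)).
  by apply: bmfM => //; exact: (bmf_shift k.+1 bl).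
rewrite -!ExZ// -ExD; [|by apply: bmfM => //; exact: bmf_cst|by apply: bmfM => //; exact: bmf_cst].
apply: le_Ex.
- by apply: bmfM; [apply: bmfM => //; exact: bmf_last_ladder|exact: (bmf_walk n bh)].
- by apply: bmfD; apply: bmfM => //; exact: bmf_cst.
move=> x; rewrite /last_ladder -/m.
have -> : walk n x = walk k.+1 x + walk m (shift k.+1 x) by rewrite -walk_shift /m subnKC.
rewrite [s * (_ + _)]mulrDr; have := cosD_le (s * walk k.+1 x) (s * walk m (shift k.+1 x)).
have c1 := cos_le1 (s * walk k.+1 x); have c2 := cos_le1 (s * walk m (shift k.+1 x)).
rewrite !indicE; case: (shift k.+1 x \in _); rewrite ?mulr0 ?mul0r ?mulr0 ?mulr1 ?mul1r ?addr0 ?mul0r//.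
by case: (x \in _); rewrite ?mul0r ?mul1r ?mulr0 ?add0r /=; lra.
Qed.

End spitzer.

(** * Survival probabilities *)

Section renewal_sequence.
Context {R : realType}.
Variables (q p : nat -> R).
Hypotheses (q0 : q 0%N = 1) (q_ge0 : forall n, 0 <= q n).
Hypothesis q_noninc : forall n m, (n <= m)%N -> q m <= q n.
Hypothesis p01 : forall n, 0 <= p n <= 1.
Hypothesis spitzer : forall n, n%:R * q n = \sum_(k < n) p k.+1 * q (n - k.+1)%N.
Hypothesis p_lim : forall e, 0 < e -> exists N, forall n, (N <= n)%N -> `|p n - 2^-1| <= e.
Implicit Types (n m k N : nat) (e : R).

Definition psum n := \sum_(j < n) q j.

Lemma psum_rev n : psum n = \sum_(k < n) q (n - k.+1)%N.
Proof. by rewrite /psum (reindex_inj rev_ord_inj). Qed.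

Lemma psum_ge n m : (m <= n)%N -> m%:R * q m <= psum n.
Proof.
move=> mn; apply: (@le_trans _ _ (psum m)).
  rewrite mulr_natl -[X in _ *+ X](card_ord m) -sumr_const; apply: ler_sum => j _.
  by apply: q_noninc; exact: ltnW.
rewrite /psum -(subnKC mn) big_split_ord/= lerDl; exact: sumr_ge0.
Qed.

Lemma psum_split n m : (m <= n)%N -> psum m + (n - m)%N%:R * q n <= psum n.
Proof.
move=> mn; rewrite /psum -[in X in _ <= X](subnKC mn) big_split_ord/= lerD2l.
rewrite mulr_natl -[X in _ *+ X](card_ord (n - m)) -sumr_const; apply: ler_sum => j _.
by apply: q_noninc; rewrite -[leqRHS](subnKC mn) leq_add2l ltnW.
Qed.

Lemma psum_ge1 n : (0 < n)%N -> 1 <= psum n.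
Proof.
case: n => // n _; rewrite /psum big_ord_recl/= q0 lerDl; exact: sumr_ge0.
Qed.

(** In Spitzer's recursion the weights are close to 1/2, except for boundedly many
    terms, which are negligible since q is nonincreasing. *)
Lemma mulr_q_psum e : 0 < e -> exists N, forall n, (N <= n)%N ->
  `|n%:R * q n - psum n / 2| <= e * psum n.
Proof.
move=> e0; have e2 : 0 < e / 2 by rewrite divr_gt0.
have [K HK] := p_lim e2.
pose M := (Num.truncn (K%:R / (e / 2))).+1.
have HM : K%:R / (e / 2) <= M%:R by apply/ltW/truncnS_gt.
exists (K + M)%N => n Nn; have Kn : (K <= n)%N by apply: leq_trans Nn; rewrite leq_addr.
have Qn0 : 0 <= psum n by exact: sumr_ge0.
have nK : (M <= n - K)%N by rewrite leq_subRL.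
have nK0 : (0 : R) < (n - K)%N%:R by rewrite ltr0n (leq_trans _ nK).
rewrite spitzer [X in _ - X / 2]psum_rev mulr_suml -sumrB.
apply: le_trans (ler_norm_sum _ _ _) _.
apply: (@le_trans _ _ (\sum_(k < n) (e / 2 * q (n - k.+1)%N + (k < K)%N%:R * (psum n / (n - K)%N%:R)))).
  apply: ler_sum => k _; rewrite mulrC -mulrBr normrM ger0_norm// mulrC.
  have [kK|Kk] := ltnP k K.
    have h1 : `|p k.+1 - 2^-1| <= 1.
      by have /andP[p0 p1] := p01 k.+1; rewrite ler_distl; apply/andP; split; lra.
    have h2 : q (n - k.+1)%N <= psum n / (n - K)%N%:R.
      rewrite ler_pdivlMr// mulrC; apply: le_trans (psum_ge (leq_subr K n)).
      by rewrite ler_wpM2l//; apply: q_noninc; rewrite leq_sub2l.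
    rewrite mul1r; apply: (@le_trans _ _ (q (n - k.+1)%N)); first by rewrite ler_piMl.
    by apply: le_trans h2 _; rewrite lerDr mulr_ge0// ltW.
  rewrite mul0r addr0 ler_wpM2r//; apply: HK; exact: leqW.
rewrite big_split/= -mulr_sumr -psum_rev -mulr_suml.
have hK : \sum_(k < n) (k < K)%N%:R <= K%:R :> R.
  rewrite -(subnKC Kn) big_split_ord/= [X in _ + X]big1 ?addr0; last first.
    by move=> k _; rewrite ltnNge leq_addr.
  by rewrite (eq_bigr (fun=> 1)) ?sumr_const ?card_ord// => k _; rewrite ltn_ord.
rewrite [leRHS](_ : _ = e / 2 * psum n + e / 2 * psum n); last by rewrite -mulrDl -splitr.
rewrite lerD2l mulrCA [e / 2 * _]mulrC ler_wpM2l//.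
rewrite ler_pdivrMr//; apply: (le_trans hK); rewrite -ler_pdivrMl//.
by rewrite mulrC (le_trans HM)// ler_nat.
Qed.

Lemma q_gt0 n : 0 < q n.
Proof.
rewrite lt0r q_ge0 andbT; apply/eqP => qn0.
have e4 : (0 : R) < 4^-1 by rewrite invr_gt0.
have [N H] := mulr_q_psum e4.
pose m := (maxn N n).+1.
have Nm : (N <= m)%N by rewrite leqW// leq_maxl.
have qm : q m = 0.
  by apply/eqP; rewrite eq_le q_ge0 andbT -qn0 q_noninc// leqW// leq_maxr.
have := H m Nm; rewrite qm mulr0 sub0r normrN ger0_norm; last by rewrite divr_ge0// sumr_ge0.
by have := psum_ge1 (ltn0Sn (maxn N n)); rewrite -/m; lra.
Qed.

(** The sum of q up to n exceeds the sum up to m by at least (n - m) q n, and both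
    sums are known up to a small factor from n q n and m q m. *)
Lemma q_ratio e : 0 < e -> exists N, forall m n, (N <= m)%N -> (m <= n)%N ->
  2 * m%:R * (1 - e) * q m <= (n + m)%:R * q n.
Proof.
move=> e0; have [e1|e1] := leP 1 e.
  exists 0%N => m n _ _; apply: (@le_trans _ _ 0); last by rewrite mulr_ge0.
  by rewrite mulr_le0_ge0// mulr_ge0_le0 ?mulr_ge0// subr_le0.
have t0 : 0 < e / 6 by rewrite divr_gt0.
have [N H] := mulr_q_psum t0; exists N => m n Nm mn.
have := H n (leq_trans Nm mn); have := H m Nm; rewrite !ler_distl.
set t := e / 6 in t0 *; have te : e = 6 * t by rewrite /t mulrC divfK.
move=> /andP[_ a2] /andP[a3 _].
have := psum_split mn; rewrite natrB// natrD => a4.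
have mnR : (m%:R : R) <= n%:R by rewrite ler_nat.
have m0 : (0 : R) <= m%:R by [].
have qn := q_gt0 n; have qm := q_gt0 m; have Qm : 0 <= psum m by exact: sumr_ge0.
move: (q n) (q m) (psum n) (psum m) (m%:R : R) (n%:R : R) qn qm Qm a2 a3 a4 mnR m0.
move=> x y A B k l x0 y0 B0 a2 a3 a4 kl k0.
have t6 : t < 6^-1 by lra.
have b1 : k * y * 2 <= (1 + 2 * t) * B by lra.
have b2 : (1 - 2 * t) * A <= l * x * 2 by lra.
have b3 : (1 - 2 * t) * (B + (l - k) * x) <= l * x * 2.
  by apply: le_trans b2; rewrite ler_wpM2l//; lra.
have kx : 0 <= k * x by rewrite mulr_ge0// ltW.
have lx : 0 <= (l - k) * x by rewrite mulr_ge0 ?subr_ge0// ltW.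
have b4 : (1 - 2 * t) * B <= (1 + 2 * t) * ((l + k) * x) by nra.
have b5 : (1 - 2 * t) * (k * y * 2) <= (1 + 2 * t) ^+ 2 * ((l + k) * x).
  apply: (@le_trans _ _ ((1 - 2 * t) * ((1 + 2 * t) * B))); first by rewrite ler_wpM2l//; lra.
  by rewrite mulrCA expr2 -mulrA ler_wpM2l//; lra.
have ky : 0 <= k * y by rewrite mulr_ge0// ltW.
have b6 : (1 + 2 * t) ^+ 2 * (2 * k * (1 - e) * y) <= (1 - 2 * t) * (k * y * 2).
  have -> : (1 + 2 * t) ^+ 2 * (2 * k * (1 - e) * y) = ((1 + 2 * t) ^+ 2 * (1 - e)) * (k * y * 2) by ring.
  rewrite ler_wpM2r ?mulr_ge0//; [exact: ltW|rewrite te expr2; nra].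
have b7 := le_trans b6 b5; rewrite ler_pM2l// in b7.
by rewrite exprn_gt0//; lra.
Qed.

Lemma mulr_q_monotone : exists C, 0 < C /\ forall m n, (m <= n)%N -> m%:R * q m <= C * (n%:R * q n).
Proof.
have e2 : (0 : R) < 2^-1 by rewrite invr_gt0.
have [N H] := q_ratio e2.
have qN := q_gt0 N; pose C := 2 + 2 / q N.
have C0 : 2 <= C by rewrite lerDl divr_ge0// ltW.
have large m n : (N <= m)%N -> (m <= n)%N -> m%:R * q m <= 2 * (n%:R * q n).
  move=> Nm mn; have := H m n Nm mn; rewrite natrD.
  have mnR : (m%:R : R) <= n%:R by rewrite ler_nat.
  have := q_ge0 n; have := q_ge0 m; nra.
exists C; split; first by lra.
move=> m n mn; have [n00|n0] := posnP n.
  by move: mn; rewrite n00 leqn0 => /eqP ->; rewrite !mul0r mulr0.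
have [Nm|mN] := leqP N m.
  by apply: le_trans (large m n Nm mn) _; rewrite ler_wpM2r// mulr_ge0.
have qm1 : q m <= 1 by rewrite -q0 q_noninc.
have CqN : 2 <= C * q N by rewrite /C mulrDl divfK ?gt_eqF//; lra.
have [nN|Nn] := leqP n N.
  have qn : q N <= q n by exact: q_noninc.
  have mnR : (m%:R : R) <= n%:R by rewrite ler_nat.
  have n1 : (1 : R) <= n%:R by rewrite ler1n.
  have m0 : (0 : R) <= m%:R by [].
  apply: (@le_trans _ _ m%:R); first by rewrite ler_piMr.
  apply: (le_trans mnR); rewrite mulrCA ler_peMr//.
  have : C * q N <= C * q n by rewrite ler_wpM2l//; lra.
  by lra.
have := large N n (leqnn N) (ltnW Nn) => h.
have mNR : (m%:R : R) <= N%:R by rewrite ler_nat ltnW.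
have m0 : (0 : R) <= m%:R by [].
apply: (@le_trans _ _ m%:R); first by rewrite ler_piMr.
have nq : 0 <= n%:R * q n by rewrite mulr_ge0.
rewrite -(ler_pM2r qN); apply: (@le_trans _ _ (N%:R * q N)); first by rewrite ler_pM2r.
by apply: (le_trans h); rewrite mulrAC ler_wpM2r//; lra.
Qed.

(** A quantity obeying Spitzer's recursion up to the factor 5/4, and a linear
    inhomogeneity, is at most linear relative to q: the recursion averages with
    total weight about 5/8 < 1. *)
Lemma spitzer_bound : exists C, 0 <= C /\ forall (E d : nat -> R) (D : R), 0 <= D ->
  (forall n, 0 <= E n) -> (forall n, E n <= d n) -> (forall k, d k <= D * k%:R) ->
  (forall n, n%:R * E n <=
     \sum_(k < n) (5 / 4 * (p k.+1 * E (n - k.+1)%N) + 5 * (d k.+1 * q (n - k.+1)%N))) ->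
  forall n, E n <= C * D * (n%:R * q n).
Proof.
have [C1 [C10 H1]] := mulr_q_monotone.
have e4 : (0 : R) < 4^-1 by rewrite invr_gt0.
have [N2 H2] := mulr_q_psum e4.
have e20 : (0 : R) < 20^-1 by rewrite invr_gt0.
have [N3 H3] := p_lim e20.
pose N4 := (20 * N3)%N; pose N := (maxn N2 N4).+1.
have psum_p n : (N4 <= n)%N -> \sum_(k < n) p k.+1 <= 3 / 5 * n%:R.
  move=> n4; have N3n : (N3 <= n)%N by apply: leq_trans n4; rewrite leq_pmull.
  apply: (@le_trans _ _ (\sum_(k < n) (11 / 20 + (k < N3)%N%:R))).
    apply: ler_sum => k _; have [kN|Nk] := ltnP k N3; first by have /andP[_ h] := p01 k.+1; rewrite /=; lra.
    by have := H3 k.+1 (leqW Nk); rewrite ler_distl => /andP[_ h]; rewrite /=; lra.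
  rewrite big_split/= sumr_const card_ord -mulr_natr.
  have hK : \sum_(k < n) (k < N3)%N%:R <= N3%:R :> R.
    rewrite -(subnKC N3n) big_split_ord/= [X in _ + X]big1 ?addr0; last first.
      by move=> k _; rewrite ltnNge leq_addr.
    by rewrite (eq_bigr (fun=> 1)) ?sumr_const ?card_ord// => k _; rewrite ltn_ord.
  have : (20 * N3%:R : R) <= n%:R by rewrite -natrM ler_nat.
  by move: hK; move: (\sum_(k < n) _) => S; lra.
have qN := q_gt0 N.
pose C2 := 80 + (q N)^-1; have C20 : 80 <= C2 by rewrite lerDl invr_ge0 ltW.
exists (C2 * C1); split; first by rewrite mulr_ge0 ?(ltW C10)//; lra.
move=> E d D D0 E0 Ed dD rec M.
pose B := C1 * (M%:R * q M).
have jB j : (j <= M)%N -> j%:R * q j <= B by move=> jM; exact: H1.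
have B0 : 0 <= B by rewrite mulr_ge0 ?(ltW C10) ?mulr_ge0.
suff main n : (n <= M)%N -> E n <= C2 * D * B.
  rewrite (_ : C2 * C1 * D * (M%:R * q M) = C2 * D * B); last by rewrite /B; ring.
  exact: main.
have [k] := ubnP n; elim: k n => // k IH n; rewrite ltnS => nk nM.
have DB : 0 <= D * B by rewrite mulr_ge0.
have [nN|Nn] := leqP n N.
  apply: le_trans (Ed n) _; apply: le_trans (dD n) _.
  rewrite -mulrA mulrCA ler_wpM2l//.
  have : n%:R * q N <= B.
    by apply: le_trans (jB n nM); rewrite ler_wpM2l// q_noninc.
  rewrite -ler_pdivlMr// => h; apply: (le_trans h); rewrite mulrC ler_wpM2r// /C2; lra.
have n0 : (0 : R) < n%:R by rewrite ltr0n (leq_trans _ Nn).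
have n2 : (N2 <= n)%N by rewrite (leq_trans _ (ltnW Nn))// leqW// leq_maxl.
have n4 : (N4 <= n)%N by rewrite (leq_trans _ (ltnW Nn))// leqW// leq_maxr.
rewrite -(ler_pM2l n0); apply: le_trans (rec n) _.
apply: (@le_trans _ _ (\sum_(j < n) (5 / 4 * (C2 * D * B) * p j.+1 + 5 * D * n%:R * q (n - j.+1)%N))).
  apply: ler_sum => j _; apply: lerD.
    have jn : (n - j.+1 < n)%N by rewrite ltn_subrL (leq_ltn_trans _ (ltn_ord j)).
    have := IH _ (leq_trans jn nk) (leq_trans (ltnW jn) nM) => h.
    have /andP[p0 _] := p01 j.+1; rewrite [leRHS](_ : _ = 5 / 4 * (p j.+1 * (C2 * D * B))); last by ring.
    by rewrite ler_wpM2l// ler_wpM2l.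
  rewrite [leRHS](_ : _ = 5 * (D * n%:R * q (n - j.+1)%N)); last by ring.
  rewrite ler_wpM2l// ler_wpM2r//; apply: le_trans (dD _) _.
  by rewrite ler_wpM2l// ler_nat.
rewrite big_split/= -!mulr_sumr -psum_rev.
have Qn0 : 0 <= psum n by exact: sumr_ge0.
have Qn : psum n <= 4 * B.
  have := H2 n n2; rewrite ler_distl => /andP[h _]; have := jB n nM; lra.
have hp := psum_p n n4.
have CDB : 0 <= C2 * D * B by rewrite -mulrA mulr_ge0//; lra.
have h1 : 5 / 4 * (C2 * D * B) * \sum_(i < n) p i.+1 <= 5 / 4 * (C2 * D * B) * (3 / 5 * n%:R).
  by rewrite ler_wpM2l// mulr_ge0.
have h2 : 5 * D * n%:R * psum n <= 5 * D * n%:R * (4 * B).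
  by rewrite ler_wpM2l// !mulr_ge0// ltW.
have h3 : 80 * (D * B) <= C2 * (D * B) by rewrite ler_wpM2r.
apply: (le_trans (lerD h1 h2)).
have -> : 5 / 4 * (C2 * D * B) * (3 / 5 * n%:R) + 5 * D * n%:R * (4 * B) =
  n%:R * (3 / 4 * (C2 * (D * B)) + 20 * (D * B)) by field.
by rewrite ler_pM2l// -(mulrA C2); lra.
Qed.

End renewal_sequence.

Section positive_walk.
Context {R : realType}.
Variable Q : probability (path R) R.
Hypothesis MP : markov_property Q.
Variable a : nat -> R.
Hypothesis a_gt0 : forall n, (0 < n)%N -> 0 < a n.
Hypothesis CLT : forall (f : R -> R) (M : R), continuous f -> (forall x, `|f x| <= M) ->
  Ex Q (fun x => f (walk n x / a n)) @[n --> \oo] --> Ex std_normal f.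
Variables b c : R.
Hypothesis step_lattice : pr Q [set x | lattice b c (x 0%N)] = 1.
Implicit Types (e s : R) (n k m N : nat).

Notation q n := (pr Q (positive n)).
Notation p n := (pr Q [set y : path R | 0 < walk n y]).

Lemma pr_positive0 : q 0%N = 1.
Proof. by rewrite positive0 prT. Qed.

Lemma pr_positive_noninc n m : (n <= m)%N -> q m <= q n.
Proof.
move=> nm; apply: le_pr; try exact: measurable_positive.
by move=> x h k /andP[k0 kn]; apply: h; rewrite k0 (leq_trans kn).
Qed.

Lemma pr_walk01 n : 0 <= p n <= 1.
Proof. by rewrite pr_ge0 pr_le1//; exact: measurable_walk_gt0. Qed.

Let plim := pr_walk_gt0 a_gt0 CLT.
Let sp := spitzer_pr MP step_lattice.
Let qge0 n : 0 <= q n := pr_ge0 Q (positive n).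

Lemma pr_positive_gt0 n : 0 < q n.
Proof.
exact: (q_gt0 pr_positive0 qge0 pr_positive_noninc pr_walk01 sp plim).
Qed.

Lemma pr_positive_ratio e : 0 < e -> exists N, forall m n, (N <= m)%N -> (m <= n)%N ->
  2 * m%:R * (1 - e) * q m <= (n + m)%:R * q n.
Proof.
exact: (q_ratio pr_positive0 qge0 pr_positive_noninc pr_walk01 sp plim).
Qed.

(** Conditioned to stay positive, the n-th position is of order a_n, with a
    truncated second moment linear in n. *)
Lemma Ex_positive_trunc_sq : exists C N0, 0 <= C /\ forall N n, (N0 <= N)%N ->
  Ex Q (fun x => \1_(positive n) x * trunc_sq (walk n x / a N)) <= C * (n%:R / N%:R) * q n.
Proof.
have [C [C0 HC]] := spitzer_bound pr_positive0 qge0 pr_positive_noninc pr_walk01 sp plim.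
have [C' [N0 [C'0 H]]] := cos_walk_le MP a_gt0 CLT ler01.
exists (64 * (C * C')), N0; split; first by rewrite !mulr_ge0.
move=> N n NN; have bp : bmf (\1_(positive n) : path R -> R) := bmf_ind (measurable_positive n).
have bc m s : bmf (fun x : path R => 1 - cos (s * walk m x)).
  by apply: bmfB; [exact: bmf_cst|exact: bmf_cos_walk].
have -> : 64 * (C * C') * (n%:R / N%:R) * q n = 64 * (C * (C' / N%:R) * (n%:R * q n)) by ring.
apply: Ex_trunc_sq => //.
- by apply: measurable_funM => //; exact: measurable_walk.
move=> s s01.
have cge0 m (t : R) x : 0 <= 1 - cos (t * walk m x) by rewrite subr_ge0 cos_le1.
have := HC (fun n => Ex Q (fun x => \1_(positive n) x * (1 - cos (s / a N * walk n x))))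
  (fun k => Ex Q (fun x => 1 - cos (s / a N * walk k x))) (C' / N%:R).
rewrite (eq_Ex _ (_ : forall x, _ = \1_(positive n) x * (1 - cos (s / a N * walk n x)))); last first.
  by move=> x; rewrite mulrA mulrAC.
apply => //.
- by rewrite divr_ge0.
- by move=> m; apply: Ex_ge0 => x; rewrite mulr_ge0// indicE.
- move=> m; apply: le_Ex => //; first by apply: bmfM => //; apply: bmf_ind; exact: measurable_positive.
  by move=> x; rewrite ler_piMl// indicE; case: (_ \in _).
- by move=> k; apply: le_trans (H N NN k s s01) _; rewrite mulrA mulrAC.
by move=> m; exact: (spitzer_cos MP step_lattice m (s / a N)).
Qed.

End positive_walk.

(** * Sine transform of the surviving walk *)

Section sine_estimates.
Context {R : realType}.
Implicit Types (u l x L : R).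

Lemma norm_sin_sub u : `|sin u - u| <= u ^+ 2.
Proof.
wlog u0 : u / 0 <= u.
  move=> h; have [/h//|u0] := leP 0 u.
  have u1 : 0 <= - u by rewrite oppr_ge0 ltW.
  by have := h _ u1; rewrite sinN sqrrN -opprD normrN.
have [->|un0] := eqVneq u 0; first by rewrite sin0 subrr normr0 sqr_ge0.
have up : 0 < u by rewrite lt_neqAle eq_sym un0.
have [x xu] := MVT up (fun z _ => is_derive_sin z) (continuous_subspaceT (@continuous_sin R)).
rewrite sin0 !subr0 => ->; move: xu; rewrite in_itv/= => /andP[x0 x1].
rewrite -[X in _ - X]mul1r -mulrBl normrM (ger0_norm u0) expr2 ler_wpM2r//.
have := lipschitz_cos x 0; rewrite cos0 subr0 (ger0_norm (ltW x0)) => h.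
exact: le_trans h (ltW x1).
Qed.

Lemma sin_scale_le L l x : 0 <= l <= L ->
  `|sin (l * x) - l * sin x| <= (L ^+ 2 + L + 1) * trunc_sq x.
Proof.
move=> /andP[l0 lL]; have L0 : 0 <= L := le_trans l0 lL.
have [x1|x1] := leP 1 `|x|.
  rewrite trunc_sq_ge1// mulr1; apply: le_trans (ler_normB _ _) _.
  have h1 := norm_sin_le1 (l * x); have := norm_sin_le1 x; rewrite normrM (ger0_norm l0).
  have := normr_ge0 (sin x); have := sqr_ge0 L; nra.
have -> : trunc_sq x = x ^+ 2.
  rewrite /trunc_sq min_r// -[x ^+ 2]real_normK ?num_real// expr_le1// ltW//.
have -> : sin (l * x) - l * sin x = (sin (l * x) - l * x) - l * (sin x - x) by ring.
apply: le_trans (ler_normB _ _) _; rewrite [X in _ + X]normrM (ger0_norm l0).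
have h1 := norm_sin_sub (l * x); have h2 := norm_sin_sub x; rewrite exprMn in h1.
have l2 : l ^+ 2 <= L ^+ 2 by rewrite ler_sqr ?nnegrE.
have := sqr_ge0 x; move: (x ^+ 2) h1 h2 => X h1 h2 X0.
have : l ^+ 2 * X <= L ^+ 2 * X by rewrite ler_wpM2r.
have : l * `|sin x - x| <= L * X by apply: ler_pM.
by lra.
Qed.

Lemma expR_sub1_le u : expR u - 1 <= u * expR u.
Proof.
have := expR_ge1Dx (- u); rewrite expRN; have e0 := expR_gt0 u.
rewrite -(ler_pM2r e0) mulVf ?gt_eqF//; lra.
Qed.

End sine_estimates.

Section sine_transform.
Context {R : realType}.
Variable Q : probability (path R) R.
Hypothesis MP : markov_property Q.
Variable a : nat -> R.
Hypothesis a_gt0 : forall n, (0 < n)%N -> 0 < a n.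
Hypothesis CLT : forall (f : R -> R) (M : R), continuous f -> (forall x, `|f x| <= M) ->
  Ex Q (fun x => f (walk n x / a n)) @[n --> \oo] --> Ex std_normal f.
Variables b c : R.
Hypothesis step_lattice : pr Q [set x | lattice b c (x 0%N)] = 1.
Implicit Types (e s l L : R) (n k m N j : nat).

Notation q n := (pr Q (positive n)).

Let plim L e (e0 : 0 < e) := cf_uniform MP a_gt0 CLT L e0.
Let bpos n : bmf (\1_(positive n) : path R -> R) := bmf_ind (measurable_positive n).

Definition exit_at j : set (path R) := [set x | positive j x /\ walk j.+1 x <= 0].

Lemma measurable_exit_at j : measurable (exit_at j).
Proof.
apply: measurableI; first exact: measurable_positive.
exact: (measurable_walk_set j.+1 (measurable_le 0)).
Qed.

Let bex j : bmf (\1_(exit_at j) : path R -> R) := bmf_ind (measurable_exit_at j).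

Lemma indic_positiveS j (x : path R) :
  \1_(positive j) x = \1_(positive j.+1) x + \1_(exit_at j) x :> R.
Proof.
rewrite !indicE; case: (boolP (x \in positive j)) => [/set_mem xp|].
  have [w0|w0] := ltP 0 (walk j.+1 x).
    rewrite mem_set ?memNset ?addr0//; first by move=> [_]; rewrite leNgt w0.
    by apply/positiveS.
  rewrite memNset ?mem_set ?add0r//; first by move=> /positiveS[_]; rewrite ltNge w0.
rewrite notin_setE => xp; rewrite !memNset ?addr0//; first by move=> [].
by move=> /positiveS[].
Qed.

Lemma pr_exit_at j : pr Q (exit_at j) = q j - q j.+1.
Proof.
apply/eqP; rewrite eq_sym subr_eq addrC; apply/eqP.
have mp n := measurable_positive (R := R) n; have me := measurable_exit_at j.
rewrite -!Ex_ind// -ExD; [|exact: bpos|exact: bex].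
by apply: eq_Ex => x; exact: indic_positiveS.
Qed.

Lemma depends_positive n : depends n (\1_(positive n) : path R -> R).
Proof. exact: (past_depends_ind (@past_positive R n)). Qed.

Definition pwcf n s := wcf Q (\1_(positive n)) n s.
Definition ewcf j s := wcf Q (\1_(exit_at j)) j.+1 s.

Lemma pwcfS j s : pwcf j.+1 s = pwcf j s * cf Q s - ewcf j s.
Proof.
have := wcfM MP 1 s (bpos j) (@depends_positive j); rewrite expr1 addn1 -/(pwcf j s) => <-.
apply/eqP; rewrite eq_sym subr_eq; apply/eqP; rewrite /pwcf /ewcf /wcf.
congr Complex => /=.
  rewrite -ExD; [|by apply: bmfM => //; exact: bmf_cos_walk|by apply: bmfM => //; exact: bmf_cos_walk].
  by apply: eq_Ex => x; rewrite indic_positiveS mulrDl.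
rewrite -ExD; [|by apply: bmfM => //; exact: bmf_sin_walk|by apply: bmfM => //; exact: bmf_sin_walk].
by apply: eq_Ex => x; rewrite indic_positiveS mulrDl.
Qed.

Lemma pwcf_unfold j m s : pwcf (j + m) s =
  pwcf j s * cf Q s ^+ m - \sum_(k < m) ewcf (j + k) s * cf Q s ^+ (m - k.+1).
Proof.
elim: m => [|m IH]; first by rewrite addn0 big_ord0 expr0 mulr1 subr0.
rewrite addnS pwcfS IH big_ord_recr/= subnn expr0 mulr1 mulrBl -mulrA -exprSr opprD addrA.
congr (_ - _ - _); rewrite mulr_suml; apply: eq_bigr => k _.
by rewrite -mulrA -exprSr subSn// subnSK// ltn_ord.
Qed.

(** The exit position is at most the last step in absolute value. Either that step
    is small on the scale of a_N, and so is the sine, or a big step occurs. *)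
Lemma Im_ewcf_le j s eta L N : (0 < N)%N -> 0 < eta -> 0 <= s <= L ->
  `|Im (ewcf j (s / a N))| <= L * eta * pr Q (exit_at j) +
     q j * pr Q [set x | eta * a N <= `|x 0%N|].
Proof.
move=> N0 eta0 /andP[s0 sL]; have aN0 := a_gt0 N0; have L0 := le_trans s0 sL.
pose B := [set x : path R | eta * a N <= `|x 0%N|].
have mB : measurable B := measurable_step (measurable_norm_ge (eta * a N)).
have bB : bmf (\1_B : path R -> R) := bmf_ind mB.
have me := measurable_exit_at j; have mp := measurable_positive (R := R) j.
rewrite -!Ex_ind// -(Ex_markov MP (bpos j) bB (@depends_positive j)).
have bsh : bmf (fun x : path R => \1_(positive j) x * \1_B (shift j x) : R).
  by apply: bmfM => //; exact: (bmf_shift j bB).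
rewrite -ExZ//.
rewrite -ExD//; last by apply: bmfM; [exact: bmf_cst|exact: bex].
rewrite /ewcf /wcf/=; apply: norm_Ex_le.
- by apply: bmfM; [exact: bex|exact: bmf_sin_walk].
- by apply: bmfD => //; apply: bmfM; [exact: bmf_cst|exact: bex].
move=> x; rewrite normrM [Num.norm (\1_ _ _)]ger0_norm ?indicE//.
case: (boolP (x \in exit_at j)) => [/set_mem [xp x0]|_]; last first.
  by rewrite mul0r mulr0 add0r mulr_ge0// indicE.
rewrite (mem_set xp) !mul1r mulr1.
have [xB|xB] := boolP (shift j x \in B).
  rewrite -[leLHS]add0r lerD ?norm_sin_le1// !mulr_ge0// ltW//.
rewrite addr0; move: xB; rewrite notin_setE /B/= => /negP; rewrite -ltNge {1}/shift addn0 => xj.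
apply: le_trans (norm_sin_le _) _; rewrite normrM normrM normfV (ger0_norm s0) (gtr0_norm aN0).
have wj : `|walk j.+1 x| <= `|x j|.
  have wS : walk j.+1 x = walk j x + x j by rewrite /walk big_ord_recr.
  have wj0 : 0 <= walk j x.
    case: j xp {x0 xj wS bsh me mp} => [|j] xp; first by rewrite walk0.
    by apply/ltW/xp; rewrite leqnn.
  rewrite ler0_norm// wS; have := ler_norm (- x j); rewrite normrN; lra.
rewrite mulrAC ler_pdivrMr// -mulrA; apply: ler_pM => //.
exact: le_trans wj (ltW xj).
Qed.

(** Up to time N the sine transform decays like a Gaussian: when the walk leaves
    the half-line it does so near 0, where the sine vanishes. *)
Lemma sine_propagation L e : 0 <= L -> 0 < e -> exists N0, forall N, (N0 <= N)%N ->
  forall j m s, (j + m <= N)%N -> 0 <= s <= L ->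
  `|Im (pwcf (j + m) (s / a N)) - gaussian (m%:R / N%:R) s * Im (pwcf j (s / a N))| <= e * q j.
Proof.
move=> L0 e0; have e4 : 0 < e / 4 by rewrite divr_gt0.
have [N1 H1] := cf_power a_gt0 (cf0 Q) (normc_cf_le1 Q) (@cf_uniformly_continuous _ Q) plim L0 e4.
pose eta := e / 4 / (L + 1).
have L1 : 0 < L + 1 by rewrite ltr_wpDl.
have eta0 : 0 < eta by rewrite divr_gt0.
have [N2 H2] := pr_big_step MP a_gt0 CLT eta0 e4.
exists (maxn N1 N2).+1 => N NN j m s jmN sL.
have N0 : (0 < N)%N by apply: leq_ltn_trans NN.
have n1 : (N1 <= N)%N by rewrite (leq_trans _ (ltnW NN))// leq_maxl.
have n2 : (N2 <= N)%N by rewrite (leq_trans _ (ltnW NN))// leq_maxr.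
set t := s / a N.
pose g k := gaussian (k%:R / N%:R) s.
have Hg k : (k <= N)%N -> normc (cf Q t ^+ k - (g k)%:C%C) <= e / 4.
  by move=> kN; have := H1 N n1 k s kN sL; rewrite /g /gaussian [s ^+ 2 * _]mulrC.
have key (z : R[i]) (A : R) k : (k <= N)%N -> normc z <= A ->
    `|Im (z * cf Q t ^+ k) - g k * Im z| <= e / 4 * A.
  move=> kN zA.
  have -> : Im (z * cf Q t ^+ k) - g k * Im z = Im (z * (cf Q t ^+ k - (g k)%:C%C)).
    by case: z {zA} => z1 z2; case: (cf Q t ^+ k) => h1 h2 /=; ring.
  apply: le_trans (normc_Im _) _; rewrite normcM mulrC.
  by apply: ler_pM; rewrite ?normc_ge0// Hg.
have mp n := measurable_positive (R := R) n.
have pA n : normc (pwcf n t) <= q n.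
  by rewrite -Ex_ind//; apply: normc_wcf_ge0 => // x; rewrite indicE.
have eA n : normc (ewcf n t) <= pr Q (exit_at n).
  by rewrite -Ex_ind; [apply: normc_wcf_ge0; [exact: bex|move=> x; rewrite indicE]|exact: measurable_exit_at].
rewrite pwcf_unfold ImB.
have jN : (j <= N)%N by apply: leq_trans jmN; exact: leq_addr.
have mN : (m <= N)%N by apply: leq_trans jmN; exact: leq_addl.
have sumIm : Im (\sum_(k < m) ewcf (j + k) t * cf Q t ^+ (m - k.+1)) =
    \sum_(k < m) Im (ewcf (j + k) t * cf Q t ^+ (m - k.+1)).
  elim/big_ind2: _ => // x1 x2 y1 y2 <- <-.
  by case: x2 => ? ?; case: y2.
rewrite sumIm addrAC; apply: le_trans (ler_normB _ _) _.
have g01 k : 0 <= g k <= 1.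
  by rewrite gaussian_ge0 gaussian_le1// divr_ge0.
set p := pr Q [set x : path R | eta * a N <= `|x 0%N|].
have p0 : 0 <= p by apply: pr_ge0.
have Np : N%:R * p <= e / 4 := H2 N n2.
have term k : (k < m)%N -> `|Im (ewcf (j + k) t * cf Q t ^+ (m - k.+1))| <=
    e / 2 * pr Q (exit_at (j + k)) + q j * p.
  move=> km; have mkN : (m - k.+1 <= N)%N by rewrite (leq_trans _ mN)// leq_subr.
  have h1 := key _ _ _ mkN (eA (j + k)%N); have h2 := Im_ewcf_le (j + k) N0 eta0 sL.
  have qq : q (j + k) * p <= q j * p.
    by rewrite ler_wpM2r// pr_positive_noninc// leq_addr.
  have Le : L * eta <= e / 4.
    by rewrite /eta mulrA ler_pdivrMr//; nra.
  have r0 : 0 <= pr Q (exit_at (j + k)) := pr_ge0 _ _.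
  have Ler : L * eta * pr Q (exit_at (j + k)) <= e / 4 * pr Q (exit_at (j + k)) by rewrite ler_wpM2r.
  have /andP[ga0 ga1] := g01 (m - k.+1)%N.
  have -> : Im (ewcf (j + k) t * cf Q t ^+ (m - k.+1)) =
    (Im (ewcf (j + k) t * cf Q t ^+ (m - k.+1)) - g (m - k.+1)%N * Im (ewcf (j + k) t)) +
    g (m - k.+1)%N * Im (ewcf (j + k) t) by rewrite subrK.
  apply: le_trans (ler_normD _ _) _; rewrite [X in _ + X]normrM (ger0_norm ga0).
  have : g (m - k.+1)%N * `|Im (ewcf (j + k) t)| <= `|Im (ewcf (j + k) t)| by rewrite ler_piMl.
  by rewrite -/t in h2; rewrite -/p in h2; lra.
have tele : \sum_(k < m) pr Q (exit_at (j + k)) <= q j.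
  have -> : \sum_(k < m) pr Q (exit_at (j + k)) = q j - q (j + m).
    elim: m {jmN mN sumIm term} => [|m IH]; first by rewrite big_ord0 addn0 subrr.
    by rewrite big_ord_recr/= IH pr_exit_at addnS; ring.
  by rewrite gerBl pr_ge0.
have hsum : `|\sum_(k < m) Im (ewcf (j + k) t * cf Q t ^+ (m - k.+1))| <= 3 / 4 * e * q j.
  apply: le_trans (ler_norm_sum _ _ _) _.
  apply: (@le_trans _ _ (\sum_(k < m) (e / 2 * pr Q (exit_at (j + k)) + q j * p))).
    by apply: ler_sum => k _; exact: term.
  rewrite big_split/= -mulr_sumr sumr_const card_ord -[_ *+ m]mulr_natr.
  have q0 : 0 <= q j := pr_ge0 _ _.
  have h1 : e / 2 * \sum_(k < m) pr Q (exit_at (j + k)) <= e / 2 * q j.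
    by rewrite ler_wpM2l// ltW// divr_gt0.
  have h2 : q j * p * m%:R <= q j * (e / 4).
    rewrite -mulrA ler_wpM2l//; apply: le_trans Np; rewrite mulrC ler_wpM2r// ler_nat//.
  by lra.
have := key _ _ _ mN (pA j); rewrite -/(g m); lra.
Qed.

(** The ratio estimate allows 3/2 in the limit at each halving; 8/5 leaves room
    and stays below 2, so that q (N / 2^i) / 2^i is negligible against q N. *)
Lemma pr_positive_halving i : exists N0, forall N, (N0 <= N)%N ->
  q (N %/ 2 ^ i) <= (8 / 5) ^+ i * q N.
Proof.
have e0 : (0 : R) < 100^-1 by rewrite invr_gt0.
have [K HK] := pr_positive_ratio MP a_gt0 CLT step_lattice e0.
elim: i => [|i [N0 IH]].
  by exists 0%N => N _; rewrite expn0 divn1 expr0 mul1r.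
exists (2 * (maxn N0 (maxn K 20)))%N => N NN.
pose m := (N %/ 2)%N.
have hm : (maxn N0 (maxn K 20) <= m)%N by rewrite leq_divRL// mulnC.
have m0 : (N0 <= m)%N by rewrite (leq_trans _ hm)// leq_maxl.
have mK : (K <= m)%N by rewrite (leq_trans _ hm)// !leq_max leqnn orbT.
have m20 : (20 <= m)%N by rewrite (leq_trans _ hm)// !leq_max leqnn !orbT.
rewrite expnS divnMA -/m; apply: le_trans (IH m m0) _.
rewrite exprSr -mulrA ler_wpM2l ?exprn_ge0//.
have mN : (m <= N)%N by rewrite leq_div.
have Nm : (N <= 2 * m + 1)%N.
  by rewrite {1}(divn_eq N 2) -/m mulnC leq_add2l -ltnS ltn_mod.
have := HK m N mK mN; rewrite natrD.
have NR : (N%:R : R) <= 2 * m%:R + 1 by rewrite -natrM natr1 ler_nat -addn1.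
have mR : (20 : R) <= m%:R by rewrite ler_nat.
have qN : 0 <= q N := pr_ge0 _ _; have qm : 0 <= q m := pr_ge0 _ _.
move: (q N) (q m) (N%:R : R) (m%:R : R) qN qm NR mR => x y k l x0 y0 kl l20 h.
have h1 : (k + l) * x <= (3 * l + 1) * x by rewrite ler_wpM2r//; lra.
have h2 : l * y * (198 / 100) <= l * x * (305 / 100) by nra.
have h3 : l * (y * (198 / 100)) <= l * (x * (305 / 100)) by lra.
by rewrite ler_pM2l in h3; lra.
Qed.

(** The factor exp(1/2) undoes the Gaussian decay of the transform at frequency
    1 / a_N. *)
Definition sine_const N := Im (pwcf N (1 / a N)) * expR (2^-1).

Lemma norm_Im_pwcf n s : `|Im (pwcf n s)| <= q n.
Proof.
apply: le_trans (normc_Im _) _; rewrite -Ex_ind; last exact: measurable_positive.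
by apply: normc_wcf_ge0 => // x; rewrite indicE.
Qed.

(** The sine is linear up to a quadratic error, bounded at infinity. *)
Lemma sine_split L n N l : 0 <= l <= L ->
  `|Im (pwcf n (l / a N)) - l * Im (pwcf n (1 / a N))| <=
  (L ^+ 2 + L + 1) * Ex Q (fun x => \1_(positive n) x * trunc_sq (walk n x / a N)).
Proof.
move=> lL; rewrite /pwcf /wcf/=.
have bt : bmf (fun x : path R => \1_(positive n) x * trunc_sq (walk n x / a N) : R).
  apply: bmfM; first exact: bpos.
  apply: bmf_trunc_sq; apply: measurable_funM => //; exact: measurable_walk.
rewrite -!ExZ//; last by apply: bmfM => //; exact: bmf_sin_walk.
rewrite -ExB; [|by apply: bmfM => //; exact: bmf_sin_walk|]; last first.
  by apply: bmfM; [exact: bmf_cst|apply: bmfM => //; exact: bmf_sin_walk].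
apply: norm_Ex_le.
- apply: bmfB; first by apply: bmfM => //; exact: bmf_sin_walk.
  by apply: bmfM; [exact: bmf_cst|apply: bmfM => //; exact: bmf_sin_walk].
- by apply: bmfM => //; exact: bmf_cst.
move=> x; have -> : \1_(positive n) x * sin (l / a N * walk n x) - l * (\1_(positive n) x * sin (1 / a N * walk n x))
  = \1_(positive n) x * (sin (l * (walk n x / a N)) - l * sin (walk n x / a N)).
  by rewrite mul1r [l / a N * _]mulrAC -mulrA [(a N)^-1 * _]mulrC; ring.
rewrite normrM ger0_norm ?indicE//= [leRHS]mulrCA ler_wpM2l//; exact: sin_scale_le.
Qed.

(** For a walk conditioned to stay positive, the sine transform at time n of
    frequency l is proportional to l exp(-l^2 n / 2N): run the propagation from a
    small fraction of N, where the position is small and the sine is linear. *)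
Lemma sine_relation L e : 1 <= L -> 0 < e -> exists N0, forall N n, (N0 <= N)%N ->
  (N <= 2 * n)%N -> (n <= N)%N -> forall s, 0 <= s <= L ->
  `|Im (pwcf n (s / a N)) * expR (n%:R / N%:R * s ^+ 2 / 2) - s * sine_const N| <= e * q N.
Proof.
move=> L1 e0; have L0 : 0 <= L by lra.
have [C [N1 [C0 H1]]] := Ex_positive_trunc_sq MP a_gt0 CLT step_lattice.
pose EL := expR (L ^+ 2).
have EL1 : 1 <= EL by rewrite -expR0 ler_expR sqr_ge0.
pose D := (L ^+ 2 + L + 1) * C + (1 + L) * (L ^+ 2 / 2) * EL.
have D0 : 0 <= D by rewrite addr_ge0// !mulr_ge0 ?addr_ge0 ?sqr_ge0//; lra.
have [i Hi] : exists i, D * (4 / 5) ^+ i <= e / 2.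
  have cv : (4 / 5) ^+ n @[n --> \oo] --> (0 : R).
    by apply: cvg_expr; rewrite ger0_norm; lra.
  have d0 : 0 < e / 2 / (D + 1) by rewrite !divr_gt0// ltr_wpDl.
  have /cvgrPdist_le /(_ _ d0) [i _ /(_ i (leqnn i))] := cv.
  rewrite sub0r normrN ger0_norm ?exprn_ge0//.
  rewrite ler_pdivlMr ?ltr_wpDl// => h; exists i.
  have : 0 <= (4 / 5 : R) ^+ i by rewrite exprn_ge0//; lra.
  by lra.
pose e1 := e / (8 * L * EL * (8 / 5) ^+ i).
have P0 : 0 < (8 / 5 : R) ^+ i by rewrite exprn_gt0//; lra.
have d1 : 0 < 8 * L * EL * (8 / 5) ^+ i by rewrite !mulr_gt0//; lra.
have e10 : 0 < e1 by rewrite divr_gt0.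
have [N2 H2] := sine_propagation L0 e10.
have [N3 H3] := pr_positive_halving i.+1.
exists (maxn N1 (maxn N2 N3)).+1 => N n NN Nn nN s sL.
have N0 : (0 < N)%N by apply: leq_ltn_trans NN.
have n1 : (N1 <= N)%N by rewrite (leq_trans _ (ltnW NN))// leq_maxl.
have n2 : (N2 <= N)%N by rewrite (leq_trans _ (ltnW NN))// !leq_max leqnn orbT.
have n3 : (N3 <= N)%N by rewrite (leq_trans _ (ltnW NN))// !leq_max leqnn !orbT.
have aN0 := a_gt0 N0; have NR : (0 : R) < N%:R by rewrite ltr0n.
have /andP[s0 s1] := sL.
pose n0 := (N %/ 2 ^ i.+1)%N.
have n0n : (n0 <= n)%N.
  apply: (@leq_trans (N %/ 2)); first by rewrite /n0 expnS divnMA leq_div.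
  by have := leq_div2r 2 Nn; rewrite mulKn.
have qn0 : q n0 <= (8 / 5) ^+ i.+1 * q N := H3 N n3.
pose r : R := n0%:R / N%:R.
have r0 : 0 <= r by rewrite divr_ge0.
have rP : r * (8 / 5) ^+ i.+1 <= (4 / 5) ^+ i.
  have h : n0%:R * 2 ^+ i.+1 <= N%:R :> R.
    by rewrite -natrX -natrM ler_nat leq_divM.
  have -> : (8 / 5 : R) ^+ i.+1 = 2 ^+ i.+1 * (4 / 5) ^+ i.+1.
    by rewrite -exprMn; congr (_ ^+ _); lra.
  rewrite mulrA; have p0 : 0 <= (4 / 5 : R) ^+ i by rewrite exprn_ge0//; lra.
  have : r * 2 ^+ i.+1 <= 1 by rewrite /r mulrAC ler_pdivrMr// mul1r.
  have := mulr_ge0 r0 (exprn_ge0 i.+1 (ler0n R 2)).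
  by rewrite [(4 / 5) ^+ i.+1]exprS; nra.
have AE l : 0 <= l <= L -> `|Im (pwcf n0 (l / a N)) - l * Im (pwcf n0 (1 / a N))| <=
    (L ^+ 2 + L + 1) * C * r * q n0.
  move=> lL; apply: le_trans (sine_split n0 N lL) _.
  have D10 : 0 <= L ^+ 2 + L + 1 by rewrite !addr_ge0// sqr_ge0.
  by apply: le_trans (ler_wpM2l D10 (H1 N n0 n1)) _; rewrite !mulrA.
have xE l : 0 <= l <= L -> 0 <= expR (r * l ^+ 2 / 2) - 1 <= r * (L ^+ 2 / 2) * EL.
  move=> /andP[l0 lL]; have u0 : 0 <= r * l ^+ 2 / 2 by rewrite !mulr_ge0 ?sqr_ge0.
  have l2 : l ^+ 2 <= L ^+ 2 by rewrite ler_sqr ?nnegrE.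
  have r1 : r <= 1 by rewrite /r ler_pdivrMr// mul1r ler_nat leq_div.
  have L20 := sqr_ge0 L; have l20 := sqr_ge0 l.
  rewrite subr_ge0 -[X in X <= expR _]expR0 ler_expR u0/=.
  apply: le_trans (expR_sub1_le _) _; apply: ler_pM; rewrite ?expR_ge0//.
    by rewrite -mulrA ler_wpM2l// ler_wpM2r// invr_ge0.
  by rewrite ler_expR; nra.
have prop k l : (n0 <= k)%N -> (k <= N)%N -> 0 <= l <= L ->
    `|Im (pwcf k (l / a N)) * expR (k%:R / N%:R * l ^+ 2 / 2) -
      Im (pwcf n0 (l / a N)) * expR (r * l ^+ 2 / 2)| <= e1 * q n0 * EL.
  move=> n0k kN lL.
  have kE : (n0 + (k - n0) = k)%N by rewrite subnKC.
  have /= := H2 N n2 n0 (k - n0)%N l; rewrite kE => /(_ kN lL) h.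
  have -> : expR (r * l ^+ 2 / 2) = gaussian ((k - n0)%:R / N%:R) l * expR (k%:R / N%:R * l ^+ 2 / 2).
    rewrite /gaussian -expRD; congr expR; rewrite natrB// /r.
    by field; rewrite gt_eqF.
  rewrite mulrA -mulrBl normrM (gtr0_norm (expR_gt0 _)).
  have -> : Im (pwcf n0 (l / a N)) * gaussian ((k - n0)%:R / N%:R) l =
    gaussian ((k - n0)%:R / N%:R) l * Im (pwcf n0 (l / a N)) by rewrite mulrC.
  apply: ler_pM; rewrite ?expR_ge0// ler_expR.
  move: lL => /andP[l0 lL]; have l2 : l ^+ 2 <= L ^+ 2 by rewrite ler_sqr ?nnegrE.
  have : k%:R / N%:R <= 1 :> R by rewrite ler_pdivrMr// mul1r ler_nat.
  have : 0 <= k%:R / N%:R :> R by rewrite divr_ge0.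
  by have := sqr_ge0 l; nra.
have l1 : 0 <= (1 : R) <= L by rewrite L1 ler01.
have hs := prop n s n0n nN sL.
have h1 := prop N 1 (leq_trans n0n nN) (leqnn N) l1.
have := AE s sL; have := xE s sL; have := xE 1 l1.
have := norm_Im_pwcf n0 (s / a N); have := norm_Im_pwcf n0 (1 / a N).
move: hs h1; rewrite /sine_const expr1n mulfV ?gt_eqF// !mul1r.
move: (Im (pwcf n (s / a N)) * _) (Im (pwcf N (a N)^-1) * _) => G K.
move: (Im (pwcf n0 (s / a N))) (Im (pwcf n0 (a N)^-1)) => As A1.
move: (expR (r * s ^+ 2 / 2)) (expR (r * 1 / 2)) => xs x1 hG hK hA1 hAs /andP[x10 x11] /andP[xs0 xs1] hAE.
have q00 : 0 <= q n0 := pr_ge0 _ _.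
have -> : G - s * K = (G - As * xs) - s * (K - A1 * x1) + ((As - s * A1) + (xs - 1) * As - s * ((x1 - 1) * A1)) by ring.
have b1 : `|s * (K - A1 * x1)| <= L * (e1 * q n0 * EL) by rewrite normrM (ger0_norm s0); apply: ler_pM.
have b2 : `|(xs - 1) * As| <= r * (L ^+ 2 / 2) * EL * q n0 by rewrite normrM (ger0_norm xs0); apply: ler_pM.
have b3 : `|s * ((x1 - 1) * A1)| <= L * (r * (L ^+ 2 / 2) * EL * q n0).
  by rewrite !normrM (ger0_norm s0) (ger0_norm x10); do 2! [apply: ler_pM; rewrite ?mulr_ge0//].
apply: le_trans (ler_normD _ _) _.
apply: le_trans (lerD (ler_normB _ _) (ler_normB _ _)) _.
have b4 := ler_normD (As - s * A1) ((xs - 1) * As).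
have e1E : e1 * (8 * L * EL * (8 / 5) ^+ i) = e by rewrite /e1 divfK// gt_eqF.
have qN0 : 0 <= q N := pr_ge0 _ _.
have c1 : (1 + L) * (e1 * q n0 * EL) <= 2 / 5 * e * q N.
  have : (1 + L) * (e1 * q n0 * EL) <= 2 * L * e1 * EL * ((8 / 5) ^+ i.+1 * q N).
    rewrite [leLHS](_ : _ = (1 + L) * e1 * EL * q n0); last by ring.
    have e1E0 : 0 <= e1 * EL by rewrite mulr_ge0 ?(ltW e10) ?(le_trans ler01 EL1).
    rewrite -[(1 + L) * _ * _]mulrA -[2 * L * _ * _]mulrA; apply: ler_pM => //.
      by rewrite mulr_ge0// addr_ge0.
    by rewrite ler_wpM2r// mulr_natl mulr2n lerD2r.
  by rewrite exprS -e1E; clear -MP a_gt0 CLT step_lattice plim bpos bex; lra.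
have c2 : D * (r * q n0) <= e / 2 * q N.
  have : r * q n0 <= (4 / 5) ^+ i * q N.
    apply: (le_trans (y := r * ((8 / 5) ^+ i.+1 * q N))); first by rewrite ler_wpM2l.
    by rewrite mulrA ler_wpM2r.
  move=> /(ler_wpM2l D0) h; apply: le_trans h _; rewrite mulrA ler_wpM2r//.
have : L * (r * (L ^+ 2 / 2) * EL * q n0) + r * (L ^+ 2 / 2) * EL * q n0 + (L ^+ 2 + L + 1) * C * r * q n0 = D * (r * q n0).
  by rewrite /D; ring.
have : 0 <= e * q N by rewrite mulr_ge0// ltW.
by clear -b1 b2 b3 b4 c1 c2 hG hAE MP a_gt0 CLT step_lattice plim bpos bex; lra.
Qed.

End sine_transform.

(** * Smoothed densities *)

Section heat_kernel.
Context {R : realType}.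
Notation mu := (@lebesgue_measure R).
Implicit Types (t u d l x : R).

(** The centred Gaussian density of variance t, in the form in which the local
    limit theorem produces it. *)
Definition heat t u : R := (2 * pi)^-1 * gaussian_cos t u.

Lemma expRN_cube_le (v : R) : 0 < v -> expR (- v) <= 27 / v ^+ 3.
Proof.
move=> v0; have h := expR_ge1Dx (v / 3).
have h3 : v / 3 <= expR (v / 3) by apply: le_trans h; rewrite lerDr.
have e3 : expR v = expR (v / 3) ^+ 3 by rewrite -expRM_natl; congr expR; field.
rewrite expRN ler_pdivlMr ?exprn_gt0// mulrC ler_pdivrMr ?expR_gt0// e3.
have : (v / 3) ^+ 3 <= expR (v / 3) ^+ 3.
  by apply: lerXn2r => //; rewrite nnegrE ?expR_ge0// divr_ge0// ltW.
by rewrite expr_div_n; lra.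
Qed.

Lemma heatE t u : 0 < t ->
  heat t u = (Num.sqrt (2 * pi * t))^-1 * expR (- (u ^+ 2 / (2 * t))).
Proof.
move=> t0; rewrite /heat gaussian_cosE// mulrA; congr (_ * _).
have p0 : 0 < 2 * pi :> R by rewrite mulr_gt0// pi_gt0.
have s1 : Num.sqrt (2 * pi) ^+ 2 = 2 * pi :> R by rewrite sqr_sqrtr// ltW.
have s0 : 0 < Num.sqrt (2 * pi : R) by rewrite sqrtr_gt0.
have t1 : 0 < Num.sqrt t by rewrite sqrtr_gt0.
rewrite [Num.sqrt (2 * pi / t)]sqrtrM ?(ltW p0)// [Num.sqrt (2 * pi * t)]sqrtrM ?(ltW p0)// sqrtrV ?(ltW t0)// -{1}s1.
move: (Num.sqrt (2 * pi)) (Num.sqrt t) s0 t1 => y z y0 z0.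
by field; rewrite !gt_eqF.
Qed.

Lemma heat_ge0 t u : 0 < t -> 0 <= heat t u.
Proof. by move=> t0; rewrite heatE// mulr_ge0 ?expR_ge0// invr_ge0 sqrtr_ge0. Qed.

Lemma heat_le_peak t u d : 0 < d -> d ^+ 2 <= t -> heat t u <= d^-1 * expR (- (u ^+ 2 / (2 * t))).
Proof.
move=> d0 dt; have t0 : 0 < t by apply: lt_le_trans dt; rewrite exprn_gt0.
rewrite heatE// ler_wpM2r ?expR_ge0// lef_pV2 ?posrE ?sqrtr_gt0 ?mulr_gt0 ?pi_gt0//.
rewrite -[leLHS]ger0_norm ?(ltW d0)// -sqrtr_sqr ler_wsqrtr//.
apply: le_trans dt _; rewrite ler_peMl ?(ltW t0)//; have := pi_ge2 R; lra.
Qed.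

Lemma heat_le t u d : 0 < d -> d ^+ 2 <= t -> heat t u <= d^-1.
Proof.
move=> d0 dt; apply: le_trans (heat_le_peak u d0 dt) _.
have t0 : 0 < t by apply: lt_le_trans dt; rewrite exprn_gt0.
rewrite ler_piMr ?invr_ge0 ?(ltW d0)// -expR0 ler_expR oppr_le0 divr_ge0 ?sqr_ge0//.
by rewrite mulr_ge0// ltW.
Qed.

Lemma heat_tail : exists K : R, 0 < K /\ forall t u d v, 0 < d -> d ^+ 2 <= t -> 0 < v ->
  v <= `|u| -> heat t u <= K * t ^+ 3 / (d * v ^+ 6).
Proof.
exists (27 * 2 ^+ 3); split; first by rewrite mulr_gt0.
move=> t u d v d0 dt v0 vu; apply: le_trans (heat_le_peak u d0 dt) _.
have t0 : 0 < t by apply: lt_le_trans dt; rewrite exprn_gt0.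
have w0 : 0 < v ^+ 2 / (2 * t) by rewrite divr_gt0 ?exprn_gt0// mulr_gt0.
have h : expR (- (u ^+ 2 / (2 * t))) <= expR (- (v ^+ 2 / (2 * t))).
  rewrite ler_expR lerN2 ler_wpM2r ?invr_ge0 ?mulr_ge0 ?(ltW t0)//.
  by rewrite -[u ^+ 2]real_normK ?num_real// ler_sqr ?nnegrE// ltW.
apply: le_trans (ler_wpM2l _ (le_trans h (expRN_cube_le w0))) _; first by rewrite invr_ge0 ltW.
by rewrite le_eqVlt; apply/orP; left; apply/eqP; field; rewrite !gt_eqF.
Qed.

Lemma gaussian_le t t' l : t <= t' -> gaussian t' l <= gaussian t l.
Proof. by move=> tt; rewrite ler_expR lerN2 ler_wpM2r// ler_wpM2r// sqr_ge0. Qed.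

Definition gaussian_sqr t l := gaussian t l * (1 + 3 * l ^+ 2).

Lemma integrable_gaussian_sqr t : 0 < t -> mu.-integrable [set: R] (EFin \o gaussian_sqr t).
Proof.
move=> t0; have i3 := integrableZl measurableT 3 (integrable_sqr_gaussian t0).
have := integrableD measurableT (integrable_gaussian t0) i3; apply: eq_integrable => // l _ /=.
by rewrite -EFinM -EFinD /gaussian_sqr mulrDr mulr1; congr (_ + _)%:E; ring.
Qed.

(** The errors are integrated against a fixed Gaussian: on the window of length L
    the transform is known, and outside of it the crude bound Q is at most Q l^2 / L
    up to a factor 3. *)
Lemma sine_inversion t0 : 0 < t0 -> exists C : R, 0 <= C /\ forall t s L (K E Q x : R) (F : R -> R),
  t0 <= t -> t + s = 1 -> 0 <= s -> 1 <= L -> (forall l, F (- l) = - F l) ->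
  (forall l, 0 <= l <= L -> `|F l - l * K * gaussian s l| <= E) ->
  (forall l, `|F l| <= Q) -> `|K| <= 2 * Q ->
  mu.-integrable [set: R] (EFin \o (fun l => gaussian t l * (sin (l * x) * F l))) ->
  `|pi^-1 * \int[mu]_l (gaussian t l * (sin (l * x) * F l)) -
    Num.sqrt (2 / pi) * K * (x * expR (- (x ^+ 2 / 2)))| <= C * (E + Q / L).
Proof.
move=> t00; exists (\int[mu]_l gaussian_sqr t0 l); split.
  by apply: Rintegral_ge0 => l _; rewrite mulr_ge0 ?gaussian_ge0// addr_ge0// mulr_ge0// sqr_ge0.
move=> t s L K E Q x F tt ts s0 L1 Fodd FE FQ KQ iF.
have L0 : 0 < L by lra.
have Q0 : 0 <= Q by apply: le_trans (FQ 0).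
have E0 : 0 <= E by have := FE 0; rewrite lexx (ltW L0) => /(_ isT); apply: le_trans.
have pi0 := @pi_gt0 R.
have i1 := @integrable_gaussian_sin R 1 x ltr01.
have i1K : mu.-integrable [set: R] (EFin \o (fun l => K * (gaussian 1 l * (l * sin (l * x))))).
  by have := integrableZl measurableT K i1; apply: eq_integrable.
have main : Num.sqrt (2 / pi) * K * (x * expR (- (x ^+ 2 / 2))) =
    pi^-1 * \int[mu]_l (K * (gaussian 1 l * (l * sin (l * x)))).
  rewrite RintegralZl// -[X in _ = _ * (_ * X)]/(gaussian_sin 1 x) gaussian_sinE// gaussian_cosE//.
  rewrite !divr1 mulr1.
  have -> : Num.sqrt (2 / pi) = pi^-1 * Num.sqrt (2 * pi) :> R.
    have -> : 2 / pi = pi^-1 ^+ 2 * (2 * pi) :> R by move: pi pi0 => p p0; field; rewrite gt_eqF.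
    by rewrite sqrtrM ?sqr_ge0// sqrtr_sqr ger0_norm// invr_ge0 ltW.
  by ring.
rewrite main -mulrBr normrM -RintegralB//.
have iD : mu.-integrable [set: R] (EFin \o (fun l => gaussian t l * (sin (l * x) * F l) - K * (gaussian 1 l * (l * sin (l * x))))).
  by have := integrableB measurableT iF i1K; apply: eq_integrable.
have p1 : `|pi^-1| <= 1 :> R.
  by rewrite ger0_norm ?invr_ge0 ?(ltW pi0)// invf_le1//; have := pi_ge2 R; lra.
apply: le_trans (ler_piMl (normr_ge0 _) p1) _.
apply: (le_trans (le_normr_Rintegral measurableT iD)).
have iG := integrable_gaussian_sqr t00.
rewrite mulrC -RintegralZl//.
have iZ : mu.-integrable [set: R] (EFin \o (fun l => (E + Q / L) * gaussian_sqr t0 l)).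
  by have := integrableZl measurableT (E + Q / L) iG; apply: eq_integrable.
apply: le_Rintegral => //.
  by have := integrable_abse iD; apply: eq_integrable.
move=> l _.
have -> : gaussian 1 l = gaussian t l * gaussian s l.
  by rewrite /gaussian -expRD -ts; congr expR; ring.
have -> : gaussian t l * (sin (l * x) * F l) - K * (gaussian t l * gaussian s l * (l * sin (l * x))) =
  gaussian t l * (sin (l * x) * (F l - l * K * gaussian s l)) by ring.
have g0 := gaussian_ge0 t l; have gl := gaussian_le l tt; have gl1 := gaussian_le1 l s0.
have gs0 := gaussian_ge0 s l.
rewrite normrM (ger0_norm g0) /gaussian_sqr mulrCA; apply: ler_pM => //.
rewrite normrM; apply: le_trans (ler_piMl (normr_ge0 _) (norm_sin_le1 _)) _.
have l20 := sqr_ge0 l; have QL : 0 <= Q / L by rewrite divr_ge0// ltW.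
have [lL|lL] := leP `|l| L.
  suff : `|F l - l * K * gaussian s l| <= E.
    by move=> h; apply: le_trans h _; rewrite mulrDr mulr1 -[leLHS]addr0 lerD ?lerDl// mulr_ge0 ?addr_ge0//; lra.
  case: (ger0P l) lL => l0 lL; first by apply: FE; rewrite l0.
  have := FE (- l); rewrite Fodd gaussianN oppr_ge0 (ltW l0) lL => /(_ isT).
  by rewrite !mulNr -opprD normrN.
have QLl : Q <= Q / L * `|l| by rewrite mulrAC ler_pdivlMr//  ler_wpM2l// ltW.
have l2E : l ^+ 2 = `|l| ^+ 2 by rewrite real_normK ?num_real.
have h1 := FQ l.
have h2 : `|l * K * gaussian s l| <= `|l| * (2 * Q).
  rewrite normrM (ger0_norm gs0); apply: le_trans (ler_piMr (normr_ge0 _) gl1) _.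
  by rewrite normrM ler_wpM2l.
have h3 : `|l| * Q <= Q / L * l ^+ 2.
  by rewrite mulrC l2E expr2 mulrA ler_wpM2r.
have h4 : Q <= `|l| * Q by rewrite ler_peMl//; lra.
apply: le_trans (ler_normB _ _) _.
have : 0 <= E * (1 + 3 * l ^+ 2) by rewrite mulr_ge0//; lra.
by lra.
Qed.

End heat_kernel.

(** The exponent is a multiple of 8 so that every power of the ratio block / N used
    later is a power of 2^-p. *)
Definition block (p N : nat) := (N %/ 2 ^ (8 * p))%N.

Lemma blockP p N : (0 < p)%N -> (2 ^ (8 * p) <= N)%N ->
  [/\ (0 < block p N)%N, (2 * block p N <= N)%N, (N <= 2 ^ (8 * p).+1 * block p N)%N
    & (2 ^ (8 * p) * block p N <= N)%N].
Proof.
move=> p0 pN; set m := block p N.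
have P0 : (0 < 2 ^ (8 * p))%N by rewrite expn_gt0.
have m0 : (0 < m)%N by rewrite divn_gt0.
have mP : (2 ^ (8 * p) * m <= N)%N by rewrite mulnC leq_divM.
split => //.
  apply: leq_trans mP; rewrite leq_mul2r; apply/orP; right.
  by rewrite -[X in (X <= _)%N]expn1 leq_exp2l// muln_gt0.
rewrite expnS; have := ltn_ceil N P0; rewrite -/(block p N) -/m => h.
apply: (leq_trans (ltnW h)); rewrite [(2 * _)%N]mulnC -mulnA mulnC leq_mul2l.
by apply/orP; right; rewrite mul2n -addnn -addn1 leq_add2l.
Qed.

Lemma block_compl m N : (0 < m)%N -> (2 * m <= N)%N ->
  [/\ (0 < N)%N, (m <= N)%N, (N - m + m = N)%N, (N <= 2 * (N - m))%N
    & (N %/ 2 ^ 1 <= N - m)%N].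
Proof. by move=> m0 mN; rewrite expn1; split; lia. Qed.

Section smoothed_density.
Context {R : realType}.
Variable Q : probability (path R) R.
Hypothesis MP : markov_property Q.
Variable a : nat -> R.
Hypothesis a_gt0 : forall n, (0 < n)%N -> 0 < a n.
Hypothesis CLT : forall (f : R -> R) (M : R), continuous f -> (forall x, `|f x| <= M) ->
  Ex Q (fun x => f (walk n x / a n)) @[n --> \oo] --> Ex std_normal f.
Variables b c : R.
Hypothesis c_gt0 : 0 < c.
Hypothesis step_lattice : pr Q [set x | lattice b c (x 0%N)] = 1.
Hypothesis step_span : forall b' c', c < c' -> pr Q [set x | lattice b' c' (x 0%N)] <> 1.
Notation mu := (@lebesgue_measure R).
Notation q n := (pr Q (positive n)).
Implicit Types (e l s x : R) (n k m N j p : nat) (f g : path R -> R).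

Let bpos n : bmf (\1_(positive n) : path R -> R) := bmf_ind (measurable_positive n).

Lemma bmf_heat_walk t j x (A : R) : 0 < t ->
  bmf (fun w : path R => heat t ((walk j w - x) / A)).
Proof.
move=> t0; have h := bmf_integral Q (integrable_gaussian t0) (bmf_cst (T := path R) (R := R) 1)
  (measurable_walk_centred j x A) (@continuous_cos R) norm_cos_le1.
have := bmfM (bmf_cst ((2 * pi)^-1 : R)) h; congr bmf.
by apply/funext => w; rewrite mul1r.
Qed.

Lemma Ex_heat t j x (A : R) f : 0 < t -> bmf f ->
  Ex Q (fun w => f w * heat t ((walk j w - x) / A)) =
  (2 * pi)^-1 * \int[mu]_l (gaussian t l * Ex Q (fun w => f w * cos (l * ((walk j w - x) / A)))).
Proof.
move=> t0 bf.
have ig := integrable_gaussian t0; have my := measurable_walk_centred j x A.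
rewrite -(Ex_integral Q ig bf my (@continuous_cos R) norm_cos_le1).
rewrite -ExZ; last exact: (bmf_integral Q ig bf my (@continuous_cos R) norm_cos_le1).
by apply: eq_Ex => w; rewrite mulrCA.
Qed.

Lemma local_limit_heat i e : 0 < e -> exists N0, forall N m, (N0 <= N)%N -> (m <= N)%N ->
  (N <= 2 ^ i * m)%N -> forall j f x, bmf f -> (forall w, 0 <= f w) -> depends j f ->
  lattice (b * (j + m)%:R) c x ->
  `|a N / c * Ex Q (fun w => f w * at_point (j + m) x w) -
    Ex Q (fun w => f w * heat (m%:R / N%:R) ((walk j w - x) / a N))| <= e * Ex Q f.
Proof.
move=> e0; have [N0 H] := local_limit MP a_gt0 CLT c_gt0 step_lattice step_span i e0.
exists N0.+1 => N m NN mN Nm j f x bf f0 df xL.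
have Np : (0 < N)%N by apply: leq_ltn_trans NN.
have mp : (0 < m)%N by case: m Nm {mN xL} => //; rewrite muln0 leqn0 => /eqP NE; rewrite NE in Np.
rewrite Ex_heat//; first exact: H (ltnW NN) mN Nm j f x bf f0 df xL.
by rewrite divr_gt0// ltr0n.
Qed.

(** Subtracting the reflected kernel turns the cosine transform into a product of
    sines, which isolates the sine transform of the position. *)
Lemma heat_reflection t j x (A : R) f : 0 < t -> bmf f ->
  mu.-integrable [set: R] (EFin \o (fun l => gaussian t l * (sin (l * (x / A)) * Im (wcf Q f j (l / A))))) /\
  Ex Q (fun w => f w * heat t ((walk j w - x) / A)) -
  Ex Q (fun w => f w * heat t ((walk j w - - x) / A)) =
  pi^-1 * \int[mu]_l (gaussian t l * (sin (l * (x / A)) * Im (wcf Q f j (l / A)))).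
Proof.
move=> t0 bf; have ig := integrable_gaussian t0.
have i1 := integrable_Ex Q ig bf (measurable_walk_centred j x A) (@continuous_cos R) norm_cos_le1.
have i2 := integrable_Ex Q ig bf (measurable_walk_centred j (- x) A) (@continuous_cos R) norm_cos_le1.
have E l : gaussian t l * Ex Q (fun w => f w * cos (l * ((walk j w - x) / A))) -
  gaussian t l * Ex Q (fun w => f w * cos (l * ((walk j w - - x) / A))) =
  2 * (gaussian t l * (sin (l * (x / A)) * Im (wcf Q f j (l / A)))).
  rewrite -mulrBr [RHS]mulrCA; congr (_ * _).
  rewrite -ExB; [|by apply: bmfM => //; apply: bmf_scaled => //; [exact: measurable_walk_centred|exact: continuous_cos|exact: norm_cos_le1]|by apply: bmfM => //; apply: bmf_scaled => //; [exact: measurable_walk_centred|exact: continuous_cos|exact: norm_cos_le1]].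
  rewrite /wcf/= -ExZ; last by apply: bmfM => //; exact: bmf_sin_walk.
  rewrite -ExZ; last by apply: bmfM; [exact: bmf_cst|apply: bmfM => //; exact: bmf_sin_walk].
  apply: eq_Ex => w.
  have -> : l * ((walk j w - x) / A) = l / A * walk j w - l * (x / A) by ring.
  have -> : l * ((walk j w - - x) / A) = l / A * walk j w + l * (x / A) by ring.
  by rewrite cosB cosD; ring.
have iD : mu.-integrable [set: R] (EFin \o (fun l => 2 * (gaussian t l * (sin (l * (x / A)) * Im (wcf Q f j (l / A)))))).
  by have := integrableB measurableT i1 i2; apply: eq_integrable => // l _; rewrite /= -EFinB E.
have iS : mu.-integrable [set: R] (EFin \o (fun l => gaussian t l * (sin (l * (x / A)) * Im (wcf Q f j (l / A))))).
  by have := integrableZl measurableT 2^-1 iD; apply: eq_integrable => // l _; rewrite /= -EFinM mulKf.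
split => //; rewrite !Ex_heat// -mulrBr -RintegralB//.
under eq_Rintegral => l _ do rewrite E.
rewrite RintegralZl// mulrA; congr (_ * _).
by rewrite invfM mulrAC mulVf ?mul1r.
Qed.

Definition limit_const N : R := Num.sqrt (2 / pi) * sine_const Q a N.

Definition rayleigh x : R := x * expR (- (x ^+ 2 / 2)).

Lemma sine_const_le N : `|sine_const Q a N| <= 2 * q N.
Proof.
rewrite /sine_const normrM mulrC (gtr0_norm (expR_gt0 _)).
apply: ler_pM; rewrite ?expR_ge0 ?norm_Im_pwcf//.
have := @expRN_half_ge R; rewrite expRN lef_pV2 ?posrE ?expR_gt0//.
Qed.

Lemma pr_positive_block p : (0 < p)%N -> exists N0, forall N, (N0 <= N)%N ->
  (2 ^ (8 * p) <= N)%N /\ q (N - block p N) <= 2 * q N.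
Proof.
move=> p0; have [N0 H] := pr_positive_halving MP a_gt0 CLT step_lattice 1.
exists (maxn N0 (2 ^ (8 * p))) => N; rewrite geq_max => /andP[n0 np]; split => //.
have [m0 m2 _ _] := blockP p0 np.
apply: (@le_trans _ _ (q (N %/ 2 ^ 1))); first by apply: pr_positive_noninc; have [] := block_compl m0 m2.
by apply: le_trans (H N n0) _; rewrite expr1 ler_wpM2r ?pr_ge0//; lra.
Qed.

(** The propagation of the sine transform and its inversion, fed with the local
    limit theorem over the last block. *)
Lemma smoothed_density p e : (0 < p)%N -> 0 < e -> exists N0, forall N, (N0 <= N)%N ->
  forall x, lattice (b * N%:R) c x ->
  `|a N / c * Ex Q (fun w => \1_(positive (N - block p N)) w * at_point N x w) -
    Ex Q (fun w => \1_(positive (N - block p N)) w *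
      heat ((block p N)%:R / N%:R) ((walk (N - block p N) w - - x) / a N)) -
    limit_const N * rayleigh (x / a N)| <= e * q N.
Proof.
move=> p0 e0; have t00 : (0 : R) < (2 ^+ (8 * p).+1)^-1 by rewrite invr_gt0 exprn_gt0.
have [C [C0 HC]] := sine_inversion t00.
pose e1 := e / 8; have e10 : 0 < e1 by rewrite divr_gt0.
pose e2 := e / (4 * (C + 1)).
have C1 : 0 < C + 1 by lra.
have e20 : 0 < e2 by rewrite divr_gt0// mulr_gt0.
pose L := 1 + 8 * C / e.
have L1 : 1 <= L by rewrite lerDl divr_ge0 ?(ltW e0)// mulr_ge0.
have [N1 H1] := local_limit_heat (8 * p).+1 e10.
have [N2 H2] := sine_relation MP a_gt0 CLT step_lattice L1 e20.
have [N3 H3] := pr_positive_block p0.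
exists (maxn N1 (maxn N2 N3)) => N; rewrite !geq_max => /and3P[n1 n2 n3] x xL.
have [np qn] := H3 N n3; have [m0 m2 mN mN'] := blockP p0 np.
set m := block p N in qn m0 m2 mN mN' *; set n := (N - m)%N in qn *.
have [Np mle nm n2N _] := block_compl m0 m2; rewrite -/n in nm n2N.
have nn : (n <= N)%N by rewrite leq_subr.
have NR : (0 : R) < N%:R by rewrite ltr0n.
have mR : (0 : R) < m%:R / N%:R by rewrite divr_gt0// ltr0n.
have f0 (w : path R) : 0 <= \1_(positive n) w :> R by rewrite indicE.
have := H1 N m n1 mle mN n _ x (bpos n) f0 (@depends_positive R n); rewrite nm => /(_ xL).
rewrite (Ex_ind _ (measurable_positive n)) => hL.
have [iF] := heat_reflection n x (a N) mR (bpos n).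
set Hm := Ex Q _; set Hp := Ex Q _; move=> hR.
have tt : (2 ^+ (8 * p).+1)^-1 <= m%:R / N%:R :> R.
  rewrite ler_pdivlMr// mulrC ler_pdivrMr ?exprn_gt0//.
  by rewrite -natrX -natrM ler_nat mulnC.
have ts : m%:R / N%:R + n%:R / N%:R = 1 :> R.
  by rewrite -mulrDl -natrD addnC nm mulfV ?gt_eqF.
have s0 : (0 : R) <= n%:R / N%:R by rewrite divr_ge0.
have Fodd l : Im (wcf Q (\1_(positive n)) n (- l / a N)) = - Im (wcf Q (\1_(positive n)) n (l / a N)).
  rewrite /wcf/= -ExN; last by apply: bmfM => //; exact: bmf_sin_walk.
  by apply: eq_Ex => w; rewrite !mulNr sinN mulrN.
have FE l : 0 <= l <= L -> `|Im (wcf Q (\1_(positive n)) n (l / a N)) - l * sine_const Q a N * gaussian (n%:R / N%:R) l| <= e2 * q N.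
  move=> lL; have := H2 N n n2 n2N nn l lL.
  set F := Im _ => h; have g0 := gaussian_ge0 (n%:R / N%:R) l; have g1 := gaussian_le1 l s0.
  have -> : F - l * sine_const Q a N * gaussian (n%:R / N%:R) l =
    gaussian (n%:R / N%:R) l * (F * expR (n%:R / N%:R * l ^+ 2 / 2) - l * sine_const Q a N).
    have E1 : gaussian (n%:R / N%:R) l * expR (n%:R / N%:R * l ^+ 2 / 2) = 1.
      by rewrite /gaussian -expRD addNr expR0.
    by rewrite mulrBr [X in _ = X - _]mulrCA E1 mulr1; congr (_ - _); ring.
  by rewrite normrM (ger0_norm g0); apply: le_trans (ler_piMl (normr_ge0 _) g1) h.
have FQ l : `|Im (wcf Q (\1_(positive n)) n (l / a N))| <= 2 * q N.
  by apply: le_trans (norm_Im_pwcf Q n (l / a N)) qn.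
have qN0 : 0 <= q N := pr_ge0 _ _.
have KQ : `|sine_const Q a N| <= 2 * (2 * q N) by have := sine_const_le N; clear -qN0 MP a_gt0 CLT c_gt0 step_lattice step_span bpos; lra.
have := HC _ _ L _ _ _ (x / a N) _ tt ts s0 L1 Fodd FE FQ KQ iF.
rewrite -hR -/(rayleigh (x / a N)) -/(limit_const N) => hS.
have cL : C * (2 * q N / L) <= e / 4 * q N.
  rewrite mulrA ler_pdivrMr; last exact: lt_le_trans L1.
  have : e * L = e + 8 * C by rewrite /L; field; rewrite gt_eqF.
  move=> eL; have -> : e / 4 * q N * L = (e + 8 * C) * q N / 4 by rewrite -eL; ring.
  by have := mulr_ge0 (ltW e0) qN0; clear -MP a_gt0 CLT c_gt0 step_lattice step_span bpos; lra.
have cE : C * (e2 * q N) <= e / 4 * q N.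
  rewrite mulrA ler_wpM2r// /e2 mulrA ler_pdivrMr ?mulr_gt0//; clear -e0 C0 MP a_gt0 CLT c_gt0 step_lattice step_span bpos; nra.
have hq : e1 * q n <= e / 4 * q N by rewrite /e1; clear -qn e0 MP a_gt0 CLT c_gt0 step_lattice step_span bpos; nra.
rewrite -[X in X - Hp - _](subrK Hm) -[_ + Hm - Hp]addrA -addrA.
apply: le_trans (ler_normD _ _) _.
apply: le_trans (lerD hL hS) _.
have := mulr_ge0 (ltW e0) qN0; rewrite mulrDr; clear -cL cE hq MP a_gt0 CLT c_gt0 step_lattice step_span bpos; lra.
Qed.

End smoothed_density.

(** * Removing the smoothing *)

Section overshoot.
Context {R : realType}.
Variable Q : probability (path R) R.
Hypothesis MP : markov_property Q.
Implicit Types (y : R) (k m j : nat) (x : path R).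

Lemma shiftD j k x : shift j (shift k x) = shift (k + j) x.
Proof. by apply/funext => i; rewrite /shift addnA. Qed.

(** The reflected maximum over a block of m steps: some final segment of the
    block climbs at least y. *)
Definition overshoot y m : set (path R) :=
  [set x | exists2 j, (j < m)%N & y <= walk (m - j) (shift j x)].

Definition first_overshoot y k : set (path R) :=
  [set x | y <= walk k.+1 x /\ ~ overshoot y k (shift 1 x)].

Lemma overshootS y m x :
  overshoot y m.+1 x <-> y <= walk m.+1 x \/ overshoot y m (shift 1 x).
Proof.
split=> [[[|j] jm h]|[h|[j jm h]]].
- by left; rewrite subn0 in h.
- by right; exists j => //; rewrite shiftD add1n -subSS.
- by exists 0%N => //; rewrite subn0.
- by exists j.+1 => //; rewrite subSS -add1n -shiftD.
Qed.

Lemma measurable_overshoot y m : measurable (overshoot y m).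
Proof.
elim: m => [|m IH].
  by rewrite (_ : overshoot y 0 = set0) //; apply/seteqP; split => x // [].
rewrite (_ : overshoot y m.+1 = [set x | y <= walk m.+1 x] `|` shift 1 @^-1` overshoot y m).
  apply: measurableU; last exact: measurable_shiftP.
  exact: (measurable_walk_set m.+1 (measurable_ge y)).
by apply/seteqP; split => x /overshootS.
Qed.

Lemma measurable_first_overshoot y k : measurable (first_overshoot y k).
Proof.
apply: measurableI; first exact: (measurable_walk_set k.+1 (measurable_ge y)).
by apply: measurableC; apply: measurable_shiftP; exact: measurable_overshoot.
Qed.

(** Decompose according to the last segment that overshoots. *)
Lemma overshoot_sum y m x : \1_(overshoot y m) x =
  \sum_(k < m) \1_(first_overshoot y k) (shift (m - k.+1) x) :> R.
Proof.
elim: m x => [|m IH] x.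
  by rewrite big_ord0 indicE memNset// => -[].
rewrite big_ord_recr/= subnn.
have -> : shift 0 x = x by apply/funext.
have -> : \1_(overshoot y m.+1) x = \1_(overshoot y m) (shift 1 x) + \1_(first_overshoot y m) x :> R.
  rewrite !indicE; have [h|h] := pselect (overshoot y m (shift 1 x)).
    have h1 : overshoot y m.+1 x by apply/overshootS; right.
    have h2 : ~ first_overshoot y m x by move=> [].
    by rewrite (mem_set h) (mem_set h1) (memNset h2) addr0.
  rewrite (memNset h) add0r; congr ((_ : bool)%:R).
  apply/idP/idP => /set_mem H; apply/mem_set.
    by move/overshootS: H => [].
  by apply/overshootS; left; case: H.
rewrite IH; congr (_ + _); apply: eq_bigr => k _.
by rewrite shiftD add1n subSS subnSK// ltn_ord.
Qed.

Lemma pr_overshoot y m : pr Q (overshoot y m) = \sum_(k < m) pr Q (first_overshoot y k).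
Proof.
have mf k := measurable_first_overshoot y k.
rewrite -Ex_ind; last exact: measurable_overshoot.
under eq_Ex => x do rewrite overshoot_sum.
rewrite Ex_sum; last by move=> k; exact: (bmf_shift (m - k.+1) (bmf_ind (mf k))).
apply: eq_bigr => k _; rewrite -(pr_shift MP (m - k.+1) (mf k)) -Ex_ind//.
exact: measurable_shiftP.
Qed.

(** Ottaviani's inequality: when the last overshooting segment starts, the walk is
    below - y / 2 unless the whole block climbs by y / 2. *)
Lemma ottaviani y m : (forall k, (k <= m)%N -> pr Q [set x | walk k x < - (y / 2)] <= 2^-1) ->
  pr Q (overshoot y m) <= 2 * pr Q [set x | y / 2 <= walk m x].
Proof.
move=> H; have mf k := measurable_first_overshoot y k.
have ml k : measurable [set x : path R | walk k x < - (y / 2)].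
  exact: (measurable_walk_set k (measurable_lt _)).
have mg : measurable [set x : path R | y / 2 <= walk m x].
  exact: (measurable_walk_set m (measurable_ge _)).
have mo := measurable_overshoot y m.
pose T k (x : path R) : R := \1_([set x | walk (m - k.+1) x < - (y / 2)]) x * \1_(first_overshoot y k) (shift (m - k.+1) x).
have bT k : bmf (T k).
  by apply: bmfM; [exact: bmf_ind|exact: (bmf_shift (m - k.+1) (bmf_ind (mf k)))].
have T0 k x : 0 <= T k x by rewrite mulr_ge0// indicE.
have pw x : \1_(overshoot y m) x <= \1_([set x | y / 2 <= walk m x]) x + \sum_(k < m) T k x.
  have [h|h] := leP (y / 2) (walk m x).
    rewrite [X in _ <= X + _]indicE mem_set//; apply: (@le_trans _ _ 1).
      by rewrite indicE; case: (_ \in _).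
    by rewrite lerDl sumr_ge0.
  rewrite [X in _ <= X + _]indicE memNset ?add0r; last by rewrite /= leNgt h.
  rewrite overshoot_sum; apply: ler_sum => k _; rewrite /T.
  case: (boolP (shift (m - k.+1) x \in first_overshoot y k)) => [/set_mem [h1 h2]|hN]; last first.
    by rewrite [X in X <= _]indicE (negbTE hN) mulr_ge0// indicE.
  rewrite [X in _ <= X * _]indicE mem_set ?mul1r//=.
  have wE : walk m x = walk (m - k.+1) x + walk k.+1 (shift (m - k.+1) x).
    by rewrite -walk_shift subnK// ltn_ord.
  by lra.
have bS : bmf (fun x => \sum_(k < m) T k x) by exact: bmf_sum.
have := le_Ex Q (bmf_ind mo) (bmfD (bmf_ind mg) bS) pw.
rewrite ExD//; last exact: bmf_ind.
rewrite Ex_sum// !Ex_ind// => h.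
suff : \sum_(k < m) Ex Q (T k) <= 2^-1 * pr Q (overshoot y m) by lra.
rewrite pr_overshoot mulr_sumr; apply: ler_sum => k _.
rewrite (Ex_markov MP (bmf_ind (ml (m - k.+1)%N)) (bmf_ind (mf k))); last first.
  by apply: past_depends_ind => x z xz /=; rewrite (walk_eq xz).
by rewrite !Ex_ind// ler_wpM2r ?pr_ge0// H// leq_subr.
Qed.

End overshoot.

Section dyadic_blocks.
Context {R : realType}.
Implicit Types (e : R) (m p N : nat).

Lemma half_powers_small e p0 : 0 < e -> exists p, (p0 <= p)%N /\ (2 ^+ p)^-1 <= e.
Proof.
move=> e0; pose k := Num.truncn e^-1; exists (maxn p0 k.+1); split; first exact: leq_maxl.
rewrite -[leRHS]invrK lef_pV2 ?posrE ?exprn_gt0 ?invr_gt0//.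
have h : e^-1 < k.+1%:R by rewrite truncnS_gt// ?invr_ge0 ltW.
apply: le_trans (ltW h) _; rewrite -natrX ler_nat.
by apply: (leq_trans (leq_maxr p0 k.+1)); rewrite ltnW// ltn_expl.
Qed.

Lemma block_ratio p N : (0 < p)%N -> (2 ^ (8 * p) <= N)%N -> forall s : R, s = (2 ^+ p)^-1 ->
  [/\ 0 < s, s <= 1, (s ^+ 4 / 2) ^+ 2 <= (block p N)%:R / N%:R :> R
    & (block p N)%:R / N%:R <= s ^+ 8 :> R].
Proof.
move=> p0 pN s sE; have [m0 m2 mN mN'] := blockP p0 pN.
have s0 : 0 < s by rewrite sE invr_gt0 exprn_gt0.
have [Np _ _ _ _] := block_compl m0 m2.
have NR : (0 : R) < N%:R by rewrite ltr0n.
have s8 : s ^+ 8 = (2 ^+ (8 * p))^-1 by rewrite sE exprVn -exprM mulnC.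
split => //.
- by rewrite sE invf_le1 ?exprn_gt0// exprn_ege1// ler1n.
- rewrite expr_div_n -exprM s8 ler_pdivlMr//.
  have : (N%:R : R) <= 2 * 2 ^+ (8 * p) * (block p N)%:R.
    by rewrite -exprS -natrX -natrM ler_nat.
  move=> h; rewrite mulrAC ler_pdivrMr ?exprn_gt0// mulrC ler_pdivrMr ?exprn_gt0//.
  have Pm : 0 <= 2 ^+ (8 * p) * (block p N)%:R :> R by rewrite mulr_ge0.
  by apply: le_trans h _; rewrite -mulrA [leRHS](_ : _ = 4 * (2 ^+ (8 * p) * (block p N)%:R)); [lra|ring].
rewrite s8 ler_pdivrMr// mulrC ler_pdivlMr ?exprn_gt0// mulrC.
by rewrite -natrX -natrM ler_nat.
Qed.

Lemma block_quarter m N : (2 * m <= N)%N -> (4 <= N)%N ->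
  [/\ (N - m - N %/ 4 + N %/ 4 = N - m)%N, (N - m - N %/ 4 + N %/ 4 + m = N)%N,
      (N %/ 2 ^ 2 <= N - m - N %/ 4)%N & (N <= 2 ^ 3 * (N %/ 4))%N].
Proof. by move=> m2 n4; split; lia. Qed.

End dyadic_blocks.

Section density_estimates.
Context {R : realType}.
Variable Q : probability (path R) R.
Hypothesis MP : markov_property Q.
Variable a : nat -> R.
Hypothesis a_gt0 : forall n, (0 < n)%N -> 0 < a n.
Hypothesis CLT : forall (f : R -> R) (M : R), continuous f -> (forall x, `|f x| <= M) ->
  Ex Q (fun x => f (walk n x / a n)) @[n --> \oo] --> Ex std_normal f.
Variables b c : R.
Hypothesis c_gt0 : 0 < c.
Hypothesis step_lattice : pr Q [set x | lattice b c (x 0%N)] = 1.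
Hypothesis step_span : forall b' c', c < c' -> pr Q [set x | lattice b' c' (x 0%N)] <> 1.
Notation q n := (pr Q (positive n)).
Implicit Types (e x y eta : R) (n k m N j p : nat).

Let plim L e (e0 : 0 < e) := cf_uniform MP a_gt0 CLT L e0.
Let bpos n : bmf (\1_(positive n) : path R -> R) := bmf_ind (measurable_positive n).

Definition hit N x := Ex Q (fun w => \1_(positive N) w * at_point N x w).

Lemma le_indic_positive n m (w : path R) : (n <= m)%N -> \1_(positive m) w <= \1_(positive n) w :> R.
Proof.
move=> nm; rewrite !indicE; have [/set_mem h|_] := boolP (w \in positive m); last by [].
by rewrite mem_set// => k /andP[k0 kn]; apply: h; rewrite k0 (leq_trans kn).
Qed.

(** Staying positive on the last block costs little away from the origin: the
    paths lost there overshoot x within that block, and the local bound keeps the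
    conditioning on the final position harmless. *)
Lemma block_loss eta : 0 < eta -> exists (D : R) p0, 0 <= D /\ forall p, (p0 <= p)%N ->
  exists N0, forall N, (N0 <= N)%N -> forall x, lattice (b * N%:R) c x -> eta * a N <= x ->
  a N / c * Ex Q (fun w => \1_(positive (N - block p N)) w * at_point N x w) - a N / c * hit N x <=
  D * ((block p N)%:R / N%:R) * q N.
Proof.
move=> eta0; have e20 : 0 < eta / 2 by rewrite divr_gt0.
have [C [N1 [C0 H1]]] := pr_walk_tail MP a_gt0 CLT e20.
have [B [N2 [B0 H2]]] := local_bound MP a_gt0 CLT c_gt0 step_lattice step_span 3.
have C2 : 0 < (2 * (C + 1))^-1 by rewrite invr_gt0 mulr_gt0//; lra.
have [p0 [p00 Hp0]] := half_powers_small 1 C2.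
exists (B * (3 * (2 * C))), p0; split => [|p pp]; first by rewrite !mulr_ge0.
have pp0 : (0 < p)%N by apply: leq_trans pp.
have [N3 H3] := pr_positive_halving MP a_gt0 CLT step_lattice 2.
exists (maxn (maxn N1 4) (maxn N2 (maxn N3 (2 ^ (8 * p))))) => N.
rewrite !geq_max => /and3P[/andP[n1 n4] n2 /andP[n3 np]] x xL xe.
have [m0 m2 _ _] := blockP pp0 np; have [Np mle nm n2N _] := block_compl m0 m2.
have [s0 s1 _ ts] := @block_ratio R p N pp0 np _ erefl.
set m := block p N in m0 m2 mle nm n2N ts *.
have NR : (0 : R) < N%:R by rewrite ltr0n.
have aN0 := a_gt0 Np; have t0 : 0 <= m%:R / N%:R :> R by rewrite divr_ge0.
have tC : C * (m%:R / N%:R) <= 2^-1.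
  have sp : m%:R / N%:R <= (2 ^+ p0)^-1 :> R.
    apply: le_trans ts _; apply: (@le_trans _ _ (2 ^+ p)^-1).
      by rewrite -[leRHS]expr1 ler_wiXn2l// ltW.
    by rewrite lef_pV2 ?posrE ?exprn_gt0// ler_weXn2l// ler1n.
  have : m%:R / N%:R <= (2 * (C + 1))^-1 :> R by apply: le_trans Hp0.
  rewrite -[(2 * _)^-1]mul1r ler_pdivlMr ?mulr_gt0//; lra.
have [k4 n1E nq Nk] := block_quarter m2 n4.
set n1' := (N - m - N %/ 4)%N in k4 n1E nq *.
have bo : bmf (\1_(overshoot x m) : path R -> R) by apply: bmf_ind; exact: measurable_overshoot.
have i0 (A : set (path R)) w : 0 <= \1_A w :> R by rewrite indicE.
have := H2 N (N %/ 4)%N n2 Nk n1' m _ _ x (bpos n1') bo (i0 _) (i0 _) (@depends_positive R n1').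
rewrite n1E k4 => /(_ xL); rewrite !Ex_ind//; [|exact: measurable_overshoot|exact: measurable_positive].
move=> hB.
have xe2 : eta / 2 * a N <= x / 2 by rewrite mulrAC ler_pM2r ?invr_gt0.
have mt k : measurable [set w : path R | eta / 2 * a N <= `|walk k w|].
  exact: (measurable_walk_set k (measurable_norm_ge _)).
have ho : pr Q (overshoot x m) <= 2 * (C * (m%:R / N%:R)).
  apply: le_trans (ottaviani MP _) _ => [k km|].
    apply: (@le_trans _ _ (pr Q [set w : path R | eta / 2 * a N <= `|walk k w|])).
      apply: le_pr => //; first exact: (measurable_walk_set k (measurable_lt _)).
      by move=> w /= h; rewrite ler_normr; apply/orP; right; lra.
    apply: le_trans (H1 N n1 k) _; apply: le_trans tC.
    by rewrite ler_wpM2l// ler_pM2r ?invr_gt0// ler_nat.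
  rewrite ler_pM2l//; apply: le_trans (H1 N n1 m); apply: le_pr => //.
    exact: (measurable_walk_set m (measurable_ge _)).
  by move=> w /= h; rewrite ler_normr; apply/orP; left; lra.
have hq : q n1' <= 3 * q N.
  apply: (le_trans (pr_positive_noninc Q nq)); apply: le_trans (H3 N n3) _.
  by rewrite ler_wpM2r ?pr_ge0//; lra.
have bat := @bmf_at_point R N x.
rewrite -mulrBr /hit -ExB; [|exact: bmfM|exact: bmfM].
have ac : 0 <= a N / c by rewrite divr_ge0// ltW.
apply: (@le_trans _ _ (B * (q n1' * pr Q (overshoot x m)))).
  apply: le_trans hB; rewrite ler_wpM2l//; apply: le_Ex.
  - by apply: bmfB; exact: bmfM.
  - by apply: bmfM => //; apply: bmfM => //; exact: (bmf_shift (N - m) bo).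
  move=> w; rewrite -mulrBl /at_point.
  have [wx|wx] := pselect (walk N w = x); last first.
    by rewrite [\1_[set _ | _ = x] w]indicE memNset// !mulr0.
  rewrite ler_wpM2r ?i0//.
  have [pn|pn] := pselect (positive (N - m) w); last first.
    rewrite !indicE (memNset pn) memNset ?subr0 ?mulr_ge0//.
    by move=> pN; apply: pn => k /andP[k0 kn]; apply: pN; rewrite k0 (leq_trans kn)// leq_subr.
  have pn1 : positive n1' w by move=> k /andP[k0 kn]; apply: pn; rewrite k0 (leq_trans kn)// leq_subr.
  rewrite [\1_(positive n1') w]indicE (mem_set pn1) mul1r [\1_(positive (N - m)) w]indicE (mem_set pn).
  have [pN|pN] := pselect (positive N w).
    by rewrite [\1_(positive N) w]indicE (mem_set pN) subrr.
  rewrite [\1_(positive N) w]indicE (memNset pN) subr0 [\1_(overshoot x m) _]indicE mem_set//.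
  have [k kN wk] : exists2 k, (0 < k <= N)%N & walk k w <= 0.
    by apply: contrapT => h; apply: pN => k kN; rewrite ltNge; apply/negP => wk; apply: h; exists k.
  have /andP[k0 kn] := kN.
  have nk : (N - m < k)%N.
    by rewrite ltnNge; apply/negP => kn'; have := pn k; rewrite k0 kn' => /(_ isT); rewrite ltNge wk.
  have [j jm [kE mjE]] : exists2 j, (j <= m)%N & (k = N - m + j)%N /\ (N = k + (m - j))%N.
    by exists (k - (N - m))%N; [|split]; move: nk kn mle; clear; lia.
  have jlt : (j < m)%N.
    rewrite ltn_neqAle jm andbT; apply/eqP => jmE.
    have kN' : k = N by rewrite mjE jmE subnn addn0.
    move: wk; rewrite kN' wx => x0; have : 0 < eta * a N by rewrite mulr_gt0.
    by rewrite ltNge => /negP; apply; apply: le_trans xe x0.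
  exists j => //; rewrite shiftD -kE.
  have : walk N w = walk k w + walk (m - j) (shift k w) by rewrite {1}mjE walk_shift.
  by rewrite wx; lra.
rewrite -!mulrA ler_wpM2l//.
rewrite [leRHS](_ : _ = (3 * q N) * (2 * (C * (m%:R / N%:R)))); last by ring.
by apply: ler_pM; rewrite ?pr_ge0.
Qed.

(** The limit away from the origin: the reflected kernel and the loss on the last
    block both vanish with the length of that block. *)
Lemma hit_interior eta e : 0 < eta -> 0 < e -> exists N0, forall N, (N0 <= N)%N ->
  forall x, lattice (b * N%:R) c x -> eta * a N <= x ->
  `|a N / c * hit N x - limit_const Q a N * rayleigh (x / a N)| <= e * q N.
Proof.
move=> eta0 e0; have [D [p0 [D0 HD]]] := block_loss eta0.
have [K [K0 HK]] := @heat_tail R.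
pose B := 4 * K / eta ^+ 6 + D + 1.
have E6 : 0 < eta ^+ 6 by rewrite exprn_gt0.
have B6 : 0 <= 4 * K / eta ^+ 6 by rewrite divr_ge0 ?(ltW E6)// mulr_ge0// ltW.
have B0 : 0 < B by rewrite /B; lra.
have eB : 0 < e / (2 * B) by rewrite divr_gt0// mulr_gt0.
have [p [pp Hp]] := half_powers_small (maxn p0 1) eB.
have /andP[pp0 p1] : (p0 <= p)%N && (0 < p)%N by rewrite -geq_max.
have e2 : 0 < e / 2 by rewrite divr_gt0.
have [N1 H1] := smoothed_density MP a_gt0 CLT c_gt0 step_lattice step_span p1 e2.
have [N2 H2] := HD p pp0.
have [N3 H3] := pr_positive_block MP a_gt0 CLT step_lattice p1.
exists (maxn N1 (maxn N2 N3)) => N; rewrite !geq_max => /and3P[n1 n2 n3] x xL xe.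
have [np qn] := H3 N n3; have [m0 m2 _ _] := blockP p1 np.
have [s0 s1 ts0 ts] := @block_ratio R p N p1 np _ erefl.
have := H1 N n1 x xL; have := H2 N n2 x xL xe.
have [Np _ _ n2N _] := block_compl m0 m2.
set m := block p N in m0 m2 ts0 ts n2N qn *; set n := (N - m)%N in n2N qn *.
set s := (2 ^+ p)^-1 in Hp s0 s1 ts0 ts.
set t : R := m%:R / N%:R in ts0 ts *.
have NR : (0 : R) < N%:R by rewrite ltr0n.
have aN0 := a_gt0 Np.
have t0 : 0 < t by rewrite divr_gt0// ltr0n.
have n0 : (0 < n)%N by move: n2N; case: (n) => //; rewrite muln0 leqNgt Np.
have d0 : 0 < s ^+ 4 / 2 by rewrite divr_gt0// exprn_gt0.
have qN0 : 0 <= q N := pr_ge0 _ _.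
have ac : 0 <= a N / c by rewrite divr_ge0// ltW.
have hr : Ex Q (fun w => \1_(positive n) w * heat t ((walk n w - - x) / a N)) <= 2 * K * s / eta ^+ 6 * q n.
  rewrite -(Ex_ind _ (measurable_positive n)) -ExZ//; apply: le_Ex.
  - by apply: bmfM => //; exact: bmf_heat_walk.
  - by apply: bmfM => //; exact: bmf_cst.
  move=> w; rewrite !indicE; case: (boolP (w \in positive n)) => [/set_mem wp|_]; last by rewrite mul0r mulr0.
  rewrite mul1r mulr1.
  have w0 : 0 < walk n w by apply: wp; rewrite n0/=.
  have ue : eta <= `|(walk n w - - x) / a N|.
    rewrite opprK ger0_norm; first by rewrite ler_pdivlMr//; lra.
    have x0 : 0 < eta * a N by rewrite mulr_gt0.
    by rewrite divr_ge0 ?(ltW aN0)//; lra.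
  apply: (le_trans (HK _ _ _ _ d0 ts0 eta0 ue)).
  have t3 : t ^+ 3 <= (s ^+ 8) ^+ 3.
    by apply: lerXn2r => //; rewrite nnegrE ?exprn_ge0// ltW.
  have s19 : s ^+ 19 <= 1 by rewrite exprn_ile1// ltW.
  rewrite ler_pdivrMr ?mulr_gt0//.
  have -> : 2 * K * s / eta ^+ 6 * (s ^+ 4 / 2 * eta ^+ 6) = K * s ^+ 5 by field; rewrite gt_eqF.
  rewrite ler_pM2l//; apply: le_trans t3 _.
  rewrite -exprM (_ : (8 * 3 = 5 + 19)%N)// exprD ler_piMr// exprn_ge0// ltW//.
have hr0 : 0 <= Ex Q (fun w => \1_(positive n) w * heat t ((walk n w - - x) / a N)).
  by apply: Ex_ge0 => w; rewrite mulr_ge0 ?heat_ge0// indicE.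
have hm : a N / c * hit N x <= a N / c * Ex Q (fun w => \1_(positive n) w * at_point N x w).
  rewrite ler_wpM2l//; apply: le_Ex; try by apply: bmfM => //; exact: bmf_at_point.
  by move=> w; rewrite ler_wpM2r ?le_indic_positive ?leq_subr//= /at_point indicE.
have st : D * t * q N <= D * s * q N.
  rewrite ler_wpM2r// ler_wpM2l//; apply: le_trans ts _.
  by rewrite -[leRHS]expr1 ler_wiXn2l// ltW.
have sB : B * s * q N <= e / 2 * q N.
  rewrite ler_wpM2r//; have := ler_wpM2l (ltW B0) Hp.
  by rewrite (_ : B * (e / (2 * B)) = e / 2)//; field; rewrite gt_eqF.
have hr2 : 2 * K * s / eta ^+ 6 * q n <= 4 * K / eta ^+ 6 * s * q N.
  have k0 : 0 <= 2 * K * s / eta ^+ 6 by rewrite divr_ge0 ?(ltW E6)// !mulr_ge0// ltW.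
  by apply: (le_trans (ler_wpM2l k0 qn)); rewrite le_eqVlt; apply/orP; left; apply/eqP; ring.
have sq : 0 <= s * q N by rewrite mulr_ge0// ltW.
move: hr hr0 hm st sB hr2; rewrite /B.
move: (limit_const Q a N * rayleigh (x / a N)) (a N / c * hit N x) (a N / c * Ex Q _) (Ex Q _) => L U T H hr hr0 hm st sB hr2 h1 h2.
have := ler_norm (T - H - L); have := ler_norm (- (T - H - L)); rewrite normrN => h3 h4.
by rewrite ler_norml; clear -hr hr0 hm st sB hr2 sq h1 h2 h3 h4 MP a_gt0 CLT c_gt0 step_lattice step_span plim bpos; apply/andP; split; lra.
Qed.

(** A walk that is still positive at a height at most a k / 16 after n steps dies
    within the next k steps with probability at least 1/4, while the survival
    probability is nearly the same at times n and n + k. *)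
Lemma pr_positive_low e : 0 < e -> exists N0, forall n k, (N0 <= k)%N -> (N0 <= n)%N ->
  pr Q (positive n `&` [set w | walk n w <= a k / 16]) <= 4 * (k%:R / (2 * n%:R) + e) * q n.
Proof.
move=> e0; have [N1 H1] := pr_walk_very_negative a_gt0 CLT.
have [N2 H2] := pr_positive_ratio MP a_gt0 CLT step_lattice e0.
exists (maxn N1 N2).+1 => n k kN nN.
have k1 : (N1 <= k)%N by rewrite (leq_trans _ (ltnW kN))// leq_maxl.
have n2 : (N2 <= n)%N by rewrite (leq_trans _ (ltnW nN))// leq_maxr.
have k0 : (0 < k)%N by apply: leq_ltn_trans kN.
have n0 : (0 < n)%N by apply: leq_ltn_trans nN.
pose A := positive n `&` [set w : path R | walk n w <= a k / 16].
pose F := [set w : path R | walk k w <= - (a k / 16)].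
have mp j := measurable_positive (R := R) j.
have mA : measurable A by apply: measurableI => //; exact: (measurable_walk_set n (measurable_le _)).
have mF : measurable F by exact: (measurable_walk_set k (measurable_le _)).
have pA : past n A.
  move=> x y xy [px wx]; split; first exact: past_positive px.
  by move: wx => /=; rewrite (walk_eq xy).
have h1 := pr_markov MP mA mF pA.
have mS : measurable (A `&` shift n @^-1` F) by apply: measurableI => //; exact: measurable_shiftP.
have h2 : pr Q (A `&` shift n @^-1` F) + q (n + k) <= q n.
  rewrite -prU//.
    apply: le_pr => //; first exact: measurableU.
    by move=> w [[[pw _] _]//|pw] j /andP[j0 jn]; apply: pw; rewrite j0 (leq_trans jn)// leq_addr.
  apply/disj_set2P/seteqP; split => // w [[[_ wn] wk] pw].
  have := pw (n + k)%N; rewrite leqnn andbT addn_gt0 n0 => /(_ isT).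
  by rewrite walk_shift; move: wn wk; rewrite /F/=; lra.
have h3 := H1 k k1.
have pA0 : 0 <= pr Q A := pr_ge0 _ _.
have h4 : pr Q A * 4^-1 <= pr Q A * pr Q F by rewrite ler_wpM2l.
have h5 := H2 n (n + k)%N n2 (leq_addr k n).
rewrite -/A; rewrite h1 in h2.
have nR : (0 : R) < n%:R by rewrite ltr0n.
have kR : (0 : R) < k%:R by rewrite ltr0n.
have qn0 : 0 <= q n := pr_ge0 _ _.
have q0 : 0 <= q (n + k)%N := pr_ge0 _ _.
move: h5; rewrite natrD => h5.
have d0 : (0 : R) < n%:R + k%:R + n%:R by lra.
have h6 : q n - q (n + k) <= (k%:R / (2 * n%:R) + e) * q n.
  rewrite -(ler_pM2l d0).
  have -> : (n%:R + k%:R + n%:R) * ((k%:R / (2 * n%:R) + e) * q n) =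
    (k%:R + k%:R * (k%:R / (2 * n%:R)) + (n%:R + k%:R + n%:R) * e) * q n.
    by field; rewrite gt_eqF.
  have r0 : 0 <= k%:R * (k%:R / (2 * n%:R)) :> R by rewrite mulr_ge0 ?divr_ge0// ltW.
  have r1 : 0 <= k%:R * (k%:R / (2 * n%:R)) * q n by rewrite mulr_ge0.
  have r2 : 0 <= k%:R * e * q n by rewrite !mulr_ge0// ltW.
  by move: h5 r1 r2; move: (k%:R * _) => r; lra.
by lra.
Qed.

(** With s = 2^-p and a block of relative length s^8, the heat kernel is at most of
    order s^-4, and of order s^2 at distance s^3. A position below 2 s^3 a_N has
    conditional probability of order s^6, by comparison with the survival over
    a number of further steps of order s^6 N: the product s^-4 s^6 is small. *)
Lemma hit_near_zero e : 0 < e -> exists (eta : R) N0, 0 < eta /\ eta <= e /\ forall N, (N0 <= N)%N ->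
  forall x, lattice (b * N%:R) c x -> x <= eta * a N -> a N / c * hit N x <= e * q N.
Proof.
move=> e0; have [K [K0 HK]] := @heat_tail R.
have [al [al0 alE]] : exists al : R, 0 < al /\ al = 32 ^+ 2.
  by exists (32 ^+ 2); split => //; rewrite exprn_gt0.
pose M := 2 * (4 * (4 * al + 1)) + 2 * K.
have M1 : 1 <= M by rewrite /M; lra.
have eB : 0 < e / (4 * M) by rewrite divr_gt0// mulr_gt0//; lra.
have [p [p3 Hp]] := half_powers_small 3 eB.
have p1 : (0 < p)%N by apply: leq_trans p3.
set s := (2 ^+ p)^-1 in Hp *.
have s0 : 0 < s by rewrite invr_gt0 exprn_gt0.
have s60 : 0 < s ^+ 6 by rewrite exprn_gt0.
have e4 : 0 < e / 4 by rewrite divr_gt0.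
have [N1 H1] := local_limit_heat MP a_gt0 CLT c_gt0 step_lattice step_span (8 * p).+1 e4.
have [N2 H2] := pr_positive_low s60.
have s61 : 0 < al * s ^+ 6 by rewrite mulr_gt0.
have [N3 H3] := norming_ratio a_gt0 plim s61.
have [N4 H4] := pr_positive_block MP a_gt0 CLT step_lattice p1.
pose j := (6 * p - 12)%N; pose N5 := maxn N2 N3.
exists (s ^+ 3), (maxn N1 (maxn N4 (2 ^ j * N5.+1))).
have s1 : s <= 1 by rewrite invf_le1 ?exprn_gt0// exprn_ege1// ler1n.
split; first by rewrite exprn_gt0.
have se : s <= e.
  by apply: le_trans Hp _; rewrite ler_pdivrMr; [rewrite ler_peMr ?(ltW e0)//; lra|lra].
split; first by apply: le_trans se; rewrite -[leRHS]expr1 ler_wiXn2l// ltW.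
move=> N; rewrite !geq_max => /and3P[n1 n4 n5] x xL xe.
have [np qn] := H4 N n4; have [m0 m2 mN _] := blockP p1 np.
have [_ _ ts0 ts] := @block_ratio R p N p1 np s erefl.
have [Np mle nm n2N _] := block_compl m0 m2.
set m := block p N in m0 m2 mN mle nm ts0 ts n2N qn *; set n := (N - m)%N in nm n2N qn *.
set t : R := m%:R / N%:R in ts0 ts *.
have NR : (0 : R) < N%:R by rewrite ltr0n.
have aN0 := a_gt0 Np.
have t0 : 0 < t by rewrite divr_gt0// ltr0n.
have d0 : 0 < s ^+ 4 / 2 by rewrite divr_gt0// exprn_gt0.
have qN0 : 0 <= q N := pr_ge0 _ _.
have qn0 : 0 <= q n := pr_ge0 _ _.
pose k := (N %/ 2 ^ j)%N.
have kN5 : (N5 < k)%N by rewrite leq_divRL ?expn_gt0// mulnC.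
have k2 : (N2 <= k)%N by rewrite (leq_trans _ (ltnW kN5))// leq_maxl.
have k3 : (N3 <= k)%N by rewrite (leq_trans _ (ltnW kN5))// leq_maxr.
have kN : (k <= N)%N by rewrite leq_div.
have k0 : (0 < k)%N by apply: leq_ltn_trans kN5.
have sj : s ^+ 6 * (4 * al) = (2 ^+ j)^-1.
  have -> : 4 * al = 2 ^+ 12 by rewrite alE; ring.
  apply: (mulIf (x := 2 ^+ j)); first by rewrite expf_eq0 pnatr_eq0 andbF.
  rewrite mulVf; last by rewrite expf_eq0 pnatr_eq0 andbF.
  have j12 : (12 + j = p * 6)%N by rewrite /j; move: p3; clear; lia.
  by rewrite -mulrA -exprD j12 exprM exprVn mulVf// !expf_eq0 pnatr_eq0 andbF.
have Pj : (0 : R) < 2 ^+ j by rewrite exprn_gt0.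
have kr1 : k%:R / N%:R <= s ^+ 6 * (4 * al) :> R.
  by rewrite sj ler_pdivrMr// mulrC ler_pdivlMr// -natrX -natrM ler_nat leq_divM.
have kr2 : s ^+ 6 * (2 * al) <= k%:R / N%:R :> R.
  have -> : s ^+ 6 * (2 * al) = (2 ^+ j)^-1 / 2 by rewrite -sj; clear -MP a_gt0 CLT c_gt0 step_lattice step_span plim bpos; lra.
  rewrite ler_pdivlMr// mulrAC ler_pdivrMr// mulrC ler_pdivrMr//.
  have hN : (N <= 2 * k * 2 ^ j)%N.
    have P2j : (0 < 2 ^ j)%N by rewrite expn_gt0.
    apply: ltnW; apply: leq_trans (ltn_ceil N P2j) _.
    by rewrite -/k leq_mul2r; apply/orP; right; rewrite mul2n -addnn -addn1 leq_add2l.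
  have : (N%:R : R) <= 2 * k%:R * 2 ^+ j by rewrite -natrX -!natrM ler_nat.
  by clear -MP a_gt0 CLT c_gt0 step_lattice step_span plim bpos; lra.
have n2 : (N2 <= n)%N.
  apply: (leq_trans k2); have [_ _ _ _ hh] := block_compl m0 m2; apply: leq_trans hh.
  have j1 : (0 < j)%N by rewrite /j; move: p3; clear; lia.
  by apply: leq_div2l; rewrite ?expn_gt0// leq_exp2l.
have ak : 2 * s ^+ 3 * a N <= a k / 16.
  have := H3 k N k3 kN; rewrite ler_norml => /andP[h _].
  have ak0 := a_gt0 k0.
  have h1 : (32 * s ^+ 3) ^+ 2 <= (a k / a N) ^+ 2.
    have -> : (32 * s ^+ 3) ^+ 2 = al * s ^+ 6 by rewrite alE; ring.
    by clear -kr2 h MP a_gt0 CLT c_gt0 step_lattice step_span plim bpos; lra.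
  have h2 : 32 * s ^+ 3 <= a k / a N.
    by rewrite -ler_sqr// nnegrE ?divr_ge0 ?(ltW ak0) ?(ltW aN0)// mulr_ge0// exprn_ge0// ltW.
  by move: h2; rewrite ler_pdivlMr//; clear -MP a_gt0 CLT c_gt0 step_lattice step_span plim bpos; lra.
have low := H2 n k k2 n2.
set A := positive n `&` _ in low.
have mA : measurable A.
  by apply: measurableI; [exact: measurable_positive|exact: (measurable_walk_set n (measurable_le _))].
have low2 : pr Q A <= 4 * (4 * al + 1) * s ^+ 6 * q n.
  apply: le_trans low _; rewrite ler_wpM2r//.
  have nR : (0 : R) < n%:R by rewrite ltr0n; move: n2N; case: (n) => //; rewrite muln0 leqNgt Np.
  have : k%:R / (2 * n%:R) <= k%:R / N%:R :> R.
    by rewrite ler_wpM2l// lef_pV2 ?posrE ?mulr_gt0// -natrM ler_nat.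
  by clear -kr1 MP a_gt0 CLT c_gt0 step_lattice step_span plim bpos; lra.
have f0 (w : path R) : 0 <= \1_(positive n) w :> R by rewrite indicE.
have := H1 N m n1 mle mN n _ x (bpos n) f0 (@depends_positive R n); rewrite nm => /(_ xL).
rewrite (Ex_ind _ (measurable_positive n)) -/t => hL.
have hH : Ex Q (fun w => \1_(positive n) w * heat t ((walk n w - x) / a N)) <=
    2 / s ^+ 4 * pr Q A + 2 * K * s ^+ 2 * q n.
  rewrite -(Ex_ind _ (measurable_positive n)) -(Ex_ind _ mA) -!ExZ//; last exact: bmf_ind.
  have bA : bmf (\1_A : path R -> R) by exact: bmf_ind.
  rewrite -ExD; [|by apply: bmfM => //; exact: bmf_cst|by apply: bmfM => //; exact: bmf_cst].
  apply: le_Ex.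
  - by apply: bmfM => //; exact: bmf_heat_walk.
  - by apply: bmfD; apply: bmfM => //; exact: bmf_cst.
  move=> w; rewrite [\1_(positive n) w]indicE; case: (boolP (w \in positive n)) => [/set_mem wp|_]; last first.
    by rewrite mul0r mulr0 addr0 mulr_ge0 ?divr_ge0 ?exprn_ge0 ?(ltW s0)// indicE.
  rewrite mul1r mulr1.
  have [wl|wl] := leP (walk n w) (a k / 16).
    rewrite [\1_A w]indicE mem_set; last by split.
    rewrite mulr1; apply: (le_trans (heat_le _ d0 ts0)).
    have ks : 0 <= 2 * K * s ^+ 2 by rewrite mulr_ge0 ?sqr_ge0// mulr_ge0// ltW.
    by rewrite invf_div lerDl.
  rewrite [\1_A w]indicE memNset; last by case=> _ /=; rewrite leNgt wl.
  rewrite mulr0 add0r.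
  have s3 : 0 < s ^+ 3 by rewrite exprn_gt0.
  have ue : s ^+ 3 <= `|(walk n w - x) / a N|.
    apply: le_trans (ler_norm _); rewrite ler_pdivlMr//; clear -ak xe wl MP a_gt0 CLT c_gt0 step_lattice step_span plim bpos; lra.
  apply: (le_trans (HK _ _ _ _ d0 ts0 s3 ue)).
  have t3 : t ^+ 3 <= (s ^+ 8) ^+ 3.
    by apply: lerXn2r => //; rewrite nnegrE ?exprn_ge0// ltW.
  rewrite ler_pdivrMr ?mulr_gt0 ?exprn_gt0//.
  rewrite (_ : 2 * K * s ^+ 2 * _ = K * (s ^+ 8) ^+ 3); last by field.
  by rewrite ler_pM2l.
have hm : a N / c * hit N x <= a N / c * Ex Q (fun w => \1_(positive n) w * at_point N x w).
  rewrite ler_wpM2l ?divr_ge0 ?(ltW aN0) ?(ltW c_gt0)//.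
  apply: le_Ex; try by apply: bmfM => //; exact: bmf_at_point.
  by move=> w; rewrite ler_wpM2r ?le_indic_positive ?leq_subr//= /at_point indicE.
have hA : 2 / s ^+ 4 * pr Q A <= 2 * (4 * (4 * al + 1)) * s ^+ 2 * q n.
  have c0 : 0 <= 2 / s ^+ 4 by rewrite divr_ge0 ?exprn_ge0// ltW.
  apply: (le_trans (ler_wpM2l c0 low2)); rewrite le_eqVlt; apply/orP; left; apply/eqP.
  by field; rewrite gt_eqF.
have s2s : s ^+ 2 <= s by rewrite -[leRHS]expr1 ler_wiXn2l// ltW.
have sE : M * s <= e / 4.
  by move: Hp; rewrite ler_pdivlMr; clear -M1 MP a_gt0 CLT c_gt0 step_lattice step_span plim bpos; lra.
have hs : (2 * (4 * (4 * al + 1)) * s ^+ 2 + 2 * K * s ^+ 2) * q n <= e / 4 * q n.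
  rewrite ler_wpM2r//; apply: le_trans sE; rewrite -mulrDl -/M ler_wpM2l//.
  by apply: le_trans M1.
have h8 : e / 4 * q n <= e / 4 * (2 * q N) by rewrite ler_wpM2l// ltW.
have := ler_norm (a N / c * Ex Q (fun w => \1_(positive n) w * at_point N x w) -
  Ex Q (fun w => \1_(positive n) w * heat t ((walk n w - x) / a N))).
by clear -hL hH hm hA hs h8 MP a_gt0 CLT c_gt0 step_lattice step_span plim bpos; lra.
Qed.

End density_estimates.

(** * Normalization *)

Section riemann_sum.
Context {R : realType}.
Implicit Types (x t h : R).

Lemma rayleighE x : rayleigh x = x * gaussian 1 x.
Proof. by rewrite /rayleigh /gaussian mul1r. Qed.

Lemma rayleigh_ge0 x : 0 <= x -> 0 <= rayleigh x.
Proof. by move=> x0; rewrite mulr_ge0// expR_ge0. Qed.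

Lemma rayleigh_le x : 0 <= x -> rayleigh x <= x.
Proof. by move=> x0; rewrite rayleighE ler_piMr// gaussian_le1. Qed.

Lemma rayleigh_le1 x : rayleigh x <= 1.
Proof.
rewrite /rayleigh expRN ler_pdivrMr ?expR_gt0// mul1r.
apply: le_trans (expR_ge1Dx _); have := sqr_ge0 (x - 1); rewrite sqrrB1; lra.
Qed.

Lemma is_derive_rayleigh x : is_derive x 1 (@rayleigh R) ((1 - x ^+ 2) * gaussian 1 x).
Proof.
have -> : @rayleigh R = (fun y => y * gaussian 1 y) by apply/funext => y; exact: rayleighE.
have dg := is_derive_gaussian 1 x.
by apply: is_derive_eq; rewrite /GRing.scale/=; ring.
Qed.

Lemma rayleigh_deriv_le x : `|(1 - x ^+ 2) * gaussian 1 x| <= 2.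
Proof.
rewrite normrM (ger0_norm (gaussian_ge0 _ _)) /gaussian mul1r expRN ler_pdivrMr ?expR_gt0//.
have := expR_ge1Dx (x ^+ 2 / 2); have := sqr_ge0 x.
by move: (x ^+ 2) => y y0 h; rewrite ler_norml; apply/andP; split; lra.
Qed.

Lemma rayleigh_riemann t h : 0 < h ->
  `|h * rayleigh t - (gaussian 1 t - gaussian 1 (t + h))| <= 2 * h ^+ 2.
Proof.
move=> h0; have th : t < t + h by rewrite ltrDl.
have [u] := MVT th (fun z _ => is_derive_gaussian 1 z) (continuous_subspaceT (@continuous_gaussian R 1)).
rewrite in_itv/= => /andP[tu uh] E.
have cr : continuous (@rayleigh R).
  by move=> y; apply: differentiable_continuous; apply/derivable1_diffP; have := is_derive_rayleigh y; case.
have [v _ Ev] := MVT tu (fun z _ => is_derive_rayleigh z) (continuous_subspaceT cr).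
have -> : gaussian 1 t - gaussian 1 (t + h) = h * rayleigh u.
  rewrite -opprB E rayleighE mul1r mulNr addrAC subrr add0r mulNr opprK mulrC//.
rewrite -mulrBr normrM (gtr0_norm h0) expr2 mulrCA ler_pM2l//.
rewrite -normrN opprB Ev normrM.
have uv : `|u - t| <= h by rewrite ger0_norm; lra.
by apply: ler_pM => //; exact: rayleigh_deriv_le.
Qed.

(** The Rayleigh density is the derivative of a decreasing exponential, so its
    Riemann sums telescope up to an error of the order of the mesh. *)
Lemma rayleigh_sum t h K : 0 < h ->
  `|\sum_(k < K) h * rayleigh (t + h * k%:R) - (gaussian 1 t - gaussian 1 (t + h * K%:R))|
  <= 2 * h ^+ 2 * K%:R.
Proof.
move=> h0; elim: K => [|K IH]; first by rewrite big_ord0 !mulr0 addr0 subrr subr0 normr0.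
have := rayleigh_riemann (t + h * K%:R) h0.
have -> : t + h * K%:R + h = t + h * K.+1%:R by rewrite -natr1; ring.
move=> st; rewrite big_ord_recr/=.
have Kn : 2 * h ^+ 2 * K.+1%:R = 2 * h ^+ 2 * K%:R + 2 * h ^+ 2 by rewrite -natr1; ring.
rewrite Kn; move: IH st; rewrite !ler_norml => /andP[i1 i2] /andP[s1 s2].
by apply/andP; split; lra.
Qed.

End riemann_sum.

Section lattice_points.
Context {R : realType}.
Implicit Types (x y be c : R) (k K : nat).

Lemma lattice_first be c : 0 < c -> exists x, [/\ lattice be c x, 0 < x & x <= c].
Proof.
move=> c0; pose z := (Num.floor (- be / c) + 1)%R.
have h1 := floor_le_tmp (- be / c); have h2 := floorD1_gt (- be / c).
exists (be + c * z%:~R); split; first by exists z.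
- by move: h2; rewrite -/z ltr_pdivrMr// mulrC; lra.
have : c * (z%:~R - 1) <= - be by rewrite mulrC -ler_pdivlMr// /z intrD addrK.
lra.
Qed.

Lemma lattice_addn be c x k : lattice be c x -> lattice be c (x + c * k%:R).
Proof. by move=> [z _ <-]; exists (z + k%:Z) => //; rewrite intrD; ring. Qed.

(** The points x + c k exhaust the positive part of the lattice. *)
Lemma lattice_sum be c x y K : 0 < c -> lattice be c x -> x <= c -> lattice be c y -> 0 < y ->
  \sum_(k < K) (y == x + c * k%:R)%:R = (y < x + c * K%:R)%R%:R :> R.
Proof.
move=> c0 [z _ xE] xc [z' _ yE] y0.
have zz : (z <= z')%R.
  rewrite -ltzD1 -(ltr_int R) intrD -(ltr_pM2l c0); lra.
have [j zj] : exists j : nat, z' = z + j%:Z.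
  by exists `|z' - z|%N; rewrite gez0_abs ?subr_ge0// addrCA subrr addr0.
have yj : y = x + c * j%:R by rewrite -xE -yE zj intrD; ring.
have E k : (y == x + c * k%:R) = (j == k).
  by rewrite yj (inj_eq (addrI x)) (inj_eq (mulfI (lt0r_neq0 c0))) eqr_nat.
have -> : (y < x + c * K%:R)%R = (j < K)%N by rewrite yj ltrD2l ltr_pM2l// ltr_nat.
under eq_bigr => k _ do rewrite E.
have [jK|jK] := ltnP j K.
  rewrite (bigD1 (Ordinal jK))//= eqxx big1 ?addr0// => k.
  by rewrite -val_eqE/= eq_sym => /negbTE ->.
by rewrite big1// => k _; rewrite gtn_eqF// (leq_trans _ jK).
Qed.

End lattice_points.

Section conditioned_limit.
Context {R : realType}.
Variable Q : probability (path R) R.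
Hypothesis MP : markov_property Q.
Variable a : nat -> R.
Hypothesis a_gt0 : forall n, (0 < n)%N -> 0 < a n.
Hypothesis CLT : forall (f : R -> R) (M : R), continuous f -> (forall x, `|f x| <= M) ->
  Ex Q (fun x => f (walk n x / a n)) @[n --> \oo] --> Ex std_normal f.
Variables b c : R.
Hypothesis c_gt0 : 0 < c.
Hypothesis step_lattice : pr Q [set x | lattice b c (x 0%N)] = 1.
Hypothesis step_span : forall b' c', c < c' -> pr Q [set x | lattice b' c' (x 0%N)] <> 1.
Notation q n := (pr Q (positive n)).
Implicit Types (e x y A : R) (n k m N j K : nat).

Let plim L e (e0 : 0 < e) := cf_uniform MP a_gt0 CLT L e0.
Let bpos n : bmf (\1_(positive n) : path R -> R) := bmf_ind (measurable_positive n).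

Lemma limit_const_le N : `|limit_const Q a N| <= 2 * q N.
Proof.
rewrite /limit_const normrM; apply: le_trans (sine_const_le Q a N).
rewrite ler_piMl// ger0_norm ?sqrtr_ge0// -[leRHS]sqrtr1 ler_wsqrtr//.
by rewrite ler_pdivrMr ?pi_gt0// mul1r pi_ge2.
Qed.

(** The two regimes meet at a height eta a_N, where the limit itself is small. *)
Lemma hit_limit e : 0 < e -> exists N0, forall N, (N0 <= N)%N ->
  forall x, lattice (b * N%:R) c x -> 0 < x ->
  `|a N / c * hit Q N x - limit_const Q a N * rayleigh (x / a N)| <= e * q N.
Proof.
move=> e0; have e3 : 0 < e / 3 by rewrite divr_gt0.
have [eta [N1 [eta0 [ee H1]]]] := hit_near_zero MP a_gt0 CLT c_gt0 step_lattice step_span e3.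
have [N2 H2] := hit_interior MP a_gt0 CLT c_gt0 step_lattice step_span eta0 e0.
exists (maxn N1 N2).+1 => N NN x xL x0.
have n1 : (N1 <= N)%N by rewrite (leq_trans _ (ltnW NN))// leq_maxl.
have n2 : (N2 <= N)%N by rewrite (leq_trans _ (ltnW NN))// leq_maxr.
have N0 : (0 < N)%N by apply: leq_ltn_trans NN.
have aN0 := a_gt0 N0; have qN0 : 0 <= q N := pr_ge0 _ _.
have [xe|xe] := leP x (eta * a N); last exact: H2 n2 x xL (ltW xe).
have h1 := H1 N n1 x xL xe.
have h0 : 0 <= a N / c * hit Q N x.
  rewrite mulr_ge0 ?divr_ge0 ?(ltW aN0) ?(ltW c_gt0)//.
  by apply: Ex_ge0 => w; rewrite mulr_ge0// /at_point indicE.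
have r0 : 0 <= x / a N by rewrite divr_ge0// ltW.
have xa : x / a N <= e / 3 by apply: le_trans ee; rewrite ler_pdivrMr.
have rr := le_trans (rayleigh_le r0) xa; have rr0 := rayleigh_ge0 r0.
apply: le_trans (ler_normB _ _) _; rewrite (ger0_norm h0) normrM (ger0_norm rr0).
have : `|limit_const Q a N| * rayleigh (x / a N) <= 2 * q N * (e / 3).
  by apply: ler_pM => //; exact: limit_const_le.
by lra.
Qed.

(** The truncated second moment at the scale a_(2^j N), which is of order
    2^(j/2) a_N. *)
Lemma positive_tail e : 0 < e -> exists (A0 : R) N0, forall A N, A0 <= A -> (N0 <= N)%N ->
  pr Q (positive N `&` [set w | A * a N <= walk N w]) <= e * q N.
Proof.
move=> e0; have [C [N1 [C0 H1]]] := Ex_positive_trunc_sq MP a_gt0 CLT step_lattice.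
have eC : 0 < e / (C + 1) by rewrite divr_gt0//; lra.
have [j [_ Hj]] := half_powers_small 0 eC.
have Pj : (0 : R) < 2 ^+ j by rewrite exprn_gt0.
have e2 : 0 < (2 ^+ j)^-1 / 2 :> R by rewrite divr_gt0// invr_gt0.
have [N2 H2] := norming_ratio a_gt0 plim e2.
exists (2 * 2 ^+ j), (maxn N1 N2).+1 => A N AA NN.
have n1 : (N1 <= N)%N by rewrite (leq_trans _ (ltnW NN))// leq_maxl.
have n2 : (N2 <= N)%N by rewrite (leq_trans _ (ltnW NN))// leq_maxr.
have N0 : (0 < N)%N by apply: leq_ltn_trans NN.
have NR : (0 : R) < N%:R by rewrite ltr0n.
have aN0 := a_gt0 N0; have qN0 : 0 <= q N := pr_ge0 _ _.
pose N' := (2 ^ j * N)%N.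
have NN' : (N <= N')%N by rewrite leq_pmull// expn_gt0.
have N'0 : (0 < N')%N by apply: leq_trans NN'.
have aN'0 := a_gt0 N'0.
have rE : N%:R / N'%:R = (2 ^+ j)^-1 :> R.
  by rewrite /N' natrM natrX invfM mulrCA mulfV ?gt_eqF// mulr1.
have := H2 N N' n2 NN'; rewrite rE ler_norml => /andP[h _].
have h1 : (2 ^+ j)^-1 / 2 <= (a N / a N') ^+ 2 by lra.
have h2 : a N' <= 2 * 2 ^+ j * a N.
  have h3 : 1 <= (2 * 2 ^+ j * (a N / a N')) ^+ 2.
    rewrite exprMn; apply: (@le_trans _ _ ((2 * 2 ^+ j) ^+ 2 * ((2 ^+ j)^-1 / 2))).
      have -> : (2 * 2 ^+ j) ^+ 2 * ((2 ^+ j)^-1 / 2) = 2 * 2 ^+ j :> R by field; rewrite gt_eqF.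
      have : 1 <= 2 ^+ j :> R by rewrite exprn_ege1// ler1n.
      lra.
    by rewrite ler_wpM2l// sqr_ge0.
  have h4 : 0 <= 2 * 2 ^+ j * (a N / a N') by rewrite !mulr_ge0// ?invr_ge0 ltW.
  have : 1 <= 2 * 2 ^+ j * (a N / a N') by rewrite -(expr_ge1 (n := 2)).
  by rewrite mulrA ler_pdivlMr// mul1r.
have mA : measurable (positive N `&` [set w : path R | A * a N <= walk N w]).
  by apply: measurableI; [exact: measurable_positive|exact: (measurable_walk_set N (measurable_ge _))].
have h3 := H1 N' N (leq_trans n1 NN').
have h4 : pr Q (positive N `&` [set w | A * a N <= walk N w]) <=
    Ex Q (fun x : path R => \1_(positive N) x * trunc_sq (walk N x / a N')).
  apply: pr_le_Ex => //.
  - by apply: bmfM => //; apply: bmf_trunc_sq; apply: measurable_funM => //; exact: measurable_walk.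
  - by move=> w; rewrite mulr_ge0 ?trunc_sq_ge0// indicE.
  move=> w [wp /= wA]; rewrite indicE mem_set// mul1r trunc_sq_ge1//.
  apply: le_trans (ler_norm _); rewrite ler_pdivlMr// mul1r; apply: le_trans wA.
  by apply: (le_trans h2); rewrite ler_pM2r.
apply: (le_trans h4); apply: (le_trans h3); rewrite rE ler_wpM2r//.
have P2 : 0 <= (2 ^+ j)^-1 :> R by rewrite invr_ge0 ltW.
by move: Hj; rewrite ler_pdivlMr; lra.
Qed.

Lemma hit_sum N x K : (0 < N)%N -> lattice (b * N%:R) c x -> x <= c ->
  \sum_(k < K) hit Q N (x + c * k%:R) = pr Q (positive N `&` [set w | walk N w < x + c * K%:R]).
Proof.
move=> N0 xL xc.
have mB : measurable [set w : path R | walk N w < x + c * K%:R].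
  exact: (measurable_walk_set N (measurable_lt _)).
have mp := measurable_positive (R := R) N.
have bh k : bmf (fun w => \1_(positive N) w * at_point N (x + c * k%:R) w).
  by apply: bmfM => //; exact: bmf_at_point.
rewrite -Ex_ind; last exact: measurableI.
have bS : bmf (fun w => \sum_(k < K) \1_(positive N) w * at_point N (x + c * k%:R) w) by exact: bmf_sum.
rewrite /hit -Ex_sum//.
apply: (Ex_lattice (n := N) MP step_lattice bS); first by apply: bmf_ind; exact: measurableI.
move=> w wL.
have [wp|wp] := pselect (positive N w); last first.
  rewrite big1 => [|k _]; last by rewrite indicE (memNset wp) mul0r.
  by rewrite indicE memNset// => -[].
have w0 : 0 < walk N w by apply: wp; rewrite N0/=.
rewrite [RHS]indicE.
have -> : (w \in positive N `&` [set w | walk N w < x + c * K%:R]) = (walk N w < x + c * K%:R)%R.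
  by apply/idP/idP => [/set_mem []//|h]; apply/mem_set.
rewrite -(lattice_sum K c_gt0 xL xc wL w0); apply: eq_bigr => k _.
rewrite indicE (mem_set wp) mul1r /at_point indicE; congr ((_ : bool)%:R).
by apply/idP/eqP => [/set_mem//|h]; exact/mem_set.
Qed.

(** Summing the limit over the lattice must give the total conditional mass 1,
    which determines the constant. *)
Lemma limit_const_lim e : 0 < e -> exists N0, forall N, (N0 <= N)%N ->
  `|limit_const Q a N - q N| <= e * q N.
Proof.
move=> e0; have e5 : 0 < e / 5 by rewrite divr_gt0.
have [A0 [N1 H1]] := positive_tail e5.
pose A := Num.max A0 (Num.max 1 (20 / e)).
have AA0 : A0 <= A by rewrite le_max lexx.
have A1 : 1 <= A by rewrite !le_max lexx orbT.
have Ae : 20 / e <= A by rewrite !le_max lexx !orbT.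
pose e1 := e / 5 / (A + 1).
have A10 : 0 < A + 1 by lra.
have e10 : 0 < e1 by rewrite divr_gt0.
have [N2 H2] := hit_limit e10.
pose d := Num.min 1 (e / 5 / (2 * (2 * (A + 1) + 1))).
have d20 : 0 < 2 * (2 * (A + 1) + 1) by lra.
have d0 : 0 < d by rewrite lt_min ltr01 divr_gt0.
have d1 : d <= 1 by rewrite ge_min lexx.
have de : (2 * (2 * (A + 1) + 1)) * d <= e / 5.
  by rewrite mulrC -ler_pdivlMr// ge_min lexx orbT.
have [N3 H3] := norming_pinfty a_gt0 plim (c / d).
exists (maxn N1 (maxn N2 N3)).+1 => N NN.
have n1 : (N1 <= N)%N by rewrite (leq_trans _ (ltnW NN))// leq_maxl.
have n2 : (N2 <= N)%N by rewrite (leq_trans _ (ltnW NN))// !leq_max leqnn orbT.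
have n3 : (N3 <= N)%N by rewrite (leq_trans _ (ltnW NN))// !leq_max leqnn !orbT.
have N0 : (0 < N)%N by apply: leq_ltn_trans NN.
have aN0 := a_gt0 N0; have qN0 : 0 <= q N := pr_ge0 _ _.
pose h := c / a N; have h0 : 0 < h by rewrite divr_gt0.
have hd : h <= d.
  by have := H3 N n3; rewrite ler_pdivrMr// /h ler_pdivrMr// mulrC.
pose K := (Num.truncn (A / h)).+1.
have Ah0 : 0 <= A / h by rewrite divr_ge0 ?(ltW h0)//; lra.
have KA : A < h * K%:R by rewrite mulrC -ltr_pdivrMr// truncnS_gt.
have KA2 : h * K%:R <= A + h.
  have /andP[+ _] := truncn_itv Ah0; rewrite ler_pdivlMr// /K -natr1 mulrDr mulr1; lra.
have [x [xL x0 xc]] := lattice_first (b * N%:R) c_gt0.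
have xkL k : lattice (b * N%:R) c (x + c * k%:R) by exact: lattice_addn.
have xk0 k : 0 < x + c * k%:R.
  have : 0 <= c * k%:R by rewrite mulr_ge0// ltW.
  by lra.
have sumE := hit_sum K N0 xL xc.
have mp := measurable_positive (R := R) N.
have m1 : measurable (positive N `&` [set w : path R | walk N w < x + c * K%:R]).
  by apply: measurableI => //; exact: (measurable_walk_set N (measurable_lt _)).
have m2 : measurable (positive N `&` [set w : path R | A * a N <= walk N w]).
  by apply: measurableI => //; exact: (measurable_walk_set N (measurable_ge _)).
set S := pr Q _ in sumE.
have S1 : S <= q N by apply: le_pr => // w [].
have S2 : q N <= S + e / 5 * q N.
  have := H1 A N AA0 n1; set T := pr Q _ => hT.
  suff : q N <= S + T by lra.
  apply: le_trans (prU_le Q m1 m2); apply: le_pr => //; first exact: measurableU.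
  move=> w wp; have [wx|wx] := ltP (walk N w) (x + c * K%:R); [by left|right; split => //=].
  apply: le_trans wx; have -> : c * K%:R = h * K%:R * a N by rewrite /h; field; rewrite gt_eqF.
  have : A * a N <= h * K%:R * a N by rewrite ler_pM2r// ltW.
  lra.
pose t := x / a N.
have t0 : 0 < t by rewrite divr_gt0.
have th : t <= h by rewrite ler_pM2r// invr_gt0.
have xkE k : (x + c * k%:R) / a N = t + h * k%:R by rewrite /t /h; ring.
have D1 : `|S - limit_const Q a N * \sum_(k < K) h * rayleigh (t + h * k%:R)| <= (A + 1) * e1 * q N.
  rewrite -sumE mulr_sumr -sumrB.
  apply: le_trans (ler_norm_sum _ _ _) _.
  apply: (@le_trans _ _ (\sum_(k < K) h * (e1 * q N))).
    apply: ler_sum => k _.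
    have := H2 N n2 _ (xkL k) (xk0 k); rewrite xkE => hk.
    have -> : hit Q N (x + c * k%:R) - limit_const Q a N * (h * rayleigh (t + h * k%:R)) =
      h * (a N / c * hit Q N (x + c * k%:R) - limit_const Q a N * rayleigh (t + h * k%:R)).
      rewrite mulrBr [h * (a N / c * _)]mulrA (_ : h * (a N / c) = 1) ?mul1r; first by ring.
      by rewrite /h; field; rewrite !gt_eqF.
    by rewrite normrM (gtr0_norm h0) ler_pM2l.
  rewrite sumr_const card_ord -[_ *+ K]mulr_natr.
  have -> : h * (e1 * q N) * K%:R = h * K%:R * (e1 * q N) by ring.
  have eq1 : 0 <= e1 * q N by rewrite mulr_ge0// ltW.
  by rewrite -[leRHS]mulrA ler_wpM2r//; lra.
have D2 := rayleigh_sum t K h0.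
set W := \sum_(k < K) _ in D1 D2.
have g1 : gaussian 1 t <= 1 by apply: gaussian_le1.
have g2 : 1 - d <= gaussian 1 t.
  have := expR_ge1Dx (- (1 * t ^+ 2 / 2)); rewrite -/(gaussian 1 t) => g.
  have t2 : t ^+ 2 <= h ^+ 2 by rewrite ler_sqr// ?nnegrE ltW.
  have h1 : h <= 1 := le_trans hd d1.
  have h2 : h ^+ 2 <= d by have : h * h <= h * 1; [rewrite ler_pM2l|rewrite expr2; lra].
  have := sqr_ge0 t; lra.
have g3 : 0 <= gaussian 1 (t + h * K%:R) := gaussian_ge0 _ _.
have g4 : gaussian 1 (t + h * K%:R) <= e / 10.
  rewrite /gaussian mul1r expRN -[leRHS]invrK lef_pV2 ?posrE ?expR_gt0 ?invr_gt0 ?divr_gt0//.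
  apply: le_trans (expR_ge1Dx _); rewrite invf_div.
  have Au : A <= t + h * K%:R by lra.
  move: (t + h * K%:R) Au => u Au.
  have : A * 1 <= u * u by apply: ler_pM; clear -A1 Au MP a_gt0 CLT c_gt0 step_lattice step_span plim bpos; lra.
  rewrite expr2.
  have -> : 10 / e = 20 / e / 2 by clear -MP a_gt0 CLT c_gt0 step_lattice step_span plim bpos; lra.
  by clear -Ae MP a_gt0 CLT c_gt0 step_lattice step_span plim bpos; lra.
have D3 : `|1 - W| <= 2 * (A + 1) * d + d + e / 10.
  have hh : 2 * h ^+ 2 * K%:R <= 2 * (A + 1) * d.
    rewrite expr2 (_ : 2 * (h * h) * K%:R = 2 * (h * K%:R) * h); last by ring.
    have k1 : h * K%:R <= A + 1 by apply: le_trans KA2 _; rewrite lerD2l (le_trans hd).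
    have k0 : 0 <= h * K%:R by rewrite mulr_ge0// ltW.
    have k2 : h * K%:R * h <= (A + 1) * d by apply: ler_pM => //; exact: ltW.
    by rewrite -[leLHS]mulrA -[leRHS]mulrA ler_pM2l.
  move: D2; rewrite !ler_norml => /andP[w1 w2]; clear -w1 w2 hh g1 g2 g3 g4 d0 MP a_gt0 CLT c_gt0 step_lattice step_span plim bpos.
  by apply/andP; split; lra.
have kq := limit_const_le N.
have D4 : `|limit_const Q a N * (1 - W)| <= 2 * (2 * (A + 1) * d + d + e / 10) * q N.
  rewrite normrM mulrAC; apply: ler_pM => //.
have E1 : (A + 1) * e1 * q N = e / 5 * q N by rewrite /e1; field; rewrite gt_eqF.
have E2 : 2 * (2 * (A + 1) * d + d + e / 10) * q N <= 2 * (e / 5) * q N.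
  by rewrite ler_wpM2r//; clear -de MP a_gt0 CLT c_gt0 step_lattice step_span plim bpos; lra.
rewrite E1 in D1; move: (limit_const Q a N) D1 D4 E2 => k D1 D4 E2.
have eq0 : 0 <= e * q N by rewrite mulr_ge0// ltW.
move: D1 (le_trans D4 E2); rewrite mulrBr mulr1; move: (k * W) => kW; clear -S1 S2 eq0 MP a_gt0 CLT c_gt0 step_lattice step_span plim bpos.
by rewrite !ler_norml => /andP[? ?] /andP[? ?]; apply/andP; split; lra.
Qed.

Lemma phi_plusE x : 0 <= x -> phi_plus x = rayleigh x.
Proof. by move=> x0; rewrite /phi_plus indicE mem_set ?mulr1. Qed.

Lemma phi_plus_le0 x : x <= 0 -> phi_plus x = 0.
Proof.
move=> x0; have [->|xn0] := eqVneq x 0; first by rewrite /phi_plus !mul0r.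
rewrite /phi_plus indicE memNset ?mulr0//= => h.
by move: xn0; rewrite eq_le h x0.
Qed.

Theorem conditioned_local_limit e : 0 < e -> exists N0, forall N, (N0 <= N)%N ->
  forall x, lattice (b * N%:R) c x ->
  `|a N / c * (hit Q N x / q N) - phi_plus (x / a N)| < e.
Proof.
move=> e0; have e4 : 0 < e / 4 by rewrite divr_gt0.
have [N1 H1] := hit_limit e4; have [N2 H2] := limit_const_lim e4.
exists (maxn N1 N2).+1 => N NN x xL.
have n1 : (N1 <= N)%N by rewrite (leq_trans _ (ltnW NN))// leq_maxl.
have n2 : (N2 <= N)%N by rewrite (leq_trans _ (ltnW NN))// leq_maxr.
have N0 : (0 < N)%N by apply: leq_ltn_trans NN.
have aN0 := a_gt0 N0.
have qN0 : 0 < q N := pr_positive_gt0 MP a_gt0 CLT step_lattice N.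
have [x0|x0] := leP x 0.
  rewrite phi_plus_le0; last by rewrite ler_pdivrMr// mul0r.
  suff -> : hit Q N x = 0 by rewrite mul0r mulr0 subrr normr0.
  rewrite /hit -[RHS](Ex_cst Q 0); apply: eq_Ex => w; rewrite /at_point !indicE.
  case: (boolP (w \in positive N)) => [/set_mem wp|_]; last by rewrite mul0r.
  rewrite memNset ?mulr0//= => wx; have := wp N; rewrite N0 leqnn => /(_ isT).
  by rewrite wx ltNge x0.
rewrite phi_plusE; last by rewrite divr_ge0// ltW.
have h1 := H1 N n1 x xL x0; have h2 := H2 N n2.
have r0 : 0 <= rayleigh (x / a N) by rewrite rayleigh_ge0// divr_ge0// ltW.
have r1 := rayleigh_le1 (x / a N).
rewrite -(ltr_pM2r qN0) -[X in _ * X < _](gtr0_norm qN0) -normrM mulrBl.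
have -> : a N / c * (hit Q N x / q N) * q N = a N / c * hit Q N x by rewrite -mulrA divfK ?gt_eqF.
set u := a N / c * hit Q N x in h1 *.
have -> : u - rayleigh (x / a N) * q N = (u - limit_const Q a N * rayleigh (x / a N)) +
  (limit_const Q a N - q N) * rayleigh (x / a N) by ring.
apply: le_lt_trans (ler_normD _ _) _; rewrite [X in _ + X]normrM (ger0_norm r0).
have h3 : `|limit_const Q a N - q N| * rayleigh (x / a N) <= `|limit_const Q a N - q N| by rewrite ler_piMr.
have : 0 < e * q N by rewrite mulr_gt0.
by lra.
Qed.

End conditioned_limit.

(** * From trajectories to random variables *)

Section transfer.
Context {d : measure_display} {T : measurableType d} {R : realType}.
Variables (P : probability T R) (X : nat -> {RV P >-> R}).
Implicit Types (n : nat) (A : set (path R)) (f : path R -> R).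

HB.instance Definition _ := isMeasurableFun.Build _ _ _ _ (trajectory X)
  (measurable_trajectory X).

Definition trajectory_law : probability (path R) R := distribution P (trajectory X).

Lemma Ex_trajectory f : bmf f -> Ex trajectory_law f = fine ('E_P[f \o trajectory X])%E.
Proof.
move=> bf; rewrite /Ex /Rintegral unlock; congr fine.
rewrite integral_distribution//; first by apply/measurable_EFinP; case: bf.
apply: bmf_integrable; have [mf [M fM]] := bf; split; last by exists M => w; exact: fM.
by apply: measurableT_comp => //; exact: measurable_trajectory.
Qed.

Lemma trajectory_law_clt (a : nat -> R) :
  cvg_in_law P (fun n w => partial_sum X n w / a n) (normal_prob 0 1) ->
  forall (f : R -> R) (M : R), continuous f -> (forall x, `|f x| <= M) ->
  Ex trajectory_law (fun x => f (walk n x / a n)) @[n --> \oo] --> Ex std_normal f.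
Proof.
move=> h f M cf fM.
have bf : bounded_fun f.
  by exists M; split; [exact: num_real|move=> x Mx w _; exact: le_trans (fM w) (ltW Mx)].
have bs : @bmf _ (measurableTypeR R) R f by split; [exact: continuous_measurable_fun|exists M].
have -> : (fun n => Ex trajectory_law (fun x : path R => f (walk n x / a n))) =
    (fun n => fine ('E_P[f \o (fun w => (partial_sum X n w / a n)%R)])%E).
  apply/funext => n; rewrite Ex_trajectory//.
  by apply: bmf_comp => //; [exists M|apply: measurable_funM => //; exact: measurable_walk].
apply: fine_cvg; rewrite EFin_Ex//; exact: h.
Qed.

Hypothesis X_indep : mutually_independent X.
Hypothesis X_ident : identically_distributed X.

Lemma trajectory_law_markov : markov_property trajectory_law.
Proof. by move=> j E F mE mF pE; exact: (trajectory_markov X_indep X_ident mE mF pE). Qed.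

End transfer.

Lemma measurable_hit {R : realType} n (y : R) : measurable (positive n `&` [set x : path R | walk n x = y]).
Proof. by apply: measurableI; [exact: measurable_positive|exact: measurable_at_point]. Qed.

Theorem theorem2 (d : measure_display) (T : measurableType d) (R : realType)
    (P : probability T R) (X : nat -> {RV P >-> R}) (a : nat -> R) (b c : R)
    (X_indep : mutually_independent X)
    (X_ident : identically_distributed X)
    (a_gt0 : forall n : nat, (0 < n)%N -> 0 < a n)
    (S_normal : cvg_in_law P (fun n w => partial_sum X n w / a n)
                  (normal_prob 0 1))
    (X_lattice : is_lattice (X 0%N) b c) :
  forall eps : R, 0 < eps -> \forall n \near \oo, forall x : int,
    `| a n / c * cond_prob P
         [set w | partial_sum X n w = b * n%:R + c * x%:~R]
         (stays_positive X n)
       - phi_plus ((b * n%:R + c * x%:~R) / a n) | < eps.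
Proof.
move=> eps eps0; have [c0 Xlat Xspan] := X_lattice.
pose Q := trajectory_law X.
have lat : pr Q [set x | lattice b c (x 0%N)] = 1 by rewrite /pr /= /distribution /pushforward Xlat.
have span b' c' : c < c' -> pr Q [set x | lattice b' c' (x 0%N)] <> 1.
  move=> cc h; apply: (Xspan b' c' cc).
  have mS : measurable (X 0%N @^-1` lattice b' c').
    by rewrite -[X in measurable X]setTI; apply: measurable_funPT => //; exact: measurable_lattice.
  rewrite -[LHS]fineK ?fin_num_measure//; exact: congr1 h.
have clt := trajectory_law_clt S_normal.
have [N H] := conditioned_local_limit (trajectory_law_markov X_indep X_ident) a_gt0 clt c0 lat span eps0.
exists N => // n /= Nn x; have := H n Nn (b * n%:R + c * x%:~R).
have -> : hit Q n (b * n%:R + c * x%:~R) = pr Q (positive n `&` [set y | walk n y = b * n%:R + c * x%:~R]).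
  rewrite -Ex_ind; last exact: measurable_hit.
  by apply: eq_Ex => y; rewrite indicI.
by rewrite /cond_prob setIC; apply; exists x.
Qed.
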